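(* Let $S$ be a II$_1$ factor and $T\subset S$ a unimodular quasi-regular irreducible subfactor. If $S$ has property (T) relative to $T$, then $\beta^{(2)}_1(T\subset S)=0$.
   Context: $S$ has property (T) relative to $T$ if: whenever $\varphi_i:S\to S$ is a net of normal $T$-bimodular completely positive maps with $\lim_i\|\varphi_i(x)-x\|_2=0$ for every $x\in S$, then $\lim_i\bigl(\sup_{x\in S,\|x\|\le1}\|\varphi_i(x)-x\|_2\bigr)=0$. **Inclusion.** $T\subset S$ is irreducible if $T'\cap S=\mathbb C1$. $\mathrm{QN}_S(T)$ is the $*$-algebra of $x\in S$ for which there are finitely many $x_i,y_j\in S$ with $xT\subset\sum_iTx_i$ and $Tx\subset\sum_jy_jT$; $T\subset S$ is quasi-regular if $\mathrm{QN}_S(T)''=S$. Write $\mathcal S=\mathrm{QN}_S(T)$. A Hilbert $T$-bimodule has finite index if its left and right $T$-dimensions are finite. $T\subset S$ is unimodular if all $T$-subbimodules of $L^2(S)$ have equal left and right $T$-dimension. $\overline\otimes_T$ is the Connes tensor product. **$L^2$-Betti numbers.** For a Hilbert $S$-bimodule $\mathcal H$, $H^n(T\subset\mathcal S,\mathcal H)$ is the $n$-th cohomology of the complex with $C^0$ the space of $T$-central vectors of $\mathcal H$, $C^n$ the space of $T$-bimodular linear maps from the $n$-fold algebraic relative tensor product $\mathcal S\otimes_T\cdots\otimes_T\mathcal S$ to $\mathcal H$, and $\delta=\sum_{i=0}^{n+1}(-1)^i\delta_i$, $(\delta_0c)(x_0\otimes\cdots\otimes x_n)=x_0c(x_1\otimes\cdots\otimes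 x_n)$, $(\delta_ic)(x_0\otimes\cdots\otimes x_n)=c(x_0\otimes\cdots\otimes x_{i-1}x_i\otimes\cdots\otimes x_n)$ for $1\le i\le n$, $(\delta_{n+1}c)(x_0\otimes\cdots\otimes x_n)=c(x_0\otimes\cdots\otimes x_{n-1})x_n$. Let $\mathcal L=L^2(T)\oplus L^2(S)\oplus(L^2(S)\overline\otimes_TL^2(S))\oplus\cdots$, $\mathcal H_{\rm reg}=L^2(S)\overline\otimes_T\mathcal L\overline\otimes_TL^2(S)$ and $\mathcal M(T\subset S)=\operatorname{End}_{S-S}(\mathcal H_{\rm reg})$. In the unimodular case $\mathcal M(T\subset S)$ has a normal semifinite faithful trace $\mu$ determined by: for every finite index $T$-bimodule $\mathcal H_1$, $T$-bimodular isometry $W:\mathcal H_1\to\mathcal L$, $p=WW^*$, $V(\xi)=1\otimes W(\xi)\otimes1$, one has $\mu((1\otimes p\otimes1)x(1\otimes p\otimes1))=\mathrm{Tr}_{\mathcal H_1}(V^*xV)$, where $\mathrm{Tr}_{\mathcal H_1}$ is the trace on $\operatorname{End}_{T-T}(\mathcal H_1)$ whose value on a projection is the (left = right) $T$-dimension of its range. Then $\beta_n^{(2)}(T\subset S)=\dim_{\mathcal M(T\subset S)}H^n(T\subset\mathcal S,\mathcal H_{\rm reg})$, with Lück's dimension function for modules over a von Neumann algebra with semifinite trace. *)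

(* Defs.v *)
From HB Require Import structures.
From mathcomp Require Import all_boot all_order all_algebra.
From mathcomp Require Import all_classical all_reals all_analysis.
From mathcomp Require Import complex.
Set Implicit Arguments.
Unset Strict Implicit.
Unset Printing Implicit Defensive.
Import Order.TTheory GRing.Theory Num.Theory.
Import numFieldNormedType.Exports.
Local Open Scope classical_set_scope.
Local Open Scope ring_scope.

HB.mixin Record NormedModule_isHilbert (R : realType) (H : Type)
    of CompleteNormedModule R[i] H := {
  inner : H -> H -> R[i] ;
  (* linear in the first variable, antilinear in the second *)
  inner_linearl : forall (a : R[i]) (x y z : H),
    inner (a *: x + y) z = a * inner x z + inner y z ;
  inner_conj : forall x y : H, inner y x = (inner x y)^* ;
  inner_norm : forall x : H, inner x x = `|x| ^+ 2
}.

#[short(type="hilbertType")]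
HB.structure Definition Hilbert (R : realType) :=
  {H of NormedModule_isHilbert R H & CompleteNormedModule R[i] H}.

Notation "'<< x , y >>" := (inner x y)
  (at level 0, x at level 99, y at level 99, format "''<<' x ,  y '>>'")
  : ring_scope.

Section Hilbert_spaces.
Variable R : realType.
Implicit Types H K : hilbertType R.

Definition bounded_op H K (f : H -> K) : Prop := linear f /\ continuous f.

(* The Hilbert space adjoint (it exists and is unique for a bounded operator;
   the default value is irrelevant). *)
Definition adj H K (f : H -> K) : K -> H :=
  xget (fun _ => 0) [set g | forall x y, '<< f x, y >> = '<< x, g y >>].

(* On R[i], [0 <= z] says that z is real and nonnegative. *)
Definition pos_op H (x : H -> H) : Prop := forall xi, 0 <= '<< x xi, xi >>.

Definition lspan H (A : set H) : set H :=
  [set v | exists n (a : 'I_n -> R[i]) (w : 'I_n -> H),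
     (forall i, A (w i)) /\ v = \sum_i a i *: w i].

Definition closed_subspace H (X : set H) : Prop :=
  [/\ X 0, (forall (a : R[i]) u v, X u -> X v -> X (a *: u + v)) & closed X].

End Hilbert_spaces.

(* Von Neumann algebras are sets of operators on a Hilbert space; the product
   is the composition and the unit is [idfun]. *)
Section von_Neumann_algebras.
Variables (R : realType) (K : hilbertType R).
Implicit Types (M A : set (K -> K)).

Definition commutant A : set (K -> K) :=
  [set y | bounded_op y /\ forall x, A x -> x \o y = y \o x].

Definition vn_algebra M : Prop :=
  [/\ (forall x, M x -> bounded_op x), (forall x, M x -> M (adj x))
    & commutant (commutant M) = M].

Definition scalars : set (K -> K) :=
  [set x | exists a : R[i], x = fun xi => a *: xi].

Definition factor M : Prop := vn_algebra M /\ commutant M `&` M = scalars.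

(* D is an upward directed set of positive operators with supremum x; for
   bounded operators this is convergence of D to x in the strong topology. *)
Definition increases_to (H : hilbertType R) (D : set (H -> H)) (x : H -> H) :
    Prop :=
  [/\ D !=set0,
      (forall d, D d -> pos_op d),
      (forall d d', D d -> D d' ->
         exists e, [/\ D e, pos_op (e \- d) & pos_op (e \- d')])
    & forall xi, supremums [set '<< d xi, xi >> | d in D] '<< x xi, xi >>].

Definition normal_map M (H : hilbertType R) (phi : (K -> K) -> (H -> H)) :
    Prop :=
  forall D x, D `<=` M -> M x -> increases_to D x ->
    increases_to (phi @` D) (phi x).

Definition linear_on (V : lmodType R[i]) M (phi : (K -> K) -> V) : Prop :=
  forall (a : R[i]) x y, M x -> M y ->
    phi (a *: x + y) = a *: phi x + phi y.

Definition faithful_normal_tracial_state M (tau : (K -> K) -> R[i]) : Prop :=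
  [/\ linear_on M (tau : (K -> K) -> R[i]^o) /\ tau idfun = 1,
      (forall x, M x -> 0 <= tau (adj x \o x)),
      (forall x, M x -> tau (adj x \o x) = 0 -> x = fun _ => 0),
      (forall x y, M x -> M y -> tau (x \o y) = tau (y \o x))
    & (forall D x, D `<=` M -> M x -> increases_to D x ->
         supremums (tau @` D) (tau x))].

Definition finite_dimensional M : Prop :=
  exists n (b : 'I_n -> K -> K),
    forall x, M x -> exists a : 'I_n -> R[i], x = \sum_i a i *: b i.

(* A II_1 factor M together with its trace tau (which is unique on M). *)
Definition II1_factor M (tau : (K -> K) -> R[i]) : Prop :=
  [/\ factor M, ~ finite_dimensional M & faithful_normal_tracial_state M tau].

Definition subfactor (T S : set (K -> K)) : Prop := T `<=` S /\ factor T.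

Definition irreducible_inclusion (T S : set (K -> K)) : Prop :=
  commutant T `&` S = scalars.

Definition QN (T S : set (K -> K)) : set (K -> K) :=
  [set x | [/\ S x,
    (exists n (u : 'I_n -> K -> K), (forall i, S (u i)) /\
       forall t, T t -> exists s : 'I_n -> K -> K,
         (forall i, T (s i)) /\ x \o t = \sum_i (s i \o u i))
    & (exists n (u : 'I_n -> K -> K), (forall i, S (u i)) /\
       forall t, T t -> exists s : 'I_n -> K -> K,
         (forall i, T (s i)) /\ t \o x = \sum_i (u i \o s i))]].

Definition quasi_regular (T S : set (K -> K)) : Prop :=
  commutant (commutant (QN T S)) = S.

Definition contraction (x : K -> K) : Prop := forall xi, `|x xi| <= `|xi|.

Definition norm2 (tau : (K -> K) -> R[i]) (x : K -> K) : R :=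
  Num.sqrt (complex.Re (tau (adj x \o x))).

Definition completely_positive M (phi : (K -> K) -> (K -> K)) : Prop :=
  forall n (x : 'I_n -> 'I_n -> K -> K), (forall i j, M (x i j)) ->
    (forall xi : 'I_n -> K, 0 <= \sum_i \sum_j '<< x i j (xi j), xi i >>) ->
    forall xi : 'I_n -> K, 0 <= \sum_i \sum_j '<< phi (x i j) (xi j), xi i >>.

Definition normal_bimodular_cp (T S : set (K -> K))
    (phi : (K -> K) -> (K -> K)) : Prop :=
  [/\ (forall x, S x -> S (phi x)) /\ linear_on S phi,
      normal_map S phi,
      completely_positive S phi
    & forall t x s, T t -> S x -> T s ->
        phi (t \o x \o s) = t \o phi x \o s].

Definition directed_order (I : Type) (le : I -> I -> Prop) : Prop :=
  [/\ inhabited I, (forall i, le i i),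
      (forall i j k, le i j -> le j k -> le i k)
    & forall i j, exists k, le i k /\ le j k].

Definition property_T_relative (T S : set (K -> K)) (tau : (K -> K) -> R[i]) :
    Prop :=
  forall (I : Type) (le : I -> I -> Prop) (phi : I -> (K -> K) -> (K -> K)),
    directed_order le ->
    (forall i, normal_bimodular_cp T S (phi i)) ->
    (forall x, S x -> forall eps : R, 0 < eps ->
       exists i0, forall i, le i0 i -> norm2 tau (phi i x \- x) <= eps) ->
    forall eps : R, 0 < eps ->
      exists i0, forall i, le i0 i ->
        (ereal_sup [set (norm2 tau (phi i x \- x))%:E
                   | x in [set x | S x /\ contraction x]] <= eps%:E)%E.

End von_Neumann_algebras.

(* A Hilbert space with left and right multiplication by operators on K.  The
   same object can be a bimodule over several pairs of algebras on K, e.g. an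
   S-S-bimodule is also a T-T-bimodule if T is contained in S. *)
Record biact (R : realType) (K : hilbertType R) := Biact {
  bi_space :> hilbertType R ;
  lact : (K -> K) -> bi_space -> bi_space ;
  ract : (K -> K) -> bi_space -> bi_space
}.

Section bimodules.
Variables (R : realType) (K : hilbertType R).
Implicit Types (M N S T A B : set (K -> K)) (X Y Z : biact K).

Definition normal_star_map M (H : hilbertType R) (pi : (K -> K) -> (H -> H)) :
    Prop :=
  [/\ linear_on M pi /\ pi idfun = idfun,
      (forall x, M x -> bounded_op (pi x)),
      (forall x, M x -> pi (adj x) = adj (pi x))
    & normal_map M pi].

Definition bimodule M N X : Prop :=
  [/\ normal_star_map M (@lact _ _ X) /\
      (forall x y, M x -> M y -> @lact _ _ X (x \o y) = lact x \o lact y),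
      normal_star_map N (@ract _ _ X) /\
      (forall x y, N x -> N y -> @ract _ _ X (x \o y) = ract y \o ract x)
    & forall x y (xi : X), M x -> N y ->
        lact x (ract y xi) = ract y (lact x xi)].

Definition bimodular M N X Y (f : X -> Y) : Prop :=
  (forall x xi, M x -> f (lact x xi) = lact x (f xi)) /\
  (forall y xi, N y -> f (ract y xi) = ract y (f xi)).

Definition bimodule_End M N X : set (X -> X) :=
  [set f | bounded_op f /\ bimodular M N f].

Definition isometry (H H' : hilbertType R) (f : H -> H') : Prop :=
  linear f /\ forall xi, `|f xi| = `|xi|.

(* X is L^2(M) with one the image of the unit of M. *)
Definition is_L2 M (tau : (K -> K) -> R[i]) X (one : X) : Prop :=
  [/\ bimodule M M X,
      (forall x, M x -> lact x one = ract x one),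
      (forall x, M x -> '<< lact x one, one >> = tau x)
    & closure [set lact x one | x in M] = setT].

Definition is_hilbert_sum M N (X : nat -> biact K) Y
    (inj : forall n, X n -> Y) : Prop :=
  [/\ bimodule M N Y,
      (forall n, isometry (inj n) /\ bimodular M N (inj n)),
      (forall m n (xi : X m) (eta : X n), m != n ->
         '<< inj m xi, inj n eta >> = 0)
    & closure (lspan [set zeta | exists n (xi : X n), zeta = inj n xi]) = setT].

(* The vectors xi for which t |-> xi t extends to a bounded operator L_xi from
   L^2(T) to X. *)
Definition right_bounded T (tau : (K -> K) -> R[i]) X : set X :=
  [set xi | exists c : R, forall t, T t ->
     `|ract t xi| <= (c * norm2 tau t)%:C%C].

(* z = L_xi'^* L_xi, as an element of T *)
Definition T_inner T (tau : (K -> K) -> R[i]) X (xi' xi : X) (z : K -> K) :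
    Prop :=
  T z /\ forall t, T t -> '<< ract t xi, xi' >> = tau (z \o t).

(* Z is the Connes tensor product over T of the A-T-bimodule X and the
   T-B-bimodule Y, i.e. the completion of the algebraic tensor product of the
   right T-bounded vectors of X with Y.  [ten xi eta] is only specified for xi
   right T-bounded.  Biadditivity of ten and [ten (ract t xi) eta =
   ten xi (lact t eta)] follow from the formula for the inner product. *)
Definition is_connes_tensor T (tau : (K -> K) -> R[i]) A B X Y Z
    (ten : X -> Y -> Z) : Prop :=
  [/\ bimodule A B Z,
      (forall xi xi' eta eta', right_bounded T tau xi ->
         right_bounded T tau xi' ->
         exists2 z, T_inner T tau xi' xi z &
           '<< ten xi eta, ten xi' eta' >> = '<< lact z eta, eta' >>),
      (forall a xi eta, A a -> right_bounded T tau xi ->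
         lact a (ten xi eta) = ten (lact a xi) eta),
      (forall b xi eta, B b -> right_bounded T tau xi ->
         ract b (ten xi eta) = ten xi (ract b eta))
    & closure (lspan [set zeta | exists xi eta,
        right_bounded T tau xi /\ zeta = ten xi eta]) = setT].

(* Hreg, up to the unitary equivalence that L^2-spaces, direct sums and Connes
   tensor products are determined by.  [rb_pow n] is L^2(T) for n = 0 and the
   n-fold Connes tensor power of L^2(S) over T for n > 0. *)
Record regular_bimodule T S (tau : (K -> K) -> R[i]) := RegularBimodule {
  rb_pow : nat -> biact K ;
  rb_oneT : rb_pow 0 ;
  rb_oneS : rb_pow 1 ;
  rb_ten : forall n, rb_pow 1 -> rb_pow n.+1 -> rb_pow n.+2 ;
  rb_L : biact K ;
  rb_inj : forall n, rb_pow n -> rb_L ;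
  rb_LS : biact K ;
  rb_tenr : rb_L -> rb_pow 1 -> rb_LS ;
  rb_Hreg : biact K ;
  rb_tenl : rb_pow 1 -> rb_LS -> rb_Hreg ;
  rb_L2T : is_L2 T tau rb_oneT ;
  rb_L2S : is_L2 S tau rb_oneS ;
  rb_powP : forall n, is_connes_tensor T tau S S (@rb_ten n) ;
  rb_LP : is_hilbert_sum T T rb_inj ;
  rb_LSP : is_connes_tensor T tau T S rb_tenr ;
  rb_HregP : is_connes_tensor T tau S S rb_tenl
}.

(* d is the T-dimension of the closed T-submodule D of H, for an action aH of T
   on H (left or right) and the corresponding action aL of T on L = L^2(T).
   The family V is a T-linear isometry from D into the direct sum of copies of
   L indexed by I, extended by 0 on the orthogonal complement of D, and the
   last sum is the value on its range projection V V^* of the tensor product of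
   the vector state of the unit of T with the trace of B(l^2(I)). *)
Definition module_dim T (L H : hilbertType R) (one : L)
    (aL : (K -> K) -> L -> L) (aH : (K -> K) -> H -> H)
    (D : set H) (d : \bar R) : Prop :=
  exists (I : choiceType) (V : I -> H -> L),
    [/\ (forall i, bounded_op (V i)),
        (forall i t xi, T t -> V i (aH t xi) = aL t (V i xi)),
        (forall xi, D xi ->
           \esum_(i in [set: I]) (complex.Re (`|V i xi| ^+ 2))%:E
           = (complex.Re (`|xi| ^+ 2))%:E),
        (forall i xi, (forall eta, D eta -> '<< xi, eta >> = 0) -> V i xi = 0)
      & d = \esum_(i in [set: I]) (complex.Re (`|adj (V i) one| ^+ 2))%:E].

Section regular.
Variables (T S : set (K -> K)) (tau : (K -> K) -> R[i]).
Variable E : regular_bimodule T S tau.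
Local Notation L2T := (rb_pow E 0).
Local Notation L2S := (rb_pow E 1).
Local Notation LL := (rb_L E).
Local Notation Hreg := (rb_Hreg E).

Definition left_dim X (D : set X) (d : \bar R) : Prop :=
  module_dim T (rb_oneT E) (@lact _ _ L2T) (@lact _ _ X) D d.

Definition right_dim X (D : set X) (d : \bar R) : Prop :=
  module_dim T (rb_oneT E) (@ract _ _ L2T) (@ract _ _ X) D d.

Definition sub_bimodule X (D : set X) : Prop :=
  [/\ closed_subspace D, (forall t xi, T t -> D xi -> D (lact t xi))
    & (forall t xi, T t -> D xi -> D (ract t xi))].

Definition unimodular : Prop :=
  forall D : set L2S, sub_bimodule D ->
    exists2 d, left_dim D d & right_dim D d.

Definition finite_index X : Prop :=
  bimodule T T X /\
  exists dl dr : R, left_dim [set: X] dl%:E /\ right_dim [set: X] dr%:E.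

(* For a finite index T-bimodule X, this determines Tr on the T-bimodular
   endomorphisms, which form a finite-dimensional algebra. *)
Definition is_bimodule_trace X (Tr : (X -> X) -> R[i]) : Prop :=
  [/\ (forall (a : R[i]) x y, bimodule_End T T x -> bimodule_End T T y ->
         Tr (a *: x + y) = a * Tr x + Tr y),
      (forall x y, bimodule_End T T x -> bimodule_End T T y -> Tr (x \o y) = Tr (y \o x))
    & (forall q, bimodule_End T T q -> q \o q = q -> adj q = q ->
         exists d : R, [/\ Tr q = d%:C%C, left_dim (range q) d%:E
                         & right_dim (range q) d%:E])].

Definition nsf_trace (H : hilbertType R) (M : set (H -> H))
    (mu : (H -> H) -> \bar R) : Prop :=
  let Mp := [set x | M x /\ pos_op x] in
  [/\ (forall x, Mp x -> 0 <= mu x)%E /\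
      (forall x y, Mp x -> Mp y -> mu (x + y)%R = mu x + mu y)%E,
      (forall (a : R) x, 0 <= a -> Mp x -> mu (a%:C%C *: x) = (a%:E * mu x)%E) /\
      (forall x, M x -> mu (adj x \o x) = mu (x \o adj x)),
      (forall x, Mp x -> mu x = 0%E -> x = 0),
      (forall D x, D `<=` M -> M x -> increases_to D x ->
         mu x = ereal_sup (mu @` D))
    & (forall x, Mp x -> x <> 0 ->
         exists y, [/\ Mp y, y <> 0, pos_op (x \- y) & (mu y < +oo)%E])].

Definition M_reg : set (Hreg -> Hreg) := @bimodule_End S S Hreg.

(* This is 1 (x) zeta (x) 1 only if zeta is right T-bounded. *)
Definition one_ten_one (zeta : LL) : Hreg :=
  rb_tenl (rb_oneS E) (rb_tenr zeta (rb_oneS E)).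

(* e = 1 (x) p (x) 1 *)
Definition is_one_ten_op (p : LL -> LL) (e : Hreg -> Hreg) : Prop :=
  bounded_op e /\
  forall (om : L2S) (zeta : LL) (eta : L2S),
    right_bounded T tau om -> right_bounded T tau zeta ->
    e (rb_tenl om (rb_tenr zeta eta)) = rb_tenl om (rb_tenr (p zeta) eta).

(* V xi = 1 (x) W xi (x) 1; the right T-bounded vectors are dense, and V is the
   continuous extension. *)
Definition is_one_ten_map X (W : X -> LL) (V : X -> Hreg) : Prop :=
  bounded_op V /\
  forall xi, right_bounded T tau (W xi) -> V xi = one_ten_one (W xi).

(* The formula for mu is stated for positive x, where mu is defined as a
   weight; both sides are linear in x. *)
Definition regular_trace (mu : (Hreg -> Hreg) -> \bar R) : Prop :=
  nsf_trace M_reg mu /\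
  forall (X : biact K) (W : X -> LL) (V : X -> Hreg) (e : Hreg -> Hreg)
         (Tr : (X -> X) -> R[i]) (x : Hreg -> Hreg),
    finite_index X -> isometry W -> bimodular T T W ->
    is_one_ten_op (W \o adj W) e -> is_one_ten_map W V ->
    is_bimodule_trace Tr -> M_reg x -> pos_op x ->
    mu (e \o x \o e) = (complex.Re (Tr (adj V \o x \o V)))%:E.

End regular.

(* The complex C^n(T, QN_S(T), X).  A linear map on the n-fold relative tensor
   product of QN_S(T) is a multilinear T-balanced function of n elements of
   QN_S(T); the values of a cochain on other operators are irrelevant, since
   coboundaries are only prescribed on QN_S(T). *)
Section cohomology.
Variables (T S : set (K -> K)) (X : biact K).

Definition tuple_in (n : nat) (x : 'I_n -> K -> K) : Prop :=
  forall i, QN T S (x i).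

Definition upd (n : nat) (x : 'I_n -> K -> K) (i : 'I_n) (y : K -> K) :
    'I_n -> K -> K := dfwith x i y.

Definition cochain (n : nat) : set (('I_n -> K -> K) -> X) :=
  match n with
  | 0 => [set c | forall x t, T t -> lact t (c x) = ract t (c x)]
  | m.+1 => [set c |
    [/\ (forall x i (a : R[i]) y z, tuple_in x -> QN T S y -> QN T S z ->
           c (upd x i (a *: y + z)) = a *: c (upd x i y) + c (upd x i z)),
        (forall x t, tuple_in x -> T t ->
           c (upd x ord0 (t \o x ord0)) = lact t (c x)),
        (forall x t, tuple_in x -> T t ->
           c (upd x ord_max (x ord_max \o t)) = ract t (c x))
      & (forall x t (i : 'I_m), tuple_in x -> T t ->
           (* lift ord_max i and lift ord0 i have values i and i.+1 *)
           c (upd x (lift ord_max i) (x (lift ord_max i) \o t)) =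
           c (upd x (lift ord0 i) (t \o x (lift ord0 i))))]]
  end.

(* For 0 < i < n.+1, face i multiplies the entries i.-1 and i; face 0 and face
   n.+1 drop the first and the last entry. *)
Definition face (n : nat) (i : nat) (x : 'I_n.+1 -> K -> K) : 'I_n -> K -> K :=
  fun k =>
    if (k.+1 < i)%N then x (lift ord_max k)
    else if k.+1 == i then x (lift ord_max k) \o x (lift ord0 k)
    else x (lift ord0 k).

Definition delta (n : nat) (c : ('I_n -> K -> K) -> X) :
    ('I_n.+1 -> K -> K) -> X :=
  fun x => \sum_(i < n.+2) (-1) ^+ i *:
    (if i == 0%N :> nat then lact (x ord0) (c (face i x))
     else if i == n.+1 :> nat then ract (x ord_max) (c (face i x))
     else c (face i x)).

Definition cocycle (n : nat) : set (('I_n -> K -> K) -> X) :=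
  [set c | @cochain n c /\ forall x, tuple_in x -> delta c x = 0].

Definition coboundary (n : nat) : set (('I_n -> K -> K) -> X) :=
  match n with
  | 0 => [set c | forall x, tuple_in x -> c x = 0]
  | m.+1 => [set c | exists2 b, @cochain m b &
                       forall x, tuple_in x -> c x = delta b x]
  end.

End cohomology.

End bimodules.

Section Luck_dimension.
Variables (R : realType) (H : hilbertType R).
Variables (M : set (H -> H)) (mu : (H -> H) -> \bar R).

Definition matrix_projection (n : nat) (p : 'I_n -> 'I_n -> H -> H) : Prop :=
  [/\ (forall i j, M (p i j)), (forall i j, adj (p i j) = p j i)
    & (forall i j, \sum_k (p i k \o p k j) = p i j)].

(* the left M-module M^n p of row vectors *)
Definition projective_module (n : nat) (p : 'I_n -> 'I_n -> H -> H) :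
    set ('I_n -> H -> H) :=
  [set v | (forall i, M (v i)) /\ forall j, \sum_i (v i \o p i j) = v j].

(* The dimension of the left M-module Z / B, for submodules B of Z of a left
   M-module A: the supremum of the dimensions of the finitely generated
   projective modules which embed into Z / B.  The function f gives
   representatives of an injective M-linear map from M^n p to Z / B. *)
Definition Luck_dim (A : zmodType) (act : (H -> H) -> A -> A) (Z B : set A) :
    \bar R :=
  ereal_sup [set d | exists n (p : 'I_n -> 'I_n -> H -> H)
                            (f : ('I_n -> H -> H) -> A),
    [/\ matrix_projection p,
        (forall v, projective_module p v -> Z (f v)),
        (forall a v w, M a -> projective_module p v -> projective_module p w ->
           B (f (fun i => (a \o v i) + w i) - (act a (f v) + f w))),
        (forall v, projective_module p v -> B (f v) -> forall i, v i = 0)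
      & d = (\sum_i mu (p i i))%E]].

End Luck_dimension.

Definition L2_betti (R : realType) (K : hilbertType R) (T S : set (K -> K))
    (tau : (K -> K) -> R[i]) (E : regular_bimodule T S tau)
    (mu : (rb_Hreg E -> rb_Hreg E) -> \bar R) (n : nat) : \bar R :=
  Luck_dim (M_reg (E := E)) mu
    (fun a (c : ('I_n -> K -> K) -> rb_Hreg E) => a \o c)
    (@cocycle _ _ T S (rb_Hreg E) n) (@coboundary _ _ T S (rb_Hreg E) n).

(* Main.v *)
Require Import Defs.
From HB Require Import structures.
From mathcomp Require Import all_boot all_order all_algebra.
From mathcomp Require Import all_classical all_reals all_analysis.
From mathcomp Require Import complex ring lra.
Set Implicit Arguments.
Unset Strict Implicit.
Unset Printing Implicit Defensive.
Import Order.TTheory GRing.Theory Num.Theory.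
Import numFieldNormedType.Exports.
Local Open Scope classical_set_scope.
Local Open Scope ring_scope.

(* A 1-cocycle is a T-bimodular derivation c from QN_S(T) to an S-bimodule, and
   all such derivations turn out to be inner, whence H^1 = 0.

   The form |c(x)|^2 + |c(x^* )|^2 is T-bimodular and, by quasi-regularity, is
   given by bounded operators on a large supply of finite index T-subbimodules
   of L^2(S).  Hence its resolvents R_eps preserve QN_S(T).  By the derivation
   rule for matrices over QN_S(T) they extend to normal T-bimodular completely
   positive maps of S, which converge to the identity in 2-norm as eps -> 0, so
   by property (T) some W = 1 - R_eps is small in 2-norm on the unit ball of S.

   This bounds the norm of W on L^2(S): otherwise a log-convexity argument gives
   n_1, ..., n_k in S with sum n_j^* n_j scalar on which W is large.  For suitable
   unitaries u_j of T the fourth moment of y = sum u_j n_j is small, by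
   irreducibility, while W y remains large, so that a truncation of y contradicts
   the choice of W.  Hence R_eps is invertible, c is bounded in 2-norm, and the
   circumcenter of the set of all c(u) u^* , with u a unitary of the norm closure
   of QN_S(T), implements c. *)

(** * The real inner product of a complex Hilbert space *)

(** Resolvents are built on one finite bimodule at a time: irreducibility bounds the multiplicity of
    a T-bimodule in L^2(S), so each element of QN_S(T) lies in a finite bimodule stable under all
    T-bimodular operators and under J; the form is bounded there and does not couple it to its
    orthogonal complement. Contractivity comes from moments, not from functional calculus: for Y the
    resolvent of a self-adjoint V, tr(Y^(2m+1) (V - Y)) is a positive multiple of the real inner
    product of c(Y^(2m+1)) and c(Y), which the Leibniz rule turns into a positive expression in the
    left and right multiplications by Y. A unital map that is contractive on matrices of all sizes
    is completely positive. Averages over the unitaries of T never occur: irreducibility enters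
    through points of least 2-norm in invariant closed convex sets, which must be scalars. *)

Section Inner_product.
Variable R : realType.
Implicit Types H : hilbertType R.

(** The order on [R[i]] is only partial; estimates are made with the real numbers [hn] and [dot], on
    which [lra] and [nra] work. *)
Definition hn H (x : H) : R := complex.Re `|x|.
Definition dot H (x y : H) : R := complex.Re '<<x, y>>.

Lemma hnE H (x : H) : `|x| = (hn x)%:C%C.
Proof.
by have := normr_ge0 x; rewrite /hn lecE; case: `|x| => a b /= /andP[/eqP -> _].
Qed.

Lemma hn_ge0 H (x : H) : 0 <= hn x.
Proof. by have := normr_ge0 x; rewrite hnE lecR. Qed.
Hint Resolve hn_ge0 : core.

Lemma Re_normC_ge0 (a : R[i]) : 0 <= complex.Re `|a|.
Proof. by rewrite normc_def /= sqrtr_ge0. Qed.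

Lemma normCE (a : R[i]) : `|a| = (complex.Re `|a|)%:C%C.
Proof. by rewrite normc_def. Qed.

Lemma hn_eq0 H (x : H) : hn x = 0 -> x = 0.
Proof. by move=> x0; apply/eqP; rewrite -normr_eq0 hnE x0. Qed.

Lemma hn0 H : hn (0 : H) = 0.
Proof. by rewrite /hn normr0. Qed.

Lemma hnD H (x y : H) : hn (x + y) <= hn x + hn y.
Proof. by have := ler_normD x y; rewrite !hnE -rmorphD lecR. Qed.

Lemma hnN H (x : H) : hn (- x) = hn x.
Proof. by rewrite /hn normrN. Qed.

Lemma hnB H (x y : H) : hn (x - y) <= hn x + hn y.
Proof. by rewrite -(hnN y); exact: hnD. Qed.

Lemma hnC H (x y : H) : hn (x - y) = hn (y - x).
Proof. by rewrite -hnN opprB. Qed.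

Lemma hnZ H (a : R[i]) (x : H) : hn (a *: x) = complex.Re `|a| * hn x.
Proof.
rewrite /hn normrZ; have : 0 <= `|a| by [].
have : 0 <= `|x| by [].
case: `|a| => a1 a2; case: `|x| => x1 x2.
by rewrite !lecE /= => /andP[/eqP -> _] /andP[/eqP -> _]; rewrite mulr0 subr0.
Qed.

Lemma hnZr H (r : R) (x : H) : hn (r%:C%C *: x) = `|r| * hn x.
Proof. by rewrite hnZ normc_def /= expr0n /= addr0 sqrtr_sqr. Qed.

Lemma hn_tri H (z x y : H) : hn (x - y) <= hn (x - z) + hn (z - y).
Proof. by rewrite -[x - y](subrKA z); exact: hnD. Qed.

Lemma innerDl H (x y z : H) : '<<x + y, z>> = '<<x, z>> + '<<y, z>>.
Proof. by have := inner_linearl 1 x y z; rewrite scale1r mul1r. Qed.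

Lemma inner0l H (z : H) : '<<0, z>> = 0.
Proof. by apply: (addrI '<<0, z>>); rewrite -innerDl !addr0. Qed.

Lemma innerZl H a (x z : H) : '<<a *: x, z>> = a * '<<x, z>>.
Proof. by have := inner_linearl a x 0 z; rewrite addr0 inner0l addr0. Qed.

Lemma innerNl H (x z : H) : '<<- x, z>> = - '<<x, z>>.
Proof. by rewrite -scaleN1r innerZl mulN1r. Qed.

Lemma innerBl H (x y z : H) : '<<x - y, z>> = '<<x, z>> - '<<y, z>>.
Proof. by rewrite innerDl innerNl. Qed.

Lemma inner_suml H (I : Type) (r : seq I) (P : pred I) (F : I -> H) z :
  '<<\sum_(i <- r | P i) F i, z>> = \sum_(i <- r | P i) '<<F i, z>>.
Proof. exact: (big_morph (fun x => '<<x, z>>) (fun x y => innerDl x y z) (inner0l z)). Qed.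

Lemma innerDr H (z x y : H) : '<<z, x + y>> = '<<z, x>> + '<<z, y>>.
Proof. by rewrite inner_conj innerDl rmorphD /= -!inner_conj. Qed.

Lemma inner0r H (z : H) : '<<z, 0>> = 0.
Proof. by rewrite inner_conj inner0l rmorph0. Qed.

Lemma innerZr H a (z x : H) : '<<z, a *: x>> = a^* * '<<z, x>>.
Proof. by rewrite inner_conj innerZl rmorphM /= -inner_conj. Qed.

Lemma innerNr H (z x : H) : '<<z, - x>> = - '<<z, x>>.
Proof. by rewrite inner_conj innerNl rmorphN /= -inner_conj. Qed.

Lemma innerBr H (z x y : H) : '<<z, x - y>> = '<<z, x>> - '<<z, y>>.
Proof. by rewrite innerDr innerNr. Qed.

Lemma inner_sumr H (I : Type) (r : seq I) (P : pred I) (F : I -> H) z :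
  '<<z, \sum_(i <- r | P i) F i>> = \sum_(i <- r | P i) '<<z, F i>>.
Proof. exact: (big_morph (fun x => '<<z, x>>) (fun x y => innerDr z x y) (inner0r z)). Qed.

Lemma inner_xx H (x : H) : '<<x, x>> = (hn x ^+ 2)%:C%C.
Proof. by rewrite inner_norm hnE rmorphXn. Qed.

Lemma ReD (a b : R[i]) : complex.Re (a + b) = complex.Re a + complex.Re b.
Proof. by case: a; case: b. Qed.
Lemma ReN (a : R[i]) : complex.Re (- a) = - complex.Re a.
Proof. by case: a. Qed.
Lemma ReB (a b : R[i]) : complex.Re (a - b) = complex.Re a - complex.Re b.
Proof. by rewrite ReD ReN. Qed.
Lemma ReRM (r : R) (a : R[i]) : complex.Re (r%:C%C * a) = r * complex.Re a.
Proof. by case: a => x y /=; rewrite mul0r subr0. Qed.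
Lemma Re_sum (I : Type) (r : seq I) (P : pred I) (F : I -> R[i]) :
  complex.Re (\sum_(i <- r | P i) F i) = \sum_(i <- r | P i) complex.Re (F i).
Proof. exact: (big_morph (fun x : R[i] => complex.Re x) ReD). Qed.

Lemma dotDl H (x y z : H) : dot (x + y) z = dot x z + dot y z.
Proof. by rewrite /dot innerDl ReD. Qed.
Lemma dotDr H (x y z : H) : dot z (x + y) = dot z x + dot z y.
Proof. by rewrite /dot innerDr ReD. Qed.
Lemma dotNl H (x z : H) : dot (- x) z = - dot x z.
Proof. by rewrite /dot innerNl ReN. Qed.
Lemma dotNr H (x z : H) : dot z (- x) = - dot z x.
Proof. by rewrite /dot innerNr ReN. Qed.
Lemma dotBl H (x y z : H) : dot (x - y) z = dot x z - dot y z.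
Proof. by rewrite dotDl dotNl. Qed.
Lemma dotBr H (x y z : H) : dot z (x - y) = dot z x - dot z y.
Proof. by rewrite dotDr dotNr. Qed.
Lemma dot0l H (z : H) : dot 0 z = 0.
Proof. by rewrite /dot inner0l. Qed.
Lemma dot0r H (z : H) : dot z 0 = 0.
Proof. by rewrite /dot inner0r. Qed.
Lemma dotC H (x y : H) : dot x y = dot y x.
Proof. by rewrite /dot inner_conj; case: '<<_, _>>. Qed.
Lemma dotZl H r (x z : H) : dot (r%:C%C *: x) z = r * dot x z.
Proof. by rewrite /dot innerZl ReRM. Qed.
Lemma dotZr H r (x z : H) : dot z (r%:C%C *: x) = r * dot z x.
Proof. by rewrite dotC dotZl dotC. Qed.
Lemma dot_suml H (I : Type) (r : seq I) (P : pred I) (F : I -> H) z :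
  dot (\sum_(i <- r | P i) F i) z = \sum_(i <- r | P i) dot (F i) z.
Proof. by rewrite /dot inner_suml Re_sum. Qed.
Lemma dot_sumr H (I : Type) (r : seq I) (P : pred I) (F : I -> H) z :
  dot z (\sum_(i <- r | P i) F i) = \sum_(i <- r | P i) dot z (F i).
Proof. by rewrite /dot inner_sumr Re_sum. Qed.
Lemma dotxx H (x : H) : dot x x = hn x ^+ 2.
Proof. by rewrite /dot inner_xx. Qed.

Lemma hn2D H (x y : H) : hn (x + y) ^+ 2 = hn x ^+ 2 + 2 * dot x y + hn y ^+ 2.
Proof. by rewrite -!dotxx dotDl !dotDr (dotC y x); lra. Qed.

Lemma hn2B H (x y : H) : hn (x - y) ^+ 2 = hn x ^+ 2 - 2 * dot x y + hn y ^+ 2.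
Proof. by rewrite hn2D dotNr hnN mulrN. Qed.

Lemma parallelogram H (x y : H) :
  hn (x + y) ^+ 2 + hn (x - y) ^+ 2 = 2 * hn x ^+ 2 + 2 * hn y ^+ 2.
Proof. by rewrite hn2D hn2B; lra. Qed.

(** The imaginary part of the inner product is itself a value of [dot], so complex identities reduce
    to two real ones and inherit the limit theorems proved for [dot]. *)
Lemma inner_dot H (x y : H) :
  '<<x, y>> = (dot x y)%:C%C + 'i%C * (dot x ('i%C *: y))%:C%C.
Proof.
rewrite /dot innerZr; case: '<<x, y>> => a b /=.
by simpc; rewrite /= ?mul0r ?mulN1r ?subr0 ?opprK ?add0r ?sub0r ?mul1r ?opprK.
Qed.

Lemma inner_eq_dot H H' (x y : H) (z w : H') :
  dot x y = dot z w -> dot x ('i%C *: y) = dot z ('i%C *: w) ->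
  '<<x, y>> = '<<z, w>>.
Proof. by rewrite (inner_dot x y) (inner_dot z w) => -> ->. Qed.

Lemma dot_ext H (x : H) : (forall y, dot x y = 0) -> x = 0.
Proof. by move=> /(_ x); rewrite dotxx => /eqP; rewrite sqrf_eq0 => /eqP/hn_eq0. Qed.

Lemma dot_inj H (x y : H) : (forall z, dot x z = dot y z) -> x = y.
Proof.
by move=> e; apply/eqP; rewrite -subr_eq0; apply/eqP/dot_ext => z; rewrite dotBl e subrr.
Qed.

Lemma inner_inj H (x y : H) : (forall z, '<<x, z>> = '<<y, z>>) -> x = y.
Proof. by move=> e; apply: dot_inj => z; rewrite /dot e. Qed.

(** The discriminant of a nonnegative quadratic polynomial. The Cauchy-Schwarz inequalities below
    come from it: for inner products, positive operators, traces and Hermitian forms. *)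
Lemma quad_ge0 (a b c : R) : 0 <= a -> (forall t, 0 <= a + 2 * t * b + t ^+ 2 * c) ->
  b ^+ 2 <= a * c.
Proof.
move=> a0 h.
have [c0|c0] := eqVneq c 0.
  suff -> : b = 0 by rewrite expr0n /= c0 mulr0.
  apply/eqP/negPn/negP => b0.
  have := h (- (a + 1) / (2 * b)); rewrite c0 mulr0 addr0.
  have -> : 2 * (- (a + 1) / (2 * b)) * b = - (a + 1) by field.
  lra.
have h1 := h 1; have h2 := h (-1).
have cp : 0 < c.
  rewrite lt_neqAle eq_sym c0 /= leNgt; apply/negP => cn.
  have b2 : 0 <= b ^+ 2 by exact: sqr_ge0.
  have bb := ler_norm b; have nb := normr_ge0 b.
  (* For negative [c] this [t] is at least 1 and makes [t * c] so negative that the linear term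
     cannot compensate. *)
  have := h ((a + 1 + 2 * `|b| - c) / (- c)).
  set t := _ / _ => ht.
  have t0 : t * c = - (a + 1 + 2 * `|b| - c) by rewrite /t; field.
  have t1 : 1 <= t by rewrite ler_pdivlMr ?oppr_gt0 // mul1r; lra.
  have : a + t * (2 * b + t * c) < 0 by rewrite t0; nra.
  by lra.
have := h (- b / c).
have -> : a + 2 * (- b / c) * b + (- b / c) ^+ 2 * c = a - b ^+ 2 / c by field.
by rewrite subr_ge0 ler_pdivrMr.
Qed.

Lemma dot_CS H (x y : H) : dot x y <= hn x * hn y.
Proof.
have : dot x y ^+ 2 <= hn x ^+ 2 * hn y ^+ 2.
  apply: quad_ge0 => [|t]; first exact: sqr_ge0.
  suff -> : hn x ^+ 2 + 2 * t * dot x y + t ^+ 2 * hn y ^+ 2 = hn (x + t%:C%C *: y) ^+ 2.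
    exact: sqr_ge0.
  by rewrite hn2D dotZr hnZr exprMn real_normK ?num_real //; lra.
have [d0 h|d0 _] := leP 0 (dot x y); last by rewrite (le_trans (ltW d0)) ?mulr_ge0.
by rewrite -ler_sqr ?nnegrE ?mulr_ge0 // exprMn.
Qed.

Lemma dot_CSN H (x y : H) : - (hn x * hn y) <= dot x y.
Proof. by rewrite lerNl -dotNl -(hnN x); exact: dot_CS. Qed.

Lemma dot_CSabs H (x y : H) : `|dot x y| <= hn x * hn y.
Proof. by rewrite ler_norml dot_CSN dot_CS. Qed.

Lemma hn_le_dot H (x : H) (c : R) : 0 <= c ->
  (forall y, dot x y <= c * hn y) -> hn x <= c.
Proof.
move=> c0 /(_ x); rewrite dotxx expr2 => h.
have [->//|x0] := eqVneq (hn x) 0.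
by move: h; rewrite ler_pM2r // lt_neqAle eq_sym x0 hn_ge0.
Qed.

(** Sequential limits with real radii; [hclosureP] and [hcomplete] translate closures and
    completeness into them. *)
Definition hcvg H (u : nat -> H) (l : H) :=
  forall e : R, 0 < e -> exists N, forall n, (N <= n)%N -> hn (u n - l) < e.

Definition hcauchy H (u : nat -> H) :=
  forall e : R, 0 < e -> exists N, forall m n, (N <= m)%N -> (N <= n)%N -> hn (u m - u n) < e.

Lemma hball H (x : H) (e : R) y : ball x e%:C%C y <-> hn (x - y) < e.
Proof. by rewrite -ball_normE /ball_ /= hnE ltcR. Qed.

Lemma pos_complex (e : R[i]) : 0 < e -> exists2 r : R, 0 < r & e = r%:C%C.
Proof. by case: e => a b; rewrite ltcE /= => /andP[/eqP -> a0]; exists a. Qed.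

Lemma hnbhsP H (x : H) (A : set H) :
  nbhs x A <-> exists2 e : R, 0 < e & forall y, hn (x - y) < e -> A y.
Proof.
split=> [/nbhs_ballP[e /= /pos_complex[r r0 ->] h]|[e e0 h]].
  by exists r => // y xy; apply: h; apply/hball.
by apply/nbhs_ballP; exists e%:C%C; [rewrite /= ltcR|move=> y /hball /h].
Qed.

Lemma hclosureP H (A : set H) x :
  closure A x <-> forall e : R, 0 < e -> exists2 a, A a & hn (x - a) < e.
Proof.
split=> [cA e e0|h B /hnbhsP[e e0 hB]].
  have [|a [Aa ha]] := cA [set y | hn (x - y) < e]; last by exists a.
  by apply/hnbhsP; exists e.
by have [a Aa xa] := h e e0; exists a; split => //; apply: hB.
Qed.

Lemma hclosedP H (A : set H) :
  closed A <-> forall x, (forall e : R, 0 < e -> exists2 a, A a & hn (x - a) < e) -> A x.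
Proof.
split=> [cA x /hclosureP h|h x /hclosureP]; last exact: h.
by move: h; rewrite -(closure_id A).1.
Qed.

Lemma hcvg_closed H (A : set H) u l : closed A -> (forall n, A (u n)) -> hcvg u l -> A l.
Proof.
move=> /hclosedP cA Au ul; apply: cA => e /ul[N h].
by exists (u N) => //; rewrite hnC h.
Qed.

Lemma hcomplete H (u : nat -> H) : hcauchy u -> exists l, hcvg u l.
Proof.
move=> cu.
have /cauchy_cvg/cvg_ex[l ul] : cauchy (u @ \oo).
  apply/cauchy_ballP => e /pos_complex[r r0 ->].
  have [N h] := cu r r0; exists ([set u n | n in [set n | N <= n]%N], [set u n | n in [set n | N <= n]%N]) => /=.
    by split; exists N => // n /= Nn; exists n.
  by move=> [a b] /= [[m Nm <-] [n Nn <-]]; apply/hball; exact: h.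
exists l => e e0.
have : nbhs l [set y | hn (l - y) < e] by apply/hnbhsP; exists e.
by move=> /ul [N _ h]; exists N => n Nn; rewrite hnC; exact: (h n).
Qed.

Lemma hcvg_uniq H (u : nat -> H) l l' : hcvg u l -> hcvg u l' -> l = l'.
Proof.
move=> ul ul'; apply/eqP; rewrite -subr_eq0; apply/eqP/hn_eq0/le_anti.
rewrite hn_ge0 andbT leNgt; apply/negP => d0.
have e0 : 0 < hn (l - l') / 2 by lra.
have [N h] := ul _ e0; have [N' h'] := ul' _ e0.
have := hn_tri (u (maxn N N')) l l'.
have := h (maxn N N') (leq_maxl _ _); have := h' (maxn N N') (leq_maxr _ _).
by rewrite hnC (hnC l (u _)) (hnC _ l'); lra.
Qed.

Lemma hcvg_cauchy H (u : nat -> H) l : hcvg u l -> hcauchy u.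
Proof.
move=> ul e e0; have [|N h] := ul (e / 2); first by lra.
exists N => m n /h hm /h hn'; apply: le_lt_trans (hn_tri l _ _) _.
by rewrite (hnC l); lra.
Qed.

Lemma hcvg_cst H (l : H) : hcvg (fun=> l) l.
Proof. by move=> e e0; exists 0%N => n _; rewrite subrr hn0. Qed.

Lemma hcvgD H (u v : nat -> H) l l' : hcvg u l -> hcvg v l' ->
  hcvg (fun n => u n + v n) (l + l').
Proof.
move=> ul vl e e0; have e2 : 0 < e / 2 by lra.
have [N h] := ul _ e2; have [N' h'] := vl _ e2.
exists (maxn N N') => n; rewrite geq_max => /andP[/h hu /h' hv].
by rewrite opprD addrACA; apply: le_lt_trans (hnD _ _) _; lra.
Qed.

Lemma hcvg_lip H H' (f : H -> H') (c : R) u l :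
  (forall x y, hn (f x - f y) <= c * hn (x - y)) -> hcvg u l ->
  hcvg (fun n => f (u n)) (f l).
Proof.
move=> hf ul e e0.
have c0 : 0 < `|c| + 1 by have := normr_ge0 c; lra.
have [|N h] := ul (e / (`|c| + 1)); first by rewrite divr_gt0.
exists N => n /h; rewrite ltr_pdivlMr // => hn1.
apply: le_lt_trans (hf _ _) _; apply: le_lt_trans _ hn1.
by rewrite mulrC; apply: ler_wpM2l => //; have := ler_norm c; lra.
Qed.

Lemma hcvgZ H (a : R[i]) (u : nat -> H) l : hcvg u l -> hcvg (fun n => a *: u n) (a *: l).
Proof.
apply: (@hcvg_lip _ _ (fun x => a *: x) (complex.Re `|a|)) => x y.
by rewrite -scalerBr hnZ.
Qed.

Lemma hcvgN H (u : nat -> H) l : hcvg u l -> hcvg (fun n => - u n) (- l).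
Proof.
by apply: (@hcvg_lip _ _ (fun x => - x) 1) => x y; rewrite -opprD hnN mul1r.
Qed.

Lemma hcvgB H (u v : nat -> H) l l' : hcvg u l -> hcvg v l' ->
  hcvg (fun n => u n - v n) (l - l').
Proof. by move=> ul vl; apply: hcvgD => //; apply: hcvgN. Qed.

Lemma hcvg_sub H (u v : nat -> H) l : hcvg u l -> (forall n, exists m, (n <= m)%N /\ v n = u m) ->
  hcvg v l.
Proof.
move=> ul h e /ul[N hN]; exists N => n Nn; have [m [nm ->]] := h n.
exact/hN/(leq_trans Nn).
Qed.

Lemma hcvg_dot_le H (u : nat -> H) l (z : H) (c : R) :
  (forall n, dot (u n) z <= c) -> hcvg u l -> dot l z <= c.
Proof.
move=> h ul; rewrite leNgt; apply/negP => lt.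
have z0 : 0 < hn z + 1 by have := hn_ge0 z; lra.
have [|N hN] := ul ((dot l z - c) / (hn z + 1)); first by rewrite divr_gt0 // subr_gt0.
have := hN N (leqnn _); rewrite ltr_pdivlMr // => hb.
have := h N; have := dot_CS (l - u N) z; rewrite dotBl hnC.
have := hn_ge0 (u N - l); nra.
Qed.

Lemma hcvg_dot_ge H (u : nat -> H) l (z : H) (c : R) :
  (forall n, c <= dot (u n) z) -> hcvg u l -> c <= dot l z.
Proof.
move=> h ul; rewrite -lerN2 -dotNr; apply: (hcvg_dot_le _ ul) => n.
by rewrite dotNr lerN2.
Qed.

Lemma hcvg_dot_eq H (u : nat -> H) l (z : H) (c : R) :
  (forall n, dot (u n) z = c) -> hcvg u l -> dot l z = c.
Proof.
by move=> h ul; apply/le_anti; rewrite (hcvg_dot_le _ ul) ?(hcvg_dot_ge _ ul) // => n; rewrite h.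
Qed.

Lemma hcvg_hn_le H (u : nat -> H) l (c : R) :
  (forall n, hn (u n) <= c) -> hcvg u l -> hn l <= c.
Proof.
move=> h ul; rewrite leNgt; apply/negP => lt.
have [|N hN] := ul (hn l - c); first by rewrite subr_gt0.
have := hN N (leqnn _); rewrite hnC => hl.
have := h N; have := hnD (l - u N) (u N); rewrite subrK; lra.
Qed.

Lemma hcvg_dense H (A : set H) x :
  (forall e : R, 0 < e -> exists2 a, A a & hn (x - a) < e) ->
  exists2 u, forall n, A (u n) & hcvg u x.
Proof.
move=> h.
have h' n : {a | A a /\ hn (x - a) < n.+1%:R^-1}.
  by apply/cid; have [|a Aa xa] := h n.+1%:R^-1; [rewrite invr_gt0 ltr0n|exists a].
exists (fun n => sval (h' n)) => [n|e e0]; first by case: (svalP (h' n)).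
exists (Num.bound e^-1) => n Nn; rewrite hnC; have [_] := svalP (h' n).
move=> /lt_le_trans; apply.
rewrite -[leRHS]invrK lef_pV2 ?posrE ?ltr0n ?invr_gt0 //.
apply: le_trans (ltW (archi_boundP _)) _; first by rewrite invr_ge0 ltW.
by rewrite ler_nat (leq_trans Nn).
Qed.

End Inner_product.
(* Identities between vectors are checked against every linear functional. *)
Ltac hvec := apply: dot_inj => ?;
  rewrite !(dotDl, dotNl, dotZl, dot0l); try ring; try field.
Ltac cvec := apply: inner_inj => ?;
  rewrite !(innerDl, innerNl, innerZl, inner0l); try ring; try field.
#[global] Hint Extern 0 (is_true (@Order.le _ _ _ (hn _))) =>
  solve [apply: hn_ge0] : core.
#[global] Hint Extern 0 (is_true (@Order.le _ _ _ (complex.Re (Num.norm _)))) =>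
  solve [apply: Re_normC_ge0] : core.

(** * Bounded operators and projections *)

Section Linear_maps.
Variable R : realType.
Implicit Types H : hilbertType R.

Lemma lin0 (U V : lmodType R[i]) (f : U -> V) : linear f -> f 0 = 0.
Proof. by move=> lf; have := lf (-1) 0 0; rewrite scaler0 addr0 scaleN1r addNr. Qed.
Lemma linD (U V : lmodType R[i]) (f : U -> V) : linear f -> {morph f : x y / x + y}.
Proof. by move=> lf x y; have := lf 1 x y; rewrite !scale1r. Qed.
Lemma linZ (U V : lmodType R[i]) (f : U -> V) : linear f -> forall a x, f (a *: x) = a *: f x.
Proof. by move=> lf a x; have := lf a x 0; rewrite !addr0 lin0 // addr0. Qed.
Lemma linN (U V : lmodType R[i]) (f : U -> V) : linear f -> {morph f : x / - x}.
Proof. by move=> lf x; rewrite -scaleN1r linZ // scaleN1r. Qed.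
Lemma linB (U V : lmodType R[i]) (f : U -> V) : linear f -> {morph f : x y / x - y}.
Proof. by move=> lf x y; rewrite linD // linN. Qed.
Lemma lin_sum (U V : lmodType R[i]) (f : U -> V) : linear f ->
  forall (I : Type) (r : seq I) (P : pred I) F,
  f (\sum_(i <- r | P i) F i) = \sum_(i <- r | P i) f (F i).
Proof. by move=> lf I r P F; apply: (big_morph f (linD lf) (lin0 lf)). Qed.

Lemma sum_opE (U : Type) (V : zmodType) (I : Type) (r : seq I) (P : pred I) (F : I -> U -> V) x :
  (\sum_(i <- r | P i) F i) x = \sum_(i <- r | P i) F i x.
Proof. exact: (big_morph (fun f : U -> V => f x)). Qed.

(** A bound on the operator norm as a predicate: bounds are only compared and propagated, so the
    least one is never formed. *)
Definition onb H H' (f : H -> H') (c : R) := forall x, hn (f x) <= c * hn x.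

Lemma continuous_bounded H H' (f : H -> H') :
  linear f -> continuous f -> exists2 c : R, 0 <= c & onb f c.
Proof.
move=> lf /(_ 0) cf.
have : nbhs (f 0) [set y | hn (f 0 - y) < 1] by apply/hnbhsP; exists 1.
move=> /cf /hnbhsP[e e0 h].
exists (2 / e) => [|x]; first by rewrite divr_ge0 // ltW.
have [->|x0] := eqVneq x 0; first by rewrite lin0 // !hn0 mulr0.
have xp : 0 < hn x by rewrite lt_neqAle hn_ge0 andbT eq_sym; apply/eqP => /hn_eq0/eqP; apply/negP.
have := h ((e / (2 * hn x))%:C%C *: x).
rewrite /= (lin0 lf) (linZ lf) !sub0r !hnN !hnZr ger0_norm; last first.
  by rewrite divr_ge0 ?ltW ?mulr_gt0.
have -> : e / (2 * hn x) * hn x = e / 2 by field; rewrite gt_eqF.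
move=> /(_ ltac:(lra)); rewrite -ltr_pdivlMl ?divr_gt0 ?mulr_gt0 // => /ltW/le_trans; apply.
by rewrite le_eqVlt; apply/orP; left; apply/eqP; field; rewrite !gt_eqF.
Qed.

Lemma onb_continuous H H' (f : H -> H') (c : R) : linear f -> onb f c -> continuous f.
Proof.
move=> lf fc x A /= /hnbhsP[e e0 hA]; apply/hnbhsP.
have c0 : 0 < `|c| + 1 by have := normr_ge0 c; lra.
exists (e / (`|c| + 1)) => [|y]; first by rewrite divr_gt0.
rewrite ltr_pdivlMr // => h; apply: hA; rewrite -linB //.
apply: le_lt_trans (fc _) _; apply: le_lt_trans h.
by rewrite [leRHS]mulrC; apply: ler_wpM2r => //; apply: le_trans (ler_norm c) _; rewrite lerDl.
Qed.

Lemma bopP H H' (f : H -> H') :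
  bounded_op f <-> linear f /\ exists2 c : R, 0 <= c & onb f c.
Proof.
split=> [[lf cf]|[lf [c c0 fc]]]; first by split => //; apply: continuous_bounded.
by split => //; apply: onb_continuous fc.
Qed.

Lemma bop_lin H H' (f : H -> H') : bounded_op f -> linear f. Proof. by case. Qed.

Lemma bop_onb H H' (f : H -> H') : bounded_op f -> exists2 c : R, 0 <= c & onb f c.
Proof. by move=> /bopP[]. Qed.

Lemma bopI H H' (f : H -> H') (c : R) : linear f -> onb f c -> bounded_op f.
Proof. by move=> lf fc; split => //; apply: onb_continuous fc. Qed.

Lemma bop_hcvg H H' (f : H -> H') u l : bounded_op f -> hcvg u l -> hcvg (fun n => f (u n)) (f l).
Proof.
move=> /bopP[lf [c _ fc]]; apply: (@hcvg_lip _ _ _ _ c) => x y.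
by rewrite -linB.
Qed.

Lemma bop0 H H' : bounded_op (fun _ : H => 0 : H').
Proof.
apply: (@bopI _ _ _ 0) => [a x y|x]; first by rewrite scaler0 addr0.
by rewrite hn0 mul0r.
Qed.

Lemma bop_id H : bounded_op (@idfun H).
Proof. by apply: (@bopI _ _ _ 1) => // x; rewrite mul1r. Qed.

Lemma onb_comp H1 H2 H3 (f : H2 -> H3) (g : H1 -> H2) a b :
  0 <= a -> onb f a -> onb g b -> onb (f \o g) (a * b).
Proof.
move=> a0 fa gb x /=; apply: le_trans (fa _) _.
by rewrite -mulrA; apply: ler_wpM2l.
Qed.

Lemma bop_comp H1 H2 H3 (f : H2 -> H3) (g : H1 -> H2) :
  bounded_op f -> bounded_op g -> bounded_op (f \o g).
Proof.
move=> /bopP[lf [a a0 fa]] /bopP[lg [b b0 gb]]; apply: (@bopI _ _ _ (a * b)).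
  by move=> k x y /=; rewrite lg lf.
exact: onb_comp.
Qed.

Lemma onbN H1 H2 (f : H1 -> H2) a : onb f a -> onb (- f) a.
Proof. by move=> fa x; rewrite hnN. Qed.

Lemma onbW H1 H2 (f : H1 -> H2) a b : a <= b -> onb f a -> onb f b.
Proof. by move=> ab fa x; apply: le_trans (fa _) _; apply: ler_wpM2r. Qed.

Lemma bop_linear H1 H2 (f g : H1 -> H2) (a : R[i]) :
  bounded_op f -> bounded_op g -> bounded_op (a *: f + g).
Proof.
move=> /bopP[lf [c c0 fc]] /bopP[lg [d d0 gd]].
apply: (@bopI _ _ _ (complex.Re `|a| * c + d)).
  move=> k x y /=; rewrite !fctE /= lf lg scalerDr !scalerA scalerDr scalerA (mulrC a) -!addrA.
  by congr (_ + _); rewrite addrCA.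
move=> x; rewrite mulrDl; apply: le_trans (hnD _ _) _; apply: lerD => //.
by rewrite /= hnZ -mulrA; apply: ler_wpM2l.
Qed.

Lemma bopD H1 H2 (f g : H1 -> H2) : bounded_op f -> bounded_op g -> bounded_op (f + g).
Proof. by move=> bf bg; rewrite -[f]scale1r; apply: bop_linear. Qed.
Lemma bopZ H1 H2 (f : H1 -> H2) a : bounded_op f -> bounded_op (a *: f).
Proof. by move=> bf; rewrite -[_ *: _]addr0; apply: bop_linear => //; apply: bop0. Qed.
Lemma bopN H1 H2 (f : H1 -> H2) : bounded_op f -> bounded_op (- f).
Proof. by move=> bf; rewrite -scaleN1r; apply: bopZ. Qed.
Lemma bopB H1 H2 (f g : H1 -> H2) : bounded_op f -> bounded_op g -> bounded_op (f - g).
Proof. by move=> bf bg; apply: bopD => //; apply: bopN. Qed.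
Lemma bop_sum H1 H2 (I : Type) (r : seq I) (P : pred I) (F : I -> H1 -> H2) :
  (forall i, P i -> bounded_op (F i)) -> bounded_op (\sum_(i <- r | P i) F i).
Proof. by move=> h; elim/big_ind: _ => //; [exact: bop0|move=> x y; exact: bopD]. Qed.

End Linear_maps.

(** * Nearest points, orthogonal projections and the Riesz representation *)

Section Projections.
Variable R : realType.
Implicit Types H : hilbertType R.

(** Midpoint convexity is all that the parallelogram law asks of a closed set for nearest points to
    exist; subspaces and convex sets have it. *)
Definition hmid H (A : set H) := forall x y, A x -> A y -> A ((2^-1 : R)%:C%C *: (x + y)).

Lemma hmid2 H (x y z : H) :
  4 * hn (x - (2^-1 : R)%:C%C *: (y + z)) ^+ 2 = hn ((x - y) + (x - z)) ^+ 2.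
Proof.
have -> : (x - y) + (x - z) = (2 : R)%:C%C *: (x - (2^-1 : R)%:C%C *: (y + z)).
  rewrite scalerBr scalerA -rmorphM /= divff ?pnatr_eq0 // scale1r addrACA opprD.
  by rewrite -[2]/(1 + 1) rmorphD /= scalerDl scale1r.
by rewrite hnZr exprMn (ger0_norm (ler0n _ _)) -natrX.
Qed.

(** The parallelogram law makes a minimizing sequence Cauchy. The estimate is stronger than
    uniqueness: an almost nearest point is close to the nearest one, which drives [hilbert_fip]. *)
Lemma hproj_ex H (A : set H) x : closed A -> A !=set0 -> hmid A ->
  exists2 p, A p & forall a, A a ->
    hn (a - p) ^+ 2 <= 2 * (hn (x - a) ^+ 2 - hn (x - p) ^+ 2).
Proof.
move=> cA [a0 Aa0] mA.
pose D := [set hn (x - a) ^+ 2 | a in A].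
pose d := inf D.
have lbD : has_inf D.
  split; first by exists (hn (x - a0) ^+ 2), a0.
  by exists 0 => _ [a _ <-]; apply: sqr_ge0.
have dle a : A a -> d <= hn (x - a) ^+ 2.
  by move=> Aa; apply: ge_inf; [case: lbD|exists a].
have mid a b : A a -> A b ->
    hn (a - b) ^+ 2 <= 2 * (hn (x - a) ^+ 2 - d) + 2 * (hn (x - b) ^+ 2 - d).
  move=> Aa Ab; have := dle _ (mA _ _ Aa Ab).
  have := hmid2 x a b; have := parallelogram (x - a) (x - b).
  have -> : (x - a) - (x - b) = b - a by rewrite opprB addrC subrKA.
  by rewrite (hnC b a); lra.
have near n : {a | A a /\ hn (x - a) ^+ 2 < d + n.+1%:R^-1}.
  apply/cid; have [|_ [a Aa <-]] := @inf_adherent _ D n.+1%:R^-1 _ lbD; last by exists a.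
  by rewrite invr_gt0 ltr0n.
pose u n := sval (near n).
have uA n : A (u n) by case: (svalP (near n)).
have ud n : hn (x - u n) ^+ 2 < d + n.+1%:R^-1 by case: (svalP (near n)).
have small (e : R) : 0 < e -> exists N, forall n, (N <= n)%N -> (n.+1%:R^-1 : R) < e.
  move=> e0; exists (Num.bound e^-1) => n Nn.
  rewrite -[ltRHS]invrK ltf_pV2 ?posrE ?ltr0n ?invr_gt0 //.
  apply: lt_le_trans (archi_boundP _) _; first by rewrite invr_ge0 ltW.
  by rewrite ler_nat (leq_trans Nn).
have cu : hcauchy u.
  move=> e e0; have [|N hN] := small (e ^+ 2 / 4); first by rewrite divr_gt0 // exprn_gt0.
  exists N => m n /hN hm /hN h.
  rewrite -ltr_sqr ?nnegrE ?(ltW e0) //.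
  move: (mid _ _ (uA m) (uA n)) (ud m) (ud n) hm h.
  by move: (m.+1%:R^-1) (n.+1%:R^-1) => a b; lra.
have [p up] := hcomplete cu.
have Ap : A p by apply: hcvg_closed up.
have pd : hn (x - p) ^+ 2 <= d.
  rewrite leNgt; apply/negP => lt.
  have dn : 0 <= d by apply: lb_le_inf; [case: lbD|move=> _ [a _ <-]; apply: sqr_ge0].
  pose s := Num.sqrt d; have s0 : 0 <= s by apply: sqrtr_ge0.
  have sd : s ^+ 2 = d by rewrite sqr_sqrtr.
  have ps : s < hn (x - p) by rewrite -ltr_sqr ?nnegrE // sd.
  pose e := (hn (x - p) - s) / 2; have e0 : 0 < e by rewrite /e; lra.
  have [N hN] := up _ e0; have [|N' hN'] := small (e ^+ 2); first by rewrite exprn_gt0.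
  have h1 := hN (maxn N N') (leq_maxl _ _); have h2 := hN' (maxn N N') (leq_maxr _ _).
  have h3 := ud (maxn N N'); have h4 := hn_tri (u (maxn N N')) x p.
  have h5 : s + e < hn (x - u (maxn N N')) by rewrite /e in h1 *; lra.
  have : (s + e) ^+ 2 < hn (x - u (maxn N N')) ^+ 2.
    by rewrite ltr_sqr ?nnegrE // addr_ge0 // ltW.
  move: h2 h3; move: (_^-1) => v; nra.
exists p => // a Aa; have := mid a p Aa Ap; have := dle _ Ap; lra.
Qed.

Lemma csub_mid H (X : set H) : closed_subspace X -> hmid X.
Proof. case=> X0 XL _ x y Xx Xy; rewrite -[_ *: _]addr0; apply: (XL) => //.
by rewrite -[x]scale1r; apply: XL. Qed.

Lemma csubD H (X : set H) : closed_subspace X -> forall x y, X x -> X y -> X (x + y).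
Proof. by case=> X0 XL _ x y Xx Xy; rewrite -[x]scale1r; apply: XL. Qed.
Lemma csubZ H (X : set H) : closed_subspace X -> forall a x, X x -> X (a *: x).
Proof. by case=> X0 XL _ a x Xx; rewrite -[_ *: _]addr0; apply: XL. Qed.
Lemma csubB H (X : set H) : closed_subspace X -> forall x y, X x -> X y -> X (x - y).
Proof. by move=> cX x y Xx Xy; apply: csubD => //; rewrite -scaleN1r; apply: csubZ. Qed.

Lemma orth_ex H (X : set H) x : closed_subspace X ->
  exists2 p, X p & forall y, X y -> '<<x - p, y>> = 0.
Proof.
move=> cX; have [X0 XL clX] := cX.
have [|p Xp h] := hproj_ex x clX _ (csub_mid cX); first by exists 0.
exists p => //.
have key y : X y -> dot (x - p) y = 0.
  move=> Xy; apply/eqP; rewrite -sqrf_eq0 eq_le sqr_ge0 andbT.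
  (* The minimality of [p] against [p - t y] is a quadratic inequality with constant term 0, so its
     linear coefficient vanishes. *)
  rewrite -(mul0r (hn y ^+ 2)); apply: quad_ge0 => // t; rewrite add0r.
  have := h (p - t%:C%C *: y) (csubB cX Xp (csubZ cX _ Xy)).
  have -> : p - t%:C%C *: y - p = - (t%:C%C *: y) by rewrite addrAC subrr add0r.
  have -> : x - (p - t%:C%C *: y) = (x - p) + t%:C%C *: y by rewrite opprB addrCA addrC.
  by rewrite hnN hn2D hnZr dotZr exprMn real_normK ?num_real //; nra.
move=> y Xy; rewrite inner_dot !key ?mulr0 ?addr0 //.
exact: csubZ.
Qed.

Definition proj H (X : set H) (x : H) : H :=
  xget 0 [set p | X p /\ forall y, X y -> '<<x - p, y>> = 0].

Section proj_theory.
Variables (H : hilbertType R) (X : set H).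
Hypothesis cX : closed_subspace X.

Lemma projP x : X (proj X x) /\ forall y, X y -> '<<x - proj X x, y>> = 0.
Proof.
have [p Xp h] := orth_ex x cX.
exact: (@xgetPex _ 0 [set p | X p /\ forall y, X y -> '<<x - p, y>> = 0] (ex_intro _ p (conj Xp h))).
Qed.

Lemma proj_in x : X (proj X x). Proof. by case: (projP x). Qed.

Lemma proj_orth x y : X y -> '<<proj X x, y>> = '<<x, y>>.
Proof.
move=> Xy; have [_ /(_ y Xy)] := projP x; rewrite innerBl => /eqP.
by rewrite subr_eq0 => /eqP.
Qed.

Lemma proj_orthr x y : X y -> '<<y, proj X x>> = '<<y, x>>.
Proof. by move=> Xy; rewrite inner_conj proj_orth // -inner_conj. Qed.

Lemma proj_uniq x p : X p -> (forall y, X y -> '<<p, y>> = '<<x, y>>) -> proj X x = p.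
Proof.
move=> Xp h; apply/eqP; rewrite -subr_eq0; apply/eqP/hn_eq0/eqP.
rewrite -sqrf_eq0 -dotxx /dot innerBl proj_orth ?h ?subrr //; apply: csubB => //; exact: proj_in.
Qed.

Lemma proj_id x : X x -> proj X x = x.
Proof. by move=> Xx; apply: proj_uniq. Qed.

Lemma proj_lin : linear (proj X).
Proof.
move=> a x y; apply: proj_uniq => [|z Xz].
  by case: cX => _ XL _; apply: XL; apply: proj_in.
by rewrite !inner_linearl !proj_orth.
Qed.

Lemma proj_sa x y : '<<proj X x, y>> = '<<x, proj X y>>.
Proof.
by rewrite -(proj_orthr y (proj_in x)) -(proj_orth x (proj_in y)).
Qed.

Lemma proj_onb : onb (proj X) 1.
Proof.
move=> x; rewrite mul1r; apply: hn_le_dot => // y.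
rewrite /dot proj_sa -/(dot _ _).
have h : hn (proj X y) <= hn y.
  have := hn2D (y - proj X y) (proj X y); rewrite subrK.
  have -> : dot (y - proj X y) (proj X y) = 0.
    by have [_ h] := projP y; rewrite /dot h //; apply: proj_in.
  by rewrite mulr0 addr0 -ler_sqr ?nnegrE // => ->; rewrite lerDr sqr_ge0.
by apply: le_trans (dot_CS _ _) _; rewrite ler_wpM2l.
Qed.

Lemma proj_bop : bounded_op (proj X).
Proof. exact: bopI proj_lin proj_onb. Qed.

Lemma proj0 x : (forall y, X y -> '<<x, y>> = 0) -> proj X x = 0.
Proof. by move=> h; apply: proj_uniq => [|y /h ->]; [case: cX|rewrite inner0l]. Qed.

Lemma proj_idem x : proj X (proj X x) = proj X x.
Proof. by rewrite proj_id //; apply: proj_in. Qed.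

End proj_theory.

Lemma proj_comm H (X : set H) (f g : H -> H) : closed_subspace X -> linear f -> linear g ->
  (forall x y, '<<f x, y>> = '<<x, g y>>) ->
  (forall x, X x -> X (f x)) -> (forall x, X x -> X (g x)) ->
  forall x, proj X (f x) = f (proj X x).
Proof.
move=> cX lf lg fg Xf Xg x; apply: proj_uniq => // [|y Xy].
  by apply: Xf; apply: proj_in.
by rewrite !fg proj_orth //; apply: Xg.
Qed.

Lemma closed_orth H (A : set H) : closed_subspace [set x | forall y, A y -> '<<x, y>> = 0].
Proof.
split=> [y _|a u v hu hv y Ay|]; first exact: inner0l.
  by rewrite inner_linearl hu ?hv // mulr0 addr0.
apply/hclosedP => x /hcvg_dense[u hu ux] y Ay.
have key z : (forall n, '<<u n, z>> = 0) -> dot x z = 0.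
  by move=> h; apply: (hcvg_dot_eq _ ux) => n; rewrite /dot h.
by rewrite inner_dot !key ?mulr0 ?addr0 // => n; rewrite ?innerZr ?hu ?mulr0.
Qed.

Lemma closed_csub H (V : set H) : V 0 -> (forall (a : R[i]) u v, V u -> V v -> V (a *: u + v)) ->
  closed_subspace (closure V).
Proof.
move=> V0 VL; split; [exact: subset_closure| |exact: closed_closure].
move=> a u v /hclosureP/hcvg_dense[u_ Vu uu] /hclosureP/hcvg_dense[v_ Vv vv].
apply/hclosureP => e e0.
have [N h] := hcvgD (hcvgZ a uu) vv e0.
by exists (a *: u_ N + v_ N); [exact: VL|rewrite hnC h].
Qed.

Lemma dense_ext H (V : set H) x : closure V = setT -> (forall y, V y -> '<<x, y>> = 0) -> x = 0.
Proof.
move=> dV h; have := closed_orth V; case=> _ _ /hclosedP => _.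
have : closure V x by rewrite dV.
move=> /hclosureP/hcvg_dense[u Vu ux].
apply/hn_eq0/eqP; rewrite -sqrf_eq0 -dotxx; apply/eqP; apply: (hcvg_dot_eq _ ux) => n.
by rewrite dotC /dot h.
Qed.

Lemma lspan_csub H (A : set H) : closed_subspace (closure (lspan A)).
Proof.
apply: closed_csub.
  by exists 0%N, (fun=> 0), (fun=> 0); split => [[]//|]; rewrite big_ord0.
move=> a _ _ [n [b [w [Aw ->]]]] [m [c [v [Av ->]]]].
exists (n + m)%N, (fun i => match fintype.split i with inl j => a * b j | inr j => c j end),
   (fun i => match fintype.split i with inl j => w j | inr j => v j end); split.
  by move=> i; case: fintype.split.
rewrite big_split_ord scaler_sumr; congr (_ + _); apply: eq_bigr => i _.
  by rewrite -[lshift m i]/(unsplit (inl i)) unsplitK scalerA.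
by rewrite -[rshift n i]/(unsplit (inr i)) unsplitK.
Qed.

Lemma lspanS H (A : set H) x : A x -> lspan A x.
Proof. by move=> Ax; exists 1%N, (fun=> 1), (fun=> x); split => //; rewrite big_ord1 scale1r. Qed.

Lemma riesz H (f : H -> R[i]) (c : R) :
  (forall a x y, f (a *: x + y) = a * f x + f y) ->
  (forall x, complex.Re `|f x| <= c * hn x) -> exists z, forall x, f x = '<<x, z>>.
Proof.
move=> lf fc; pose X := [set x | f x = 0].
have f0 : f 0 = 0 by have := lf (-1) 0 0; rewrite scaler0 addr0 mulN1r addNr.
have fB x y : f (x - y) = f x - f y.
  by rewrite addrC -scaleN1r lf mulN1r addrC.
have cX : closed_subspace X.
  split=> // [a u v /= fu fv|]; first by rewrite /X /= lf fu fv mulr0 addr0.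
  apply/hclosedP => x h; rewrite /X /=; apply/eqP; rewrite -normr_eq0.
  have /eqP : complex.Re `|f x| = 0.
    apply/le_anti/andP; split => //.
    rewrite leNgt; apply/negP => p.
    have c0 : 0 < `|c| + 1 by have := normr_ge0 c; lra.
    have [|a Xa xa] := h (complex.Re `|f x| / (`|c| + 1)); first by rewrite divr_gt0.
    have := fc (x - a); rewrite fB Xa subr0; move: xa; rewrite ltr_pdivlMr //.
    have := ler_norm c; have := hn_ge0 (x - a); nra.
  by move=> /eqP e; rewrite normCE e.
have [all0|/existsNP[y /eqP fy]] := pselect (forall y, f y = 0).
  by exists 0 => x; rewrite all0 inner0r.
pose w := y - proj X y.
have fw : f w = f y by rewrite fB (proj_in cX y : f _ = 0) subr0.
have w0 : '<<w, w>> != 0.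
  rewrite inner_xx; apply/eqP => [[/eqP]]; rewrite sqrf_eq0 => /eqP/hn_eq0 w0.
  by move: fy; rewrite -fw w0 f0 eqxx.
exists ((f w / '<<w, w>>)^* *: w) => x; rewrite innerZr conjCK.
have Xx : X (x - (f x / f w) *: w).
  rewrite /X /= fB -[_ *: w]addr0 lf f0 addr0 divfK ?subrr //.
  by rewrite fw.
have /eqP : '<<x - (f x / f w) *: w, w>> = 0.
  by rewrite inner_conj; have [_ ->] := projP cX y; rewrite ?rmorph0.
rewrite innerBl innerZl subr_eq0 => /eqP ->; field.
by rewrite w0 fw fy.
Qed.

End Projections.

(** * Adjoints *)

Section Adjoints.
Variable R : realType.
Implicit Types H K : hilbertType R.

Lemma inner_CS H (x y : H) : complex.Re `|'<<x, y>>| <= hn x * hn y.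
Proof.
have [->|z0] := eqVneq '<<x, y>> 0; first by rewrite normr0 mulr_ge0.
set z := '<<x, y>>; pose a := z^* / `|z|.
have na : `|a| = 1 by rewrite normrM normfV normr_id norm_conjC divff // normr_eq0.
have -> : complex.Re `|z| = dot (a *: x) y.
  rewrite /dot innerZl -/z /a mulrAC -normCKC expr2 -mulrA divff ?mulr1 //.
  by rewrite normr_eq0.
by apply: le_trans (dot_CS _ _) _; rewrite hnZ na /= mul1r.
Qed.

Lemma adj_ex H K (f : H -> K) : bounded_op f ->
  exists g, forall x y, '<<f x, y>> = '<<x, g y>>.
Proof.
move=> /bopP[lf [c c0 fc]].
have h y : exists z, forall x, '<<f x, y>> = '<<x, z>>.
  apply: (@riesz _ _ (fun x => '<<f x, y>>) (c * hn y)) => [a u v|x].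
    by rewrite lf inner_linearl.
  by apply: le_trans (inner_CS _ _) _; rewrite mulrAC ler_wpM2r.
by exists (fun y => sval (cid (h y))) => x y; apply: (svalP (cid (h y))).
Qed.

Lemma adjP H K (f : H -> K) : bounded_op f -> forall x y, '<<f x, y>> = '<<x, adj f y>>.
Proof. by move=> /adj_ex[g hg]; apply: (@xgetPex _ (fun=> 0) [set g | forall x y, '<<f x, y>> = '<<x, g y>>]); exists g. Qed.

Lemma adjPr H K (f : H -> K) : bounded_op f -> forall x y, '<<y, f x>> = '<<adj f y, x>>.
Proof. by move=> bf x y; rewrite inner_conj adjP // -inner_conj. Qed.

Lemma adj_dot H K (f : H -> K) : bounded_op f -> forall x y, dot (f x) y = dot x (adj f y).
Proof. by move=> bf x y; rewrite /dot adjP. Qed.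

Lemma adj_uniq H K (f : H -> K) g : bounded_op f ->
  (forall x y, '<<f x, y>> = '<<x, g y>>) -> adj f = g.
Proof.
move=> bf h; apply/funext => y; apply: inner_inj => x.
by rewrite inner_conj -adjP // h -inner_conj.
Qed.

Lemma adj_onb H K (f : H -> K) c : bounded_op f -> 0 <= c -> onb f c -> onb (adj f) c.
Proof.
move=> bf c0 fc y; apply: hn_le_dot => [|x]; first by rewrite mulr_ge0.
rewrite dotC -adj_dot //; apply: le_trans (dot_CS _ _) _.
by rewrite mulrAC ler_wpM2r.
Qed.

Lemma adj_bop H K (f : H -> K) : bounded_op f -> bounded_op (adj f).
Proof.
move=> bf; have [c c0 fc] := bop_onb bf; apply: bopI (adj_onb bf c0 fc) => a x y.
by apply: inner_inj => z; rewrite inner_linearl -!adjPr // inner_linearl.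
Qed.

Lemma adjK H K (f : H -> K) : bounded_op f -> adj (adj f) = f.
Proof.
by move=> bf; apply: adj_uniq => [|x y]; [exact: adj_bop|rewrite adjPr].
Qed.

Lemma adj_comp H1 H2 H3 (f : H2 -> H3) (g : H1 -> H2) : bounded_op f -> bounded_op g ->
  adj (f \o g) = adj g \o adj f.
Proof. by move=> bf bg; apply: adj_uniq => [|x y]; [exact: bop_comp|rewrite /= !adjP]. Qed.

Lemma adj_lin H K (f g : H -> K) a : bounded_op f -> bounded_op g ->
  adj (a *: f + g) = a^* *: adj f + adj g.
Proof.
move=> bf bg; apply: adj_uniq => [|x y]; first exact: bop_linear.
by rewrite !fctE /= inner_linearl !adjP // innerDr innerZr conjCK.
Qed.

Lemma adjD H K (f g : H -> K) : bounded_op f -> bounded_op g -> adj (f + g) = adj f + adj g.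
Proof. by move=> bf bg; have := adj_lin 1 bf bg; rewrite rmorph1 !scale1r. Qed.
Lemma adj0 H K : adj (fun _ : H => 0 : K) = fun=> 0.
Proof. by apply: adj_uniq => [|x y]; [exact: bop0|rewrite inner0l inner0r]. Qed.
Lemma adjZ H K (f : H -> K) a : bounded_op f -> adj (a *: f) = a^* *: adj f.
Proof.
move=> bf; have := adj_lin a bf (@bop0 R H K); rewrite adj0.
by rewrite -[(fun _ : H => 0)]/(0 : H -> K) -[(fun _ : K => 0)]/(0 : K -> H) !addr0.
Qed.
Lemma adjN H K (f : H -> K) : bounded_op f -> adj (- f) = - adj f.
Proof. by move=> bf; rewrite -scaleN1r adjZ // rmorphN1 scaleN1r. Qed.
Lemma adjB H K (f g : H -> K) : bounded_op f -> bounded_op g -> adj (f - g) = adj f - adj g.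
Proof. by move=> bf bg; rewrite adjD ?adjN //; apply: bopN. Qed.
Lemma adj_id H : adj (@idfun H) = idfun.
Proof. by apply: adj_uniq => //; exact: bop_id. Qed.
Lemma adj_sum H K (I : Type) (r : seq I) (P : pred I) (F : I -> H -> K) :
  (forall i, bounded_op (F i)) ->
  adj (\sum_(i <- r | P i) F i) = \sum_(i <- r | P i) adj (F i).
Proof.
move=> bF; elim: r => [|i r IH]; first by rewrite !big_nil; exact: adj0.
rewrite !big_cons; case: ifP => // _; rewrite adjD ?IH //.
exact: bop_sum.
Qed.
Lemma adj_proj H (X : set H) : closed_subspace X -> adj (proj X) = proj X.
Proof. by move=> cX; apply: adj_uniq; [exact: proj_bop|exact: proj_sa]. Qed.

(* U is 0 on the orthogonal complement of the domain of the relation. *)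
Lemma ext_op H1 H2 (G : H1 -> H2 -> Prop) (c : R) : 0 <= c ->
  G 0 0 ->
  (forall (a : R[i]) x y x' y', G x y -> G x' y' -> G (a *: x + x') (a *: y + y')) ->
  (forall x y, G x y -> hn y <= c * hn x) ->
  exists U, [/\ bounded_op U, onb U c, (forall x y, G x y -> U x = y)
    & (forall z, (forall x y, G x y -> '<<z, x>> = 0) -> U z = 0)].
Proof.
move=> c0 G0 GL Gc.
pose V := [set x | exists y, G x y].
have cV : closed_subspace (closure V).
  apply: closed_csub; first by exists 0.
  by move=> a u v [y Gy] [y' Gy']; exists (a *: y + y'); apply: GL.
(* The closure of the graph. The bound [c] passes to it and makes it single valued, with domain
   [closure V]. *)
pose rel x y := forall e : R, 0 < e -> exists x' y', [/\ G x' y', hn (x - x') < e & hn (y - y') < e].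
have relb x y : rel x y -> hn y <= c * hn x.
  move=> h; apply/ler_addgt0Pr => e e0.
  have [|x' [y' [g hx hy]]] := h (e / (c + 1)); first by rewrite divr_gt0 // ltr_wpDl.
  have := Gc _ _ g; have := hnD (y - y') y'; rewrite subrK.
  have := hnD x (x' - x); rewrite addrC subrK (hnC x') => hx' hy' hg.
  have : hn (x - x') * (c + 1) < e by rewrite -ltr_pdivlMr ?ltr_wpDl.
  have : hn (y - y') * (c + 1) < e by rewrite -ltr_pdivlMr ?ltr_wpDl.
  have : e / (c + 1) * (c + 1) = e by rewrite divfK // gt_eqF // ltr_wpDl.
  move: (e / (c + 1)) hx hy => d hx hy hd h1 h2.
  have := hn_ge0 (x - x'); have := hn_ge0 (y - y'); nra.
have relL (a : R[i]) x y x' y' : rel x y -> rel x' y' -> rel (a *: x + x') (a *: y + y').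
  move=> h h' e e0; pose d := complex.Re `|a| + 1.
  have d0 : 0 < d by rewrite /d ltr_wpDl.
  have e2 : 0 < e / 2 by lra.
  have [|u [v [g hu hv]]] := h (e / 2 / d); first by rewrite divr_gt0.
  have [u' [v' [g' hu' hv']]] := h' _ e2.
  exists (a *: u + u'), (a *: v + v'); split; first exact: GL.
    rewrite opprD addrACA -scalerBr; apply: le_lt_trans (hnD _ _) _.
    rewrite hnZ; move: hu; rewrite ltr_pdivlMr // /d; have := hn_ge0 (x - u); nra.
  rewrite opprD addrACA -scalerBr; apply: le_lt_trans (hnD _ _) _.
  rewrite hnZ; move: hv; rewrite ltr_pdivlMr // /d; have := hn_ge0 (y - v); nra.
have Grel x y : G x y -> rel x y by move=> g e e0; exists x, y; rewrite !subrr !hn0.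
have reluniq x y y' : rel x y -> rel x y' -> y = y'.
  move=> h h'; apply/eqP; rewrite -subr_eq0; apply/eqP/hn_eq0/le_anti; rewrite hn_ge0 andbT.
  have := relb _ _ (relL (-1) _ _ _ _ h' h).
  by rewrite !scaleN1r addNr hn0 mulr0 addrC.
have relex x : closure V x -> exists y, rel x y.
  move=> /hclosureP/hcvg_dense[u Vu ux].
  pose v n := sval (cid (Vu n)).
  have Gv n : G (u n) (v n) by apply: (svalP (cid (Vu n))).
  have cv : hcauchy v.
    move=> e e0; have [|N hN] := hcvg_cauchy ux (e := e / (c + 1)).
      by rewrite divr_gt0 // ltr_wpDl.
    exists N => m n Nm Nn; have := hN m n Nm Nn; rewrite ltr_pdivlMr ?ltr_wpDl //.
    have := Gc _ _ (GL (-1) _ _ _ _ (Gv n) (Gv m)); rewrite !scaleN1r ![- _ + _]addrC.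
    have := hn_ge0 (u m - u n); nra.
  have [y vy] := hcomplete cv; exists y => e e0.
  have [N hN] := ux e e0; have [N' hN'] := vy e e0.
  exists (u (maxn N N')), (v (maxn N N')); split => //.
    by rewrite hnC hN // leq_maxl.
  by rewrite hnC hN' // leq_maxr.
pose U x := sval (cid (relex _ (proj_in cV x))).
have Urel x : rel (proj (closure V) x) (U x) by apply: (svalP (cid (relex _ (proj_in cV x)))).
have Uc : onb U c.
  move=> x; apply: le_trans (relb _ _ (Urel x)) _.
  by rewrite ler_wpM2l //; have := proj_onb cV x; rewrite mul1r.
exists U; split => //.
- apply: bopI Uc => a x y; apply: (reluniq (proj (closure V) (a *: x + y))) => //.
  by rewrite (proj_lin cV); apply: relL.
- move=> x y g; apply: (reluniq x); last exact: Grel.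
  rewrite -{1}(proj_id cV (x := x)) //; apply: subset_closure; by exists y.
- move=> z h; apply: (reluniq 0); last exact: Grel.
  rewrite -(proj0 cV (x := z)) // => x cx; rewrite inner_conj.
  rewrite (_ : '<<x, z>> = 0) ?rmorph0 //.
  have cO : closed_subspace [set x | forall y, [set z] y -> '<<x, y>> = 0] by exact: closed_orth.
  have : closure V `<=` [set x | forall y, [set z] y -> '<<x, y>> = 0].
    case: cO => _ _ cl; rewrite [X in _ `<=` X]((closure_id _).1 cl).
    apply: closureS => u [v Gv] _ -> /=.
    by rewrite inner_conj (h _ _ Gv) rmorph0.
  by move=> /(_ x cx z); apply.
Qed.

End Adjoints.

(** * Positive operators and C*-algebras of operators *)

Section Positive_operators.
Variable R : realType.
Implicit Types H K : hilbertType R.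

Definition sa H (x : H -> H) := bounded_op x /\ adj x = x.
Definition psd H (x : H -> H) := sa x /\ forall xi, 0 <= dot (x xi) xi.

Lemma sa_inner H (x : H -> H) : sa x -> forall xi eta, '<<x xi, eta>> = '<<xi, x eta>>.
Proof. by case=> bx sx xi eta; rewrite adjP // sx. Qed.
Lemma sa_dot H (x : H -> H) : sa x -> forall xi eta, dot (x xi) eta = dot xi (x eta).
Proof. by move=> sx xi eta; rewrite /dot sa_inner. Qed.
Lemma saI H (x : H -> H) : bounded_op x -> (forall xi eta, '<<x xi, eta>> = '<<xi, x eta>>) -> sa x.
Proof. by move=> bx h; split => //; apply: adj_uniq. Qed.

(** Complex polarization: the vectors [a + b] and [a + i b] give two equations for the two mixed
    inner products. *)
Lemma quad_zero H (y : H -> H) : linear y -> (forall xi, '<<y xi, xi>> = 0) -> y = fun=> 0.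
Proof.
move=> ly h; apply/funext => a; apply: inner_inj => b; rewrite inner0l.
have e1 : '<<y a, b>> + '<<y b, a>> = 0.
  have := h (a + b); rewrite (linD ly) innerDl !innerDr !h add0r addr0; exact.
have e2 : - 'i%C * '<<y a, b>> + 'i%C * '<<y b, a>> = 0.
  have := h (a + 'i%C *: b); rewrite (linD ly) (linZ ly) innerDl !innerDr !innerZl !innerZr !h.
  by rewrite !mulr0 add0r addr0; congr (_ * _ + _ = _); apply/eqP; rewrite eq_complex /= oppr0 !eqxx.
have : 'i%C * ('<<y b, a>> - '<<y a, b>>) = 0 by rewrite mulrBr -mulNr addrC.
move=> /eqP; rewrite mulf_eq0 => /orP[/eqP[]/eqP|]; first by rewrite oner_eq0.
rewrite subr_eq0 => /eqP e3; move: e1; rewrite e3 => /eqP.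
by rewrite -mulr2n mulrn_eq0 /= => /eqP.
Qed.

Lemma pos_psd H (x : H -> H) : bounded_op x -> pos_op x -> psd x.
Proof.
move=> bx px; split; last by move=> xi; have := px xi; rewrite lecE => /andP[].
split => //; have bax := adj_bop bx.
have : x - adj x = fun=> 0.
  apply: quad_zero; first exact: bop_lin (bopB bx bax).
  move=> xi; rewrite !fctE innerBl -adjPr // (inner_conj (x xi)).
  have := px xi; rewrite lecE => /andP[/eqP]; case: '<<_, _>> => a b /= -> _.
  by apply/eqP; rewrite eq_complex /= oppr0 !subrr eqxx.
by move=> /eqP; rewrite subr_eq0 => /eqP.
Qed.

Lemma sa_im H (x : H -> H) xi : sa x -> '<<x xi, xi>> = (dot (x xi) xi)%:C%C.
Proof.
move=> sx; have : '<<x xi, xi>> = '<<x xi, xi>>^* by rewrite -inner_conj sa_inner.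
rewrite /dot; case: '<<_, _>> => a b /= [] e.
by have -> : b = 0 by lra.
Qed.

Lemma psd_pos H (x : H -> H) : psd x -> pos_op x.
Proof. by move=> [sx px] xi; rewrite sa_im // lecR. Qed.

Lemma sa_lin H (x y : H -> H) (a : R) : sa x -> sa y -> sa (a%:C%C *: x + y).
Proof.
move=> [bx sx] [by_ sy]; split; first exact: bop_linear.
by rewrite adj_lin // sx sy; congr (_ *: _ + _); apply/eqP; rewrite eq_complex /= oppr0 !eqxx.
Qed.
Lemma saD H (x y : H -> H) : sa x -> sa y -> sa (x + y).
Proof. by move=> sx sy; rewrite -[x]scale1r; apply: (@sa_lin _ _ _ 1). Qed.
Lemma sa0 H : sa (0 : H -> H).
Proof. by split; [exact: bop0|rewrite -[RHS]adj0]. Qed.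
Lemma saZ H (x : H -> H) (a : R) : sa x -> sa (a%:C%C *: x).
Proof. by move=> sx; rewrite -[_ *: x]addr0; apply: sa_lin => //; apply: sa0. Qed.
Lemma saN H (x : H -> H) : sa x -> sa (- x).
Proof. by case=> bx sx; split; [exact: bopN|rewrite adjN // sx]. Qed.
Lemma saB H (x y : H -> H) : sa x -> sa y -> sa (x - y).
Proof. by move=> sx sy; apply: saD => //; apply: saN. Qed.
Lemma sa_id H : sa (@idfun H).
Proof. by split; [exact: bop_id|exact: adj_id]. Qed.
Lemma sa_comp H (x y : H -> H) : sa x -> sa y -> x \o y = y \o x -> sa (x \o y).
Proof. by case=> bx sx [by_ sy] e; split; [exact: bop_comp|rewrite adj_comp // sx sy e]. Qed.
Lemma sa_adj_comp H K (x : H -> K) : bounded_op x -> sa (adj x \o x).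
Proof.
move=> bx; have bax := adj_bop bx; split; first exact: bop_comp.
by rewrite adj_comp // adjK.
Qed.

Lemma psdD H (x y : H -> H) : psd x -> psd y -> psd (x + y).
Proof. by move=> [sx px] [sy py]; split=> [|xi]; [exact: saD|rewrite !fctE dotDl addr_ge0]. Qed.
Lemma psd0 H : psd (0 : H -> H).
Proof. by split=> [|xi]; [exact: sa0|rewrite (_ : (0 : H -> H) xi = 0) // dot0l]. Qed.
Lemma psdZ H (x : H -> H) (a : R) : 0 <= a -> psd x -> psd (a%:C%C *: x).
Proof. by move=> a0 [sx px]; split=> [|xi]; [exact: saZ|rewrite !fctE dotZl mulr_ge0]. Qed.
Lemma psd_sum H (I : Type) (r : seq I) (P : pred I) (F : I -> H -> H) :
  (forall i, P i -> psd (F i)) -> psd (\sum_(i <- r | P i) F i).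
Proof. by move=> h; elim/big_ind: _ => //; [exact: psd0|exact: psdD]. Qed.
Lemma psd_adj_comp H K (x : H -> K) : bounded_op x -> psd (adj x \o x).
Proof.
move=> bx; split=> [|xi]; first exact: sa_adj_comp.
by rewrite /= dotC -adj_dot // dotxx sqr_ge0.
Qed.
Lemma psd_sqr H (x : H -> H) : sa x -> psd (x \o x).
Proof. by case=> bx sx; have := psd_adj_comp bx; rewrite sx. Qed.
Lemma psd_conj H (x y : H -> H) : bounded_op x -> psd y -> psd (adj x \o y \o x).
Proof.
move=> bx [sy py]; have bax := adj_bop bx; have [by_ ay] := sy.
split=> [|xi]; last by rewrite /= dotC -adj_dot // dotC.
split; first by do 2 apply: bop_comp => //.
by rewrite (adj_comp (bop_comp bax by_) bx) (adj_comp bax by_) (adjK bx) ay.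
Qed.

Lemma psd_CS H (x : H -> H) xi eta : psd x ->
  dot (x xi) eta ^+ 2 <= dot (x xi) xi * dot (x eta) eta.
Proof.
move=> [sx px]; apply: quad_ge0 => // t; have := px (xi + t%:C%C *: eta).
have lx := bop_lin sx.1.
rewrite (linD lx) (linZ lx) dotDl !dotDr !dotZl !dotZr (sa_dot sx eta xi) (dotC eta).
by rewrite expr2; lra.
Qed.

(** Cauchy-Schwarz for the form of [x], at [xi] and [x xi]. *)
Lemma psd_onb H (x : H -> H) c : 0 <= c -> psd x ->
  (forall xi, dot (x xi) xi <= c * hn xi ^+ 2) -> onb x c.
Proof.
move=> c0 px h xi; have [sx px0] := px.
have [->|n0] := eqVneq (hn (x xi)) 0; first by rewrite mulr_ge0.
have np : 0 < hn (x xi) by rewrite lt_neqAle eq_sym n0 hn_ge0.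
have := psd_CS xi (x xi) px; rewrite dotxx => e.
have : (hn (x xi) ^+ 2) ^+ 2 <= (c * hn xi ^+ 2) * (c * hn (x xi) ^+ 2).
  by apply: le_trans e _; apply: ler_pM.
have -> : c * hn xi ^+ 2 * (c * hn (x xi) ^+ 2) = (c * hn xi) ^+ 2 * hn (x xi) ^+ 2 by ring.
rewrite [(_ ^+ 2) ^+ 2]expr2 ler_pM2r ?exprn_gt0 // ler_sqr ?nnegrE ?mulr_ge0 //.
Qed.

Lemma onb_le H (x : H -> H) c xi : onb x c -> dot (x xi) xi <= c * hn xi ^+ 2.
Proof. by move=> h; apply: le_trans (dot_CS _ _) _; rewrite expr2 mulrA ler_wpM2r. Qed.
Lemma onb_ge H (x : H -> H) c xi : onb x c -> - (c * hn xi ^+ 2) <= dot (x xi) xi.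
Proof. by move=> /onbN/onb_le -/(_ xi); rewrite fctE dotNl lerNl. Qed.

Lemma sa_onb H (x : H -> H) c : 0 <= c -> sa x ->
  (forall xi, `|dot (x xi) xi| <= c * hn xi ^+ 2) -> onb x c.
Proof.
move=> c0 sx h; have lx := bop_lin sx.1.
have key xi eta : 2 * dot (x xi) eta <= c * (hn xi ^+ 2 + hn eta ^+ 2).
  have h1 := h (xi + eta); have h2 := h (xi - eta).
  have := parallelogram xi eta.
  move: h1 h2; rewrite !ler_norml (linB lx) (linD lx) !(dotDl, dotDr, dotNl, dotNr).
  rewrite (sa_dot sx eta xi) (dotC eta) => /andP[_ h1] /andP[h2 _] p.
  by nra.
move=> xi; have [->|n0] := eqVneq (hn (x xi)) 0; first by rewrite mulr_ge0.
have np : 0 < hn (x xi) by rewrite lt_neqAle eq_sym n0 hn_ge0.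
have [/hn_eq0 ->|m0] := eqVneq (hn xi) 0; first by rewrite (lin0 lx) !hn0 mulr0.
have mp : 0 < hn xi by rewrite lt_neqAle eq_sym m0 hn_ge0.
(* Rescaling [x xi] to the length of [xi] makes the arithmetic mean in [key] sharp. *)
have := key xi ((hn xi / hn (x xi))%:C%C *: x xi).
rewrite dotZr dotxx hnZr exprMn real_normK ?num_real // expr_div_n divfK ?expf_neq0 //.
have -> : 2 * (hn xi / hn (x xi) * hn (x xi) ^+ 2) = 2 * hn xi * hn (x xi) by field.
have -> : c * (hn xi ^+ 2 + hn xi ^+ 2) = 2 * hn xi * (c * hn xi) by ring.
by rewrite ler_pM2l // mulr_gt0.
Qed.

Lemma psd_le_trans H (x y z : H -> H) : psd (y - x) -> psd (z - y) -> psd (z - x).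
Proof. by move=> h1 h2; rewrite -[z](subrK y) -addrA; apply: psdD. Qed.

End Positive_operators.

(** * Norm-closed operator algebras: geometric limits and inverses *)

Section Cstar.
Variables (R : realType) (H : hilbertType R).
Implicit Types (x y : H -> H).

(** Concrete unital C*-algebras. Inverses, square roots and unitaries are constructed once and then
    used in von Neumann algebras, among the T-bimodular operators on L^2(S), in matrix algebras and
    in the norm closure of QN_S(T). *)
Record cstar (N : set (H -> H)) : Prop := Cstar {
  cs_bop : forall x, N x -> bounded_op x ;
  cs_id : N idfun ;
  cs_lin : forall a x y, N x -> N y -> N (a *: x + y) ;
  cs_comp : forall x y, N x -> N y -> N (x \o y) ;
  cs_adj : forall x, N x -> N (adj x) ;
  cs_lim : forall x, (forall e : R, 0 < e -> exists2 y, N y & onb (x - y) e) -> N x }.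

Variable N : set (H -> H).
Hypothesis cN : cstar N.

Lemma csD x y : N x -> N y -> N (x + y).
Proof. by move=> Nx Ny; rewrite -[x]scale1r; apply: cs_lin. Qed.
Lemma cs0 : N 0.
Proof. by have := cs_lin cN (-1) (cs_id cN) (cs_id cN); rewrite scaleN1r addNr. Qed.
Lemma csZ a x : N x -> N (a *: x).
Proof. by move=> Nx; rewrite -[_ *: x]addr0; apply: cs_lin => //; exact: cs0. Qed.
Lemma csN x : N x -> N (- x).
Proof. by move=> Nx; rewrite -scaleN1r; apply: csZ. Qed.
Lemma csB x y : N x -> N y -> N (x - y).
Proof. by move=> Nx Ny; apply: csD => //; apply: csN. Qed.
Lemma cs_sum (I : Type) (r : seq I) (P : pred I) (F : I -> H -> H) :
  (forall i, P i -> N (F i)) -> N (\sum_(i <- r | P i) F i).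
Proof. by move=> h; elim/big_ind: _ => //; [exact: cs0|exact: csD]. Qed.

(** Limits of operators are taken at a geometric rate throughout; the explicit error stands in for a
    norm topology on operators. *)
Lemma cs_geo (f : nat -> H -> H) (C r : R) : 0 <= C -> 0 <= r < 1 ->
  (forall n, N (f n)) -> (forall n, onb (f n.+1 - f n) (C * r ^+ n)) ->
  exists2 x, N x & forall n, onb (x - f n) (C * r ^+ n / (1 - r)).
Proof.
move=> C0 /andP[r0 r1] Nf h.
have r1' : 0 < 1 - r by rewrite subr_gt0.
have h2 n m xi : hn (f (n + m)%N xi - f n xi) <= C * r ^+ n / (1 - r) * hn xi.
  have : hn (f (n + m)%N xi - f n xi) <= C * r ^+ n / (1 - r) * (1 - r ^+ m) * hn xi.
    elim: m => [|m IH]; first by rewrite addn0 subrr hn0 expr0 subrr mulr0 mul0r.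
    rewrite addnS; apply: le_trans (hn_tri (f (n + m)%N xi) _ _) _.
    apply: le_trans (lerD (h _ _) IH) _; rewrite -mulrDl; apply: ler_wpM2r => //.
    rewrite le_eqVlt; apply/orP; left; apply/eqP; rewrite exprD exprS; field.
    by rewrite gt_eqF.
  move=> /le_trans; apply; apply: ler_wpM2r => //.
  rewrite ler_piMr ?divr_ge0 ?mulr_ge0 ?exprn_ge0 ?(ltW r1') //.
  by rewrite gerBl exprn_ge0.
have small (c e : R) : 0 <= c -> 0 < e -> exists n, C * r ^+ n / (1 - r) * c < e.
  move=> c0 e0; have : (fun n => (C * c / (1 - r)) * r ^+ n) @ \oo --> (C * c / (1 - r)) * 0.
    by apply: cvgMr; apply: cvg_expr; rewrite ger0_norm.
  rewrite mulr0 => /cvgrPdist_lt /(_ e e0) [n _ /(_ n (leqnn _))] /=.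
  rewrite sub0r normrN ger0_norm; last by rewrite mulr_ge0 ?divr_ge0 ?mulr_ge0 ?exprn_ge0 // ltW.
  by move=> lt; exists n; rewrite (le_lt_trans _ lt) // le_eqVlt; apply/orP; left; apply/eqP; ring.
have cau xi : hcauchy (fun n => f n xi).
  move=> e e0; have [|n hn'] := small (hn xi) (e / 2) (hn_ge0 _); first by lra.
  exists n => p q np nq; apply: le_lt_trans (hn_tri (f n xi) _ _) _.
  have := h2 n (p - n)%N xi; have := h2 n (q - n)%N xi; rewrite !subnKC // (hnC (f q xi)).
  by move: hn'; lra.
pose x xi := sval (cid (hcomplete (cau xi))).
have xl xi : hcvg (fun n => f n xi) (x xi) by apply: (svalP (cid (hcomplete (cau xi)))).
have key n : onb (x - f n) (C * r ^+ n / (1 - r)).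
  move=> xi; rewrite !fctE; apply: (@hcvg_hn_le _ _ (fun m => f (n + m)%N xi - f n xi)) => //.
  apply: hcvgB; last exact: hcvg_cst.
  by apply: (hcvg_sub (xl xi)) => m; exists (n + m)%N; rewrite leq_addl.
exists x => //; apply: (cs_lim cN) => e e0; have [n hn'] := small 1 e ler01 e0.
by exists (f n) => //; apply: onbW (key n); rewrite -[leLHS]mulr1 ltW.
Qed.

Lemma onb_lim_eq x y : (forall e : R, 0 < e -> onb (x - y) e) -> x = y.
Proof.
move=> h; apply/funext => xi; apply/eqP; rewrite -subr_eq0; apply/eqP/hn_eq0/le_anti.
rewrite hn_ge0 andbT; apply/ler_addgt0Pr => e e0; rewrite add0r.
have p : 0 < hn xi + 1 by rewrite ltr_wpDl.
have := h (e / (hn xi + 1)) (divr_gt0 e0 p) xi; rewrite !fctE => /le_trans; apply.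
by rewrite -mulrA ler_piMr ?(ltW e0) // mulrC ler_pdivrMr // mul1r lerDl.
Qed.

End Cstar.

Section Functional_calculus.
Variables (R : realType) (H : hilbertType R).
Implicit Types (x y g h : H -> H).
Variable N : set (H -> H).
Hypothesis cN : cstar N.

Lemma cs_lin_ x : N x -> linear x. Proof. by move=> /(cs_bop cN) []. Qed.

Lemma csK_lim x (f : nat -> H -> H) (C r : R) : 0 <= C -> 0 <= r < 1 ->
  (forall n, onb (x - f n) (C * r ^+ n / (1 - r))) -> forall xi, hcvg (fun n => f n xi) (x xi).
Proof.
move=> C0 /andP[r0 r1] h xi e e0.
have r1' : 0 < 1 - r by rewrite subr_gt0.
have : (fun n => (C * hn xi / (1 - r)) * r ^+ n) @ \oo --> (C * hn xi / (1 - r)) * 0.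
  by apply: cvgMr; apply: cvg_expr; rewrite ger0_norm.
rewrite mulr0 => /cvgrPdist_lt /(_ e e0) [n _ hn'] /=.
exists n => m nm; have := hn' m nm => /=; rewrite sub0r normrN ger0_norm; last first.
  by rewrite mulr_ge0 ?divr_ge0 ?mulr_ge0 ?exprn_ge0 // ltW.
move=> lt; rewrite hnC; apply: le_lt_trans (h m xi) _; apply: le_lt_trans _ lt.
by rewrite le_eqVlt; apply/orP; left; apply/eqP; ring.
Qed.

Lemma hcvg_comm x y (f : nat -> H -> H) : bounded_op y ->
  (forall xi, hcvg (fun n => f n xi) (x xi)) -> (forall n, y \o f n = f n \o y) -> y \o x = x \o y.
Proof.
move=> by_ fx h; apply/funext => xi /=.
apply: (hcvg_uniq (u := fun n => y (f n xi))); first exact: bop_hcvg.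
have e n : y (f n xi) = f n (y xi) by have := congr1 (fun f => f xi) (h n).
by rewrite (funext e).
Qed.

Lemma hcvg_sa x (f : nat -> H -> H) : bounded_op x ->
  (forall xi, hcvg (fun n => f n xi) (x xi)) -> (forall n, sa (f n)) -> sa x.
Proof.
move=> bx fx sf; apply: saI => // xi eta.
have key z w : dot (x z) w = dot z (x w).
  rewrite [RHS]dotC.
  have le1 (e : R) : 0 < e -> `|dot (x z) w - dot (x w) z| <= e.
    move=> e0.
    have p : 0 < hn z + hn w + 1 by rewrite ltr_wpDl // addr_ge0.
    have [n1 h1] := fx z _ (divr_gt0 e0 p).
    have [n2 h2] := fx w _ (divr_gt0 e0 p).
    pose n := maxn n1 n2.
    have := h1 n (leq_maxl _ _); have := h2 n (leq_maxr _ _).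
    rewrite !ltr_pdivlMr // => b2 b1.
    have e1 : dot (f n z) w = dot (f n w) z by rewrite (sa_dot (sf n)) dotC.
    have -> : dot (x z) w - dot (x w) z = dot (f n w - x w) z - dot (f n z - x z) w.
      by rewrite !dotBl e1; ring.
    apply: le_trans (ler_normB _ _) _.
    apply: le_trans (lerD (dot_CSabs _ _) (dot_CSabs _ _)) _.
    have := hn_ge0 (f n z - x z); have := hn_ge0 (f n w - x w).
    have := hn_ge0 z; have := hn_ge0 w; nra.
  apply/eqP; rewrite -subr_eq0 -normr_eq0; apply/eqP/le_anti; rewrite normr_ge0 andbT.
  by apply/ler_addgt0Pr => e e0; rewrite add0r le1.
apply: inner_eq_dot; rewrite ?key //.
by have := key xi ('i%C *: eta); rewrite (linZ (bop_lin bx)).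
Qed.

Lemma hcvg_psd x (f : nat -> H -> H) : bounded_op x ->
  (forall xi, hcvg (fun n => f n xi) (x xi)) -> (forall n, psd (f n)) -> psd x.
Proof.
move=> bx fx pf; split; first by apply: (hcvg_sa bx fx) => n; case: (pf n).
by move=> xi; apply: (hcvg_dot_ge _ (fx xi)) => n; case: (pf n).
Qed.

(** The Neumann series of [q = 1 - x / b], where [b = c + d] exceeds the bound [c] of [x]; the lower
    bound [d] keeps the norm of [q] at most [1 - d / b]. *)
Lemma cs_inv x (d : R) : 0 < d -> N x -> psd x -> (forall xi, d * hn xi ^+ 2 <= dot (x xi) xi) ->
  exists y, [/\ N y, psd y, x \o y = idfun & y \o x = idfun].
Proof.
move=> d0 Nx px dx; have [sx px0] := px.
have [c c0 xc] := bop_onb (cs_bop cN Nx).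
pose b := c + d; have b0 : 0 < b by rewrite /b; lra.
pose q := idfun - (b^-1)%:C%C *: x.
have Nq : N q by apply: csB => //; [apply: cs_id|apply: csZ].
have qE xi : q xi = xi - (b^-1)%:C%C *: x xi by [].
have sq : sa q by apply: saB; [exact: sa_id|exact: saZ].
have lq := bop_lin sq.1.
have qd xi : dot (q xi) xi = hn xi ^+ 2 - b^-1 * dot (x xi) xi by rewrite qE dotBl dotZl dotxx.
have pq : psd q.
  split=> // xi; rewrite qd subr_ge0 ler_pdivrMl //.
  by apply: le_trans (onb_le _ xc) _; rewrite ler_wpM2r ?sqr_ge0 // /b; lra.
pose r := 1 - d / b.
have r01 : 0 <= r < 1.
  by rewrite /r subr_ge0 ler_pdivrMr // mul1r gtrBl divr_gt0 // andbT /b lerDr.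
have qr : onb q r.
  apply: psd_onb => //; first by case/andP: r01.
  move=> xi; rewrite qd /r; have bi : 0 <= b^-1 by rewrite invr_ge0 ltW.
  by have := ler_wpM2l bi (dx xi); lra.
pose s n := \sum_(k < n) iter k (fun y => q \o y) idfun.
have Nit k : N (iter k (fun y => q \o y) idfun).
  by elim: k => [|k IH] /=; [exact: cs_id|apply: cs_comp].
have itr k : onb (iter k (fun y => q \o y) idfun) (r ^+ k).
  elim: k => [|k IH] /=; first by move=> xi; rewrite expr0 mul1r.
  by rewrite exprS; apply: onb_comp => //; case/andP: r01.
have Ns n : N (s n) by apply: cs_sum.
have sr n : onb (s n.+1 - s n) (1 * r ^+ n).
  rewrite mul1r (_ : s n.+1 - s n = iter n (fun y => q \o y) idfun) //.
  by rewrite /s big_ord_recr /= addrAC subrr add0r.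
have [y0 Ny0 hy0] := cs_geo cN ler01 r01 Ns sr.
have yl := csK_lim ler01 r01 hy0.
have sS n : s n.+1 = idfun + (q \o s n).
  have e : \sum_(i < n) (q \o iter i (fun y => q \o y) idfun) = q \o s n.
    by apply/funext => xi; rewrite /s /= !sum_opE (lin_sum lq).
  transitivity (idfun + \sum_(i < n) (q \o iter i (fun y => q \o y) idfun)).
    by rewrite /s big_ord_recl.
  exact: (congr1 (fun f : H -> H => idfun + f) e).
have itC k : q \o iter k (fun y => q \o y) idfun = iter k (fun y => q \o y) idfun \o q.
  by elim: k => [//|k IH] /=; rewrite -[RHS]/(q \o (iter k (fun y => q \o y) idfun \o q)) -IH.
have sC n : q \o s n = s n \o q.
  apply/funext => xi; rewrite /s /= !sum_opE (lin_sum lq); apply: eq_bigr => k _.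
  by have := congr1 (fun f => f xi) (itC k).
have yC : q \o y0 = y0 \o q by apply: (hcvg_comm sq.1 yl).
have yq : y0 = idfun + (q \o y0).
  apply/funext => xi; apply: (hcvg_uniq (u := fun n => s n.+1 xi)).
    by apply: (hcvg_sub (yl xi)) => n; exists n.+1.
  have -> : (fun n => s n.+1 xi) = (fun n => xi + q (s n xi)).
    by apply/funext => n; rewrite sS.
  by apply: hcvgD; [exact: hcvg_cst|apply: bop_hcvg => //; case: sq].
pose y := (b^-1)%:C%C *: y0.
have xE xi : x xi = b%:C%C *: (xi - q xi).
  by rewrite qE opprB addrCA subrr addr0 scalerA -rmorphM /= divff ?gt_eqF // scale1r.
have by_ : (b * b^-1)%:C%C = 1 :> R[i] by rewrite divff ?gt_eqF.
have xy : x \o y = idfun.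
  apply/funext => xi /=; rewrite xE /y !fctE (linZ lq) -scalerBr scalerA -rmorphM /= by_ scale1r.
  by rewrite {1}yq fctE /= addrK.
have yx : y \o x = idfun.
  have ly := cs_lin_ Ny0.
  apply/funext => xi /=; rewrite /y !fctE xE (linZ ly) scalerA -rmorphM /= mulVf ?gt_eqF // scale1r (linB ly).
  have := congr1 (fun f => f xi) yC; rewrite /= => <-.
  by rewrite {1}yq fctE /= addrK.
have Ny : N y by apply: csZ.
have bY := cs_bop cN Ny.
have yE xi : x (y xi) = xi by have := congr1 (fun f => f xi) xy.
exists y; split => //; split.
  by apply: saI => // xi eta; rewrite -{1}(yE eta) -(sa_inner sx) yE.
by move=> xi; have := px0 (y xi); rewrite yE dotC.
Qed.

End Functional_calculus.

(** * Square roots *)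

Section Square_roots.
Variables (R : realType) (H : hilbertType R).
Implicit Types (x y g h : H -> H).
Variable N : set (H -> H).
Hypothesis cN : cstar N.

Lemma comm_linear x y (a : R[i]) z : bounded_op z -> z \o x = x \o z -> z \o y = y \o z ->
  z \o (a *: x + y) = (a *: x + y) \o z.
Proof.
move=> bz zx zy; apply/funext => xi /=; rewrite !fctE (linD (bop_lin bz)) (linZ (bop_lin bz)).
by have := congr1 (fun f => f xi) zx; have := congr1 (fun f => f xi) zy; rewrite /= => -> ->.
Qed.

Lemma comm_comp x y z : z \o x = x \o z -> z \o y = y \o z -> z \o (x \o y) = (x \o y) \o z.
Proof. by move=> zx zy; rewrite -[LHS]/((z \o x) \o y) zx -[LHS]/(x \o (z \o y)) zy. Qed.

(** The iteration [w <- (a + w^2) / 2] with [a = 1 - g] converges to [1 - sqrt g]. The lower bound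
    [d] keeps the iterates below [r = sqrt (1 - d)], which is also the contraction factor. The root
    commutes with whatever commutes with [g], because each iterate does. *)
Lemma cs_sqrt_inv g (d : R) : 0 < d -> d <= 1 -> N g -> psd g ->
  (forall xi, d * hn xi ^+ 2 <= dot (g xi) xi) ->
  (forall xi, dot (g xi) xi <= hn xi ^+ 2) ->
  exists h, [/\ N h, psd h, h \o h = g & forall y, bounded_op y -> y \o g = g \o y -> y \o h = h \o y].
Proof.
move=> d0 d1 Ng pg dg g1.
pose r := Num.sqrt (1 - d).
have r2 : r ^+ 2 = 1 - d by rewrite sqr_sqrtr // subr_ge0.
have r0 : 0 <= r by apply: sqrtr_ge0.
have r1 : r < 1 by rewrite -ltr_sqr ?nnegrE // r2 expr1n gtrBl.
pose a := idfun - g.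
have sg := pg.1.
have aE xi : a xi = xi - g xi by [].
have Na : N a by apply: csB => //; apply: cs_id.
have pa : psd a.
  by split=> [|xi]; [apply: saB => //; exact: sa_id|rewrite aE dotBl dotxx subr_ge0].
have ar : onb a (r ^+ 2).
  apply: psd_onb => // [|xi]; first exact: sqr_ge0.
  by rewrite aE dotBl dotxx r2; have := dg xi; lra.
pose F w := (2^-1 : R)%:C%C *: (a + (w \o w)).
pose w n := iter n F 0.
have h2 : 0 <= 2^-1 :> R by rewrite invr_ge0.
have Nw n : N (w n).
  by elim: n => [|n IH]; [exact: cs0|apply: csZ => //; apply: csD => //; apply: cs_comp].
have wC y n : bounded_op y -> y \o g = g \o y -> y \o w n = w n \o y.
  move=> by_ yg; elim: n => [|n IH] /=; first by apply/funext => xi /=; rewrite -[LHS]/(y 0) (lin0 (bop_lin by_)).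
  rewrite /F -[_ *: _]addr0; apply: comm_linear => //.
    rewrite -[a]scale1r; apply: comm_linear => //; last exact: comm_comp.
    by apply/funext => xi /=; rewrite !aE (linB (bop_lin by_)); have := congr1 (fun f => f xi) yg => /= ->.
  by apply/funext => xi; rewrite /= -[LHS]/(y 0) (lin0 (bop_lin by_)).
have wg n : w n \o g = g \o w n by rewrite -wC //; [exact: cs_bop cN _ Ng].
have ww m n : w m \o w n = w n \o w m by apply: wC; [exact: cs_bop cN _ (Nw m)|exact: wg].
have wp n : psd (w n) /\ onb (w n) r.
  elim: n => [|n [IH1 IH2]]; first by split; [exact: psd0|move=> xi; rewrite hn0 mulr_ge0].
  split; first by apply: psdZ => //; apply: psdD => //; apply: psd_sqr; case: IH1.
  move=> xi; rewrite /= /F !fctE hnZr ger0_norm //.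
  have h1 := ar xi; have h3 : hn (w n (w n xi)) <= r ^+ 2 * hn xi by rewrite expr2; apply: onb_comp.
  have := hnD (a xi) (w n (w n xi)); rewrite /= => h4.
  have h5 : r ^+ 2 * hn xi <= r * hn xi by rewrite ler_wpM2r // expr2 ler_piMr // ltW.
  by lra.
have wd n : onb (w n.+1 - w n) (1 * r ^+ n).
  rewrite mul1r; elim: n => [|n IH].
    rewrite expr0 -[w 0%N]/0 subr0; apply: onbW (wp 1%N).2; exact: ltW.
  have -> : w n.+2 - w n.+1 = ((2^-1 : R)%:C%C *: (w n.+1 + w n)) \o (w n.+1 - w n).
    have l1 := cs_lin_ cN (Nw n); have l2 := cs_lin_ cN (Nw n.+1).
    apply/funext => xi.
    transitivity ((2^-1 : R)%:C%C *: (a xi + w n.+1 (w n.+1 xi)) - (2^-1 : R)%:C%C *: (a xi + w n (w n xi))) => //.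
    transitivity ((2^-1 : R)%:C%C *: (w n.+1 (w n.+1 xi - w n xi) + w n (w n.+1 xi - w n xi))) => //.
    rewrite (linB l1) (linB l2); have := congr1 (fun f => f xi) (ww n n.+1).
    by rewrite -[(w n \o w n.+1) xi]/(w n (w n.+1 xi)) => ->; rewrite -[(w n.+1 \o w n) xi]/(w n.+1 (w n xi)); hvec.
  rewrite exprS; apply: onb_comp => //.
  move=> xi; rewrite !fctE hnZr ger0_norm //.
  have := hnD (w n.+1 xi) (w n xi); have := (wp n.+1).2 xi; have := (wp n).2 xi; lra.
have r01 : 0 <= r < 1 by rewrite r0.
have [v Nv hv] := cs_geo cN ler01 r01 Nw wd.
have vl := csK_lim ler01 r01 hv.
have lv := cs_lin_ cN Nv.
have vr : onb v r.
  by move=> xi; apply: (hcvg_hn_le _ (vl xi)) => n; apply: (wp n).2.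
have vE xi : v xi = (2^-1 : R)%:C%C *: (a xi + v (v xi)).
  apply: (hcvg_uniq (u := fun n => w n.+1 xi)); first by apply: (hcvg_sub (vl xi)) => n; exists n.+1.
  apply: (@hcvgZ _ _ _ (fun n => a xi + w n (w n xi))).
  apply: hcvgD; first exact: hcvg_cst.
  have -> : (fun n => w n (w n xi)) = (fun n => (w n (w n xi) - w n (v xi)) + w n (v xi)).
    by apply/funext => n; rewrite subrK.
  rewrite -[v (v xi)]add0r; apply: hcvgD => // e e0.
  have [n0 h0] := vl xi e e0; exists n0 => n /h0 lt; rewrite subr0 -(linB (cs_lin_ cN (Nw n))).
  apply: le_lt_trans ((wp n).2 _) _; apply: le_lt_trans lt.
  by rewrite ler_piMl // ltW.
have bv := cs_bop cN Nv.
have pv : psd v by apply: (hcvg_psd bv vl) => n; case: (wp n).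
exists (idfun - v); split.
- by apply: csB => //; exact: cs_id.
- split=> [|xi]; first by apply: saB; [exact: sa_id|case: pv].
  rewrite -[(idfun - v) xi]/(xi - v xi) dotBl dotxx subr_ge0.
  by apply: le_trans (onb_le _ vr) _; rewrite ler_piMl ?sqr_ge0 // ltW.
- apply/funext => xi /=; rewrite -![(idfun - v) _]/(_ - v _) (linB lv).
  have := congr1 (fun z => z + z) (vE xi).
  rewrite -scalerDl -rmorphD /= (_ : 2^-1 + 2^-1 = 1 :> R) ?scale1r; last by lra.
  rewrite aE => e; apply: dot_inj => z.
  have := congr1 (fun u => dot u z) e.
  by rewrite !(dotDl, dotNl); lra.
- move=> y by_ yg; have yv := hcvg_comm by_ vl (fun n => wC y n by_ yg).
  apply/funext => xi /=; rewrite -![(idfun - v) _]/(_ - v _) (linB (bop_lin by_)).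
  by have := congr1 (fun f => f xi) yv => /= ->.
Qed.

(** With [k] a root of a multiple of [g + e], the form of [(g + e) h] is a multiple of that of
    [k h k]. Roots exist so far only for operators bounded below, hence the shift by [e], which then
    tends to 0. *)
Lemma comm_psd g h : N g -> psd g -> psd h -> h \o g = g \o h -> forall xi, 0 <= dot (g (h xi)) xi.
Proof.
move=> Ng pg ph hg xi; have [sg pg0] := pg; have [sh ph0] := ph.
have [c c0 gc] := bop_onb (cs_bop cN Ng).
have hp0 := ph0 xi.
have key (e : R) : 0 < e -> - (e * dot (h xi) xi) <= dot (g (h xi)) xi.
  move=> e0; pose b := c + e; have b0 : 0 < b by rewrite /b; lra.
  have bi : 0 < b^-1 by rewrite invr_gt0.
  pose g' := (b^-1)%:C%C *: (g + e%:C%C *: idfun).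
  have g'E z : g' z = (b^-1)%:C%C *: (g z + e%:C%C *: z) by [].
  have [||||||k [Nk pk kk kC]] := @cs_sqrt_inv g' (e / b).
  - by rewrite divr_gt0.
  - by rewrite ler_pdivrMr // mul1r /b lerDr.
  - by apply: csZ => //; apply: csD => //; apply: csZ => //; apply: cs_id.
  - apply: psdZ; first exact: ltW.
    apply: psdD => //; apply: psdZ; first exact: ltW.
    by split=> [|z]; [exact: sa_id|rewrite /= dotxx sqr_ge0].
  - move=> z; rewrite g'E dotZl dotDl dotZl dotxx.
    by have := mulr_ge0 (ltW bi) (pg0 z); lra.
  - move=> z; rewrite g'E dotZl dotDl dotZl dotxx ler_pdivrMl // /b mulrDl lerD2r.
    exact: onb_le.
  have hk : h \o k = k \o h.
    apply: kC; first by case: sh.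
    have := comm_linear (b^-1)%:C%C sh.1 (x := g + e%:C%C *: idfun) (y := 0).
    rewrite addr0; apply; last by apply/funext => z /=; rewrite -[LHS]/(h 0) (lin0 (bop_lin sh.1)).
    rewrite addrC; apply: comm_linear => //; exact: sh.1.
  have : 0 <= dot (g' (h xi)) xi.
    rewrite -kk /=; have := congr1 (fun f => f xi) hk; rewrite /= => <-.
    by rewrite (sa_dot pk.1) ph0.
  by rewrite g'E dotZl pmulr_rge0 // dotDl dotZl; lra.
rewrite leNgt; apply/negP => lt.
have p : 0 < dot (h xi) xi + 1 by lra.
have := key (- dot (g (h xi)) xi / 2 / (dot (h xi) xi + 1)).
rewrite divr_gt0 ?divr_gt0 ?oppr_gt0 // => /(_ isT).
have -> : - dot (g (h xi)) xi / 2 / (dot (h xi) xi + 1) * dot (h xi) xi =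
   - dot (g (h xi)) xi / 2 * (dot (h xi) xi / (dot (h xi) xi + 1)) by field; rewrite gt_eqF.
have : dot (h xi) xi / (dot (h xi) xi + 1) <= 1 by rewrite ler_pdivrMr //; lra.
move: (_ / _) => t; nra.
Qed.

(** From [(h + h') (h - h') = t]: as [h^2] is at least [e^2] and the product [h' h] is positive,
    [h + h'] shrinks no vector by a factor below [e], so the difference is at most [t / e]. *)
Lemma sqrt_dist h h' (t e : R) : N h' -> psd h -> psd h' -> h \o h' = h' \o h ->
  0 < e -> 0 <= t <= e ^+ 2 -> (forall xi, h (h xi) = h' (h' xi) + t%:C%C *: xi) ->
  (forall xi, e ^+ 2 * hn xi ^+ 2 <= dot (h (h xi)) xi) -> onb (h - h') e.
Proof.
move=> Nh' ph ph' hC e0 /andP[t0 te] hh he xi; rewrite fctE.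
have lh := bop_lin ph.1.1; have lh' := bop_lin ph'.1.1.
set d := h xi - h' xi.
have e1 : h d + h' d = t%:C%C *: xi.
  rewrite /d (linB lh) (linB lh') hh; have := congr1 (fun f => f xi) hC; rewrite /= => ->.
  by hvec.
have e2 : e ^+ 2 * hn d ^+ 2 <= (t * hn xi) ^+ 2.
  have -> : (t * hn xi) ^+ 2 = hn (h d + h' d) ^+ 2 by rewrite e1 hnZr ger0_norm.
  rewrite hn2D -(dotxx (h d)) (sa_dot ph.1 d) dotC.
  have := he d; have := sqr_ge0 (hn (h' d)).
  have := comm_psd Nh' ph' ph hC d; rewrite (sa_dot ph'.1).
  by lra.
have e0' := ltW e0.
have e3 : (e * hn d) ^+ 2 <= (e ^+ 2 * hn xi) ^+ 2.
  rewrite exprMn; apply: le_trans e2 _; rewrite ler_sqr ?nnegrE ?mulr_ge0 ?sqr_ge0 //.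
  exact: ler_wpM2r.
by rewrite -(ler_pM2l e0) mulrA -expr2 -ler_sqr ?nnegrE ?mulr_ge0 ?sqr_ge0.
Qed.

(** The roots of [g / b + e_n^2] exist by [cs_sqrt_inv], and [sqrt_dist] makes them converge at the
    rate [e_n = 2^-n / 2]. *)
Lemma cs_sqrt g : N g -> psd g ->
  exists h, [/\ N h, psd h, h \o h = g & forall y, bounded_op y -> y \o g = g \o y -> y \o h = h \o y].
Proof.
move=> Ng pg; have [sg pg0] := pg.
have [c c0 gc] := bop_onb (cs_bop cN Ng).
(* With this scaling [g / b] is at most 1/2, and [e_n^2] is at most 1/4, so the sum stays below
   1. *)
pose b := 2 * (c + 1); have b0 : 0 < b by rewrite /b; lra.
have bi : 0 < b^-1 by rewrite invr_gt0.
pose e n : R := 2^-1 ^+ n / 2.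
have e0 n : 0 < e n by rewrite /e divr_gt0 // exprn_gt0 // invr_gt0.
have h0 : 0 <= 2^-1 :> R by rewrite invr_ge0.
have h1 : 2^-1 <= 1 :> R by lra.
have e1 n : e n <= 2^-1 by rewrite /e ler_pdivrMr // mulVf // exprn_ile1.
pose G n := (b^-1)%:C%C *: g + (e n ^+ 2)%:C%C *: idfun.
have GE n z : G n z = (b^-1)%:C%C *: g z + (e n ^+ 2)%:C%C *: z by [].
have h_ n : {h | [/\ N h, psd h, h \o h = G n & forall y, bounded_op y -> y \o g = g \o y -> y \o h = h \o y]}.
  apply/cid; have [||||||h [Nh ph hh hC]] := @cs_sqrt_inv (G n) (e n ^+ 2).
  - exact: exprn_gt0.
  - by have := e0 n; have := e1 n; nra.
  - by apply: csD => //; apply: csZ => //; apply: cs_id.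
  - apply: psdD; first by apply: psdZ => //; exact: ltW.
    apply: psdZ; first exact: sqr_ge0.
    by split=> [|z]; [exact: sa_id|rewrite /= dotxx sqr_ge0].
  - by move=> z; rewrite GE dotDl !dotZl dotxx lerDr mulr_ge0 // ltW.
  - move=> z; rewrite GE dotDl !dotZl dotxx.
    have h2 : b^-1 * dot (g z) z <= 2^-1 * hn z ^+ 2.
      rewrite ler_pdivrMl // /b; have := onb_le z gc; have := sqr_ge0 (hn z); lra.
    have h3 : e n ^+ 2 <= 4^-1 by have := e0 n; have := e1 n; nra.
    by have := sqr_ge0 (hn z); nra.
  exists h; split => // y by_ yg; apply: hC => //.
  have := comm_linear (b^-1)%:C%C by_ yg (y := (e n ^+ 2)%:C%C *: idfun); apply.
  by apply/funext => z /=; rewrite !fctE (linZ (bop_lin by_)).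
pose h n := sval (h_ n).
have hP n : [/\ N (h n), psd (h n), h n \o h n = G n & forall y, bounded_op y -> y \o g = g \o y -> y \o h n = h n \o y].
  exact: (svalP (h_ n)).
have hhE n z : h n (h n z) = G n z by case: (hP n) => _ _ <-.
have hg n : h n \o g = g \o h n.
  by case: (hP n) => _ _ _ hC; rewrite hC //; exact: sg.1.
have dist n : onb (h n - h n.+1) (e n).
  have [Nh ph hh hC] := hP n; have [Nh' ph' hh' hC'] := hP n.+1.
  apply: (@sqrt_dist _ _ (e n ^+ 2 - e n.+1 ^+ 2)) => //.
  - by apply: hC'; [exact: ph.1.1|exact: hg].
  - have eS : e n.+1 <= e n.
      by rewrite /e exprS; have : 0 <= 2^-1 ^+ n :> R := exprn_ge0 n h0; lra.
    by have := e0 n; have := e0 n.+1; nra.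
  - by move=> z; rewrite !hhE !GE; hvec.
  - by move=> z; rewrite hhE GE dotDl !dotZl dotxx lerDr mulr_ge0 // ltW.
have r01 : 0 <= (2^-1 : R) < 1 by rewrite invr_ge0 ler0n invf_lt1 // ltr1n.
have half0 : 0 <= (2^-1 : R) by case/andP: r01.
have Nh n : N (h n) by case: (hP n).
have dist' n : onb (h n.+1 - h n) (2^-1 * 2^-1 ^+ n).
  move=> z; rewrite fctE hnC; apply: le_trans (dist n z) _.
  by rewrite /e [2^-1 * _]mulrC.
have [v Nv hv] := cs_geo cN half0 r01 Nh dist'.
have vl := csK_lim half0 r01 hv.
have bv := cs_bop cN Nv.
have pv : psd v by apply: (hcvg_psd bv vl) => n; case: (hP n).
pose s := Num.sqrt b; have s2 : s ^+ 2 = b by rewrite sqr_sqrtr // ltW.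
have [C C0 vC] := bop_onb bv.
have vv z : v (v z) = (b^-1)%:C%C *: g z.
  apply: (hcvg_uniq (u := fun n => h n (h n z))).
    have -> : (fun n => h n (h n z)) = (fun n => (h n (h n z) - v (h n z)) + v (h n z)).
      by apply/funext => n; rewrite subrK.
    rewrite -[v (v z)]add0r; apply: hcvgD; last exact: bop_hcvg.

    move=> d d0; have [B hB] : exists B, forall n, hn (h n z) <= B.
      exists (hn (v z) + (2^-1 / (1 - 2^-1)) * hn z) => n.
      have := hv n z; rewrite fctE => hz.
      have := hnB (v z) (v z - h n z); rewrite opprB addrCA subrr addr0 => /le_trans; apply.
      rewrite lerD2l; apply: le_trans hz _; apply: ler_wpM2r => //.
      apply: ler_wpM2r; first by rewrite invr_ge0; lra.
      by rewrite ler_piMr // exprn_ile1.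
    have B0 : 0 <= B by apply: le_trans (hB 0%N).
    have cv : (fun n => (2^-1 / (1 - 2^-1) * B) * 2^-1 ^+ n) @ \oo --> (2^-1 / (1 - 2^-1) * B) * (0 : R).
      by apply: cvgMr; apply: cvg_expr; rewrite ger0_norm //; case/andP: r01.
    move: cv; rewrite mulr0 => /cvgrPdist_lt /(_ d d0) [n0 _ hn0'].
    exists n0 => n nn; have := hn0' n nn => /=; rewrite sub0r normrN => /(le_lt_trans (ler_norm _)) lt.
    rewrite subr0 hnC; apply: le_lt_trans (hv n (h n z)) _; apply: le_lt_trans lt.
    have -> : 2^-1 / (1 - 2^-1) * B * 2^-1 ^+ n = 2^-1 * 2^-1 ^+ n / (1 - 2^-1) * B :> R by ring.
    by apply: ler_wpM2l => //; rewrite divr_ge0 ?mulr_ge0 ?exprn_ge0 //; lra.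
  have -> : (fun n => h n (h n z)) = (fun n => (b^-1)%:C%C *: g z + (e n ^+ 2)%:C%C *: z).
    by apply/funext => n; rewrite hhE.
  rewrite -[X in hcvg _ X]addr0; apply: hcvgD; first exact: hcvg_cst.
  move=> d d0; have cv : (fun n => (2^-1 * hn z) * 2^-1 ^+ n) @ \oo --> (2^-1 * hn z) * (0 : R).
    by apply: cvgMr; apply: cvg_expr; rewrite ger0_norm //; case/andP: r01.
  move: cv; rewrite mulr0 => /cvgrPdist_lt /(_ d d0) [n0 _ hn0'].
  exists n0 => n nn; have := hn0' n nn => /=; rewrite sub0r normrN => /(le_lt_trans (ler_norm _)) lt.
  rewrite subr0 hnZr ger0_norm ?sqr_ge0 //; apply: le_lt_trans lt.
  have -> : 2^-1 * hn z * 2^-1 ^+ n = e n * hn z by rewrite /e; ring.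
  apply: ler_wpM2r => //; have := e0 n; have := e1 n; nra.
exists (s%:C%C *: v); split.
- exact: csZ.
- by apply: psdZ => //; apply: sqrtr_ge0.
- apply/funext => z /=; rewrite !fctE (linZ (bop_lin bv)) vv !scalerA -!rmorphM /=.
  by rewrite -expr2 s2 divff ?scale1r // gt_eqF.
- move=> y by_ yg; have yv := hcvg_comm by_ vl (fun n => let: And4 _ _ _ hC := hP n in hC y by_ yg).
  apply/funext => z /=; rewrite !fctE (linZ (bop_lin by_)).
  by have := congr1 (fun f => f z) yv => /= ->.
Qed.

End Square_roots.

(** * Unitaries, representations and monotone limits *)

Section Cstar_consequences.
Variables (R : realType) (H : hilbertType R).
Implicit Types (x y g h : H -> H).
Variable N : set (H -> H).
Hypothesis cN : cstar N.

Lemma psd_sub_adj x c : bounded_op x -> 0 <= c -> onb x c ->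
  psd ((c ^+ 2)%:C%C *: idfun - (adj x \o x)).
Proof.
move=> bx c0 xc; split=> [|xi].
  by apply: saB; [apply: saZ; exact: sa_id|exact: sa_adj_comp].
rewrite -[(_ - _) xi]/((c ^+ 2)%:C%C *: xi - adj x (x xi)) dotBl dotZl dotxx subr_ge0.
rewrite dotC -adj_dot // dotxx -exprMn ler_sqr ?nnegrE ?mulr_ge0 //; exact: xc.
Qed.

(** [u = x + i sqrt (1 - x^2)], whose root commutes with [x]. *)
Lemma cs_unitary x : N x -> sa x -> onb x 2^-1 ->
  exists u, [/\ N u, adj u \o u = idfun, u \o adj u = idfun & x = (2^-1 : R)%:C%C *: (u + adj u)].
Proof.
move=> Nx sx xc; have bx := cs_bop cN Nx.
have [x1 ax] := sx.
have h0 : 0 <= 2^-1 :> R by rewrite invr_ge0.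
have px : psd (idfun - (x \o x)).
  have onx : onb x 1 by apply: onbW xc; lra.
  have := psd_sub_adj bx ler01 onx; rewrite expr1n scale1r ax; exact.
have [|b [Nb pb bb bC]] := cs_sqrt cN _ px.
  by apply: (csB cN); [exact: cs_id|exact: cs_comp].
have sb := pb.1; have bb0 := cs_bop cN Nb.
have xb : x \o b = b \o x.
  apply: bC => //; apply/funext => xi /=.
  by rewrite -![(idfun - _) _]/(_ - x (x _)) (linB (bop_lin bx)).
have xbE xi : x (b xi) = b (x xi) by have := congr1 (fun f => f xi) xb.
have bbE xi : b (b xi) = xi - x (x xi) by have := congr1 (fun f => f xi) bb.
pose u := 'i%C *: b + x.
have lx := bop_lin bx; have lb := bop_lin bb0.
have au : adj u = (- 'i%C) *: b + x.
  by rewrite /u adj_lin // ax sb.2; congr (_ *: _ + _); apply/eqP; rewrite eq_complex /= oppr0 !eqxx.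
have uE xi : u xi = 'i%C *: b xi + x xi by [].
have auE xi : adj u xi = (- 'i%C) *: b xi + x xi by rewrite au.
have ii : 'i%C * 'i%C = -1 :> R[i] by rewrite -expr2 sqr_i.
exists u; split.
- by apply: cs_lin.
- apply/funext => xi /=; rewrite auE uE !(linD lx, linD lb, linZ lx, linZ lb) xbE bbE.
  by rewrite scalerDr !scalerA mulNr ii opprK; cvec.
- apply/funext => xi /=; rewrite uE auE !(linD lx, linD lb, linZ lx, linZ lb) xbE bbE.
  by rewrite scalerDr !scalerA mulrN ii opprK; cvec.
- apply/funext => xi; rewrite -[RHS]/((2^-1 : R)%:C%C *: (u xi + adj u xi)) uE auE.
  by rewrite scaleNr addrACA addrN add0r; hvec.
Qed.

Lemma hn_eq (G : hilbertType R) (a b : R) : 0 <= a -> 0 <= b -> a ^+ 2 = b ^+ 2 -> a = b.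
Proof. by move=> a0 b0 /eqP; rewrite eqrXn2 // => /eqP. Qed.

Lemma unitary_isom x xi : bounded_op x -> adj x \o x = idfun -> hn (x xi) = hn xi.
Proof.
move=> bx e; apply: hn_eq => //; rewrite -!dotxx adj_dot //.
by have := congr1 (fun f => f xi) e => /= ->.
Qed.

Lemma onb_adj_sqr x c : bounded_op x -> 0 <= c -> onb (adj x \o x) (c ^+ 2) -> onb x c.
Proof.
move=> bx c0 h xi; rewrite -ler_sqr ?nnegrE ?mulr_ge0 // exprMn -dotxx adj_dot // dotC.
exact: (onb_le xi h).
Qed.

End Cstar_consequences.

(** * Representations and antirepresentations are positive and contractive *)

Section Representations.
Variables (R : realType) (H K : hilbertType R).
Implicit Types (x y g h : H -> H).
Variable N : set (H -> H).
Hypothesis cN : cstar N.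

(* A *-homomorphism (such as a left action) or a *-antihomomorphism (such as a
   right action). *)
Record jrep (pi : (H -> H) -> (K -> K)) : Prop := Jrep {
  jr_lin : linear_on N pi ;
  jr_id : pi idfun = idfun ;
  jr_bop : forall x, N x -> bounded_op (pi x) ;
  jr_adj : forall x, N x -> pi (adj x) = adj (pi x) ;
  jr_mul : (forall x y, N x -> N y -> pi (x \o y) = pi x \o pi y) \/
           (forall x y, N x -> N y -> pi (x \o y) = pi y \o pi x) }.

Variable pi : (H -> H) -> (K -> K).
Hypothesis jpi : jrep pi.

Lemma jrD x y : N x -> N y -> pi (x + y) = pi x + pi y.
Proof. by move=> Nx Ny; have := jr_lin jpi 1 Nx Ny; rewrite !scale1r. Qed.
Lemma jr0 : pi 0 = 0.
Proof.
have := jr_lin jpi (-1) (cs_id cN) (cs_id cN); rewrite scaleN1r addNr => ->.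
by rewrite scaleN1r addNr.
Qed.
Lemma jrZ a x : N x -> pi (a *: x) = a *: pi x.
Proof. by move=> Nx; have := jr_lin jpi a Nx (cs0 cN); rewrite jr0 !addr0. Qed.
Lemma jrN x : N x -> pi (- x) = - pi x.
Proof. by move=> Nx; rewrite -scaleN1r jrZ // scaleN1r. Qed.
Lemma jrB x y : N x -> N y -> pi (x - y) = pi x - pi y.
Proof. by move=> Nx Ny; rewrite jrD ?jrN //; apply: csN. Qed.
Lemma jr_sum (I : Type) (r : seq I) (P : pred I) (F : I -> H -> H) :
  (forall i, N (F i)) -> pi (\sum_(i <- r | P i) F i) = \sum_(i <- r | P i) pi (F i).
Proof.
move=> h; elim: r => [|i r IH]; first by rewrite !big_nil jr0.
by rewrite !big_cons; case: ifP => // _; rewrite jrD ?IH //; apply: cs_sum.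
Qed.

Lemma jr_sqr x : N x -> pi (x \o x) = pi x \o pi x.
Proof. by move=> Nx; case: (jr_mul jpi) => ->. Qed.

Lemma jr_sa x : N x -> sa x -> sa (pi x).
Proof. by move=> Nx [bx ax]; split; [exact: jr_bop|rewrite -jr_adj // ax]. Qed.

Lemma jr_psd x : N x -> psd x -> psd (pi x).
Proof.
move=> Nx px; have [h [Nh ph <- _]] := cs_sqrt cN Nx px.
by rewrite jr_sqr //; apply: psd_sqr; apply: jr_sa => //; case: ph.
Qed.

Lemma jr_onb x c : N x -> 0 <= c -> onb x c -> onb (pi x) c.
Proof.
move=> Nx c0 xc; have bx := cs_bop cN Nx; have bpx := jr_bop jpi Nx.
have gen y : N y -> onb y c -> psd ((c ^+ 2)%:C%C *: idfun - pi (adj y \o y)).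
  move=> Ny yc; have := jr_psd _ (psd_sub_adj (cs_bop cN Ny) c0 yc).
  have Nay : N (adj y \o y) by apply: cs_comp => //; apply: cs_adj.
  have Nc : N ((c ^+ 2)%:C%C *: idfun) by apply: csZ => //; exact: cs_id.
  by rewrite jrB // jrZ ?(jr_id jpi); [apply; exact: csB|exact: cs_id].
have Nax := cs_adj cN Nx.
have ons : onb (adj (pi x) \o pi x) (c ^+ 2).
  have [p ep] : exists2 p, p = adj (pi x) \o pi x & psd ((c ^+ 2)%:C%C *: idfun - p).
    have axc : onb (adj x) c by apply: adj_onb.
    case: (jr_mul jpi) => h.
      by exists (pi (adj x \o x)); [rewrite h // jr_adj|exact: gen].
    (* An antihomomorphism maps [x x^*], not [x^* x], to [pi(x)^* pi(x)]. *)
    exists (pi (adj (adj x) \o adj x)); last exact: gen.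
    by rewrite h ?jr_adj ?adjK //; rewrite (jr_adj jpi) ?(jr_adj jpi) ?adjK //; exact: cs_adj.
  rewrite -ep => -[sp pp]; apply: psd_onb; first exact: sqr_ge0.
    by rewrite ep; apply: psd_adj_comp.
  move=> xi; have := pp xi; rewrite -[(_ - _) xi]/((c ^+ 2)%:C%C *: xi - p xi).
  by rewrite dotBl dotZl dotxx subr_ge0.
exact: onb_adj_sqr.
Qed.

End Representations.

(** * Strong limits of decreasing sequences of positive operators *)

Section Monotone_limits.
Variables (R : realType) (H : hilbertType R).

Lemma mono_real (s : nat -> R) : (forall n, 0 <= s n) -> (forall n, s n.+1 <= s n) ->
  forall e : R, 0 < e -> exists N, forall m n, (N <= m)%N -> (m <= n)%N -> s m - s n <= e.
Proof.
move=> s0 sd e e0.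
have dec m n : (m <= n)%N -> s n <= s m.
  by move=> /subnKC <-; elim: (n - m)%N => [|k IH]; rewrite ?addn0 // addnS (le_trans (sd _)).
have hi : has_inf (range s) by split; [exists (s 0%N), 0%N|exists 0 => _ [n _ <-]].
have [_ [N _ <-] lt] := inf_adherent e0 hi.
exists N => m n Nm mn; have := dec _ _ Nm.
have : inf (range s) <= s n by apply: ge_inf; [case: hi|exists n].
lra.
Qed.

(** The decreasing quadratic forms converge; Cauchy-Schwarz for the positive operator [a m - a n]
    turns this into convergence of the vectors. *)
Lemma mono_lim (a : nat -> H -> H) : (forall n, psd (a n)) -> (forall n, psd (a n - a n.+1)) ->
  exists2 x, psd x & forall xi, hcvg (fun n => a n xi) (x xi).
Proof.
move=> pa pd.
have dec m n : (m <= n)%N -> psd (a m - a n).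
  move=> /subnKC <-; elim: (n - m)%N => [|k IH]; first by rewrite addn0 subrr; exact: psd0.
  by rewrite addnS; apply: (psd_le_trans (pd _) IH).
have [C C0 aC] := bop_onb (pa 0%N).1.1.
have qle m n xi : (m <= n)%N -> dot (a n xi) xi <= dot (a m xi) xi.
  by move=> mn; have := (dec m n mn).2 xi; rewrite fctE dotBl subr_ge0.
have dC m n : (m <= n)%N -> onb (a m - a n) C.
  move=> mn; apply: psd_onb => // [|xi]; first exact: dec.
  rewrite fctE dotBl; apply: le_trans (onb_le xi aC).
  by apply: le_trans (qle 0%N m xi (leq0n _)); rewrite gerBl; case: (pa n).
have cau xi : hcauchy (fun n => a n xi).
  have key (e : R) : 0 < e -> exists N, forall m n, (N <= m)%N -> (m <= n)%N -> hn (a m xi - a n xi) < e.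
    move=> e0; have [|||N hN] := @mono_real (fun n => dot (a n xi) xi) _ _ (e ^+ 2 / (2 * (C + 1))).
    - by move=> n; case: (pa n).
    - by move=> n; apply: qle.
    - by rewrite divr_gt0 ?exprn_gt0 // mulr_gt0 // ltr_wpDl.
    exists N => m n Nm mn; rewrite -ltr_sqr ?nnegrE ?(ltW e0) //.
    have := hN m n Nm mn => h.
    have := psd_CS xi ((a m - a n) xi) (dec m n mn); rewrite dotxx.
    rewrite -![(a m - a n) xi]/(a m xi - a n xi) dotBl.
    set z := a m xi - a n xi => h2.
    have h3 := onb_le z (dC m n mn); have := (dec m n mn).2 z => h4.
    have [z0|z0] := eqVneq (hn z) 0; first by rewrite z0 expr0n exprn_gt0.
    have zp : 0 < hn z ^+ 2 by rewrite exprn_gt0 // lt_neqAle eq_sym z0 hn_ge0.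
    have p : 0 < C + 1 by rewrite ltr_wpDl.
    have h5 : hn z ^+ 2 * hn z ^+ 2 <= (e ^+ 2 / (2 * (C + 1))) * (C * hn z ^+ 2).
      rewrite -expr2; apply: le_trans h2 _; apply: ler_pM => //.
      by have := (dec m n mn).2 xi; rewrite -![(a m - a n) xi]/(a m xi - a n xi) dotBl.
    rewrite mulrA ler_pM2r // in h5; apply: le_lt_trans h5 _.
    rewrite mulrAC ltr_pdivrMr ?mulr_gt0 // ltr_pM2l ?exprn_gt0 //; lra.
  move=> e e0; have [N hN] := key e e0; exists N => m n Nm Nn.
  by case/orP: (leq_total m n) => mn; [exact: hN|rewrite hnC; exact: hN].
pose x xi := sval (cid (hcomplete (cau xi))).
have xl xi : hcvg (fun n => a n xi) (x xi) by apply: (svalP (cid (hcomplete (cau xi)))).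
exists x => //; apply: (hcvg_psd _ xl pa).
apply: (@bopI _ _ _ _ C) => [k u v|xi].
  apply: (hcvg_uniq (xl _)).
  have -> : (fun n => a n (k *: u + v)) = (fun n => k *: a n u + a n v).
    by apply/funext => n; have := bop_lin (pa n).1.1 k u v.
  by apply: hcvgD => //; apply: hcvgZ.
apply: (@hcvg_hn_le _ _ (fun n => a n xi)) => // n.
apply: (psd_onb C0 (pa n)) => z; apply: le_trans (onb_le z aC); exact: qle.
Qed.

End Monotone_limits.

(** * Von Neumann algebras and normal traces *)

Section Von_Neumann.
Variables (R : realType) (K : hilbertType R).
Implicit Types (x y : K -> K) (A M : set (K -> K)).

Lemma commutant_slim A (a : nat -> K -> K) b : (forall x, A x -> bounded_op x) ->
  (forall n, commutant A (a n)) -> bounded_op b -> (forall xi, hcvg (fun n => a n xi) (b xi)) ->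
  commutant A b.
Proof.
move=> bA ca bb ab; split => // x Ax.
apply: (hcvg_comm (bA x Ax) ab) => n; exact: (ca n).2.
Qed.

Lemma vn_mem M : vn_algebra M -> forall x, bounded_op x ->
  (forall z, commutant M z -> z \o x = x \o z) -> M x.
Proof. by case=> _ _ e x bx h; rewrite -e; split. Qed.

Lemma vn_comm M x z : M x -> commutant M z -> z \o x = x \o z.
Proof. by move=> Mx [_ ->]. Qed.

Lemma vn_slim M (a : nat -> K -> K) b : vn_algebra M ->
  (forall n, M (a n)) -> bounded_op b -> (forall xi, hcvg (fun n => a n xi) (b xi)) -> M b.
Proof.
move=> vM Ma bb ab; have [bM _ e] := vM; rewrite -e.
by apply: (commutant_slim _ _ bb ab) => [z [] //|n]; rewrite e.
Qed.

Lemma harm_small (e : R) : 0 < e -> exists n : nat, n.+1%:R^-1 < e.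
Proof.
move=> e0; exists (Num.bound e^-1).
rewrite -[ltRHS]invrK ltf_pV2 ?posrE ?ltr0n ?invr_gt0 //.
apply: lt_trans (archi_boundP _) _; first by rewrite invr_ge0 ltW.
by rewrite ltr_nat.
Qed.

Lemma vn_cstar M : vn_algebra M -> cstar M.
Proof.
move=> vM; have [bM aM e] := vM; split => //.
- by apply: vn_mem => //; exact: bop_id.
- move=> a x y Mx My; apply: vn_mem => //; first by apply: bop_linear; apply: bM.
  by move=> z cz; apply: comm_linear; [case: cz|exact: vn_comm cz|exact: vn_comm cz].
- move=> x y Mx My; apply: vn_mem => //; first by apply: bop_comp; apply: bM.
  by move=> z cz; apply: comm_comp; exact: vn_comm cz.
move=> x h.
have hy n : {y | M y /\ onb (x - y) n.+1%:R^-1}.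
  by apply/cid; have [|y My xy] := h n.+1%:R^-1; [rewrite invr_gt0 ltr0n|exists y].
pose y n := sval (hy n).
have My n : M (y n) by case: (svalP (hy n)).
have xy n : onb (x - y n) n.+1%:R^-1 by case: (svalP (hy n)).
have yl xi : hcvg (fun n => y n xi) (x xi).
  move=> d d0; have p : 0 < hn xi + 1 by rewrite ltr_wpDl.
  have [N hN] := harm_small (divr_gt0 d0 p); exists N => n Nn.
  rewrite hnC; apply: le_lt_trans (xy n xi) _.
  have le : n.+1%:R^-1 <= N.+1%:R^-1 :> R by rewrite lef_pV2 ?posrE ?ltr0n // ler_nat.
  move: hN; rewrite ltr_pdivlMr //.
  have : 0 <= n.+1%:R^-1 :> R by rewrite invr_ge0.
  move: (n.+1%:R^-1) (N.+1%:R^-1) le => a b ab a0; have := hn_ge0 xi; nra.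
have [c c0 yc] := bop_onb (bM _ (My 0%N)).
apply: (vn_slim vM My _ yl); apply: (@bopI _ _ _ _ (1 + c)) => [k u v|xi].
  apply: (hcvg_uniq (yl _)).
  have -> : (fun n => y n (k *: u + v)) = (fun n => k *: y n u + y n v).
    by apply/funext => n; have [l _] := bM _ (My n); rewrite l.
  by apply: hcvgD => //; apply: hcvgZ.
have := hnD ((x - y 0%N) xi) (y 0%N xi); rewrite {1}fctE subrK => /le_trans; apply.
rewrite mulrDl; apply: lerD => //; apply: le_trans (xy 0%N xi) _.
by rewrite invr1.
Qed.

Lemma sup_complex (A : set R[i]) (s : R[i]) : (forall a, A a -> complex.Im a = 0) -> A !=set0 ->
  supremums A s -> [/\ complex.Im s = 0, (forall a, A a -> complex.Re a <= complex.Re s)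
    & forall e : R, 0 < e -> exists2 a, A a & complex.Re s - e < complex.Re a].
Proof.
move=> rA [a0 Aa0] [us ls].
have le a : A a -> complex.Im s = 0 /\ complex.Re a <= complex.Re s.
  by move=> Aa; have := us _ Aa; rewrite lecE (rA _ Aa) => /andP[/eqP -> ->].
have [s0 _] := le _ Aa0.
split; [exact: s0|by move=> a /le[]|move=> e e0; apply: contrapT => h].
have : ubound A (complex.Re s - e)%:C%C.
  move=> a Aa; rewrite lecE (rA _ Aa) /= eqxx /= leNgt; apply/negP => lt; apply: h.
  by exists a.
by move=> /ls; rewrite lecE /= => /andP[_]; rewrite lerBrDl gerDr leNgt e0.
Qed.

(** Normality is formulated with directed sets, whereas the limits taken here are sequential; this
    links the two. *)
Lemma inc_seq (a : nat -> K -> K) x : (forall n, psd (a n)) ->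
  (forall n, psd (a n.+1 - a n)) -> psd x -> (forall xi, hcvg (fun n => a n xi) (x xi)) ->
  increases_to (range a) x.
Proof.
move=> pa pd px al.
have dec m n : (m <= n)%N -> psd (a n - a m).
  move=> /subnKC <-; elim: (n - m)%N => [|k IH]; first by rewrite addn0 subrr; exact: psd0.
  by rewrite addnS; apply: (psd_le_trans IH (pd _)).
have Ep y y' : psd (y - y') -> pos_op (y \- y').
  by move=> p; have -> : (y \- y') = y - y' by []; exact: psd_pos.
split.
- by exists (a 0%N), 0%N.
- by move=> _ [n _ <-]; apply: psd_pos.
- move=> _ _ [m _ <-] [n _ <-]; exists (a (maxn m n)); split; first by exists (maxn m n).
    by apply: Ep; apply: dec; apply: leq_maxl.
  by apply: Ep; apply: dec; apply: leq_maxr.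
move=> xi; rewrite (sa_im xi px.1); split.
  move=> _ [_ [n _ <-] <-]; rewrite (sa_im xi (pa n).1) lecR.
  apply: (@hcvg_dot_ge _ _ (fun m => a (n + m)%N xi)) => [m|].
    have := (dec n (n + m)%N (leq_addr _ _)).2 xi; rewrite fctE dotBl subr_ge0; exact.
  by apply: (hcvg_sub (al xi)) => m; exists (n + m)%N; rewrite leq_addl.
move=> z h; have : z = (complex.Re z)%:C%C.
  have := h _ (ex_intro2 _ _ (a 0%N) (ex_intro2 _ _ 0%N I erefl) erefl).
  by rewrite (sa_im xi (pa 0%N).1) lecE /= => /andP[/eqP]; case: z h => u v _ /= ->.
move=> ->; rewrite lecR; apply: (hcvg_dot_le _ (al xi)) => n.
have := h _ (ex_intro2 _ _ (a n) (ex_intro2 _ _ n I erefl) erefl).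
by rewrite (sa_im xi (pa n).1) lecE => /andP[].
Qed.

Lemma psd_small (H : hilbertType R) (d : H -> H) C xi : psd d -> onb d C -> hn (d xi) ^+ 2 <= C * dot (d xi) xi.
Proof.
move=> pd dC; have [z0|z0] := eqVneq (hn (d xi)) 0.
  rewrite (hn_eq0 z0) dot0l hn0 expr0n mulr0; exact: lexx.
have zp : 0 < hn (d xi) ^+ 2 by rewrite exprn_gt0 // lt_neqAle eq_sym z0 hn_ge0.
have := psd_CS xi (d xi) pd; rewrite dotxx => h.
rewrite -(ler_pM2r zp) -expr2; apply: le_trans h _.
rewrite mulrAC mulrC; apply: ler_wpM2r; first by case: pd.
exact: onb_le.
Qed.

(** Both actions of a normal bimodule are instances. Limits of operators are carried over to the
    bimodule in which the cocycle takes its values by treating all normal representations at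
    once. *)
Definition nrep M (H : hilbertType R) (pi : (K -> K) -> (H -> H)) := jrep M pi /\ normal_map M pi.

(** Normality gives the convergence of the quadratic forms, and [psd_small] upgrades it to strong
    convergence. *)
Lemma nrep_mono M (H : hilbertType R) (pi : (K -> K) -> (H -> H)) (a : nat -> K -> K) x : cstar M -> nrep M pi ->
  (forall n, M (a n)) -> M x -> (forall n, psd (a n)) ->
  (forall n, psd (a n.+1 - a n)) -> psd x -> (forall xi, hcvg (fun n => a n xi) (x xi)) ->
  forall xi, hcvg (fun n => pi (a n) xi) (pi x xi).
Proof.
move=> cM [jp np] Ma Mx pa pd px al xi.
have inc := inc_seq pa pd px al.
have [] := np _ _ _ Mx inc; first by move=> _ [n _ <-].
move=> _ _ _ /(_ xi) sup.
have dec m n : (m <= n)%N -> psd (pi (a n) - pi (a m)).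
  move=> mn; rewrite -(jrB cM jp) //; apply: (jr_psd cM jp); first exact: csB.
  move: mn => /subnKC <-; elim: (n - m)%N => [|k IH]; first by rewrite addn0 subrr; exact: psd0.
  by rewrite addnS; apply: (psd_le_trans IH (pd _)).
have sp n := jr_sa jp (Ma n) (pa n).1.
have spx := jr_sa jp Mx px.1.
have [||_ le near] := sup_complex _ _ sup.
- by move=> _ [_ [_ [n _ <-] <-] <-]; rewrite sa_im.
- by exists ('<<pi (a 0%N) xi, xi>>), (pi (a 0%N)) => //; exists (a 0%N) => //; exists 0%N.
have pdx n : psd (pi x - pi (a n)).
  rewrite -(jrB cM jp) //; apply: (jr_psd cM jp); first exact: csB.
  apply: (@hcvg_psd _ _ _ (fun m => a (n + m)%N - a n)).
  - by apply: bopB; apply: cs_bop cM _ _.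
  - move=> z; apply: hcvgB; last exact: hcvg_cst.
    by apply: (hcvg_sub (al z)) => m; exists (n + m)%N; rewrite leq_addl.
  - move=> m; elim: m => [|k IH]; first by rewrite addn0 subrr; exact: psd0.
    by rewrite addnS; apply: (psd_le_trans IH (pd _)).
have [C C0 xC] := bop_onb spx.1.
have bC n : onb (pi x - pi (a n)) C.
  apply: psd_onb => // z; apply: le_trans (onb_le z xC).
  rewrite fctE dotBl gerBl; have := (jr_psd cM jp (Ma n) (pa n)).2 z; exact.
move=> e e0; have [|_ [_ [_ [n _ <-] <-] <-] lt] := near (e ^+ 2 / (C + 1)).
  by rewrite divr_gt0 ?exprn_gt0 // ltr_wpDl.
exists n => m nm; rewrite hnC -ltr_sqr ?nnegrE ?(ltW e0) //.
have := psd_small xi (pdx m) (bC m); rewrite {1}fctE => /le_lt_trans; apply.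
have := (dec n m nm).2 xi; have := (pdx m).2 xi.
rewrite !fctE !dotBl; move: lt; rewrite -!/(dot _ _) => lt h1 h2.
have p : 0 < C + 1 by rewrite ltr_wpDl.
have : (dot (pi x xi) xi - dot (pi (a m) xi) xi) * (C + 1) < e ^+ 2.
  by rewrite -ltr_pdivlMr //; lra.
lra.
Qed.

Lemma nrep_id M : vn_algebra M -> nrep M (fun x => x).
Proof.
move=> [bM aM _]; split.
  split=> //; left=> //.
by move=> D x _ _; rewrite image_id.
Qed.

Lemma jr_onb_comp (H : hilbertType R) M (pi : (K -> K) -> (H -> H)) y e c : cstar M -> jrep M pi ->
  M y -> M e -> sa y -> sa e -> 0 <= c -> onb (y \o e) c -> onb (pi y \o pi e) c.
Proof.
move=> cM jp My Me sy se c0 h; case: (jr_mul jp) => m; rewrite -m //.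
  by apply: (jr_onb cM jp) => //; apply: cs_comp.
apply: (jr_onb cM jp) => //; first exact: cs_comp.
rewrite -(sy.2) -(se.2) -adj_comp; [|exact: sy.1|exact: se.1].
by apply: adj_onb => //; apply: bop_comp; [case: sy|case: se].
Qed.

End Von_Neumann.

(** * Normal traces and a noncommutative Egorov theorem *)

Section Egorov.
Variables (R : realType) (K : hilbertType R) (M : set (K -> K)) (tau : (K -> K) -> R[i]).
Hypothesis vM : vn_algebra M.
Hypothesis fM : faithful_normal_tracial_state M tau.
Implicit Types (x y : K -> K).

Let cM := vn_cstar vM.
Definition trR x := complex.Re (tau x).

Lemma tr_lin a x y : M x -> M y -> tau (a *: x + y) = a * tau x + tau y.
Proof. by case: fM => [[h _] _ _ _ _]; exact: h. Qed.
Lemma tr1 : tau idfun = 1. Proof. by case: fM => [[]]. Qed.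
Lemma trD x y : M x -> M y -> tau (x + y) = tau x + tau y.
Proof. by move=> Mx My; have := tr_lin 1 Mx My; rewrite scale1r mul1r. Qed.
Lemma tr0 : tau 0 = 0.
Proof. by have := tr_lin (-1) (cs_id cM) (cs_id cM); rewrite scaleN1r addNr mulN1r addNr. Qed.
Lemma trZ a x : M x -> tau (a *: x) = a * tau x.
Proof. by move=> Mx; have := tr_lin a Mx (cs0 cM); rewrite tr0 !addr0. Qed.
Lemma trN x : M x -> tau (- x) = - tau x.
Proof. by move=> Mx; rewrite -scaleN1r trZ // mulN1r. Qed.
Lemma trB x y : M x -> M y -> tau (x - y) = tau x - tau y.
Proof. by move=> Mx My; rewrite trD ?trN //; apply: csN. Qed.
Lemma tr_sum (I : Type) (r : seq I) (P : pred I) (F : I -> K -> K) : (forall i, M (F i)) ->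
  tau (\sum_(i <- r | P i) F i) = \sum_(i <- r | P i) tau (F i).
Proof.
move=> h; elim: r => [|i r IH]; first by rewrite !big_nil tr0.
by rewrite !big_cons; case: ifP => // _; rewrite trD ?IH //; apply: cs_sum.
Qed.
Lemma trC x y : M x -> M y -> tau (x \o y) = tau (y \o x).
Proof. by case: fM => _ _ _ h _; exact: h. Qed.
Lemma tr_sqr x : M x -> 0 <= tau (adj x \o x).
Proof. by case: fM => _ h _ _ _; exact: h. Qed.
Lemma tr_faith x : M x -> tau (adj x \o x) = 0 -> x = 0.
Proof. by case: fM => _ _ h _ _; exact: h. Qed.
Lemma tr_pos x : M x -> psd x -> 0 <= tau x.
Proof.
move=> Mx px; have [h [Mh ph <- _]] := cs_sqrt cM Mx px.
by rewrite -{1}(ph.1.2); apply: tr_sqr.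
Qed.
Lemma trR_pos x : M x -> psd x -> 0 <= trR x.
Proof. by move=> Mx px; have := tr_pos Mx px; rewrite lecE => /andP[]. Qed.
Lemma tr_psd0 x : M x -> psd x -> trR x = 0 -> x = 0.
Proof.
move=> Mx px t0; have := tr_pos Mx px; have [h [Mh ph e _]] := cs_sqrt cM Mx px.
rewrite lecE => /andP[/eqP i0 _].
have h0 : h = 0.
  apply: tr_faith => //; rewrite (ph.1.2) e.
  by move: t0 i0; rewrite /trR; case: (tau x) => a b /= -> ->.
rewrite -e h0; apply/funext => z; reflexivity.
Qed.

Lemma tr_mono (a : nat -> K -> K) x c : (forall n, M (a n)) -> M x -> (forall n, psd (a n)) ->
  (forall n, psd (a n.+1 - a n)) -> psd x -> (forall xi, hcvg (fun n => a n xi) (x xi)) ->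
  (forall n, trR (a n) <= c) -> trR x <= c.
Proof.
move=> Ma Mx pa pd px al h.
have [_ _ _ _ nt] := fM.
have raM : range a `<=` M by move=> _ [n _ <-].
have [||_ _ near] := sup_complex _ _ (nt _ _ raM Mx (inc_seq pa pd px al)).
- by move=> _ [_ [n _ <-] <-]; have := tr_pos (Ma n) (pa n); rewrite lecE => /andP[/eqP].
- by exists (tau (a 0%N)), (a 0%N) => //; exists 0%N.
apply/ler_addgt0Pr => e /near [_ [_ [n _ <-] <-]]; have := h n; rewrite /trR; lra.
Qed.

(** [e] and [e'] are the inverses of [1 + s] and [1 + s']. Cauchy-Schwarz for the form of [1 + s],
    at [e xi] and [e' xi], compares them. *)
Lemma inv_anti (H : hilbertType R) (s s' e e' : H -> H) : psd s -> psd (s' - s) -> psd e -> psd e' ->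
  (forall xi, e xi + s (e xi) = xi) -> (forall xi, e' xi + s' (e' xi) = xi) -> psd (e - e').
Proof.
move=> ps pd pe pe' he he'.
split=> [|xi]; first by apply: saB; [case: pe|case: pe'].
rewrite fctE dotBl subr_ge0.
have pb : psd (idfun + s) by apply: psdD => //; split=> [|z]; [exact: sa_id|rewrite /= dotxx sqr_ge0].
have := psd_CS (e xi) (e' xi) pb; rewrite -![(idfun + s) _]/(_ + s _) he.
have -> : dot (e' xi + s (e' xi)) (e' xi) = dot (e' xi) xi - dot ((s' - s) (e' xi)) (e' xi).
  have := congr1 (dot (e' xi)) (he' xi); rewrite fctE dotBl dotDl dotDr (dotC (e' xi) (s' _)); lra.
have := pd.2 (e' xi); set p := dot _ (e' xi); have := pe'.2 xi; have := pe.2 xi.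
rewrite (dotC xi (e' xi)) (dotC xi (e xi)).
move: (dot (e' xi) xi) (dot (e xi) xi) => u v v0 u0 p0.
have [->//|un] := eqVneq u 0; have up : 0 < u by rewrite lt_neqAle eq_sym un.
rewrite expr2 => h; rewrite -(ler_pM2l up); apply: le_trans h _.
by rewrite mulrC; apply: ler_wpM2r => //; lra.
Qed.

(** The cut-off [e m] is the inverse of [1 + s], where [s] sums [4^n z_n] over [n >= m]; it replaces
    a spectral projection. It compresses each [4^n z_n] below 1, and [1 - e m] has trace at most
    [2 * 2^-m], so [e m] increases to 1 in every normal representation. *)
Lemma egorov (z : nat -> K -> K) : (forall n, M (z n)) -> (forall n, psd (z n)) ->
  (forall n, trR (z n) <= 8^-1 ^+ n) ->
  exists e : nat -> K -> K, [/\ forall m, M (e m), forall m, psd (e m) /\ onb (e m) 1,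
    (forall (H : hilbertType R) (pi : (K -> K) -> (H -> H)), nrep M pi ->
       forall xi, hcvg (fun m => pi (e m) xi) xi)
    & forall m n, (m <= n)%N -> forall xi, dot (z n (e m xi)) (e m xi) <= 4^-1 ^+ n * hn xi ^+ 2].
Proof.
move=> Mz pz tz.
pose s m N := \sum_(m <= n < N) ((4 ^+ n)%:C%C *: z n : K -> K).
have c4 n : 0 <= 4 ^+ n :> R by rewrite exprn_ge0.
have Ms m N : M (s m N) by apply: cs_sum => // n _; apply: csZ.
have ps m N : psd (s m N) by apply: psd_sum => // n _; apply: psdZ.
have ts m N : trR (s m N) <= 2 * 2^-1 ^+ m.
  have key : (m <= N)%N -> trR (s m N) <= 2 * 2^-1 ^+ m - 2 * 2^-1 ^+ N.
    move=> /subnKC <-; elim: (N - m)%N => [|k IH].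
      by rewrite addn0 /s big_geq // /trR tr0 subrr.
    rewrite addnS /s big_nat_recr ?leq_addr //= /trR trD; [|exact: Ms|exact: csZ].
    rewrite ReD; have := tz (m + k)%N; rewrite trZ // ReRM -/(trR _) => h1.
    have h2 : 4 ^+ (m + k) * trR (z (m + k)%N) <= 2^-1 ^+ (m + k).
      apply: le_trans (ler_wpM2l (c4 _) h1) _; rewrite -exprMn.
      by rewrite (_ : 4 * 8^-1 = 2^-1) //; field.
    have := IH; rewrite /trR -/(s m (m + k)%N) exprS; lra.
  case: (leqP m N) => [/key h|lt]; last first.
    by rewrite /s big_geq ?(ltnW lt) // /trR tr0 /= mulr_ge0 // exprn_ge0.
  apply: le_trans h _; rewrite gerBl mulr_ge0 // exprn_ge0 //; lra.
have E_ m N : {e | [/\ M e, psd e, forall xi, e xi + s m N (e xi) = xi & forall xi, e (xi + s m N xi) = xi]}.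
  apply/cid; have [||||e [Me pe e1 e2]] := @cs_inv _ _ M cM (idfun + s m N) 1.
  - exact: ltr01.
  - by apply: csD => //; exact: cs_id.
  - by apply: psdD => //; split=> [|w]; [exact: sa_id|rewrite /= dotxx sqr_ge0].
  - by move=> xi; rewrite mul1r fctE dotDl dotxx lerDl; case: (ps m N).
  exists e; split=> // xi; first by have := congr1 (fun f => f xi) e1.
  by have := congr1 (fun f => f xi) e2.
pose E m N := sval (E_ m N).
have ME m N : M (E m N) by case: (svalP (E_ m N)).
have pE m N : psd (E m N) by case: (svalP (E_ m N)).
have sE m N xi : E m N xi + s m N (E m N xi) = xi by move: xi; case: (svalP (E_ m N)).
have Es m N xi : E m N (xi + s m N xi) = xi by move: xi; case: (svalP (E_ m N)).
have E1 m N : onb (E m N) 1.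
  move=> xi; rewrite mul1r; have := hn2D (E m N xi) (s m N (E m N xi)); rewrite sE => h.
  rewrite -ler_sqr ?nnegrE // h (dotC (E m N xi)).
  by have := (ps m N).2 (E m N xi); have := sqr_ge0 (hn (s m N (E m N xi))); lra.
have E1p m N : psd (idfun - E m N).
  split=> [|xi]; first by apply: saB; [exact: sa_id|case: (pE m N)].
  by rewrite fctE dotBl dotxx subr_ge0; apply: le_trans (onb_le xi (E1 m N)) _; rewrite mul1r.
have Ets m N : trR (idfun - E m N) <= 2 * 2^-1 ^+ m.
  apply: le_trans (ts m N); rewrite -subr_ge0 /trR -ReB -trB //; last by apply: csB => //; exact: cs_id.
  apply: trR_pos; first by apply: csB => //; apply: csB => //; exact: cs_id.
  split=> [|xi]; first by apply: saB; [case: (ps m N)|case: (E1p m N)].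
  have -> : (s m N - (idfun - E m N)) xi = s m N xi - (xi - E m N xi) by [].
  have := sE m N xi; set eta := E m N xi.
  have [sS pS] := ps m N; have lS := bop_lin sS.1.
  move: (s m N) sS pS lS => S sS pS lS <-; rewrite (linD lS) dotBl.
  have -> : dot (eta + S eta - eta) (eta + S eta) = dot (S eta) (eta + S eta) by rewrite addrAC subrr add0r.
  rewrite dotDl addrAC subrr add0r dotDr.
  have -> : dot (S (S eta)) eta = hn (S eta) ^+ 2 by rewrite (sa_dot sS) dotxx.
  by rewrite addr_ge0 ?sqr_ge0.
have sN m N : psd (s m N.+1 - s m N).
  rewrite /s; case: (leqP m N) => [le|lt]; last first.
    rewrite !big_geq ?subrr ?(ltnW lt) //; exact: psd0.
  by rewrite big_nat_recr //= addrAC subrr add0r; apply: psdZ.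
have sm m N : psd (s m N - s m.+1 N).
  rewrite /s; case: (ltnP m N) => [lt|le]; last first.
    rewrite !big_geq ?subrr //; [exact: psd0|exact: leqW].
  by rewrite (big_ltn lt) addrK; apply: psdZ.
have e_ m : {e | psd e /\ forall xi, hcvg (fun N => E m N xi) (e xi)}.
  apply/cid; have [//||e pe el] := @mono_lim _ _ (E m); last by exists e.
  by move=> N; apply: (inv_anti (ps m N) (sN m N) (pE m N) (pE m N.+1) (sE m N) (sE m N.+1)).
pose e m := sval (e_ m).
have pe m : psd (e m) by case: (svalP (e_ m)).
have el m xi : hcvg (fun N => E m N xi) (e m xi) by case: (svalP (e_ m)).
have Me m : M (e m) by apply: (vn_slim vM (ME m) (pe m).1.1 (el m)).
have e1 m : onb (e m) 1 by move=> xi; apply: (hcvg_hn_le _ (el m xi)) => N; apply: E1.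
have e1p m : psd (idfun - e m).
  split=> [|xi]; first by apply: saB; [exact: sa_id|case: (pe m)].
  by rewrite fctE dotBl dotxx subr_ge0; apply: le_trans (onb_le xi (e1 m)) _; rewrite mul1r.
have te m : trR (idfun - e m) <= 2 * 2^-1 ^+ m.
  apply: (@tr_mono (fun N => idfun - E m N)) => //.
  - by move=> N; apply: csB => //; exact: cs_id.
  - by apply: csB => //; exact: cs_id.
  - move=> N; have -> : (idfun - E m N.+1 - (idfun - E m N)) = E m N - E m N.+1.
      by rewrite opprB addrC subrKA.
    by apply: (inv_anti (ps m N) (sN m N) (pE m N) (pE m N.+1) (sE m N) (sE m N.+1)).
  - by move=> xi; apply: hcvgB; [exact: hcvg_cst|exact: el].
have em m : psd (e m.+1 - e m).
  apply: (@hcvg_psd _ _ _ (fun N => E m.+1 N - E m N)).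
  - by apply: bopB; [case: (pe m.+1).1|case: (pe m).1].
  - by move=> xi; apply: hcvgB; exact: el.
  - by move=> N; apply: (inv_anti (ps m.+1 N) (sm m N) (pE m.+1 N) (pE m N) (sE m.+1 N) (sE m N)).
have [g pg gl] : exists2 g, psd g & forall xi, hcvg (fun m => (idfun - e m) xi) (g xi).
  apply: mono_lim => // m; have -> : (idfun - e m - (idfun - e m.+1)) = e m.+1 - e m.
    by rewrite opprB addrC subrKA.
  exact: em.
have Mg : M g by apply: (vn_slim vM _ pg.1.1 gl) => m; apply: csB => //; exact: cs_id.
have ge m : psd ((idfun - e m) - g).
  apply: (@hcvg_psd _ _ _ (fun k => (idfun - e m) - (idfun - e (m + k)%N))).
  - by apply: bopB; [case: (e1p m).1|case: pg.1].
  - move=> xi; apply: hcvgB; first exact: hcvg_cst.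
    by apply: (hcvg_sub (gl xi)) => k; exists (m + k)%N; rewrite leq_addl.
  - elim=> [|k IH]; first by rewrite addn0 subrr; exact: psd0.
    rewrite addnS; apply: (psd_le_trans _ IH).
    have -> : (idfun - e (m + k)%N - (idfun - e (m + k).+1)) = e (m + k).+1 - e (m + k)%N.
      by rewrite opprB addrC subrKA.
    exact: em.
have g0 : g = 0.
  apply: tr_psd0 => //; apply/le_anti; rewrite trR_pos // andbT.
  apply/ler_addgt0Pr => d d0; rewrite add0r.
  have [n hn'] : exists n, 2 * 2^-1 ^+ n <= d.
    have : (fun n => 2 * 2^-1 ^+ n) @ \oo --> (2 * 0 : R).
      by apply: cvgMr; apply: cvg_expr; rewrite ger0_norm // invf_lt1 // ltr1n.
    rewrite mulr0 => /cvgrPdist_lt /(_ d d0) [n _ /(_ n (leqnn _))] /=.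
    by rewrite sub0r normrN => /(le_lt_trans (ler_norm _)) /ltW; exists n.
  apply: le_trans hn'; apply: le_trans (te n).
  have := trR_pos _ (ge n); rewrite /trR trB // ?ReB ?subr_ge0; last by apply: csB => //; exact: cs_id.
  by apply; do 2 apply: csB => //; exact: cs_id.
exists e; split=> //.
- move=> H pi np xi; have [jp _] := np; rewrite -[X in hcvg _ X]/(idfun xi) -(jr_id jp).
  apply: (nrep_mono cM np) => //.
  + exact: cs_id.
  + by split=> [|w]; [exact: sa_id|rewrite /= dotxx sqr_ge0].
  move=> w; have -> : idfun w = w - g w by rewrite g0 -[(0 : K -> K) w]/(0 : K) subr0.
  have -> : (fun n => e n w) = (fun n => w - (idfun - e n) w).
    by apply/funext => n; rewrite fctE opprB addrCA subrr addr0.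
  by apply: hcvgB => //; exact: hcvg_cst.
- move=> m n mn xi.
  have [h [Mh ph hh _]] := cs_sqrt cM (Mz n) (pz n).
  have hE (y : K) : dot (z n y) y = hn (h y) ^+ 2 by rewrite -hh /= (sa_dot ph.1) dotxx.
  rewrite hE; have q : 4^-1 ^+ n * hn xi ^+ 2 = (2^-1 ^+ n * hn xi) ^+ 2.
    by rewrite exprMn -exprM mulnC exprM (_ : 2^-1 ^+ 2 = 4^-1 :> R) //; field.
  have q0 : 0 <= 2^-1 ^+ n * hn xi by rewrite mulr_ge0 // exprn_ge0.
  rewrite q ler_sqr ?nnegrE //.
  apply: (@hcvg_hn_le _ _ (fun k => h (E m (n.+1 + k)%N xi))); last first.
    apply: bop_hcvg; first by case: ph.1.
    by apply: (hcvg_sub (el m xi)) => k; exists (n.+1 + k)%N; rewrite leq_addl.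
  move=> k; rewrite -ler_sqr ?nnegrE // -q -hE.
  set N := (n.+1 + k)%N; set y := E m N xi.
  have p4 : 0 < 4 ^+ n :> R by rewrite exprn_gt0.
  have d1 : 4 ^+ n * dot (z n y) y <= dot (s m N y) y.
    rewrite /s sum_opE dot_suml (big_cat_nat (n := n)) ?(leq_trans _ (leq_addr _ _)) //=.
    have nN : (n < N)%N by rewrite /N addSn ltnS leq_addr.
    rewrite [X in _ + X]big_ltn // -dotZl addrCA lerDl addr_ge0 // sumr_ge0 // => i _.
      by have := (psdZ (c4 i) (pz i)).2 y.
    by have := (psdZ (c4 i) (pz i)).2 y.
  have d2 : dot (s m N y) y <= hn xi ^+ 2.
    have := hn2D y (s m N y); rewrite sE => ->; rewrite dotC.
    have := sqr_ge0 (hn (s m N y)); have := sqr_ge0 (hn y); have := (ps m N).2 y; rewrite dotC.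
    by lra.
  by rewrite exprVn ler_pdivlMl //; apply: le_trans d1 d2.
Qed.

(** On the range of each Egorov cut-off [e m] for the squared increments, the sequence converges
    uniformly at the rate [2^-n]. This estimate concerns norms of operators only, hence holds in
    every normal representation; so the limits in all of them come from a single [y]. *)
Lemma ac_seq (x : nat -> K -> K) C : 0 <= C -> (forall n, M (x n)) -> (forall n, sa (x n)) ->
  (forall n, onb (x n) C) ->
  (forall n, trR ((x n.+1 - x n) \o (x n.+1 - x n)) <= 8^-1 ^+ n) ->
  exists y, [/\ M y, sa y, onb y C
    & forall (H : hilbertType R) (pi : (K -> K) -> (H -> H)), nrep M pi ->
       forall xi, hcvg (fun n => pi (x n) xi) (pi y xi)].
Proof.
move=> C0 Mx sx xC tx.
pose d n := x n.+1 - x n.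
have Md n : M (d n) by apply: csB.
have sd n : sa (d n) by apply: saB.
have [||e [Me pe el ez]] := @egorov (fun n => d n \o d n) _ _ tx.
- by move=> n; apply: cs_comp.
- by move=> n; apply: psd_sqr.
have de m n : (m <= n)%N -> onb (d n \o e m) (2^-1 ^+ n).
  move=> mn xi; have := ez m n mn xi; rewrite /= (sa_dot (sd n)) dotxx.
  have -> : 4^-1 ^+ n * hn xi ^+ 2 = (2^-1 ^+ n * hn xi) ^+ 2.
    by rewrite exprMn -exprM mulnC exprM (_ : 2^-1 ^+ 2 = 4^-1 :> R) //; field.
  by rewrite ler_sqr ?nnegrE ?mulr_ge0 ?exprn_ge0.
have tail m n k xi : (m <= n)%N -> hn (x (n + k)%N (e m xi) - x n (e m xi)) <= 2 * 2^-1 ^+ n * hn xi.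
  move=> mn; suff : hn (x (n + k)%N (e m xi) - x n (e m xi)) <= (2 * 2^-1 ^+ n - 2 * 2^-1 ^+ (n + k)) * hn xi.
    move=> /le_trans; apply; apply: ler_wpM2r => //; rewrite gerBl mulr_ge0 // exprn_ge0 //; lra.
  elim: k => [|k IH]; first by rewrite addn0 !subrr hn0 mul0r.
  rewrite addnS; apply: le_trans (hn_tri (x (n + k)%N (e m xi)) _ _) _.
  have := de m (n + k)%N (leq_trans mn (leq_addr _ _)) xi; rewrite /= /d fctE => h1.
  apply: le_trans (lerD h1 IH) _; rewrite -mulrDl; apply: ler_wpM2r => //.
  by rewrite exprS; lra.
have small (D t : R) : 0 < t -> exists n, D * 2^-1 ^+ n < t.
  move=> t0; have : (fun n => D * 2^-1 ^+ n) @ \oo --> (D * 0 : R).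
    by apply: cvgMr; apply: cvg_expr; rewrite ger0_norm // invf_lt1 // ltr1n.
  rewrite mulr0 => /cvgrPdist_lt /(_ t t0) [n _ /(_ n (leqnn _))] /=.
  by rewrite sub0r normrN => /(le_lt_trans (ler_norm _)); exists n.
have dec (n k : nat) : 2^-1 ^+ (n + k) <= 2^-1 ^+ n :> R.
  by rewrite exprD ler_piMr ?exprn_ge0 // exprn_ile1 //; lra.
have cau xi : hcauchy (fun n => x n xi).
  have ei := el _ _ (nrep_id vM) xi.
  move=> t t0; have p : 0 < 8 * (C + 1) by lra.
  have [m hm] := ei _ (divr_gt0 t0 p); have {hm} := hm m (leqnn _).
  rewrite ltr_pdivlMr // => hm.
  have [n0 h0] := small (2 * hn xi) (t / 4) ltac:(lra).
  exists (n0 + m)%N => p1 q1 hp hq.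
  have key q : (n0 + m <= q)%N -> hn (x q (e m xi) - x (n0 + m)%N (e m xi)) <= t / 4.
    move=> /subnKC <-; apply: le_trans (tail m _ _ _ (leq_addl _ _)) _.
    apply: le_trans (ltW h0); rewrite mulrAC; apply: ler_wpM2l; first by rewrite mulr_ge0.
    exact: dec.
  have kp := key _ hp; have kq := key _ hq.
  have far q : hn (x q xi - x q (e m xi)) <= t / 8.
    rewrite -(linB (bop_lin (sx q).1)); apply: le_trans (xC q _) _; rewrite hnC.
    by have := hn_ge0 (e m xi - xi); lra.
  have := hn_tri (x p1 (e m xi)) (x p1 xi) (x q1 xi).
  have := hn_tri (x q1 (e m xi)) (x p1 (e m xi)) (x q1 xi).
  have := hn_tri (x (n0 + m)%N (e m xi)) (x p1 (e m xi)) (x q1 (e m xi)).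
  have := far p1; have := far q1; rewrite (hnC (x q1 xi)) (hnC (x (n0 + m)%N _)); lra.
pose y xi := sval (cid (hcomplete (cau xi))).
have yl xi : hcvg (fun n => x n xi) (y xi) by apply: (svalP (cid (hcomplete (cau xi)))).
have yC : onb y C by move=> xi; apply: (hcvg_hn_le _ (yl xi)) => n; apply: xC.
have by_ : bounded_op y.
  apply: bopI yC => k u v; apply: (hcvg_uniq (yl _)).
  have -> : (fun n => x n (k *: u + v)) = (fun n => k *: x n u + x n v).
    by apply/funext => n; have := bop_lin (sx n).1 k u v.
  by apply: hcvgD => //; apply: hcvgZ.
have sy : sa y by apply: (hcvg_sa by_ yl).
have My : M y by apply: (vn_slim vM Mx by_ yl).
exists y; split => // H pi np xi.
have [jp _] := np.
have key m n : (m <= n)%N -> onb (pi (x n - y) \o pi (e m)) (2 * 2^-1 ^+ n).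
  move=> mn; apply: (jr_onb_comp cM jp) => //.
  - exact: csB.
  - exact: saB.
  - by case: (pe m) => -[].
  move=> z; rewrite /= fctE hnC.
  apply: (@hcvg_hn_le _ _ (fun k => x (n + k)%N (e m z) - x n (e m z))) => [k|]; first exact: tail.
  apply: hcvgB; last exact: hcvg_cst.
  by apply: (hcvg_sub (yl _)) => k; exists (n + k)%N; rewrite leq_addl.
have ei := el _ _ np xi.
move=> t t0; have p : 0 < 8 * (C + 1) by lra.
have [m hm] := ei _ (divr_gt0 t0 p); have {hm} := hm m (leqnn _).
rewrite ltr_pdivlMr // => hm.
have [n0 h0] := small (2 * hn xi) (t / 2) ltac:(lra).
exists (n0 + m)%N => n hn1.
have lx := bop_lin (jr_bop jp (Mx n)); have ly := bop_lin (jr_bop jp My).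
have px := jr_onb cM jp (Mx n) C0 (xC n); have py := jr_onb cM jp My C0 yC.
have k1 := key m n (leq_trans (leq_addl _ _) hn1) xi.
rewrite /= (jrB cM jp) // fctE in k1.
have k2 : 2 * 2^-1 ^+ n * hn xi <= t / 2.
  apply: le_trans (ltW h0); rewrite mulrAC; apply: ler_wpM2l; first by rewrite mulr_ge0.
  by rewrite -(subnKC (leq_trans (leq_addr _ _) hn1)); exact: dec.
have f1 : hn (pi (x n) xi - pi (x n) (pi (e m) xi)) <= t / 8.
  by rewrite -(linB lx); apply: le_trans (px _) _; rewrite hnC; have := hn_ge0 (pi (e m) xi - xi); lra.
have f2 : hn (pi y (pi (e m) xi) - pi y xi) <= t / 8.
  by rewrite -(linB ly); apply: le_trans (py _) _; have := hn_ge0 (pi (e m) xi - xi); lra.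
have := hn_tri (pi (x n) (pi (e m) xi)) (pi (x n) xi) (pi y xi).
have := hn_tri (pi y (pi (e m) xi)) (pi (x n) (pi (e m) xi)) (pi y xi).
lra.
Qed.

End Egorov.

(** * The standard form *)

Section Real_trace.
Variables (R : realType) (H : hilbertType R) (N : set (H -> H)) (tr : (H -> H) -> R).
Implicit Types (x y : H -> H).

(** Real values suffice for inequalities. The record serves both the real part of [tau] on S and the
    unnormalized trace on matrices over S. *)
Record rtrace : Prop := Rtrace {
  rt_lin : forall (a : R) x y, N x -> N y -> tr (a%:C%C *: x + y) = a * tr x + tr y ;
  rt_C : forall x y, N x -> N y -> tr (x \o y) = tr (y \o x) ;
  rt_sqr : forall x, N x -> 0 <= tr (adj x \o x) ;
  rt_faith : forall x, N x -> tr (adj x \o x) = 0 -> x = 0 }.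

Hypothesis cN : cstar N.
Hypothesis tN : rtrace.

Lemma rtD x y : N x -> N y -> tr (x + y) = tr x + tr y.
Proof. by move=> Nx Ny; have := rt_lin tN 1 Nx Ny; rewrite scale1r mul1r. Qed.
Lemma rt0 : tr 0 = 0.
Proof.
have := rt_lin tN (-1) (cs_id cN) (cs_id cN).
by rewrite rmorphN1 scaleN1r addNr mulN1r addNr.
Qed.
Lemma rtZ (a : R) x : N x -> tr (a%:C%C *: x) = a * tr x.
Proof. by move=> Nx; have := rt_lin tN a Nx (cs0 cN); rewrite rt0 !addr0. Qed.
Lemma rtN x : N x -> tr (- x) = - tr x.
Proof. by move=> Nx; have := rtZ (-1) Nx; rewrite rmorphN1 scaleN1r mulN1r. Qed.
Lemma rtB x y : N x -> N y -> tr (x - y) = tr x - tr y.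
Proof. by move=> Nx Ny; rewrite rtD ?rtN //; apply: csN. Qed.

Lemma rt_sum (I : Type) (r : seq I) (P : pred I) (F : I -> H -> H) : (forall i, N (F i)) ->
  tr (\sum_(i <- r | P i) F i) = \sum_(i <- r | P i) tr (F i).
Proof.
move=> h; suff [] : N (\sum_(i <- r | P i) F i) /\ tr (\sum_(i <- r | P i) F i) = \sum_(i <- r | P i) tr (F i) by [].
elim/big_rec2: _ => [|i a y _ [Ny e]]; first by split; [exact: cs0|exact: rt0].
by split; [exact: csD|rewrite rtD // e].
Qed.

Lemma rt_psd x : N x -> psd x -> 0 <= tr x.
Proof.
move=> Nx px; have [h [Nh ph <- _]] := cs_sqrt cN Nx px.
by rewrite -{1}(ph.1.2); apply: rt_sqr.
Qed.

Lemma rt_le x y : N x -> N y -> psd (y - x) -> tr x <= tr y.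
Proof. by move=> Nx Ny p; rewrite -subr_ge0 -rtB //; apply: rt_psd => //; apply: csB. Qed.

Lemma rt_mul_psd x y : N x -> N y -> psd x -> psd y -> 0 <= tr (x \o y).
Proof.
move=> Nx Ny px py; have [h [Nh ph <- _]] := cs_sqrt cN Ny py.
have Nxh := cs_comp cN Nx Nh.
rewrite -[x \o (h \o h)]/((x \o h) \o h) (rt_C tN) // -{1}(ph.1.2).
apply: rt_psd; first by apply: cs_comp => //; apply: cs_adj.
by have := psd_conj (cs_bop cN Nh) px.
Qed.

(* With h = sqrt (x^2) and a = h - x one has x a = - h a, so that the trace of
   a x a is at most 0. *)
Lemma trace_psd x : N x -> sa x -> (forall a, N a -> 0 <= tr (adj a \o (x \o a))) -> psd x.
Proof.
move=> Nx sx pos; have bx := sx.1.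
have [|h [Nh ph hh hC]] := cs_sqrt cN _ (psd_sqr sx); first exact: cs_comp.
have xh : x \o h = h \o x by apply: hC.
have xhE z : x (h z) = h (x z) by have := congr1 (fun f => f z) xh.
have hhE z : h (h z) = x (x z) by have := congr1 (fun f => f z) hh.
pose a := h - x.
have Na : N a by apply: csB.
have sa_a : sa a by apply: saB => //; case: ph.
have lx := bop_lin bx; have lh := bop_lin ph.1.1.
have aE z : a z = h z - x z by [].
have xa : x \o a = - (h \o a).
  apply/funext => z; rewrite -[LHS]/(x (a z)) -[RHS]/(- h (a z)) !aE (linB lx) (linB lh).
  by rewrite xhE hhE opprB.
have haa : 0 <= tr (a \o (h \o a)).
  apply: rt_psd; first by apply: cs_comp => //; apply: cs_comp.
  by have := psd_conj (cs_bop cN Na) ph; rewrite sa_a.2.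
have aha0 : tr (a \o (h \o a)) = 0.
  apply/le_anti; rewrite haa andbT; have := pos a Na; rewrite sa_a.2 xa.
  have -> : a \o (- (h \o a)) = - (a \o (h \o a)).
    by apply/funext => z; rewrite fctE /= (linN (bop_lin sa_a.1)).
  by rewrite rtN ?oppr_ge0 //; apply: cs_comp => //; apply: cs_comp.
have [k [Nk pk kk kC]] := cs_sqrt cN Nh ph.
have ka : k \o a = 0.
  apply: (rt_faith tN); first exact: cs_comp.
  have bk := cs_bop cN Nk; rewrite adj_comp //; last exact: sa_a.1.
  by rewrite sa_a.2 pk.1.2 -aha0 -kk.
have ha z : h (a z) = 0.
  by rewrite -kk /=; have := congr1 (fun f => f z) ka => /= ->; rewrite -[LHS]/(k 0) (lin0 (bop_lin pk.1.1)).
have a0 : a = 0.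
  apply/funext => z; apply/hn_eq0/eqP; rewrite -sqrf_eq0 -dotxx; apply/eqP.
  rewrite (sa_dot sa_a) (_ : a (a z) = 0) ?dot0r // aE ha sub0r.
  have e : x (a z) = - h (a z) := congr1 (fun f => f z) xa.
  by rewrite e ha !oppr0.
by have /eqP := a0; rewrite subr_eq0 => /eqP <-.
Qed.

End Real_trace.

Definition standard_form (R : realType) (K : hilbertType R) (M : set (K -> K))
    (tau : (K -> K) -> R[i]) (X : biact K) (one : X) : Prop :=
  [/\ vn_algebra M, faithful_normal_tracial_state M tau & is_L2 M tau one].

(** * Operators as vectors of L^2 *)

Section L2.
Variables (R : realType) (K : hilbertType R) (M : set (K -> K)) (tau : (K -> K) -> R[i]).
Variables (X : biact K) (one : X).
Hypothesis LX : standard_form M tau one.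
Let vM : vn_algebra M. Proof. by case: LX. Qed.
Let fM : faithful_normal_tracial_state M tau. Proof. by case: LX. Qed.
Let lX : is_L2 M tau one. Proof. by case: LX. Qed.
Implicit Types (x y : K -> K).

Let cM := vn_cstar vM.
Let bM := cs_bop cM.
Local Notation la := (@lact _ _ X).
Local Notation ra := (@ract _ _ X).

Lemma tau_rtrace : rtrace M (trR tau).
Proof.
split=> [a x y Mx My|x y Mx My|x Mx|x Mx].
- by rewrite /trR (tr_lin fM) // ReD ReRM.
- by rewrite /trR (trC fM).
- by have := tr_sqr fM Mx; rewrite lecE => /andP[].
- move=> t0; apply: (tr_faith fM) => //; have := tr_sqr fM Mx.
  rewrite lecE => /andP[/eqP i0 _]; move: t0 i0; rewrite /trR.
  by case: (tau _) => a b /= -> ->.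
Qed.

Lemma la_nrep : nrep M la.
Proof.
case: lX => -[[[[l1 l2] l3 l4 l5] l6] _ _] _ _ _; split=> //.
by split=> //; left.
Qed.

Lemma ra_nrep : nrep M ra.
Proof.
case: lX => -[_ [[[l1 l2] l3 l4 l5] l6] _] _ _ _; split=> //.
by split=> //; right.
Qed.

Lemma laM x y : M x -> M y -> la (x \o y) = la x \o la y.
Proof. by case: lX => -[[_ h] _ _] _ _ _; apply: h. Qed.
Lemma raM x y : M x -> M y -> ra (x \o y) = ra y \o ra x.
Proof. by case: lX => -[_ [_ h] _] _ _ _; apply: h. Qed.
Lemma laraC x y xi : M x -> M y -> la x (ra y xi) = ra y (la x xi).
Proof. by case: lX => -[_ _ h] _ _ _; apply: h. Qed.
Lemma la_bop x : M x -> bounded_op (la x).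
Proof. by case: la_nrep => jp _; apply: (jr_bop jp). Qed.
Lemma ra_bop x : M x -> bounded_op (ra x).
Proof. by case: ra_nrep => jp _; apply: (jr_bop jp). Qed.
Lemma la_adj x xi eta : M x -> '<<la x xi, eta>> = '<<xi, la (adj x) eta>>.
Proof. by move=> Mx; have [jp _] := la_nrep; rewrite (jr_adj jp) // adjP //; apply: la_bop. Qed.
Lemma ra_adj x xi eta : M x -> '<<ra x xi, eta>> = '<<xi, ra (adj x) eta>>.
Proof. by move=> Mx; have [jp _] := ra_nrep; rewrite (jr_adj jp) // adjP //; apply: ra_bop. Qed.
Lemma la_adjr x xi eta : M x -> '<<xi, la x eta>> = '<<la (adj x) xi, eta>>.
Proof. by move=> Mx; rewrite inner_conj la_adj // -inner_conj. Qed.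
Lemma la_onb x c : M x -> 0 <= c -> onb x c -> onb (la x) c.
Proof. by have [jp _] := la_nrep; apply: (jr_onb cM jp). Qed.
Lemma ra_onb x c : M x -> 0 <= c -> onb x c -> onb (ra x) c.
Proof. by have [jp _] := ra_nrep; apply: (jr_onb cM jp). Qed.

Definition hat x : X := la x one.

Lemma hat_lin a x y : M x -> M y -> hat (a *: x + y) = a *: hat x + hat y.
Proof. by have [jp _] := la_nrep; move=> Mx My; rewrite /hat (jr_lin jp). Qed.
Lemma hatD x y : M x -> M y -> hat (x + y) = hat x + hat y.
Proof. by move=> Mx My; have := hat_lin 1 Mx My; rewrite !scale1r. Qed.
Lemma hatZ a x : M x -> hat (a *: x) = a *: hat x.
Proof. by have [jp _] := la_nrep; move=> Mx; rewrite /hat (jrZ cM jp). Qed.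
Lemma hat0 : hat 0 = 0.
Proof. by have [jp _] := la_nrep; rewrite /hat (jr0 cM jp). Qed.
Lemma hatB x y : M x -> M y -> hat (x - y) = hat x - hat y.
Proof. by have [jp _] := la_nrep; move=> Mx My; rewrite /hat (jrB cM jp). Qed.
Lemma hat_sum (I : Type) (r : seq I) (P : pred I) (F : I -> K -> K) : (forall i, M (F i)) ->
  hat (\sum_(i <- r | P i) F i) = \sum_(i <- r | P i) hat (F i).
Proof. by have [jp _] := la_nrep; move=> h; rewrite /hat (jr_sum cM jp) // sum_opE. Qed.
Lemma hat_id : hat idfun = one.
Proof. by have [jp _] := la_nrep; rewrite /hat (jr_id jp). Qed.
Lemma la_hat x y : M x -> M y -> la x (hat y) = hat (x \o y).
Proof. by move=> Mx My; rewrite /hat laM. Qed.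
Lemma ra_one x : M x -> ra x one = hat x.
Proof. by case: lX => _ h _ _ Mx; rewrite /hat h. Qed.
Lemma ra_hat x y : M x -> M y -> ra x (hat y) = hat (y \o x).
Proof. by move=> Mx My; rewrite /hat -laraC // ra_one // la_hat. Qed.
Lemma hat_inner x y : M x -> M y -> '<<hat x, hat y>> = tau (adj y \o x).
Proof.
move=> Mx My; have May := cs_adj cM My; rewrite [hat y]/hat la_adjr // la_hat //.
by case: lX => _ _ h _; rewrite -h //; apply: cs_comp.
Qed.
Lemma hat_one x : M x -> '<<hat x, one>> = tau x.
Proof. by case: lX => _ _ h _; apply: h. Qed.
Lemma hat_hn2 x : M x -> hn (hat x) ^+ 2 = trR tau (adj x \o x).
Proof. by move=> Mx; rewrite -dotxx /dot hat_inner. Qed.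
Lemma norm2_hat x : M x -> norm2 tau x = hn (hat x).
Proof. by move=> Mx; rewrite /norm2 -[complex.Re _]/(trR tau _) -hat_hn2 // sqrtr_sqr ger0_norm. Qed.
Lemma hat_hn_adj x : M x -> hn (hat (adj x)) = hn (hat x).
Proof.
move=> Mx; have Max := cs_adj cM Mx; apply: (hn_eq X) => //.
by rewrite (hat_hn2 Max) (hat_hn2 Mx) (adjK (bM Mx)) /trR (trC fM Mx Max).
Qed.
Lemma hn_one : hn one = 1.
Proof.
apply: (hn_eq X) => //; rewrite -hat_id hat_hn2 /trR ?adj_id ?(tr1 fM) ?expr1n //.
exact: cs_id.
Qed.
Lemma hat_inj x y : M x -> M y -> hat x = hat y -> x = y.
Proof.
move=> Mx My /eqP; rewrite -subr_eq0 -hatB // => /eqP e.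
have Mxy : M (x - y) by apply: csB.
have /eqP : x - y = 0.
  by apply: (rt_faith tau_rtrace) => //; rewrite -hat_hn2 // e hn0 expr0n.
by rewrite subr_eq0 => /eqP.
Qed.
Lemma hat_onbl x y c : M x -> M y -> 0 <= c -> onb x c -> hn (hat (x \o y)) <= c * hn (hat y).
Proof. by move=> Mx My c0 xc; rewrite -la_hat //; apply: la_onb. Qed.
Lemma hat_onbr x y c : M x -> M y -> 0 <= c -> onb y c -> hn (hat (x \o y)) <= c * hn (hat x).
Proof. by move=> Mx My c0 xc; rewrite -ra_hat //; apply: ra_onb. Qed.
Lemma hat_le x c : M x -> 0 <= c -> onb x c -> hn (hat x) <= c.
Proof. by move=> Mx c0 xc; have := la_onb Mx c0 xc one; rewrite hn_one mulr1. Qed.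

Lemma hat_dense (z : X) e : 0 < e -> exists2 x, M x & hn (z - hat x) < e.
Proof.
move=> e0; case: lX => _ _ _ h; have : closure [set la x one | x in M] z by rewrite h.
by move=> /hclosureP /(_ e e0) [_ [x Mx <-] zx]; exists x.
Qed.

Lemma hat_approx (z : X) : exists2 x : nat -> K -> K, forall n, M (x n) & hcvg (fun n => hat (x n)) z.
Proof.
have [u Au uz] := @hcvg_dense _ _ [set la x one | x in M] z (fun e e0 => ex2_ind (fun x Mx zx => ex_intro2 _ _ (hat x) (ex_intro2 _ _ x Mx erefl) zx) (hat_dense z e0)).
exists (fun n => sval (cid2 (Au n))) => [n|]; first by case: (cid2 (Au n)).
by have -> : (fun n => hat (sval (cid2 (Au n)))) = u by apply/funext => n; case: (cid2 (Au n)).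
Qed.

Lemma hat_ext (z w : X) : (forall a, M a -> '<<z, hat a>> = '<<w, hat a>>) -> z = w.
Proof.
move=> h; apply/eqP; rewrite -subr_eq0; apply/eqP.
case: lX => _ _ _ d; apply: (dense_ext d) => _ [a Ma <-].
by rewrite innerBl h // subrr.
Qed.

End L2.

Lemma hcvg_dot2 (R : realType) (H H' : hilbertType R) (u : nat -> H) (v : nat -> H') l m z w :
  hcvg u l -> hcvg v m -> (forall n, dot (u n) z = dot (v n) w) -> dot l z = dot m w.
Proof.
move=> ul vm h; apply/eqP; rewrite -subr_eq0 -normr_eq0; apply/eqP/le_anti; rewrite normr_ge0 andbT.
apply/ler_addgt0Pr => e e0; rewrite add0r.
have p : 0 < hn z + hn w + 1 by rewrite ltr_wpDl // addr_ge0.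
have [n1 h1] := ul _ (divr_gt0 e0 p); have [n2 h2] := vm _ (divr_gt0 e0 p).
pose n := maxn n1 n2; have := h1 n (leq_maxl _ _); have := h2 n (leq_maxr _ _).
rewrite !ltr_pdivlMr // => b2 b1.
have -> : dot l z - dot m w = dot (v n - m) w - dot (u n - l) z.
  by rewrite !dotBl h; ring.
apply: le_trans (ler_normB _ _) _.
apply: le_trans (lerD (dot_CSabs _ _) (dot_CSabs _ _)) _.
have := hn_ge0 (u n - l); have := hn_ge0 (v n - m); have := hn_ge0 z; have := hn_ge0 w; nra.
Qed.

Lemma hcvg_inner2 (R : realType) (H H' : hilbertType R) (u : nat -> H) (v : nat -> H') l m z w :
  hcvg u l -> hcvg v m -> (forall n, '<<u n, z>> = '<<v n, w>>) -> '<<l, z>> = '<<m, w>>.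
Proof.
move=> ul vm h; apply: inner_eq_dot; first by apply: (hcvg_dot2 ul vm) => n; rewrite /dot h.
by apply: (hcvg_dot2 ul vm) => n; rewrite /dot !innerZr h.
Qed.

Lemma fast_sub (R : realType) (H : hilbertType R) (u : nat -> H) (r : nat -> R) : hcauchy u ->
  (forall n, 0 < r n) -> exists phi : nat -> nat,
    (forall n, (n <= phi n)%N) /\ forall n, hn (u (phi n.+1) - u (phi n)) < r n.
Proof.
move=> cu r0; have f n : {N | forall m k, (N <= m)%N -> (N <= k)%N -> hn (u m - u k) < r n}.
  by apply/cid; apply: cu.
pose phi n := (n + \sum_(k < n.+1) sval (f k))%N.
have le n m : (n <= m)%N -> (sval (f n) <= phi m)%N.
  move=> nm; apply: leq_trans (leq_addl _ _).
  by rewrite (bigD1 (inord n : 'I_m.+1)) //= inordK ?ltnS // leq_addr.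
exists phi; split=> [n|n]; first exact: leq_addr.
by apply: (svalP (f n)); apply: le.
Qed.

Lemma hcvg_subseq (R : realType) (H : hilbertType R) (u : nat -> H) (phi : nat -> nat) l : hcauchy u ->
  (forall n, (n <= phi n)%N) -> hcvg (fun n => u (phi n)) l -> hcvg u l.
Proof.
move=> cu np ul e e0; have e2 : 0 < e / 2 by rewrite divr_gt0.
have [n1 h1] := cu _ e2; have [n2 h2] := ul _ e2.
exists n1 => n nn; pose m := maxn n1 n2.
have := h2 m (leq_maxr _ _); have := h1 n (phi m) nn (leq_trans (leq_maxl _ _) (np m)).
have := hn_tri (u (phi m)) (u n) l; lra.
Qed.

Lemma complex_eq_Re (R : realType) (a b : R[i]) : complex.Re a = complex.Re b ->
  complex.Re ('i%C * a) = complex.Re ('i%C * b) -> a = b.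
Proof. by case: a b => [a a'] [b b'] /= -> h; congr (_ +i* _)%C; move: h; simpc => /= /oppr_inj. Qed.

Lemma hcvg_innerC (R : realType) (H H' : hilbertType R) (u : nat -> H) (v : nat -> H') l m z w :
  hcvg u l -> hcvg v m -> (forall n, '<<u n, z>> = '<<w, v n>>) -> '<<l, z>> = '<<w, m>>.
Proof.
move=> ul vm h; apply: complex_eq_Re.
  by rewrite -/(dot _ _) -/(dot w m) (dotC w); apply: (hcvg_dot2 ul vm) => n; rewrite (dotC _ w) /dot h.
have vE (k : H') : complex.Re ('i%C * '<<w, k>>) = dot k ('i%C *: w) by rewrite -innerZl -/(dot _ _) dotC.
have uE (k : H) : complex.Re ('i%C * '<<k, z>>) = dot k (- ('i%C *: z)).
  by rewrite -scaleNr /dot innerZr; congr complex.Re; congr (_ * _); apply/eqP; rewrite eq_complex /= oppr0 opprK !eqxx.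
by rewrite uE vE; apply: (hcvg_dot2 ul vm) => n; rewrite -uE -vE h.
Qed.

(** * The involution of the standard form and bounded vectors *)

Definition hconv (R : realType) (H : hilbertType R) (A : set H) :=
  forall x y (t : R), 0 <= t <= 1 -> A x -> A y -> A (x + t%:C%C *: (y - x)).

Lemma hconv_mid (R : realType) (H : hilbertType R) (A : set H) : hconv A -> hmid A.
Proof.
move=> cA x y Ax Ay; have -> : (2^-1 : R)%:C%C *: (x + y) = x + (2^-1 : R)%:C%C *: (y - x) by hvec.
by apply: cA => //; apply/andP; split; lra.
Qed.

Lemma hconv_proj (R : realType) (H : hilbertType R) (A : set H) z : closed A -> A !=set0 -> hconv A ->
  exists2 p, A p & forall a, A a -> dot (z - p) (a - p) <= 0.
Proof.
move=> clA neA cA; have [p Ap h] := hproj_ex z clA neA (hconv_mid cA).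
exists p => // a Aa; apply/ler_addgt0Pr => e e0; rewrite add0r.
have q0 : 0 <= hn (a - p) ^+ 2 by apply: sqr_ge0.
(* Small enough for [t * hn (a - p) ^+ 2] to be at most [e], and well defined even if [a = p]. *)
pose t := e / (e + hn (a - p) ^+ 2).
have t0 : 0 < t by rewrite divr_gt0 // ltr_pwDl.
have t1 : t <= 1 by rewrite ler_pdivrMr ?mul1r ?lerDl ?ltr_pwDl.
have tq : t * hn (a - p) ^+ 2 <= e.
  rewrite /t mulrAC ler_pdivrMr ?ltr_pwDl //.
  by rewrite mulrDr lerDr mulr_ge0 // ltW.
have At : A (p + t%:C%C *: (a - p)) by apply: cA => //; rewrite (ltW t0).
have := h _ At; have -> : z - (p + t%:C%C *: (a - p)) = (z - p) - t%:C%C *: (a - p) by hvec.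
rewrite (hn2B (z - p)) dotZr hnZr (ger0_norm (ltW t0)) exprMn.
have := sqr_ge0 (hn (p + t%:C%C *: (a - p) - p)); move: (hn _ ^+ 2) => w w0 hw.
have : 2 * t * dot (z - p) (a - p) <= t * (t * hn (a - p) ^+ 2) by lra.
have : t * (t * hn (a - p) ^+ 2) <= t * e by rewrite ler_pM2l.
move=> l1 l2; have : t * (2 * dot (z - p) (a - p)) <= t * e by lra.
rewrite ler_pM2l //; lra.
Qed.

Section L2_conjugation.
Variables (R : realType) (K : hilbertType R) (M : set (K -> K)) (tau : (K -> K) -> R[i]).
Variables (X : biact K) (one : X).
Hypothesis LX : standard_form M tau one.
Let vM : vn_algebra M. Proof. by case: LX. Qed.
Let fM : faithful_normal_tracial_state M tau. Proof. by case: LX. Qed.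
Implicit Types (x y : K -> K).

Let cM := vn_cstar vM.
Let bM := cs_bop cM.
Local Notation la := (@lact _ _ X).
Local Notation ra := (@ract _ _ X).
Local Notation hat := (hat one).

Lemma hat_innerC x y : M x -> M y -> '<<hat (adj x), hat y>> = '<<hat (adj y), hat x>>.
Proof.
move=> Mx My; have [Max May] := (cs_adj cM Mx, cs_adj cM My).
by rewrite !(hat_inner LX) // (trC fM).
Qed.

(** The antiunitary J which sends the vector of [x] to that of [x^*]. It is antilinear, out of reach
    of [ext_op], so it is defined through its inner products with the dense set of vectors
    [hat a]. *)
Definition Jop (z : X) : X :=
  xget 0 [set w | forall a, M a -> '<<w, hat a>> = '<<hat (adj a), z>>].

Lemma Jop_cvg_ex (x : nat -> K -> K) z : (forall n, M (x n)) -> hcvg (fun n => hat (x n)) z ->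
  exists2 w, hcvg (fun n => hat (adj (x n))) w &
    forall a, M a -> '<<w, hat a>> = '<<hat (adj a), z>>.
Proof.
move=> Mx xz; have [w xw] : exists w, hcvg (fun n => hat (adj (x n))) w.
  apply: hcomplete => e e0; have [n h] := hcvg_cauchy xz e0.
  exists n => m k nm nk; have [Mm Mk] := (cs_adj cM (Mx m), cs_adj cM (Mx k)).
  rewrite -(hatB LX) // -adjB ?(hat_hn_adj LX) ?(hatB LX) //; try exact: bM; try exact: h.
  exact: csB.
exists w => // a Ma; apply: (hcvg_innerC xw xz) => n; exact: hat_innerC.
Qed.

Lemma JopP z a : M a -> '<<Jop z, hat a>> = '<<hat (adj a), z>>.
Proof.
have [x Mx xz] := hat_approx LX z; have [w _ h] := Jop_cvg_ex Mx xz.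
exact: (@xgetPex _ 0 [set w | forall a, M a -> '<<w, hat a>> = '<<hat (adj a), z>>] (ex_intro _ w h)).
Qed.

Lemma Jop_uniq z w : (forall a, M a -> '<<w, hat a>> = '<<hat (adj a), z>>) -> Jop z = w.
Proof. by move=> h; apply: (hat_ext LX) => a Ma; rewrite JopP // h. Qed.

Lemma Jop_cvg (x : nat -> K -> K) z : (forall n, M (x n)) -> hcvg (fun n => hat (x n)) z ->
  hcvg (fun n => hat (adj (x n))) (Jop z).
Proof. by move=> Mx xz; have [w xw h] := Jop_cvg_ex Mx xz; rewrite (Jop_uniq h). Qed.

Lemma Jop_hat x : M x -> Jop (hat x) = hat (adj x).
Proof. by move=> Mx; apply: Jop_uniq => a Ma; apply: hat_innerC. Qed.

Lemma JopK z : Jop (Jop z) = z.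
Proof.
apply: Jop_uniq => a Ma; have Maa := cs_adj cM Ma.
by rewrite [RHS]inner_conj JopP // (adjK (bM Ma)) -inner_conj.
Qed.

Lemma Jop_lin a z w : Jop (a *: z + w) = a^* *: Jop z + Jop w.
Proof.
apply: Jop_uniq => b Mb.
by rewrite innerDl innerZl innerDr innerZr !JopP.
Qed.

Lemma JopD z w : Jop (z + w) = Jop z + Jop w.
Proof. by have := Jop_lin 1 z w; rewrite scale1r conjC1 scale1r. Qed.
Lemma Jop0 : Jop 0 = 0.
Proof. by apply: (addIr (Jop 0)); rewrite -JopD !add0r. Qed.
Lemma JopZ a z : Jop (a *: z) = a^* *: Jop z.
Proof. by have := Jop_lin a z 0; rewrite Jop0 !addr0. Qed.
Lemma JopN z : Jop (- z) = - Jop z.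
Proof. by apply: (addIr (Jop z)); rewrite -JopD !addNr Jop0. Qed.
Lemma JopB z w : Jop (z - w) = Jop z - Jop w.
Proof. by rewrite JopD JopN. Qed.
Lemma Jop_sum (I : Type) (r : seq I) (P : pred I) (F : I -> X) :
  Jop (\sum_(i <- r | P i) F i) = \sum_(i <- r | P i) Jop (F i).
Proof. by apply: (big_morph Jop) => [z w|]; [exact: JopD|exact: Jop0]. Qed.

Lemma Jop_inner z w : '<<Jop z, Jop w>> = '<<w, z>>.
Proof.
have [x Mx xw] := hat_approx LX w; have jx := Jop_cvg Mx xw.
rewrite inner_conj [RHS]inner_conj; congr (_^*).
apply: (hcvg_innerC jx xw) => n; rewrite inner_conj (JopP z (cs_adj cM (Mx n))).
by rewrite (adjK (bM (Mx n))) -inner_conj.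
Qed.

Lemma Jop_hn z : hn (Jop z) = hn z.
Proof. by apply: (hn_eq X) => //; rewrite -!dotxx /dot Jop_inner. Qed.

Lemma Jop_la x z : M x -> Jop (la x z) = ra (adj x) (Jop z).
Proof.
move=> Mx; have Max := cs_adj cM Mx; apply: Jop_uniq => a Ma.
rewrite (ra_adj LX _ _ Max) (adjK (bM Mx)) (ra_hat LX) // JopP; last exact: cs_comp.
rewrite (adj_comp (bM Ma) (bM Mx)) -(la_hat LX) //; last exact: cs_adj.
by rewrite [RHS](la_adjr LX).
Qed.

Lemma Jop_ra x z : M x -> Jop (ra x z) = la (adj x) (Jop z).
Proof.
move=> Mx; have Max := cs_adj cM Mx.
by rewrite -{1}(adjK (bM Mx)) -{1}(JopK z) -Jop_la // JopK.
Qed.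

(* A polar decomposition up to [e], by the inverse of the square root of
   [a^* a + e^2]. *)
Lemma approx_polar a (e : R) : M a -> 0 < e -> exists u k,
  [/\ M u, onb u 1, M k & psd k] /\ a = u \o (k \o k) /\
  trR tau (k \o k) <= trR tau (adj u \o a) + e.
Proof.
move=> Ma e0; have ba := bM Ma; have e2 : 0 < e ^+ 2 by rewrite exprn_gt0.
pose g := adj a \o a + (e ^+ 2)%:C%C *: (@idfun K).
have Mg : M g by apply: (csD cM); [apply: cs_comp => //; apply: cs_adj|apply: (csZ cM); exact: cs_id].
have gE z : dot (g z) z = hn (a z) ^+ 2 + e ^+ 2 * hn z ^+ 2.
  by rewrite dotDl dotZl dotxx (dotC (adj a _)) -(adj_dot ba) dotxx.
have pg : psd g.
  apply: psdD; first exact: psd_adj_comp.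
  by apply: psdZ => //; [exact: ltW|split; [exact: sa_id|move=> z; rewrite dotxx sqr_ge0]].
have [s [Ms ps ss _]] := cs_sqrt cM Mg pg.
have [k [Mk pk kk _]] := cs_sqrt cM Ms ps.
have [C C0 sC] := bop_onb ps.1.1.
have sE z : hn (s z) ^+ 2 = hn (a z) ^+ 2 + e ^+ 2 * hn z ^+ 2.
  by rewrite -gE -ss -dotxx [RHS]/= -(sa_dot ps.1).
have [|z|t [Mt pt st ts]] := cs_inv cM (_ : 0 < e ^+ 2 / (C + 1)) Ms ps.
- by rewrite divr_gt0 // ltr_wpDl.
- have := psd_small z ps sC; rewrite sE => h.
  rewrite mulrAC ler_pdivrMr ?ltr_wpDl //.
  have := ps.2 z; have := sqr_ge0 (hn (a z)); move: h; nra.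
have Mu : M (a \o t) by exact: cs_comp.
exists (a \o t), k; split; last split.
- split=> // z /=; rewrite mul1r -(@ler_pXn2r _ 2) ?nnegrE //.
  have := sE (t z); rewrite -[s (t z)]/((s \o t) z) st /= => ->.
  by rewrite lerDl mulr_ge0 // ?sqr_ge0 // ltW.
- by rewrite kk -[(a \o t) \o s]/(a \o (t \o s)) ts.
- rewrite kk (adj_comp ba pt.1.1) pt.1.2.
  have -> : (t \o adj a) \o a = s - (e ^+ 2)%:C%C *: t.
    have -> : (t \o adj a) \o a = t \o (s \o s - (e ^+ 2)%:C%C *: idfun).
      by rewrite ss /g addrK.
    apply/funext => z; rewrite -[LHS]/(t (s (s z) - (e ^+ 2)%:C%C *: z)) (linB (bop_lin pt.1.1)).
    by rewrite (linZ (bop_lin pt.1.1)) -[t (s _)]/((t \o s) _) ts.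
  have [Met rM] := (csZ cM (e ^+ 2)%:C%C Mt, tau_rtrace LX).
  rewrite (rtB cM rM) // (rtZ cM rM) //.
  suff : e ^+ 2 * trR tau t <= e by lra.
  have te : onb t e^-1.
    move=> z; rewrite mulrC ler_pdivlMr //.
    rewrite -(@ler_pXn2r _ 2) ?nnegrE ?mulr_ge0 ?(ltW e0) // exprMn mulrC.
    have := sE (t z); rewrite -[s (t z)]/((s \o t) z) st /= => ->.
    by rewrite lerDr sqr_ge0.
  have : trR tau t <= e^-1.
    rewrite /trR -(hat_one LX) // -/(dot _ _).
    apply: le_trans (dot_CS _ _) _; rewrite (hn_one LX) mulr1.
    by apply: (hat_le LX) => //; rewrite invr_ge0 ltW.
  move=> h; have := ler_wpM2l (ltW e2) h.
  by rewrite expr2 -!mulrA divff ?gt_eqF // mulr1.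
Qed.

(** Operator balls are complete in 2-norm. A subsequence also converges strongly in every normal
    representation, which is how conditions expressed in such representations are shown to be
    closed. Real and imaginary parts are treated separately because [ac_seq] concerns self-adjoint
    operators. *)
Lemma ball_complete C (x : nat -> K -> K) : 0 <= C -> (forall n, M (x n)) ->
  (forall n, onb (x n) C) -> hcauchy (fun n => hat (x n)) ->
  exists y phi, [/\ M y, onb y C, (forall n, (n <= phi n)%N), hcvg (fun n => hat (x n)) (hat y)
    & forall (H : hilbertType R) (pi : (K -> K) -> (H -> H)), nrep M pi ->
       forall xi, hcvg (fun n => pi (x (phi n)) xi) (pi y xi)].
Proof.
move=> C0 Mx xC cx.
(* The squares of these increments are at most [8^-n], the rate that [ac_seq] asks for. *)
have [|phi [np hp]] := @fast_sub _ _ _ (fun n => 3^-1 ^+ n.+1 : R) cx.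
  by move=> n; rewrite exprn_gt0 // invr_gt0.
pose re z := (2^-1 : R)%:C%C *: (z + adj z) : K -> K.
pose im z := re (- 'i%C *: z).
have reM z : M z -> M (re z) by move=> Mz; apply: (csZ cM); apply: (csD cM) => //; apply: cs_adj.
have reS z : M z -> sa (re z).
  move=> Mz; apply: saZ; split; first by apply: bopD; [apply: bM|apply: adj_bop; apply: bM].
  by rewrite adjD ?adjK 1?addrC //; [apply: bM|apply: bM|apply: adj_bop; apply: bM].
have reC z : M z -> onb z C -> onb (re z) C.
  move=> Mz zC w; rewrite -[re z w]/((2^-1 : R)%:C%C *: (z w + adj z w)) hnZr gtr0_norm ?invr_gt0 //.
  have := hnD (z w) (adj z w); have := zC w; have := adj_onb (bM Mz) C0 zC w; lra.
have reB z w : M z -> M w -> re z - re w = re (z - w).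
  move=> Mz Mw; rewrite /re (adjB (bM Mz) (bM Mw)) -scalerBr; congr (_ *: _).
  by rewrite opprD addrACA.
have reH z : M z -> hn (hat (re z)) <= hn (hat z).
  move=> Mz; have Maz := cs_adj cM Mz.
  rewrite (hatZ LX); last exact: (csD cM).
  rewrite (hatD LX) //.
  rewrite hnZr gtr0_norm ?invr_gt0 //.
  have := hnD (hat z) (hat (adj z)); rewrite (hat_hn_adj LX Mz); lra.
have conv (c : R[i]) : complex.Re `|c| = 1 -> exists y, [/\ M y, onb y C
    & forall (H : hilbertType R) (pi : (K -> K) -> (H -> H)), nrep M pi ->
       forall xi, hcvg (fun n => pi (re (c *: x (phi n))) xi) (pi y xi)].
  move=> c1; have Mc n : M (c *: x n) by apply: (csZ cM).
  have [|||n|y [My _ yC h]] := ac_seq vM fM C0 (x := fun n => re (c *: x (phi n))) => [n|n|n||].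
  - exact: reM.
  - exact: reS.
  - apply: reC => // z; rewrite -[(c *: x (phi n)) z]/(c *: x (phi n) z) hnZ c1 mul1r; exact: xC.
  - have s := saB (reS _ (Mc (phi n.+1))) (reS _ (Mc (phi n))).
    rewrite -{1}s.2 -(hat_hn2 LX); last by apply: (csB cM); apply: reM.
    rewrite reB // -scalerBr.
    have Md : M (x (phi n.+1) - x (phi n)) by apply: (csB cM).
    have l1 := reH _ (csZ cM c Md).
    have l2 := hp n.
    rewrite (hatZ LX) // hnZ c1 mul1r (hatB LX) // in l1.
    have l3 := le_trans l1 (ltW l2).
    apply: le_trans (_ : (3^-1 ^+ n.+1) ^+ 2 <= _).
      by rewrite ler_pXn2r ?nnegrE // exprn_ge0 // invr_ge0.
    rewrite -exprM muln2 -addnn exprD; apply: le_trans (_ : 3^-1 ^+ n * 3^-1 ^+ n <= _).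
      apply: ler_pM; rewrite ?exprn_ge0 ?invr_ge0 // exprS ler_piMl ?exprn_ge0 ?invr_ge0 //; lra.
    rewrite -exprMn; apply: lerXn2r; rewrite ?nnegrE ?mulr_ge0 ?invr_ge0 //.
    by rewrite -invfM lef_pV2 ?posrE //; lra.
  - by exists y.
have [|a [Ma aC ha]] := conv 1; first by rewrite normr1.
have [|b [Mb bC hb]] := conv (- 'i%C); first by rewrite normrN /= expr0n expr1n add0r sqrtr1.
have Mib : M ('i%C *: b) by apply: (csZ cM).
have My : M (a + 'i%C *: b) by apply: (csD cM).
have xE z : M z -> z = re (1 *: z) + 'i%C *: re (- 'i%C *: z).
  move=> Mz; apply/funext => w.
  rewrite -[RHS]/((2^-1 : R)%:C%C *: ((1 *: z) w + adj (1 *: z) w) + 'i%C *: ((2^-1 : R)%:C%C *: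
    ((- 'i%C *: z) w + adj (- 'i%C *: z) w))).
  rewrite !(adjZ _ (bM Mz)) -[adj z]/(adj z : K -> K).
  rewrite -[(_ *: z) w]/(1 *: z w) -[((- _) *: z) w]/(- 'i%C *: z w).
  rewrite -[(1^* *: _) w]/(1^* *: adj z w) -[((- 'i%C)^* *: _) w]/((- 'i%C)^* *: adj z w).
  have -> : (- 'i%C : R[i])^* = 'i%C by apply/eqP; rewrite eq_complex /= oppr0 opprK !eqxx.
  rewrite conjC1; apply: inner_inj => v; rewrite !(innerDl, innerZl).
  have i2 : 'i%C * 'i%C = -1 :> R[i] by rewrite -expr2 sqr_i.
  have h2 : (2^-1 : R)%:C%C + (2^-1 : R)%:C%C = 1 :> R[i].
    by rewrite -rmorphD /= (_ : 2^-1 + 2^-1 = 1 :> R) //; field.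
  set p := '<<z w, v>>; set q := '<<adj z w, v>>; set h := (2^-1)%:C%C.
  have -> : h * (1 * p + 1 * q) + 'i%C * (h * (- 'i%C * p + 'i%C * q)) =
    h * p * (1 - 'i%C * 'i%C) + h * q * (1 + 'i%C * 'i%C) by ring.
  by rewrite i2 opprK subrr mulr0 addr0 -[LHS](mul1r p) -[in LHS]h2 -/h; ring.
have cv (H : hilbertType R) (pi : (K -> K) -> (H -> H)) : nrep M pi ->
       forall xi, hcvg (fun n => pi (x (phi n)) xi) (pi (a + 'i%C *: b) xi).
  move=> np' xi; have jp := np'.1.
  rewrite (jrD jp) // (jrZ cM jp) // -[(pi a + _) xi]/(pi a xi + 'i%C *: pi b xi).
  have -> : (fun n => pi (x (phi n)) xi) = (fun n => pi (re (1 *: x (phi n))) xi +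
    'i%C *: pi (re (- 'i%C *: x (phi n))) xi).
    apply/funext => n; have Mn := Mx (phi n).
    have M1 := reM _ (csZ cM 1 Mn); have M2 := reM _ (csZ cM (- 'i%C) Mn).
    have M3 := csZ cM 'i%C M2.
    have e1 := congr1 (fun y => pi y xi) (xE _ Mn).
    rewrite /= (jrD jp M1 M3) (jrZ cM jp 'i%C M2) in e1; exact: e1.
  by apply: hcvgD; [exact: ha|apply: hcvgZ; exact: hb].
exists (a + 'i%C *: b), phi; split=> //.
  move=> z; have h := cv _ _ (nrep_id vM) z.
  by apply: hcvg_hn_le h => n; apply: xC.
exact: hcvg_subseq cx np (cv _ _ (la_nrep LX) one).
Qed.

Lemma ball_closed C : 0 <= C -> closed [set hat x | x in [set x | M x /\ onb x C]].
Proof.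
move=> C0; apply/hclosedP => z /hcvg_dense[u hu uz].
pose x n := sval (cid2 (hu n)).
have [h1 h2] : (forall n, M (x n) /\ onb (x n) C) /\ (fun n => hat (x n)) = u.
  by split=> [n|]; [|apply/funext => n]; rewrite /x; case: cid2.
rewrite -h2 in uz.
have [y [phi [My yC _ h _]]] := ball_complete C0 (fun n => (h1 n).1) (fun n => (h1 n).2) (hcvg_cauchy uz).
by exists y => //; apply: hcvg_uniq h uz.
Qed.

Lemma ball_conv C : 0 <= C -> hconv [set hat x | x in [set x | M x /\ onb x C]].
Proof.
move=> C0 _ _ t t01 [x [Mx xC] <-] [y [My yC] <-].
have Md := csB cM My Mx; have Mt := csZ cM t%:C%C Md.
exists (x + t%:C%C *: (y - x)); last by rewrite (hatD LX) // (hatZ LX) // (hatB LX).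
split=> [|z]; first exact: (csD cM).
have -> : (x + t%:C%C *: (y - x)) z = (1 - t)%:C%C *: x z + t%:C%C *: y z.
  by rewrite -[LHS]/(x z + t%:C%C *: (y z - x z)); hvec.
case/andP: t01 => t0 t1; apply: le_trans (hnD _ _) _; rewrite !hnZr !ger0_norm ?subr_ge0 //.
have := ler_wpM2l t0 (yC z); have t1' : 0 <= 1 - t by lra.
have := ler_wpM2l t1' (xC z); lra.
Qed.

(** Let [hat x0] be the point nearest to [z] in the closed ball of radius C, and [eta] the
    difference. If [u k^2] is a polar decomposition of an approximation of [eta], the bound on [z]
    gives [<eta, z> <= C tr(k^2)] up to small errors; the right side is about [C <eta, u>], which is
    at most [<eta, x0>] since [C u] lies in the ball. Hence [eta = 0]. *)
Lemma bounded_vector (z : X) C : 0 <= C -> (forall a, M a -> hn (ra a z) <= C * hn (hat a)) ->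
  exists x, [/\ M x, onb x C & hat x = z].
Proof.
move=> C0 zC; have [|p [x0 [Mx0 x0C] <-] hp] := hconv_proj z (ball_closed C0) _ (ball_conv C0).
  exists (hat 0); exists 0 => //; split; first exact: cs0.
  by move=> w; rewrite hn0 mulr_ge0.
exists x0; split=> //; apply/eqP; rewrite eq_sym -subr_eq0; apply/eqP/hn_eq0/eqP.
rewrite -sqrf_eq0 -dotxx; set eta := z - hat x0; apply/eqP/le_anti.
rewrite {2}dotxx sqr_ge0 andbT; apply/ler_addgt0Pr => d d0; rewrite add0r.
(* The approximation errors add up to at most [e * (2 * C + hn z)]. *)
pose B := 2 * C + hn z + 1.
have B0 : 0 < B by rewrite /B; have := hn_ge0 z; lra.
pose e := d / B; have e0 : 0 < e by rewrite divr_gt0.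
have [a Ma ae] := hat_dense LX eta e0.
have [u [k [[Mu u1 Mk pk] [aE tk]]]] := approx_polar Ma e0.
have l1 : dot eta z <= dot (hat a) z + e * hn z.
  have -> : eta = hat a + (eta - hat a) by rewrite addrC subrK.
  rewrite dotDl lerD2l; apply: le_trans (dot_CS _ _) _.
  by rewrite ler_wpM2r // ltW.
have Muk := cs_comp cM Mu Mk.
have l2 : dot (hat a) z <= C * trR tau (k \o k).
  have -> : hat a = ra k (hat (u \o k)) by rewrite (ra_hat LX) // aE.
  rewrite /dot (ra_adj LX) // -/(dot _ _); apply: le_trans (dot_CS _ _) _.
  rewrite pk.1.2; apply: le_trans (_ : hn (hat k) * (C * hn (hat k)) <= _).
    by apply: ler_pM => //; [rewrite -[leRHS]mul1r; apply: (hat_onbl LX)|apply: zC].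
  by rewrite mulrCA -expr2 (hat_hn2 LX) // pk.1.2.
have l3 : trR tau (adj u \o a) <= dot eta (hat u) + e.
  rewrite /trR -(hat_inner LX) // -/(dot _ _).
  have -> : hat a = eta - (eta - hat a) by rewrite opprB addrC subrK.
  rewrite dotBl lerD2l; apply: le_trans (ler_norm _) _; rewrite normrN.
  apply: le_trans (dot_CSabs _ _) _.
  have := hat_le LX Mu ler01 u1; have := hn_ge0 (hat u); have := hn_ge0 (eta - hat a).
  have := ltW ae; nra.
have l4 : C * dot eta (hat u) <= dot eta (hat x0).
  have := hp (hat (C%:C%C *: u)); rewrite (hatZ LX) // dotBr dotZr subr_le0; apply.
  exists (C%:C%C *: u); last by rewrite (hatZ LX).
  split; first exact: (csZ cM).
  move=> w; rewrite -[(_ *: u) w]/(C%:C%C *: u w) hnZr ger0_norm //.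
  by rewrite ler_wpM2l // -[leRHS]mul1r; apply: u1.
rewrite {2}/eta dotBr.
have l5 := ler_wpM2l C0 tk; have l6 := ler_wpM2l C0 l3.
have : e * B = d by rewrite /e divfK // gt_eqF.
rewrite /B; have := hn_ge0 z; nra.
Qed.

Lemma bounded_vectorl (z : X) C : 0 <= C -> (forall a, M a -> hn (la a z) <= C * hn (hat a)) ->
  exists x, [/\ M x, onb x C & hat x = z].
Proof.
move=> C0 zC; have [|x [Mx xC xz]] := @bounded_vector (Jop z) C C0.
  move=> a Ma; have Maa := cs_adj cM Ma.
  by rewrite -{1}(adjK (bM Ma)) -Jop_la // Jop_hn -(hat_hn_adj LX) //; apply: zC.
exists (adj x); split; [exact: cs_adj|by apply: adj_onb => //; exact: bM|].
by rewrite -Jop_hat // xz JopK.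
Qed.

End L2_conjugation.

(** * Matrix algebras *)

Lemma sqrt_sum_sqr (R : rcfType) (I : finType) (a : I -> R) : (forall i, 0 <= a i) ->
  Num.sqrt (\sum_i a i ^+ 2) <= \sum_i a i.
Proof.
move=> a0; have s0 : 0 <= \sum_i a i by apply: sumr_ge0.
rewrite -[leRHS](ger0_norm s0) -sqrtr_sqr ler_wsqrtr // expr2 mulr_suml; apply: ler_sum => i _.
by rewrite expr2 ler_wpM2l // (bigD1 i) //= lerDl sumr_ge0.
Qed.

Section Finite_powers.
Variables (R : realType) (H : hilbertType R) (I : finType).

(** Any finite index type is allowed: besides columns of vectors, matrices of vectors are needed,
    indexed by pairs. *)
Definition hpow : Type := {ffun I -> H}.
HB.instance Definition _ := GRing.Lmodule.on hpow.
Implicit Types x y z : hpow.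

Definition hp_sqr x : R := \sum_i hn (x i) ^+ 2.
Definition hp_norm x : R[i] := (Num.sqrt (hp_sqr x))%:C%C.
Definition hp_inner x y : R[i] := \sum_i '<<x i, y i>>.

Lemma hp_linearl a x y z : hp_inner (a *: x + y) z = a * hp_inner x z + hp_inner y z.
Proof.
rewrite /hp_inner mulr_sumr -big_split /=; apply: eq_bigr => i _.
by rewrite !ffunE inner_linearl.
Qed.

Lemma hp_conj x y : hp_inner y x = (hp_inner x y)^*.
Proof. by rewrite /hp_inner rmorph_sum; apply: eq_bigr => i _; rewrite inner_conj. Qed.

Lemma hp_sqr_ge0 x : 0 <= hp_sqr x.
Proof. by apply: sumr_ge0 => i _; apply: sqr_ge0. Qed.

Lemma hp_sqrE x : hp_inner x x = (hp_sqr x)%:C%C.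
Proof. by rewrite /hp_inner /hp_sqr rmorph_sum; apply: eq_bigr => i _; rewrite inner_xx. Qed.

Lemma hp_normD x y : hp_norm (x + y) <= hp_norm x + hp_norm y.
Proof.
rewrite /hp_norm -rmorphD lecR; pose d := \sum_i dot (x i) (y i).
have sD t : hp_sqr (x + t%:C%C *: y) = hp_sqr x + 2 * t * d + t ^+ 2 * hp_sqr y.
  rewrite /hp_sqr /d !mulr_sumr -!big_split /=; apply: eq_bigr => i _.
  by rewrite !ffunE hn2D dotZr hnZr exprMn real_normK ?num_real //; ring.
have cs : d ^+ 2 <= hp_sqr x * hp_sqr y.
  by apply: quad_ge0 => [|t]; [exact: hp_sqr_ge0|rewrite -sD hp_sqr_ge0].
have := sD 1; rewrite scale1r expr1n mulr1 mul1r => ->.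
rewrite -(@ler_pXn2r _ 2) ?nnegrE ?addr_ge0 ?sqrtr_ge0 //.
rewrite sqr_sqrtr; last by have := hp_sqr_ge0 (x + 1%:C%C *: y); rewrite sD; lra.
rewrite sqrrD !sqr_sqrtr ?hp_sqr_ge0 // -addrA -[in leRHS]addrA lerD2l lerD2r.
have : d <= Num.sqrt (hp_sqr x) * Num.sqrt (hp_sqr y).
  rewrite -sqrtrM ?hp_sqr_ge0 //.
  by apply: le_trans (ler_norm _) _; rewrite -sqrtr_sqr ler_wsqrtr.
lra.
Qed.

Lemma hp_normZ a x : hp_norm (a *: x) = `|a| * hp_norm x.
Proof.
rewrite /hp_norm normCE -rmorphM; congr (_%:C)%C.
have -> : hp_sqr (a *: x) = complex.Re `|a| ^+ 2 * hp_sqr x.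
  by rewrite /hp_sqr mulr_sumr; apply: eq_bigr => i _; rewrite ffunE hnZ exprMn.
by rewrite sqrtrM ?sqr_ge0 // sqrtr_sqr ger0_norm.
Qed.

Lemma hp_norm0 x : hp_norm x = 0 -> x = 0.
Proof.
move=> /(congr1 (@complex.Re _)) /= /eqP; rewrite sqrtr_eq0 => h.
have /eqP : hp_sqr x = 0 by apply/le_anti; rewrite h hp_sqr_ge0.
rewrite psumr_eq0 => [/allP h0|i _]; last exact: sqr_ge0.
apply/ffunP => i; rewrite ffunE; apply: hn_eq0; apply/eqP.
by rewrite -sqrf_eq0; apply: h0; rewrite mem_index_enum.
Qed.

HB.instance Definition _ := Lmodule_isNormed.Build R[i] hpow hp_normD hp_normZ hp_norm0.

Lemma hp_complete (F : set_system hpow) : ProperFilter F -> cauchy F -> cvg F.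
Proof.
move=> PF /cauchyP cF.
have cvi i : {l : H | ((fun x : hpow => x i) @ F) --> l}.
  apply/cid; suff /cvg_ex : cvg ((fun x : hpow => x i) @ F) by [].
  apply/cauchy_cvgP/cauchyP => e e0; have [x Fx] := cF e e0.
  exists (x i); apply: (@filterS _ F _ (ball x e)) => [y|]; last exact: Fx.
  have [r r0 ->] := pos_complex e0 => hy; apply/hball.
  have {hy} : hp_norm ((x : hpow) - y) < r%:C%C := hy.
  rewrite ltcR; apply: le_lt_trans.
  rewrite -[leLHS]ger0_norm // -sqrtr_sqr ler_wsqrtr // /hp_sqr (bigD1 i) //= !ffunE lerDl.
  by apply: sumr_ge0 => j _; apply: sqr_ge0.
apply/cvg_ex; exists ([ffun i => sval (cvi i)] : hpow); apply/fcvg_ballP => e e0.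
have [r r0 ->] := pos_complex e0.
pose d := r / (#|I|%:R + 1); have d0 : 0 < d by rewrite divr_gt0 // ltr_wpDl.
have : \forall x \near F, forall i, hn (sval (cvi i) - (x : hpow) i) < d.
  apply: filter_forall => i; have /cvg_ballP h := svalP (cvi i).
  have dC : 0 < d%:C%C :> R[i] by rewrite ltcR.
  by have := h _ dC; apply: filterS => x /hball.
apply: filterS => x h; suff : hp_norm ([ffun i => sval (cvi i)] - (x : hpow)) < r%:C%C by [].
rewrite ltcR.
apply: le_lt_trans (sqrt_sum_sqr _) _ => //.
apply: le_lt_trans (_ : \sum_(i in I) d < r).
  by apply: ler_sum => i _; rewrite !ffunE; apply: ltW.
rewrite sumr_const -mulr_natl /d mulrA ltr_pdivrMr ?ltr_wpDl // mulrC ltr_pM2l //.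
by rewrite ltrDl.
Qed.

HB.instance Definition _ := Uniform_isComplete.Build hpow hp_complete.

Lemma hp_innern x : hp_inner x x = `|x| ^+ 2.
Proof. by rewrite hp_sqrE -[`|x|]/(hp_norm x) /hp_norm -rmorphXn /= sqr_sqrtr ?hp_sqr_ge0. Qed.

HB.instance Definition _ := NormedModule_isHilbert.Build R hpow hp_linearl hp_conj hp_innern.

Lemma hpow_inner x y : '<<x, y>> = \sum_i '<<x i, y i>>. Proof. by []. Qed.
Lemma hpow_dot x y : dot x y = \sum_i dot (x i) (y i).
Proof. by rewrite /dot hpow_inner Re_sum. Qed.
Lemma hpow_hn2 x : hn x ^+ 2 = \sum_i hn (x i) ^+ 2.
Proof. by rewrite -dotxx hpow_dot; apply: eq_bigr => i _; rewrite dotxx. Qed.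
Lemma hpow_hn x i : hn (x i) <= hn x.
Proof.
rewrite -(@ler_pXn2r _ 2) ?nnegrE // hpow_hn2 (bigD1 i) //= lerDl.
by apply: sumr_ge0 => j _; apply: sqr_ge0.
Qed.

Definition hin i (v : H) : hpow := [ffun j => if j == i then v else 0].

Lemma hin_inner i v x : '<<hin i v, x>> = '<<v, x i>>.
Proof.
rewrite hpow_inner (bigD1 i) //= ffunE eqxx big1 ?addr0 // => j /negbTE ji.
by rewrite ffunE ji inner0l.
Qed.
Lemma hin_innerr i v x : '<<x, hin i v>> = '<<x i, v>>.
Proof. by rewrite inner_conj hin_inner -inner_conj. Qed.
Lemma hin_hn i v : hn (hin i v) = hn v.
Proof. by apply: (hn_eq H) => //; rewrite -!dotxx /dot hin_inner ffunE eqxx. Qed.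
Lemma hin_lin i : linear (hin i).
Proof.
move=> a v w; apply/ffunP => j; rewrite !ffunE; case: eqP => //.
by rewrite scaler0 addr0.
Qed.
Lemma hin_bop i : bounded_op (hin i).
Proof. by apply: (@bopI _ _ _ _ 1) => [|v]; [exact: hin_lin|rewrite hin_hn mul1r]. Qed.
Lemma hpowE x : x = \sum_i hin i (x i).
Proof.
apply/ffunP => j; rewrite sum_ffunE (bigD1 j) //= !ffunE eqxx big1 ?addr0 // => i /negbTE ij.
by rewrite ffunE eq_sym ij.
Qed.

End Finite_powers.

Lemma bop_lim (R : realType) (H H' : hilbertType R) (x : H -> H') :
  (forall e : R, 0 < e -> exists2 y, bounded_op y & onb (x - y) e) -> bounded_op x.
Proof.
move=> h; have [y0 by0 h0] := h 1 ltr01; have [c c0 yc] := bop_onb by0.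
apply: (@bopI _ _ _ _ (1 + c)) => [a v w|v]; last first.
  rewrite mulrDl; apply: le_trans (lerD (h0 v) (yc v)).
  by rewrite -{1}(subrK (y0 v) (x v)); apply: hnD.
apply/eqP; rewrite -subr_eq0; apply/eqP/hn_eq0/le_anti; rewrite hn_ge0 andbT.
pose B := hn (a *: v + w) + complex.Re `|a| * hn v + hn w + 1.
have B0 : 0 < B by rewrite ltr_wpDl // !addr_ge0 // mulr_ge0.
apply/ler_addgt0Pr => e e0; rewrite add0r.
have [y by_ hy] := h (e / B) (divr_gt0 e0 B0); have e1 : e = e / B * B by rewrite divfK // gt_eqF.
have -> : x (a *: v + w) - (a *: x v + x w) =
    (x (a *: v + w) - y (a *: v + w)) - (a *: (x v - y v) + (x w - y w)).
  by rewrite (bop_lin by_); cvec.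
apply: le_trans (hnB _ _) _; apply: le_trans (lerD (lexx _) (hnD _ _)) _.
rewrite hnZ e1 /B; have := hy (a *: v + w); have := hy w.
have := ler_wpM2l (Re_normC_ge0 a) (hy v).
rewrite -![(x - y) _]/(x _ - y _); have := divr_gt0 e0 B0; nra.
Qed.

Section Matrix_algebras.
Variables (R : realType) (K : hilbertType R) (I : finType) (N : set (K -> K)).
Hypothesis cN : cstar N.
Local Notation KI := (hpow K I).
Implicit Types (X Y : KI -> KI).

Definition entry X i j : K -> K := fun v => X (hin j v) i.
Definition matN : set (KI -> KI) := [set X | bounded_op X /\ forall i j, N (entry X i j)].

Lemma entryE X xi i : linear X -> X xi i = \sum_j entry X i j (xi j).
Proof.
by move=> lX; rewrite {1}(hpowE xi) (lin_sum lX) sum_ffunE.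
Qed.

Lemma entry_ext X Y : linear X -> linear Y -> (forall i j, entry X i j = entry Y i j) -> X = Y.
Proof.
move=> lX lY h; apply/funext => xi; apply/ffunP => i; rewrite !entryE //.
by apply: eq_bigr => j _; rewrite h.
Qed.

Lemma entry_lin a X Y i j : entry (a *: X + Y) i j = a *: entry X i j + entry Y i j.
Proof. by apply/funext => v; rewrite /entry -[(a *: X + Y) _]/(a *: X _ + Y _) !ffunE. Qed.

Lemma entry_comp X Y i k : linear X -> entry (X \o Y) i k = \sum_j (entry X i j \o entry Y j k).
Proof.
by move=> lX; apply/funext => v; rewrite {1}/entry /= (entryE _ _ lX) sum_opE.
Qed.

Lemma entry_bop X i j : bounded_op X -> bounded_op (entry X i j).
Proof.
move=> bX; have [lX [c c0 Xc]] := (bop_lin bX, bop_onb bX); apply: (@bopI _ _ _ _ c) => [a v w|v].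
  by rewrite /entry hin_lin lX !ffunE.
by apply: le_trans (hpow_hn _ _) _; rewrite -(hin_hn j v).
Qed.

Lemma entry_adj X i j : bounded_op X -> entry (adj X) i j = adj (entry X j i).
Proof.
move=> bX; symmetry; apply: adj_uniq; first exact: entry_bop.
by move=> v w; rewrite /entry -hin_innerr (adjP bX) hin_inner.
Qed.

Lemma entry_id i j : entry (@idfun KI) i j = if i == j then idfun else 0.
Proof. by apply/funext => v; rewrite /entry ffunE; case: eqP. Qed.

Definition mx_op (x : I -> I -> K -> K) : KI -> KI := fun xi => [ffun i => \sum_j x i j (xi j)].

Lemma entry_mx_op x i j : (forall i j, N (x i j)) -> entry (mx_op x) i j = x i j.
Proof.
move=> Nx; apply/funext => v; rewrite /entry ffunE (bigD1 j) //= ffunE eqxx big1 ?addr0 // => k kj.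
by rewrite ffunE (negbTE kj) (lin0 (bop_lin (cs_bop cN (Nx i k)))).
Qed.

Lemma mx_op_mat x : (forall i j, N (x i j)) -> matN (mx_op x).
Proof.
move=> Nx; split=> [|i j]; last by rewrite entry_mx_op.
have -> : mx_op x = \sum_i \sum_j (@hin _ K I i \o x i j \o (fun xi : KI => xi j)).
  apply/funext => xi; rewrite sum_opE; apply/ffunP => i; rewrite ffunE sum_ffunE [RHS](bigD1 i) //=.
  rewrite [X in _ + X]big1 ?addr0 => [|k ki].
    by rewrite sum_opE sum_ffunE; apply: eq_bigr => j _; rewrite /= ffunE eqxx.
  by rewrite sum_opE sum_ffunE big1 // => j _; rewrite /= ffunE eq_sym (negbTE ki).
do 2!apply: bop_sum => ? _.
apply: bop_comp; first by apply: bop_comp; [exact: hin_bop|exact: cs_bop (Nx _ _)].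
by apply: (@bopI _ _ _ _ 1) => [a v w|v]; [rewrite !ffunE|rewrite mul1r hpow_hn].
Qed.

Lemma mat_cstar : cstar matN.
Proof.
split=> [X []//||a X Y [bX NX] [bY NY]|X Y [bX NX] [bY NY]|X [bX NX]|X h].
- split=> [|i j]; first exact: bop_id.
  by rewrite entry_id; case: eqP => _; [exact: cs_id|exact: cs0].
- by split=> [|i j]; [exact: bop_linear|rewrite entry_lin; apply: cs_lin].
- split=> [|i j]; first exact: bop_comp.
  by rewrite (entry_comp _ _ _ (bop_lin bX)); apply: (cs_sum cN) => k _; apply: (cs_comp cN).
- by split=> [|i j]; [exact: adj_bop|rewrite entry_adj //; apply: cs_adj].
- have bX : bounded_op X by apply: bop_lim => e /h[Y [bY _]]; exists Y.
  split=> // i j; apply: (cs_lim cN) => e /h[Y [bY NY] XY]; exists (entry Y i j) => // v.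
  apply: le_trans (_ : hn ((X - Y) (hin j v)) <= _); last by rewrite -(hin_hn j v); apply: XY.
  rewrite -[(X - Y) _]/(X (hin j v) - Y (hin j v)).
  by have := hpow_hn (X (hin j v) - Y (hin j v)) i; rewrite !ffunE.
Qed.

Variable tr : (K -> K) -> R.
Hypothesis tN : rtrace N tr.

Definition mat_tr X : R := \sum_i tr (entry X i i).

Lemma mat_tr_comp X Y : matN X -> matN Y ->
  mat_tr (X \o Y) = \sum_i \sum_j tr (entry X i j \o entry Y j i).
Proof.
move=> [bX NX] [bY NY]; apply: eq_bigr => i _; rewrite (entry_comp _ _ _ (bop_lin bX)).
by rewrite (rt_sum cN tN) // => j; apply: (cs_comp cN).
Qed.

Lemma mat_rtrace : rtrace matN mat_tr.
Proof.
have sqrE X : matN X -> mat_tr (adj X \o X) = \sum_i \sum_j tr (adj (entry X j i) \o entry X j i).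
  move=> NX; rewrite mat_tr_comp //; last exact: cs_adj mat_cstar _ NX.
  by apply: eq_bigr => i _; apply: eq_bigr => j _; rewrite entry_adj //; case: NX.
split=> [a X Y [bX NX] [bY NY]|X Y NX NY|X NX|X NX].
- rewrite /mat_tr mulr_sumr -big_split /=; apply: eq_bigr => i _.
  by rewrite entry_lin (rt_lin tN).
- rewrite !mat_tr_comp // exchange_big /=; apply: eq_bigr => i _; apply: eq_bigr => j _.
  by rewrite (rt_C tN) //; [case: NX|case: NY].
- rewrite sqrE //; apply: sumr_ge0 => i _; apply: sumr_ge0 => j _.
  by apply: (rt_sqr tN); case: NX.
- rewrite sqrE // => /eqP; rewrite psumr_eq0 => [/allP h|i _]; last first.
    by apply: sumr_ge0 => j _; apply: (rt_sqr tN); case: NX.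
  apply: entry_ext; [by case: NX => /bop_lin|exact: bop_lin (bop0 _ _)|move=> j i].
  have := h i (mem_index_enum _) => /=.
  rewrite psumr_eq0 => [/allP h'|k _]; last by apply: (rt_sqr tN); case: NX.
  have /eqP e := h' j (mem_index_enum _).
  rewrite (rt_faith tN _ e); last by case: NX.
  by apply/funext => v; rewrite /entry ffunE.
Qed.

End Matrix_algebras.

(** * Density of weakly dense subalgebras *)

(* The elements of minimal norm converge along the directed family. *)
Lemma hilbert_fip (R : realType) (H : hilbertType R) (J : Type) (C : J -> set H) (B : R) (j0 : J) :
  (forall j, [/\ closed (C j), C j !=set0 & hmid (C j)]) ->
  (forall j x, C j x -> hn x <= B) ->
  (forall i j, exists k, C k `<=` C i `&` C j) ->
  exists p, forall j, C j p.
Proof.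
move=> hC bC dC.
have min j : {p | C j p /\ forall a, C j a -> hn (a - p) ^+ 2 <= 2 * (hn a ^+ 2 - hn p ^+ 2)}.
  apply/cid; have [c n m] := hC j; have [p Cp h] := hproj_ex 0 c n m.
  by exists p; split=> // a /h; rewrite !sub0r !hnN.
pose p j := sval (min j).
have Cp j : C j (p j) by case: (svalP (min j)).
have hp j a : C j a -> hn (a - p j) ^+ 2 <= 2 * (hn a ^+ 2 - hn (p j) ^+ 2).
  by case: (svalP (min j)) => _; apply.
pose A := [set hn (p j) ^+ 2 | j in [set: J]].
have hA : has_sup A.
  split; first by exists (hn (p j0) ^+ 2), j0.
  exists (B ^+ 2) => _ [j _ <-]; have := bC _ _ (Cp j); have := hn_ge0 (p j).
  by move=> h1 h2; rewrite ler_pXn2r ?nnegrE // (le_trans h1).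
have ubA j : hn (p j) ^+ 2 <= sup A by apply: sup_upper_bound => //; exists j.
have near (e : R) : 0 < e -> {j | sup A - e < hn (p j) ^+ 2}.
  by move=> e0; apply/cid; have [_ [j _ <-] h] := sup_adherent e0 hA; exists j.
pose ep n : R := n.+1%:R^-1; have ep0 n : 0 < ep n by rewrite /ep invr_gt0 ltr0n.
(* Along the members [C (s n)] the minimal norms approach their supremum, so any member inside
   [C (s n)] has its minimal point within [sqrt (2 * ep n)] of that of [C (s n)]. *)
pose s n := sval (near (ep n) (ep0 n)).
have sP n : sup A - ep n < hn (p (s n)) ^+ 2 by apply: (svalP (near (ep n) (ep0 n))).
have refine n k : C k `<=` C (s n) -> hn (p k - p (s n)) ^+ 2 <= 2 * ep n.
  by move=> h; have := hp _ _ (h _ (Cp k)); have := ubA k; have := sP n; lra.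
have refine' n k (d : R) : 0 < d -> 2 * ep n < d ^+ 2 -> C k `<=` C (s n) -> hn (p k - p (s n)) < d.
  move=> d0 h1 h2; rewrite -(@ltr_pXn2r _ 2) ?nnegrE ?(ltW d0) //.
  exact: le_lt_trans (refine _ _ h2) h1.
have small (d : R) : 0 < d -> exists N, forall n, (N <= n)%N -> 2 * ep n < d ^+ 2.
  move=> d0; have [N hN] := harm_small (divr_gt0 (exprn_gt0 2 d0) (ltr0n _ 2)).
  exists N => n Nn; rewrite mulrC -ltr_pdivlMr //; apply: le_lt_trans hN.
  by rewrite /ep lef_pV2 ?posrE ?ltr0n // ler_nat.
have [l sl] : exists l, hcvg (fun n => p (s n)) l.
  apply: hcomplete => e e0; have e2 : 0 < e / 2 by rewrite divr_gt0.
  have [N hN] := small _ e2; exists N => m n Nm Nn; have [k kmn] := dC (s m) (s n).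
  have h1 : C k `<=` C (s m) by move=> x /kmn[].
  have h2 : C k `<=` C (s n) by move=> x /kmn[].
  have := refine' _ _ _ e2 (hN _ Nm) h1; have := refine' _ _ _ e2 (hN _ Nn) h2.
  have := hn_tri (p k) (p (s m)) (p (s n)); rewrite (hnC (p (s m)) (p k)); lra.
exists l => j; have [cj _ _] := hC j.
apply/(hclosedP _).1 => // e e0; have e2 : 0 < e / 2 by rewrite divr_gt0.
have [N hN] := small _ e2; have [N' hN'] := sl _ e2.
pose n := maxn N N'; have [k kj] := dC j (s n).
have h2 : C k `<=` C (s n) by move=> x /kj[].
exists (p k); first by have [] := kj _ (Cp k).
have := refine' _ _ _ e2 (hN n (leq_maxl _ _)) h2; have := hN' n (leq_maxr _ _).
by have := hn_tri (p (s n)) l (p k); rewrite (hnC l (p (s n))) (hnC (p (s n)) (p k)); lra.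
Qed.

Section Density.
Variables (R : realType) (K : hilbertType R) (M : set (K -> K)) (tau : (K -> K) -> R[i]).
Variables (X : biact K) (one : X).
Hypothesis LX : standard_form M tau one.
Let vM : vn_algebra M. Proof. by case: LX. Qed.
Let cM := vn_cstar vM.
Let bM := cs_bop cM.
Implicit Types (x y : K -> K).
Local Notation hat := (hat one).

Variable Q : set (K -> K).
Hypothesis QM : Q `<=` M.
Hypothesis Q1 : Q idfun.
Hypothesis Qlin : forall a x y, Q x -> Q y -> Q (a *: x + y).
Hypothesis Qcomp : forall x y, Q x -> Q y -> Q (x \o y).
Hypothesis Qadj : forall x, Q x -> Q (adj x).
Hypothesis QccM : commutant (commutant Q) = M.

Let L0 : set X := closure [set hat x | x in Q].
(** The elements of M whose vectors are limits of vectors from Q; the aim is [S1 = M]. Density of Q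
    is only known for a weak topology on K, and K need not be separable, so sequences in Q do not
    suffice. *)
Let S1 : set (K -> K) := [set x | M x /\ L0 (hat x)].

Lemma hatQ_csub : closed_subspace L0.
Proof.
apply: closed_csub.
  have Q0 : Q 0 by have := Qlin (-1) Q1 Q1; rewrite scaleN1r addNr.
  by exists 0 => //; exact: (hat0 LX).
move=> a _ _ [x Qx <-] [y Qy <-]; exists (a *: x + y); first exact: Qlin.
by rewrite (hat_lin LX) //; apply: QM.
Qed.

Lemma S1_sub x : Q x -> S1 x.
Proof. by move=> Qx; split; [exact: QM|apply: subset_closure; exists x]. Qed.

Lemma S1_lin a x y : S1 x -> S1 y -> S1 (a *: x + y).
Proof.
move=> [Mx Lx] [My Ly]; split; first exact: cs_lin.
by rewrite (hat_lin LX) //; have [_ h _] := hatQ_csub; apply: h.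
Qed.

Lemma S1_adj x : S1 x -> S1 (adj x).
Proof.
move=> [Mx /hclosureP Lx]; split; first exact: cs_adj.
apply/hclosureP => e e0; have [_ [q Qq <-] h] := Lx e e0.
exists (hat (adj q)); first by exists (adj q) => //; exact: Qadj.
have Mq := QM Qq; have [Max Maq] := (cs_adj cM Mx, cs_adj cM Mq).
by rewrite -!(Jop_hat LX) // -(JopB LX) (Jop_hn LX).
Qed.

Lemma S1_comp x y : S1 x -> S1 y -> S1 (x \o y).
Proof.
move=> [Mx Lx] [My Ly]; split; first exact: cs_comp.
have raL q z : Q q -> L0 z -> L0 (@ract _ _ X q z).
  move=> Qq /hclosureP/hcvg_dense[u hu uz]; have Mq := QM Qq.
  have cL : closed L0 by exact: closed_closure.
  apply: (hcvg_closed cL _ (bop_hcvg (ra_bop LX Mq) uz)) => n.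
  have [p Qp <-] := hu n; rewrite (ra_hat LX) //; last exact: QM.
  by apply: subset_closure; exists (p \o q) => //; exact: Qcomp.
move/hclosureP: (Ly) => /hcvg_dense[u hu uy].
have cL : closed L0 by exact: closed_closure.
rewrite -(la_hat LX) //; apply: (hcvg_closed cL _ (bop_hcvg (la_bop LX Mx) uy)) => n.
have [p Qp <-] := hu n; have Mp := QM Qp.
rewrite (la_hat LX) // -(ra_hat LX) //; exact: raL.
Qed.

Lemma S1_cstar : cstar S1.
Proof.
split=> [x [Mx _]|||||x h]; [exact: bM|exact: S1_sub|exact: S1_lin|exact: S1_comp|exact: S1_adj|].
have Mx : M x by apply: (cs_lim cM) => e /h[y [My _]]; exists y.
split=> //; have cL : closed L0 by exact: closed_closure.
apply: ((hclosedP _).1 cL) => e e0; have e2 : 0 < e / 2 by rewrite divr_gt0.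
have [y [My Ly] xy] := h _ e2; exists (hat y) => //.
rewrite -(hatB LX) //; apply: le_lt_trans (hat_le LX (csB cM Mx My) (ltW e2) xy) _.
by rewrite ltr_pdivrMr // mulr2n mulrDr mulr1 ltrDl.
Qed.

Section Approximation.
Variables (I : finType) (y : K -> K).
Hypotheses (My : M y) (sy : sa y).
Local Notation KI := (hpow K I).

Definition ampl (J : finType) x : hpow K J -> hpow K J := fun xi => [ffun i => x (xi i)].

Lemma ampl_bop (J : finType) x : bounded_op x -> bounded_op (@ampl J x).
Proof.
move=> bx; have [lx [c c0 xc]] := (bop_lin bx, bop_onb bx); apply: (@bopI _ _ _ _ c) => [a v w|v].
  by apply/ffunP => i; rewrite !ffunE lx.
rewrite -(@ler_pXn2r _ 2) ?nnegrE ?mulr_ge0 // exprMn !hpow_hn2 mulr_sumr; apply: ler_sum => i _.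
by rewrite ffunE -exprMn ler_pXn2r ?nnegrE ?mulr_ge0.
Qed.

Lemma ampl_inner (J : finType) x (v w : hpow K J) : bounded_op x ->
  '<<ampl x v, w>> = '<<v, ampl (adj x) w>>.
Proof. by move=> bx; rewrite !hpow_inner; apply: eq_bigr => i _; rewrite !ffunE (adjP bx). Qed.

(** Von Neumann's density argument: the projection onto the closure of the amplified orbit of [v]
    under S1 has entries in the commutant of Q, which commute with [y]; so the amplified [y] maps
    [v] into this closure. *)
Lemma S1_bicommutant (J : finType) (v w : hpow K J) :
  (forall b, S1 b -> '<<ampl b v, w>> = 0) -> '<<ampl y v, w>> = 0.
Proof.
move=> h; pose V := [set ampl b v | b in S1].
have cS := S1_cstar.
have cV : closed_subspace (closure V).
  apply: closed_csub => [|a _ _ [b Sb <-] [c Sc <-]].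
    by exists 0; [exact: cs0 cS|apply/ffunP => i; rewrite !ffunE].
  by exists (a *: b + c); [exact: S1_lin|apply/ffunP => i; rewrite !ffunE].
have Vinv b z : S1 b -> closure V z -> closure V (ampl b z).
  move=> Sb /hclosureP/hcvg_dense[u hu uz]; have bb := cs_bop cS Sb.
  have cl : closed (closure V) by exact: closed_closure.
  apply: (hcvg_closed cl _ (bop_hcvg (ampl_bop _ bb) uz)) => n; have [c Sc <-] := hu n.
  apply: subset_closure; exists (b \o c); first exact: S1_comp.
  by apply/ffunP => i; rewrite !ffunE.
have PC b : S1 b -> forall z, proj (closure V) (ampl b z) = ampl b (proj (closure V) z).
  move=> Sb; have bb := cs_bop cS Sb; have Sab := S1_adj Sb.
  apply: (proj_comm cV (bop_lin (ampl_bop _ bb)) (bop_lin (ampl_bop _ (cs_bop cS Sab)))).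
  - by move=> z t; exact: ampl_inner.
  - by move=> z; exact: Vinv.
  - by move=> z; exact: Vinv.
have bP := proj_bop cV.
have yP i j : y \o entry (proj (closure V)) i j = entry (proj (closure V)) i j \o y.
  have := My; rewrite -QccM => -[_ hy]; symmetry; apply: hy; split; first exact: entry_bop.
  move=> q Qq; apply/funext => z; have Sq := S1_sub Qq.
  rewrite /entry /=; have -> : hin j (q z) = ampl q (hin j z) :> hpow K J.
    by apply/ffunP => k; rewrite !ffunE; case: eqP => // _; rewrite (lin0 (bop_lin (cs_bop cS Sq))).
  by rewrite PC // ffunE.
have Pv : proj (closure V) v = v.
  apply: (proj_id cV); apply: subset_closure; exists idfun; first exact: S1_sub.
  by apply/ffunP => i; rewrite ffunE.
have -> : ampl y v = proj (closure V) (ampl y v).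
  apply/ffunP => i; rewrite (entryE _ _ (bop_lin bP)).
  rewrite -{1}Pv ffunE (entryE _ _ (bop_lin bP)) (lin_sum (bop_lin (bM My))).
  apply: eq_bigr => j _; rewrite !ffunE.
  by have := congr1 (fun f => f (v j)) (yP i j).
have /hclosureP/hcvg_dense[u hu uz] := proj_in cV (ampl y v).
have : '<<proj (closure V) (ampl y v), w>> = '<<(0 : hpow K J), w>>.
  apply: (hcvg_inner2 uz (hcvg_cst 0)) => n; have [b Sb <-] := hu n.
  by rewrite h // inner0l.
by rewrite inner0l.
Qed.

(* Self-adjoint operators in [S1] approximate [y] in the real span: a vector
   which is orthogonal to [b xi] for the real part of the inner product and all
   self-adjoint [b] satisfies [<b xi, h> + <b h, xi> = 0] for all [b]. *)
Lemma sa_approx (xi : I -> K) (e : R) : 0 < e ->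
  exists b, [/\ S1 b, sa b & forall i, hn (b (xi i) - y (xi i)) < e].
Proof.
move=> e0; have cS := S1_cstar.
pose Xi : KI := [ffun i => xi i]; pose V := [set ampl b Xi | b in [set b | S1 b /\ sa b]].
have VD t v w : V v -> V w -> V (t%:C%C *: v + w).
  move=> [b [Sb sb] <-] [c [Sc sc] <-]; exists (t%:C%C *: b + c); last first.
    by apply/ffunP => i; rewrite !ffunE.
  by split; [exact: S1_lin|exact: sa_lin].
have cD t v w : closure V v -> closure V w -> closure V (t%:C%C *: v + w).
  move=> /hclosureP/hcvg_dense[u hu uv] /hclosureP/hcvg_dense[u' hu' uw].
  have cl : closed (closure V) by exact: closed_closure.
  apply: (hcvg_closed cl _ (hcvgD (hcvgZ t%:C%C uv) uw)) => n.
  by apply: subset_closure; apply: VD.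
have V0 : V 0.
  exists 0; first by split; [exact: cs0 cS|exact: sa0].
  by apply/ffunP => i; rewrite !ffunE.
have [|||p Vp hp] := @hconv_proj _ _ (closure V) (ampl y Xi).
- exact: closed_closure.
- by exists 0; apply: subset_closure.
- move=> v w t _ Vv Vw; have -> : v + t%:C%C *: (w - v) = t%:C%C *: w + ((1 - t)%:C%C *: v + 0) by hvec.
  by apply: (cD) => //; apply: (cD) => //; apply: subset_closure.
pose h := ampl y Xi - p.
have orth v : closure V v -> dot h v = 0.
  move=> Vv; have le t : t * dot h v <= 0.
    rewrite -dotZr; have := hp (t%:C%C *: v + p); rewrite addrK; apply; exact: cD.
  by have := le 1; have := le (-1); lra.
have orth_sa b : S1 b -> sa b -> dot (ampl b Xi) h = 0.
  by move=> Sb sb; rewrite dotC; apply: orth; apply: subset_closure; exists b.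
have fE b : S1 b -> '<<ampl b Xi, h>> + '<<ampl b h, Xi>> = 0.
  move=> Sb; have bb := cs_bop cS Sb; have Sab := S1_adj Sb; have bab := cs_bop cS Sab.
  have amplD c d : ampl (c + d) = ampl c + ampl d :> (KI -> KI).
    by apply/funext => z; apply/ffunP => i; rewrite !ffunE.
  have amplZ a c : ampl (a *: c) = a *: ampl c :> (KI -> KI).
    by apply/funext => z; apply/ffunP => i; rewrite !ffunE.
  have re (c : K -> K) : S1 c -> '<<ampl c Xi, h>> + '<<ampl c h, Xi>> +
      ('<<ampl (adj c) Xi, h>> + '<<ampl (adj c) h, Xi>>) = 0.
    move=> Sc; have bc := cs_bop cS Sc; have Sac := S1_adj Sc; have bac := cs_bop cS Sac.
    have s : sa (c + adj c).
      by split; [exact: bopD|rewrite (adjD bc bac) (adjK bc) addrC].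
    have := orth_sa _ (csD cS Sc Sac) s; rewrite amplD -[(_ + _) Xi]/(ampl c Xi + ampl (adj c) Xi) dotDl.
    rewrite (ampl_inner h Xi bc) (ampl_inner h Xi bac) (adjK bc).
    rewrite (inner_conj (ampl c Xi)) (inner_conj (ampl (adj c) Xi)) /dot.
    move: '<<ampl c Xi, h>> '<<ampl (adj c) Xi, h>> => [a1 a2] [b1 b2] /= e1.
    apply/eqP; rewrite eq_complex /=; apply/andP; split; apply/eqP; [|by ring].
    by move: e1; lra.
  have r1 := re b Sb; have := re ('i%C *: b) (csZ cS 'i%C Sb).
  rewrite (adjZ _ bb) !amplZ -![('i%C *: _) _]/('i%C *: ampl b _) -![(_^* *: _) _]/('i%C^* *: ampl (adj b) _).
  rewrite !innerZl; have -> : ('i%C : R[i])^* = - 'i%C by apply/eqP; rewrite eq_complex /= oppr0 !eqxx.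
  move: r1; set u := '<<_, _>>; set v := '<<_, _>>; set u' := '<<_, _>>; set v' := '<<_, _>>.
  move=> r1 r2; have i0 : 'i%C != 0 :> R[i] by rewrite eq_complex /= oner_eq0 andbF.
  have r3 : u + v - (u' + v') = 0.
    by apply: (mulfI i0); rewrite mulr0 -r2; ring.
  have : (u + v) * 2 = 0 by rewrite -[RHS](addr0 0) -{1}r1 -r3; ring.
  by move/eqP; rewrite mulf_eq0 pnatr_eq0 orbF => /eqP.
(* Testing the tuple [(Xi, h)] against [(h, Xi)] collects both terms of [fE] in one inner
   product. *)
pose Th : hpow K (I + I)%type := [ffun i => match i with inl i => Xi i | inr i => h i end].
pose Th' : hpow K (I + I)%type := [ffun i => match i with inl i => h i | inr i => Xi i end].
have ThE b : '<<ampl b Th, Th'>> = '<<ampl b Xi, h>> + '<<ampl b h, Xi>>.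
  rewrite !hpow_inner big_sumType /=.
  by congr (_ + _); apply: eq_bigr => i _; rewrite !ffunE.
have : '<<ampl y Xi, h>> + '<<ampl y h, Xi>> = 0.
  by rewrite -ThE; apply: S1_bicommutant => b Sb; rewrite ThE fE.
rewrite (ampl_inner h Xi sy.1) sy.2 (inner_conj (ampl y Xi)) => y0.
have dh : dot (ampl y Xi) h = 0.
  by move: y0; rewrite /dot; case: '<<_, _>> => a b /= [] ; lra.
have h0 : h = 0.
  apply: hn_eq0; apply/eqP; rewrite -sqrf_eq0 -dotxx {2}/h dotBr (orth p Vp) subr0 dotC dh //.
have /hclosureP/(_ _ e0)[_ [b [Sb sb] <-] hb] : closure V (ampl y Xi).
  by move/eqP: h0; rewrite subr_eq0 => /eqP ->.
exists b; split=> // i; rewrite hnC; apply: le_lt_trans hb.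
by have := hpow_hn (ampl y Xi - ampl b Xi) i; rewrite !ffunE.
Qed.

End Approximation.

(** The contractions of S1 close to [z] on a finite set form a downward directed family of closed
    convex subsets of a ball of L^2. [hilbert_fip] gives a common point, and the operator behind it
    agrees with [z] at every vector. *)
Lemma S1_strong (z : K -> K) : M z -> (forall (s : seq K) n, exists g,
    [/\ S1 g, onb g 1 & forall xi, xi \in s -> hn (g xi - z xi) <= n.+1%:R^-1]) -> S1 z.
Proof.
move=> Mz h; have o1 : 0 <= 1 :> R by [].
pose C (j : seq K * nat) := [set hat g | g in [set g | [/\ S1 g, onb g 1
  & forall xi, xi \in j.1 -> hn (g xi - z xi) <= j.2.+1%:R^-1]]].
have [j|j _ [g [[Mg _] g1 _] <-]|[s m] [s' m']|p hp] := @hilbert_fip _ _ _ C 1 ([::], 0%N).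
- split.
  + apply/hclosedP => w /hcvg_dense[u hu uw].
    pose g n := sval (cid2 (hu n)).
    have [h1 h2] : (forall n, [/\ S1 (g n), onb (g n) 1
        & forall xi, xi \in j.1 -> hn (g n xi - z xi) <= j.2.+1%:R^-1]) /\ (fun n => hat (g n)) = u.
      by split=> [n|]; [|apply/funext => n]; rewrite /g; case: cid2.
    rewrite -h2 in uw.
    have Sg n : S1 (g n) by case: (h1 n).
    have g1 n : onb (g n) 1 by case: (h1 n).
    have [y [phi [My y1 np hy hs]]] := ball_complete LX o1 (fun n => (Sg n).1) g1 (hcvg_cauchy uw).
    exists y; last exact: hcvg_uniq hy uw.
    have cL : closed L0 by exact: closed_closure.
    split=> //; first by split=> //; apply: (hcvg_closed cL _ hy) => n; case: (Sg n).
    move=> xi xj; apply: (hcvg_hn_le _ (hcvgB (hs _ _ (nrep_id vM) xi) (hcvg_cst (z xi)))) => n.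
    by case: (h1 (phi n)) => _ _; apply.
  + by have [g hg] := h j.1 j.2; exists (hat g), g.
  + apply: hconv_mid => _ _ t t01 [g [Sg g1 gz] <-] [k [Sk k1 kz] <-].
    have [Mg Mk] := (Sg.1, Sk.1); have Md := csB cM Mk Mg; have Mt := csZ cM t%:C%C Md.
    exists (g + t%:C%C *: (k - g)); last by rewrite (hatD LX) // (hatZ LX) // (hatB LX).
    have E (v : K) : (g + t%:C%C *: (k - g)) v = (1 - t)%:C%C *: g v + t%:C%C *: k v.
      by rewrite -[LHS]/(g v + t%:C%C *: (k v - g v)); hvec.
    case/andP: t01 => t0 t1; have t1' : 0 <= 1 - t by lra.
    split=> [|v|v vj].
    * have cS := S1_cstar; apply: (csD cS) => //; apply: (csZ cS); exact: (csB cS).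
    * rewrite E; apply: le_trans (hnD _ _) _; rewrite !hnZr !ger0_norm //.
      by have := ler_wpM2l t0 (k1 v); have := ler_wpM2l t1' (g1 v); lra.
    * have -> : (g + t%:C%C *: (k - g)) v - z v = (1 - t)%:C%C *: (g v - z v) + t%:C%C *: (k v - z v).
        by rewrite E; hvec.
      apply: le_trans (hnD _ _) _; rewrite !hnZr !ger0_norm //.
      move: (_^-1) (gz _ vj) (kz _ vj) => d l1 l2.
      by have := ler_wpM2l t0 l2; have := ler_wpM2l t1' l1; lra.
- exact: (hat_le LX).
- exists (s ++ s', maxn m m') => _ [g [Sg g1 gz] <-].
  have le k : (k <= maxn m m')%N -> (maxn m m').+1%:R^-1 <= k.+1%:R^-1 :> R.
    by move=> km; rewrite lef_pV2 ?posrE ?ltr0n // ler_nat.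
  by split; exists g => //; split=> // v vs; apply: le_trans (gz v _) (le _ _);
    rewrite /= ?mem_cat ?vs ?orbT // ?leq_maxl ?leq_maxr.
have [g [Sg _ _] gp] := hp ([::], 0%N).
suff <- : g = z by [].
apply/funext => v; apply/eqP; rewrite -subr_eq0; apply/eqP/hn_eq0/le_anti.
rewrite hn_ge0 andbT; apply/ler_addgt0Pr => e e0; rewrite add0r.
have [n hn'] := harm_small e0; have [k [Sk _ kz] kp] := hp ([:: v], n).
have gk : g = k by apply: (hat_inj LX); [exact: Sg.1|exact: Sk.1|rewrite gp].
by rewrite gk (le_trans (kz v _) (ltW hn')) ?mem_head.
Qed.

(** As in Kaplansky's density theorem, approximants without a common norm bound are made bounded by
    passing to [(1 + y^2)^-1] and [y (1 + y^2)^-1]. Both lie in S1 by [S1_strong], and [y] is their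
    quotient. *)
Lemma S1_sa y : M y -> sa y -> S1 y.
Proof.
move=> My sy; have cS := S1_cstar; have ly := bop_lin sy.1.
have res (N : set (K -> K)) (b : K -> K) : cstar N -> N b -> sa b -> exists g, [/\ N g, psd g,
    (forall v, g v + b (b (g v)) = v), (forall v, g (v + b (b v)) = v) & onb g 1 /\ onb (b \o g) 1].
  move=> cN Nb sb; have bb := sb.1.
  have p : psd (idfun + (b \o b)).
    by apply: psdD; [split; [exact: sa_id|move=> v; rewrite dotxx sqr_ge0]|exact: psd_sqr].
  have E (v : K) : dot ((idfun + (b \o b)) v) v = hn v ^+ 2 + hn (b v) ^+ 2.
    by rewrite -[(_ + _) v]/(v + b (b v)) dotDl (sa_dot sb) !dotxx.
  have Ng0 : N (idfun + (b \o b)) by apply: (csD cN); [exact: cs_id|exact: cs_comp].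
  have [|g [Ng pg g1 g2]] := cs_inv cN (ltr01 : 0 < 1 :> R) Ng0 p.
    by move=> v; rewrite E mul1r lerDl sqr_ge0.
  have g1E v : g v + b (b (g v)) = v := congr1 (fun f => f v) g1.
  have bd v : hn (g v) ^+ 2 + hn (b (g v)) ^+ 2 <= hn v * hn (g v).
    by rewrite -E -[X in X <= _]/(dot (g v + b (b (g v))) (g v)) g1E; exact: dot_CS.
  have gle v : hn (g v) <= hn v.
    rewrite leNgt; apply/negP => lt; have := bd v; have := sqr_ge0 (hn (b (g v))).
    have := hn_ge0 v; nra.
  exists g; split=> //; first by move=> v; have := congr1 (fun f => f v) g2.
  split=> v; rewrite mul1r //= -(@ler_pXn2r _ 2) ?nnegrE //.
  by have := bd v; have := gle v; have := hn_ge0 v; have := hn_ge0 (g v); have := sqr_ge0 (hn (g v)); nra.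
have [G [MG pG GE GE' [G1 yG1]]] := res M y cM My sy.
have approx (s : seq K) (n : nat) : exists b g, [/\ S1 g, S1 (b \o g), onb g 1, onb (b \o g) 1
    & forall xi, xi \in s -> hn (g xi - G xi) <= n.+1%:R^-1 /\ hn (b (g xi) - y (G xi)) <= n.+1%:R^-1].
  have d0 : 0 < n.+1%:R^-1 / 4 :> R by rewrite divr_gt0 // invr_gt0 ltr0n.
  pose xi (i : 'I_(size s) + 'I_(size s)) : K :=
    match i with inl i => G (nth 0 s i) | inr i => y (G (nth 0 s i)) end.
  (* By the resolvent identities [e1] and [e2] it is enough that [b] is close to [y] at the vectors
     [G v] and [y (G v)]. *)
  have [b [Sb sb hb]] := @sa_approx _ y My sy xi _ d0; have lb := bop_lin sb.1.
  have [g [Sg pg gE gE' [g1 bg1]]] := res S1 b cS Sb sb; have lg := bop_lin pg.1.1.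
  have gb v : g (b v) = b (g v).
    rewrite -{1}(gE v) (linD lb) -[b (b (b (g v)))]/(b (b (b (g v)))) gE'; by [].
  exists b, g; split=> //; first exact: cs_comp cS _ _ Sb Sg.
  move=> v vs; have iv : (index v s < size s)%N by rewrite index_mem.
  have hd : n.+1%:R^-1 = 4 * (n.+1%:R^-1 / 4) :> R by rewrite mulrC divfK.
  have := hb (inl (Ordinal iv)); have := hb (inr (Ordinal iv)); rewrite /= nth_index //.
  move: (n.+1%:R^-1) d0 hd => r d0 ->; move: d0; move: (r / 4) => d d0; set p := G v.
  rewrite (hnC (b _)) (hnC (b p)); set eta2 := y (y p) - b (y p); set eta1 := y p - b p => h2 h1.
  have e1 : g v - p = g eta2 + b (g eta1).
    have -> : g v - p = g (p + y (y p)) - g (p + b (b p)) by rewrite GE gE'.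
    by rewrite -gb -(linD lg) -(linB lg); congr (g _); rewrite /eta1 /eta2 (linB lb); cvec.
  have e2 : b (g v) - y p = b (g eta2) - g eta1.
    have -> : b (g v) - y p = b (g v - p) - eta1 by rewrite (linB lb) /eta1; cvec.
    by rewrite e1 (linD lb) -{2}(gE eta1); cvec.
  have l1 w : hn (g w) <= hn w by rewrite -[leRHS]mul1r.
  have l2 w : hn (b (g w)) <= hn w by rewrite -[leRHS]mul1r; apply: bg1.
  split; first by rewrite e1; have := hnD (g eta2) (b (g eta1)); have := l1 eta2; have := l2 eta1; lra.
  by rewrite e2; have := hnB (b (g eta2)) (g eta1); have := l1 eta1; have := l2 eta2; lra.
have SG : S1 G.
  apply: S1_strong => // s n; have [b [g [Sg _ g1 _ h]]] := approx s n.
  by exists g; split=> // v /h[].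
have SyG : S1 (y \o G).
  apply: S1_strong => [|s n]; first exact: cs_comp.
  by have [b [g [_ Sg _ g1 h]]] := approx s n; exists (b \o g); split=> // v /h[].
have [c c0 yc] := bop_onb sy.1.
(* [G] is bounded below because [G >= G^2] and the norm of [v] is at most [1 + c^2] times that of
   [G v]. *)
have q0 : 0 < (1 + c ^+ 2) ^+ 2 by rewrite exprn_gt0 // ltr_pwDl // sqr_ge0.
have [|v|T [ST _ GT _]] := cs_inv cS (_ : 0 < ((1 + c ^+ 2) ^+ 2)^-1) SG pG; first by rewrite invr_gt0.
  rewrite mulrC ler_pdivrMr // mulrC; apply: le_trans (_ : (1 + c ^+ 2) ^+ 2 * hn (G v) ^+ 2 <= _).
    rewrite -exprMn ler_pXn2r ?nnegrE ?mulr_ge0 ?addr_ge0 ?sqr_ge0 // -{1}(GE v) mulrDl mul1r.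
    apply: le_trans (hnD _ _) _; rewrite lerD2l expr2 -mulrA.
    exact: le_trans (yc _) (ler_wpM2l c0 (yc _)).
  by rewrite ler_pM2l //; have := psd_small v pG G1; rewrite mul1r.
have -> : y = (y \o G) \o T by apply/funext => v; have /= := congr1 (fun f => y (f v)) GT.
exact: S1_comp.
Qed.

(** With [q] the adjoint of [p] this is the decomposition into self-adjoint parts. *)
Lemma half_sum (V : lmodType R[i]) (p q : V) :
  p = (2^-1 : R)%:C%C *: (p + q) + 'i%C *: ((2^-1 : R)%:C%C *: ('i%C *: (q - p))).
Proof.
have i2 : 'i%C * 'i%C = -1 :> R[i] by rewrite -expr2 sqr_i.
have h2 : (2^-1 : R)%:C%C + (2^-1 : R)%:C%C = 1 :> R[i].
  by rewrite -rmorphD /= (_ : 2^-1 + 2^-1 = 1 :> R) //; field.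
have e : 'i%C * (2^-1 : R)%:C%C * 'i%C = - (2^-1 : R)%:C%C by rewrite mulrAC i2 mulN1r.
rewrite !scalerA e scaleNr -scalerBr opprB addrACA subrr addr0 scalerDr -scalerDl.
by rewrite h2 scale1r.
Qed.

Lemma dense_subalgebra : L0 = setT.
Proof.
have cS := S1_cstar; apply/seteqP; split=> // z _; have [x Mx xz] := hat_approx LX z.
have cL : closed L0 by exact: closed_closure.
apply: (hcvg_closed cL _ xz) => n; suff [] : S1 (x n) by [].
move: (x n) (Mx n) => y My; have May := cs_adj cM My.
have by_ := bM My; have bay := bM May.
rewrite (half_sum y (adj y)); apply: (csD cS); last apply: (csZ cS).
  apply: S1_sa; first by apply: (csZ cM); exact: (csD cM).
  by apply: saZ; split; [exact: bopD|rewrite (adjD by_ bay) (adjK by_) addrC].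
apply: S1_sa; first by do 2!apply: (csZ cM); exact: (csB cM).
apply: saZ; split; first by apply: bopZ; exact: bopB.
rewrite (adjZ _ (bopB bay by_)) (adjB bay by_) (adjK by_).
have -> : ('i%C : R[i])^* = - 'i%C by apply/eqP; rewrite eq_complex /= oppr0 !eqxx.
by rewrite scaleNr -scalerN opprB.
Qed.

End Density.

(** * Irreducible inclusions *)

Section Commutants.
Variables (R : realType) (H : hilbertType R).

Lemma commutant_cstar (A : set (H -> H)) : (forall x, A x -> bounded_op x) ->
  (forall x, A x -> A (adj x)) -> cstar (commutant A).
Proof.
move=> bA aA; split=> [z []//||a y z [by_ hy] [bz hz]|y z [by_ hy] [bz hz]|z [bz hz]|z h].
- by split=> //; exact: bop_id.
- split=> [|x Ax]; first exact: bop_linear.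
  by apply: comm_linear; [exact: bA|exact: hy|exact: hz].
- split=> [|x Ax]; first exact: bop_comp.
  by apply: comm_comp; [exact: hy|exact: hz].
- split=> [|x Ax]; first exact: adj_bop.
  have bx := bA _ Ax; have bax := bA _ (aA _ Ax).
  by rewrite -{1}(adjK bx) -(adj_comp bz bax) -{2}(adjK bx) -(adj_comp bax bz) hz //; apply: aA.
- have bz : bounded_op z by apply: bop_lim => e /h[y [by_ _]]; exists y.
  split=> // x Ax; have bx := bA _ Ax; have [c c0 xc] := bop_onb bx.
  have p : 0 < 2 * c + 1 by rewrite ltr_wpDl // mulr_ge0.
  apply: onb_lim_eq => e e0; have [y [by_ hy] zy] := h _ (divr_gt0 e0 p).
  move=> v; have E : x (y v) = y (x v) := congr1 (fun f => f v) (hy x Ax).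
  have -> : (x \o z - (z \o x)) v = x ((z - y) v) - (z - y) (x v).
    by rewrite -[LHS]/(x (z v) - z (x v)) -![(z - y) _]/(z _ - y _) (linB (bop_lin bx)) E; cvec.
  apply: le_trans (hnB _ _) _; have l1 := xc ((z - y) v); have l2 := zy v; have l3 := zy (x v).
  have l4 := xc v; have d0 := ltW (divr_gt0 e0 p).
  have -> : e * hn v = (2 * c + 1) * (e / (2 * c + 1)) * hn v by congr (_ * _); rewrite mulrC divfK ?gt_eqF.
  move: (e / _) d0 l2 l3 => d d0 l2 l3; have := ler_wpM2l c0 l2; have := ler_wpM2l d0 l4.
  have := hn_ge0 v; have := mulr_ge0 d0 (hn_ge0 v); lra.
Qed.

End Commutants.

Lemma op_ext_orth (R : realType) (H H' : hilbertType R) (A : set H) (f g : H -> H') :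
  bounded_op f -> bounded_op g -> (forall x, A x -> f x = g x) ->
  (forall z, (forall x, A x -> '<<z, x>> = 0) -> f z = g z) -> f = g.
Proof.
move=> bf bg fg fg'; pose Y := closure (lspan A); have cY : closed_subspace Y := lspan_csub A.
have fgY z : Y z -> f z = g z.
  move=> /hclosureP/hcvg_dense[u hu uz]; apply: (hcvg_uniq (bop_hcvg bf uz)).
  have -> : (fun n => f (u n)) = (fun n => g (u n)); last exact: bop_hcvg.
  apply/funext => n; have [m [a [w [Aw ->]]]] := hu n.
  rewrite (lin_sum (bop_lin bf)) (lin_sum (bop_lin bg)); apply: eq_bigr => i _.
  by rewrite (linZ (bop_lin bf)) (linZ (bop_lin bg)) fg.
apply/funext => z; have -> : z = proj Y z + (z - proj Y z) by rewrite addrC subrK.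
rewrite (linD (bop_lin bf)) (linD (bop_lin bg)) fgY; last exact: proj_in.
congr (_ + _); apply: fg' => x Ax; have [_ h] := projP cY z; apply: h.
by apply: subset_closure; apply: lspanS.
Qed.

(** Invariance of the graph under [a] gives the relation on the domain; invariance of the domain
    under the adjoint [b] makes its orthogonal complement, where [U] vanishes, invariant under
    [a]. *)
Lemma ext_op_comm (R : realType) (H1 H2 : hilbertType R) (G : H1 -> H2 -> Prop) (U : H1 -> H2)
    (a b : H1 -> H1) (a' : H2 -> H2) :
  bounded_op U -> (forall x y, G x y -> U x = y) ->
  (forall z, (forall x y, G x y -> '<<z, x>> = 0) -> U z = 0) ->
  bounded_op a -> bounded_op a' -> (forall x y, '<<a x, y>> = '<<x, b y>>) ->
  (forall x y, G x y -> G (a x) (a' y)) -> (forall x y, G x y -> exists y', G (b x) y') ->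
  forall x, U (a x) = a' (U x).
Proof.
move=> bU UG U0 ba ba' ab Ga Gb.
suff e : U \o a = a' \o U by move=> x; exact: (congr1 (fun f => f x) e).
apply: (@op_ext_orth _ _ _ [set x | exists y, G x y]); [exact: bop_comp|exact: bop_comp| |].
  by move=> x [y xy] /=; rewrite (UG _ _ xy) (UG _ _ (Ga _ _ xy)).
move=> z h /=; rewrite (U0 z) ?(lin0 (bop_lin ba')) => [|x y xy]; last by apply: h; exists y.
by apply: U0 => x y xy; rewrite ab; have [y' h'] := Gb _ _ xy; apply: h; exists y'.
Qed.

Lemma hpow_hcvg (R : realType) (H : hilbertType R) (I : finType) (u : nat -> hpow H I) (l : hpow H I) :
  (forall i, hcvg (fun n => u n i) (l i)) -> hcvg u l.
Proof.
move=> h e e0; pose d := e / (#|I|%:R + 1); have d0 : 0 < d by rewrite divr_gt0 // ltr_wpDl.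
have N i : {N | forall n, (N <= n)%N -> hn (u n i - l i) < d} by apply/cid; exact: h.
exists (\max_i sval (N i)) => n nN.
have le : hn (u n - l) <= \sum_i hn (u n i - l i).
  rewrite -(ger0_norm (hn_ge0 (u n - l))) -sqrtr_sqr hpow_hn2.
  have := @sqrt_sum_sqr _ I (fun i => hn (u n i - l i)) (fun i => hn_ge0 _).
  apply: le_trans; apply: ler_wsqrtr; apply: ler_sum => i _; by rewrite !ffunE.
apply: le_lt_trans le _; apply: le_lt_trans (_ : \sum_(i in I) d < e).
  apply: ler_sum => i _; apply/ltW/(svalP (N i)); apply: leq_trans nN; exact: leq_bigmax.
rewrite sumr_const -mulr_natl /d mulrA ltr_pdivrMr ?ltr_wpDl // mulrC ltr_pM2l //.
by rewrite ltrDl.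
Qed.

Section Unitaries.
Variables (R : realType) (K : hilbertType R).

Definition unitary (N : set (K -> K)) u := [/\ N u, adj u \o u = idfun & u \o adj u = idfun].

Lemma unitary_adj N u : cstar N -> unitary N u -> unitary N (adj u).
Proof.
move=> cN [Nu u1 u2]; split; [exact: cs_adj|by rewrite (adjK (cs_bop cN Nu))|].
by rewrite (adjK (cs_bop cN Nu)).
Qed.

Lemma unitary_onb N u : cstar N -> unitary N u -> onb u 1.
Proof. by move=> cN [Nu u1 _] v; rewrite mul1r (unitary_isom v (cs_bop cN Nu) u1). Qed.

(** By [cs_unitary] small self-adjoint elements are means of a unitary and its adjoint, so the
    unitaries span the algebra. *)
Lemma unitary_ind (N P : set (K -> K)) : cstar N ->
  (forall a x y, P x -> P y -> P (a *: x + y)) -> (forall u, unitary N u -> P u) ->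
  forall x, N x -> P x.
Proof.
move=> cN Plin Pu.
have P0 : P 0.
  have P1 : P idfun by apply: Pu; split; [exact: cs_id|rewrite adj_id|rewrite adj_id].
  by have := Plin (-1) _ _ P1 P1; rewrite scaleN1r addNr.
have PZ a x : P x -> P (a *: x) by move=> Px; rewrite -[a *: x]addr0; apply: Plin.
have PD x y : P x -> P y -> P (x + y) by move=> Px Py; rewrite -[x]scale1r; apply: Plin.
have Psa x : N x -> sa x -> P x.
  move=> Nx sx; have [c c0 xc] := bop_onb sx.1.
  have p : 0 < 2 * (c + 1) by rewrite mulr_gt0 // ltr_wpDl.
  have [|||u [Nu u1 u2 xu]] := @cs_unitary _ _ _ cN ((2 * (c + 1))^-1%:C%C *: x).
  - exact: csZ.
  - exact: saZ.
  - move=> v; rewrite -[(_ *: x) v]/((2 * (c + 1))^-1%:C%C *: x v) hnZr gtr0_norm ?invr_gt0 //.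
    rewrite mulrC ler_pdivrMr // mulrC mulrA (mulrC _ 2^-1) mulrA mulVf ?pnatr_eq0 // mul1r.
    by apply: le_trans (xc v) _; rewrite ler_wpM2r // lerDl.
  have -> : x = (2 * (c + 1))%:C%C *: ((2 * (c + 1))^-1%:C%C *: x).
    by rewrite scalerA -rmorphM divff ?gt_eqF // scale1r.
  rewrite xu; do 2!apply: (PZ); apply: (PD); first by apply: (Pu).
  by apply: (Pu); apply: unitary_adj.
move=> x Nx; have bx := cs_bop cN Nx; have Nax := cs_adj cN Nx; have bax := cs_bop cN Nax.
rewrite (half_sum x (adj x)); apply: (PD); last apply: (PZ).
  apply: Psa; first by apply: (csZ cN); exact: (csD cN).
  by apply: saZ; split; [exact: bopD|rewrite (adjD bx bax) (adjK bx) addrC].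
apply: Psa; first by do 2!apply: (csZ cN); exact: (csB cN).
apply: saZ; split; first by apply: bopZ; exact: bopB.
rewrite (adjZ _ (bopB bax bx)) (adjB bax bx) (adjK bx).
have -> : ('i%C : R[i])^* = - 'i%C by apply/eqP; rewrite eq_complex /= oppr0 !eqxx.
by rewrite scaleNr -scalerN opprB.
Qed.

End Unitaries.

Record inclusion (R : realType) (K : hilbertType R) (T S : set (K -> K)) (tau : (K -> K) -> R[i])
    (XT X : biact K) (oneT : XT) (one : X) : Prop := Inclusion {
  in_T : standard_form T tau oneT ;
  in_S : standard_form S tau one ;
  in_sub : T `<=` S ;
  in_irr : commutant T `&` S = @scalars _ K }.

(** * Convex sets and functionals invariant under the unitaries of T *)

Section Ergodicity.
Variables (R : realType) (K : hilbertType R) (T S : set (K -> K)) (tau : (K -> K) -> R[i]).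
Variables (XT X : biact K) (oneT : XT) (one : X).
Hypothesis TS : inclusion T S tau oneT one.
Let LS := in_S TS.
Let vS : vn_algebra S. Proof. by case: LS. Qed.
Let fS : faithful_normal_tracial_state S tau. Proof. by case: LS. Qed.
Let vT : vn_algebra T. Proof. by case: (in_T TS). Qed.
Let cS := vn_cstar vS.
Let cT := vn_cstar vT.
Let bS := cs_bop cS.
Implicit Types (x y u : K -> K).
Local Notation hat := (hat one).

Lemma unitary_sub u : unitary T u -> unitary S u.
Proof. by case=> Tu u1 u2; split=> //; exact: (in_sub TS). Qed.

Lemma central_scalar x : S x -> (forall u, unitary T u -> u \o x = x \o u) ->
  exists a : R[i], x = a *: idfun.
Proof.
move=> Sx h; have : (commutant T `&` S) x.
  split=> //; split; first exact: bS.
  apply: (unitary_ind cT) => // a y z hy hz; symmetry.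
  by apply: comm_linear; [exact: bS|symmetry; exact: hy|symmetry; exact: hz].
by rewrite (in_irr TS) => -[a ->]; exists a.
Qed.

(** The element of least 2-norm is unique, hence fixed by conjugation with the unitaries of T, hence
    a scalar by irreducibility. *)
Lemma ergodic_scalar (C : set (K -> K)) : C `<=` S -> C !=set0 ->
  closed [set hat x | x in C] -> hconv [set hat x | x in C] ->
  (forall u x, unitary T u -> C x -> C (u \o x \o adj u)) -> exists a : R[i], C (a *: idfun).
Proof.
move=> CS [x1 Cx1] clC cvC inv.
have [|_ [x Cx <-] h] := hproj_ex 0 clC _ (hconv_mid cvC); first by exists (hat x1), x1.
suff [a e] : exists a : R[i], x = a *: idfun by exists a; rewrite -e.
have Sx := CS _ Cx.
apply: central_scalar => // u uT; have uS := unitary_sub uT; have [Su u1 u2] := uS.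
have auS := unitary_adj cS uS; have Sau : S (adj u) by case: auS.
have Sux := cs_comp cS Su Sx.
have e : u \o x \o adj u = x.
  apply: (hat_inj LS) => //; first exact: (cs_comp cS).
  apply/eqP; rewrite -subr_eq0; apply/eqP/hn_eq0/eqP; rewrite -sqrf_eq0; apply/eqP/le_anti.
  rewrite sqr_ge0 andbT; apply: le_trans (h _ _) _.
    by exists (u \o x \o adj u) => //; exact: inv.
  rewrite !sub0r !hnN pmulr_rle0 // subr_le0 ler_pXn2r ?nnegrE //.
  apply: le_trans (hat_onbr LS Sux Sau ler01 (unitary_onb cS auS)) _; rewrite mul1r.
  by apply: le_trans (hat_onbl LS Su Sx ler01 (unitary_onb cS uS)) _; rewrite mul1r.
by rewrite -[in RHS]e -[RHS]/((u \o x) \o (adj u \o u)) u1.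
Qed.

(** The operators in a ball which agree with [y] under the functional and under [tau] form a set to
    which [ergodic_scalar] applies. Evaluating both at the scalar found there shows that the
    functional is a multiple of the trace. *)
Lemma central_state (H : hilbertType R) (pi : (K -> K) -> (H -> H)) (I : finType) (v : I -> H) :
  nrep S pi ->
  (forall u y, unitary T u -> S y ->
     \sum_i '<<pi (u \o y \o adj u) (v i), v i>> = \sum_i '<<pi y (v i), v i>>) ->
  forall y, S y -> \sum_i '<<pi y (v i), v i>> = (\sum_i '<<v i, v i>>) * tau y.
Proof.
move=> npi inv y Sy; have jp := npi.1; pose om x := \sum_i '<<pi x (v i), v i>>.
pose V : hpow H I := [ffun i => v i]; pose P x : hpow H I := [ffun i => pi x (v i)].
have omE x : om x = '<<P x, V>> by rewrite hpow_inner; apply: eq_bigr => i _; rewrite !ffunE.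
have om_lin a x z : S x -> S z -> om (a *: x + z) = a * om x + om z.
  move=> Sx Sz; rewrite /om mulr_sumr -big_split /=; apply: eq_bigr => i _.
  by rewrite (jr_lin jp) // -[(_ + _) (v i)]/(a *: pi x (v i) + pi z (v i)) inner_linearl.
have [c c0 yc] := bop_onb (bS Sy).
pose C := [set x | [/\ S x, onb x c, om x = om y & tau x = tau y]].
have [|||||a [_ _ oa ta]] := @ergodic_scalar C.
- by move=> x [].
- by exists y.
- apply/hclosedP => z /hcvg_dense[w hw wz].
  pose x n := sval (cid2 (hw n)).
  have [h1 h2] : (forall n, C (x n)) /\ (fun n => hat (x n)) = w.
    by split=> [n|]; [|apply/funext => n]; rewrite /x; case: cid2.
  rewrite -h2 in wz.
  have Sx n : S (x n) by case: (h1 n).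
  have xc n : onb (x n) c by case: (h1 n).
  have [g [phi [Sg gc np hg hs]]] := ball_complete LS c0 Sx xc (hcvg_cauchy wz).
  exists g; last exact: hcvg_uniq hg wz.
  split=> //; last first.
    rewrite -(hat_one LS) // -(hat_one LS Sy).
    by apply: (hcvg_inner2 hg (hcvg_cst (hat y))) => n; rewrite !(hat_one LS) //; case: (h1 n).
  rewrite omE (omE y); have Pc : hcvg (fun n => P (x (phi n))) (P g).
    apply: hpow_hcvg => i; have -> : (fun n => P (x (phi n)) i) = (fun n => pi (x (phi n)) (v i)).
      by apply/funext => n; rewrite ffunE.
    by rewrite ffunE; exact: hs.
  apply: (hcvg_inner2 Pc (hcvg_cst (P y))) => n; rewrite -!omE.
  by case: (h1 (phi n)).
- move=> _ _ t t01 [x [Sx xc ox tx] <-] [z [Sz zc oz tz] <-].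
  have [g [Sg gc] gE] := ball_conv LS c0 t01 (ex_intro2 _ _ x (conj Sx xc) erefl) (ex_intro2 _ _ z (conj Sz zc) erefl).
  exists (x + t%:C%C *: (z - x)).
    have Szx := csB cS Sz Sx.
    have e : x + t%:C%C *: (z - x) = g.
      apply: (hat_inj LS) => //; first by apply: (csD cS) => //; exact: csZ.
      by rewrite gE (hatD LS) ?(hatZ LS) ?(hatB LS) //; exact: csZ.
    have oB : om (z - x) = 0 by rewrite addrC -scaleN1r om_lin // ox oz mulN1r addNr.
    have tB : tau (z - x) = 0 by rewrite (trB vS fS) // tx tz subrr.
    split; [by rewrite e|by rewrite e| |].
      by rewrite addrC om_lin // oB mulr0 add0r.
    by rewrite (trD fS) ?(trZ vS fS) ?tB ?mulr0 ?addr0 //; exact: csZ.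
  by rewrite (hatD LS) ?(hatZ LS) ?(hatB LS) //; do ?[exact: csZ|exact: csB]; apply: csZ => //; exact: csB.
- move=> u x uT [Sx xc ox tx]; have uS := unitary_sub uT; have auS := unitary_adj cS uS.
  have [Su u1 u2] := uS; have [Sau _ _] := auS; have Sux := cs_comp cS Su Sx.
  split.
  + exact: (cs_comp cS).
  + move=> w /=; have bu := bS Su; have bau := bS Sau.
    rewrite (unitary_isom _ bu u1); apply: le_trans (xc _) _.
    by rewrite (unitary_isom _ bau) // (adjK bu).
  + by rewrite /om inv.
  + by rewrite (trC fS Sux Sau) -[adj u \o (u \o x)]/((adj u \o u) \o x) u1.
have S1 := cs_id cS.
have om1 : om idfun = \sum_i '<<v i, v i>> by rewrite /om; under eq_bigr do rewrite (jr_id jp).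
have : om (a *: idfun) = a * om idfun.
  have := om_lin a _ _ S1 (cs0 cS); rewrite addr0 => ->.
  by rewrite /om [X in _ + X]big1 ?addr0 // => i _; rewrite (jr0 cS jp) inner0l.
rewrite -/(om y) oa om1 mulrC => ->; congr (_ * _).
by rewrite -ta (trZ vS fS) // (tr1 fS) mulr1.
Qed.

(** [central_state] at [a^* a], or at [a a^*] for an antirepresentation, identifies the sum of the
    squared norms of the vectors [pi a (v i)] with a multiple of that of [hat a]. *)
Lemma state_bound (H : hilbertType R) (pi : (K -> K) -> (H -> H)) (I : finType) (v : I -> H) :
  nrep S pi ->
  (forall u y, unitary T u -> S y ->
     \sum_i '<<pi (u \o y \o adj u) (v i), v i>> = \sum_i '<<pi y (v i), v i>>) ->
  exists2 C : R, 0 <= C & forall i a, S a -> hn (pi a (v i)) <= C * hn (hat a).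
Proof.
move=> npi inv; have jp := npi.1; exists (Num.sqrt (\sum_i hn (v i) ^+ 2)); first exact: sqrtr_ge0.
move=> i a Sa; have Saa := cs_adj cS Sa.
have s0 : 0 <= \sum_i hn (v i) ^+ 2 by apply: sumr_ge0 => j _; apply: sqr_ge0.
rewrite -(@ler_pXn2r _ 2) ?nnegrE ?mulr_ge0 ?sqrtr_ge0 // exprMn sqr_sqrtr //.
have key b : S b -> pi b = adj (pi a) \o pi a -> complex.Re (tau b) = hn (hat a) ^+ 2 ->
    hn (pi a (v i)) ^+ 2 <= (\sum_i hn (v i) ^+ 2) * hn (hat a) ^+ 2.
  move=> Sb pb tb; have := central_state npi inv Sb.
  have -> : \sum_i '<<v i, v i>> = (\sum_i hn (v i) ^+ 2)%:C%C.
    by rewrite rmorph_sum; apply: eq_bigr => j _; rewrite inner_xx.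
  move=> /(congr1 (@complex.Re _)); rewrite ReRM tb => <-.
  rewrite Re_sum (bigD1 i) //= pb.
  have E j : complex.Re '<<(adj (pi a) \o pi a) (v j), v j>> = hn (pi a (v j)) ^+ 2.
    by rewrite -adjPr ?inner_xx //; exact: (jr_bop jp).
  rewrite E lerDl; apply: sumr_ge0 => j _; rewrite E; exact: sqr_ge0.
case: (jr_mul jp) => mul.
  apply: (key (adj a \o a)); first exact: (cs_comp cS).
    by rewrite mul // (jr_adj jp).
  by rewrite (hat_hn2 LS).
apply: (key (a \o adj a)); first exact: (cs_comp cS).
  by rewrite mul // (jr_adj jp).
by rewrite (hat_hn2 LS) // /trR (trC fS Sa Saa).
Qed.

End Ergodicity.

(** * Frames of bimodules *)

Section Parseval_frames.
Variables (R : realType) (K : hilbertType R) (T S : set (K -> K)) (tau : (K -> K) -> R[i]).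
Variables (XT X : biact K) (oneT : XT) (one : X).
Hypothesis TS : inclusion T S tau oneT one.
Let LS := in_S TS.
Let LT := in_T TS.
Let vS : vn_algebra S. Proof. by case: LS. Qed.
Let vT : vn_algebra T. Proof. by case: LT. Qed.
Let fT : faithful_normal_tracial_state T tau. Proof. by case: LT. Qed.
Let cS := vn_cstar vS.
Let cT := vn_cstar vT.
Let bS := cs_bop cS.
Let bT := cs_bop cT.
Let TsS := in_sub TS.
Implicit Types (x y t u : K -> K).
Local Notation hatT := (hat oneT).
Local Notation hat := (hat one).
Local Notation la := (@lact _ _ X).
Local Notation ra := (@ract _ _ X).
Local Notation laT := (@lact _ _ XT).

Definition left_adj (H : biact K) :=
  forall t, T t -> forall xi eta, '<<@lact _ _ H t xi, eta>> = '<<xi, lact (adj t) eta>>.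

Definition left_linear (H H' : biact K) (f : H -> H') :=
  bounded_op f /\ forall t xi, T t -> f (lact t xi) = lact t (f xi).

Lemma left_adjT : left_adj XT. Proof. by move=> t Tt xi eta; apply: (la_adj LT). Qed.
Lemma left_adjX : left_adj X. Proof. by move=> t /TsS St xi eta; apply: (la_adj LS). Qed.

Lemma left_linear_comp (H1 H2 H3 : biact K) (f : H2 -> H3) (g : H1 -> H2) :
  left_linear f -> left_linear g -> left_linear (f \o g).
Proof.
move=> [bf hf] [bg hg]; split; first exact: bop_comp.
by move=> t xi Tt /=; rewrite hg // hf.
Qed.

Lemma left_linear_adj (H1 H2 : biact K) (f : H1 -> H2) : left_adj H1 -> left_adj H2 ->
  left_linear f -> left_linear (adj f).
Proof.
move=> a1 a2 [bf hf]; split; first exact: adj_bop.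
move=> t xi Tt; apply: inner_inj => z; have Tat := cs_adj cT Tt.
rewrite inner_conj [RHS]inner_conj; congr (_^*).
rewrite -(adjP bf) -{1 2}(adjK (bT Tt)) -(a1 _ Tat) -(adjP bf) hf //.
by rewrite (a2 _ Tat).
Qed.

(** A left T-linear operator on L^2(T) is right multiplication by an element of T, so the vector
    state of the unit is a trace on such operators. *)
Lemma trace_swap (c d : XT -> XT) : left_linear c -> left_linear d ->
  '<<c (d oneT), oneT>> = '<<d (c oneT), oneT>>.
Proof.
have vec (f : XT -> XT) : left_linear f -> exists2 m, T m & f oneT = hatT m.
  move=> [bf hf]; have [C C0 fC] := bop_onb bf.
  have [|m [Tm _ me]] := bounded_vectorl LT C0 (z := f oneT); last by exists m.
  by move=> a Ta; rewrite -hf //; apply: fC.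
move=> hc hd; have [m Tm cm] := vec c hc; have [m' Tm' dm] := vec d hd.
have E1 : c (hatT m') = laT m' (hatT m) by rewrite -cm; exact: hc.2.
have E2 : d (hatT m) = laT m (hatT m') by rewrite -dm; exact: hd.2.
rewrite cm dm E1 E2 (la_hat LT Tm' Tm) (la_hat LT Tm Tm') (hat_one LT (cs_comp cT Tm' Tm)).
by rewrite (hat_one LT (cs_comp cT Tm Tm')) (trC fT Tm' Tm).
Qed.

Lemma hatT_hn t : T t -> hn (hat t) = hn (hatT t).
Proof. by move=> Tt; apply: (hn_eq X) => //; rewrite (hat_hn2 LT) ?(hat_hn2 LS) //; exact: TsS. Qed.

Lemma right_mult_ex x : S x -> exists2 U : XT -> X, left_linear U &
  forall t, T t -> U (hatT t) = hat (t \o x).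
Proof.
move=> Sx; have [c c0 xc] := bop_onb (bS Sx).
pose G xi eta := exists t, [/\ T t, xi = hatT t & eta = hat (t \o x)].
have [|a xi eta xi' eta' [t [Tt -> ->]] [s [Ts -> ->]]|_ _ [t [Tt -> ->]]|U [bU _ UG U0]] := @ext_op _ _ _ G c c0.
- by exists 0; rewrite (hat0 LT) -(hat0 LS); split=> //; exact: cs0.
- exists (a *: t + s); split; first exact: cs_lin.
    by rewrite (hat_lin LT).
  by rewrite -(hat_lin LS) //; apply: (cs_comp cS) => //; exact: TsS.
- rewrite -hatT_hn //; apply: (hat_onbr LS) => //; exact: TsS.
exists U; last by move=> t Tt; apply: UG; exists t.
split=> // t xi Tt; have Tat := cs_adj cT Tt.
apply: (ext_op_comm (b := laT (adj t)) bU UG U0 (la_bop LT Tt) (la_bop LS (TsS Tt))).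
- by move=> z w; exact: left_adjT.
- move=> _ _ [s [Ts -> ->]]; exists (t \o s); split; first exact: (cs_comp cT).
    by rewrite (la_hat LT).
  by rewrite (la_hat LS) //; [exact: TsS|apply: (cs_comp cS) => //; exact: TsS].
- move=> _ y [s [Ts -> _]]; exists (hat ((adj t \o s) \o x)), (adj t \o s).
  by split; [exact: (cs_comp cT)|rewrite (la_hat LT)|].
Qed.

Definition sub_bimod (D : set X) := [/\ closed_subspace D,
  forall t z, T t -> D z -> D (la t z) & forall t z, T t -> D z -> D (ra t z)].

(* [D] is contained in the closure of the sum of the spaces [T x_i]. *)
Definition left_gen (D : set X) (I : finType) (x : I -> K -> K) := (forall i, S (x i)) /\
  forall p, (forall i t, T t -> '<<p, hat (t \o x i)>> = 0) -> forall z, D z -> '<<p, z>> = 0.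

(* With [U_i] from [right_mult_ex] and [b^2 = sum U_i U_i^*], the maps
   [b xi |-> U_i^* xi] form a Parseval frame of the closure of the range of [b]. *)
Lemma frame_ex (D : set X) (I : finType) (x : I -> K -> K) : sub_bimod D -> @left_gen D I x ->
  exists V : I -> X -> XT, [/\ (forall i, left_linear (V i)),
    (forall z, \sum_i adj (V i) (V i z) = proj D z) & (forall i z, V i (proj D z) = V i z)].
Proof.
move=> [cD Dl Dr] [Sx gen].
pose U i := sval (cid2 (right_mult_ex (Sx i))).
have hU i : left_linear (U i) by rewrite /U; case: cid2.
have UE i t : T t -> U i (hatT t) = hat (t \o x i) by rewrite /U; case: cid2 => /= V _; apply.
have bU i := (hU i).1; have haU i := left_linear_adj left_adjT left_adjX (hU i); have baU i := (haU i).1.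
pose A : set (X -> X) := [set la t | t in T].
have cN : cstar (commutant A).
  apply: commutant_cstar => [_ [t Tt <-]|_ [t Tt <-]]; first exact: (la_bop LS (TsS Tt)).
  by exists (adj t); [exact: cs_adj|exact: (jr_adj (la_nrep LS).1 (TsS Tt))].
pose B := \sum_i (U i \o adj (U i)) : X -> X.
have BE z : B z = \sum_i U i (adj (U i) z) by rewrite /B sum_opE.
have NB : commutant A B.
  apply: (cs_sum cN) => i _; split; first exact: bop_comp.
  move=> _ [t Tt <-]; apply/funext => z /=; by rewrite (haU i).2 // (hU i).2.
have pB : psd B.
  apply: psd_sum => i _; have := psd_adj_comp (baU i); by rewrite (adjK (bU i)).
have BB z w : '<<B z, w>> = \sum_i '<<adj (U i) z, adj (U i) w>>.
  by rewrite BE inner_suml; apply: eq_bigr => i _; rewrite (adjP (bU i)).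
have [b [Nb pb bb _]] := cs_sqrt cN NB pB.
have bE z w : '<<b z, b w>> = \sum_i '<<adj (U i) z, adj (U i) w>>.
  by rewrite -(sa_inner pb.1) -BB -bb.
have bla t z : T t -> b (la t z) = la t (b z).
  by move=> Tt; have [_ h] := Nb; have := congr1 (fun f => f z) (h (la t) (ex_intro2 _ _ t Tt erefl)).
have lb := bop_lin pb.1.1.
have Vex i : {V : X -> XT | [/\ left_linear V, (forall z, V (b z) = adj (U i) z) &
    (forall z, (forall w, '<<z, b w>> = 0) -> V z = 0)]}.
  apply/cid; pose G xi eta := exists z, xi = b z /\ eta = adj (U i) z.
  have la_ := bop_lin (baU i).
  have [|a xi eta xi' eta' [z [-> ->]] [w [-> ->]]|_ _ [z [-> ->]]|V [bV _ VG V0]] := @ext_op _ _ _ G 1 ler01.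
  - by exists 0; rewrite (lin0 lb) (lin0 la_).
  - by exists (a *: z + w); rewrite lb la_.
  - rewrite mul1r -(@ler_pXn2r _ 2) ?nnegrE // -!dotxx /dot bE Re_sum (bigD1 i) //= lerDl.
    by apply: sumr_ge0 => j _; rewrite inner_xx sqr_ge0.
  exists V; split.
  - split=> // t xi Tt; have Tat := cs_adj cT Tt.
    apply: (ext_op_comm (b := la (adj t)) bV VG V0 (la_bop LS (TsS Tt)) (la_bop LT Tt)).
    + by move=> z w; exact: left_adjX.
    + by move=> _ _ [z [-> ->]]; exists (la t z); rewrite bla // (haU i).2.
    + by move=> _ y [z [-> _]]; exists (adj (U i) (la (adj t) z)), (la (adj t) z); rewrite bla.
  - by move=> z; apply: VG; exists z.
  - by move=> z h; apply: V0 => _ _ [w [-> _]]; exact: h.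
pose V i := sval (Vex i).
have [hV Vb V0] : [/\ (forall i, left_linear (V i)), (forall i z, V i (b z) = adj (U i) z) &
    (forall i z, (forall w, '<<z, b w>> = 0) -> V i z = 0)].
  by split=> i; rewrite /V; case: (svalP (Vex i)).
have bV i := (hV i).1; have baV i := adj_bop (bV i).
pose Z := \sum_i (adj (V i) \o V i) : X -> X.
have ZE z : Z z = \sum_i adj (V i) (V i z) by rewrite /Z sum_opE.
have bZ : bounded_op Z by apply: bop_sum => i _; exact: bop_comp.
have ZZ z w : '<<Z z, w>> = \sum_i '<<V i z, V i w>>.
  by rewrite ZE inner_suml; apply: eq_bigr => i _; rewrite inner_conj -(adjP (bV i)) -inner_conj.
have Zb z : Z (b z) = b z.
  have h w : '<<Z (b z) - b z, b w>> = 0.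
    rewrite innerBl ZZ bE; apply/eqP; rewrite subr_eq0; apply/eqP.
    by apply: eq_bigr => i _; rewrite !Vb.
  apply/eqP; rewrite -subr_eq0; apply/eqP/hn_eq0/eqP; rewrite -sqrf_eq0 -dotxx /dot.
  rewrite innerBr h subr0 inner_conj ZZ big1 ?conjC0 // => i _; by rewrite (V0 i _ h) inner0r.
pose Y := closure (lspan (range b)); have cY : closed_subspace Y := lspan_csub _.
have YB z : Y (b z) by apply: subset_closure; apply: lspanS; exists z.
have ZY z : Y z -> Z z = z.
  move=> /hclosureP/hcvg_dense[u hu uz]; apply: (hcvg_uniq (bop_hcvg bZ uz)).
  have -> : (fun n => Z (u n)) = u; last exact: uz.
  apply/funext => n; have [m [a [w [Aw ->]]]] := hu n.
  rewrite (lin_sum (bop_lin bZ)); apply: eq_bigr => i _; rewrite (linZ (bop_lin bZ)).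
  by have [v _ <-] := Aw i; rewrite Zb.
(* The component of [z] orthogonal to the range of [b] is killed by every [adj (U i)], hence
   orthogonal to the generators of D, and so to [z] itself. *)
have DY z : D z -> Y z.
  move=> Dz; pose p := z - proj Y z; have pY w : Y w -> '<<p, w>> = 0 by have [_ h] := projP cY z; exact: h.
  have bp : b p = 0.
    by apply: dot_ext => w; rewrite (sa_dot pb.1) /dot pY.
  have Up i : adj (U i) p = 0.
    apply: hn_eq0; apply/eqP; rewrite -sqrf_eq0 -dotxx; apply/eqP/le_anti.
    rewrite dotxx sqr_ge0 andbT -dotxx.
    have : dot (b p) (b p) = 0 by rewrite bp dot0l.
    rewrite /dot bE Re_sum (bigD1 i) //= => <-; rewrite lerDl.
    by apply: sumr_ge0 => j _; rewrite inner_xx sqr_ge0.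
  have pz : '<<p, z>> = 0.
    apply: (gen _ _ _ Dz) => i t Tt; rewrite -UE // inner_conj (adjP (bU i)) Up inner0r conjC0 //.
  have p0 : p = 0.
    apply: hn_eq0; apply/eqP; rewrite -sqrf_eq0 -dotxx /dot {2}/p innerBr pz pY ?subrr //.
    exact: proj_in.
  by move/eqP: p0; rewrite subr_eq0 => /eqP ->; exact: proj_in.
have bP := proj_bop cD; have lP : left_linear (proj D).
  split=> // t z Tt; have Tat := cs_adj cT Tt.
  apply: (proj_comm cD (bop_lin (la_bop LS (TsS Tt))) (bop_lin (la_bop LS (TsS Tat)))).
  - by move=> a c; exact: left_adjX.
  - by move=> a; exact: Dl.
  - by move=> a; exact: Dl.
exists (fun i => V i \o proj D); split=> [i|z|i z].
- exact: left_linear_comp.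
- have E : \sum_i adj (V i) (V i (proj D z)) = proj D z by rewrite -ZE ZY //; apply: DY; exact: proj_in.
  rewrite -[RHS](proj_idem cD) -E (lin_sum (bop_lin bP)); apply: eq_bigr => i _.
  by rewrite (adj_comp (bV i) bP) (adj_proj cD).
- by rewrite /= (proj_idem cD).
Qed.

End Parseval_frames.

Lemma lspan_min (R : realType) (H : hilbertType R) (A Y : set H) : closed_subspace Y ->
  A `<=` Y -> closure (lspan A) `<=` Y.
Proof.
move=> cY AY z /hclosureP/hcvg_dense[u hu uz]; have [Y0 YL cl] := cY.
apply: (hcvg_closed cl _ uz) => n; have [m [a [w [Aw ->]]]] := hu n.
elim/big_rec: _ => // i v _ Yv; exact: YL (AY _ (Aw i)) Yv.
Qed.

Lemma preim_csub (R : realType) (H H' : hilbertType R) (f : H -> H') (Y : set H') : closed_subspace Y ->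
  bounded_op f -> closed_subspace [set z | Y (f z)].
Proof.
move=> [Y0 YL cl] bf; have lf := bop_lin bf; split=> [|a u v /= Yu Yv|].
- by rewrite /= (lin0 lf).
- by rewrite lf; apply: YL.
- apply/hclosedP => z /hcvg_dense[u hu uz]; exact: (hcvg_closed cl hu (bop_hcvg bf uz)).
Qed.

(** * Frames whose elements lie in S and whose coefficients lie in T *)

Section Frames.
Variables (R : realType) (K : hilbertType R) (T S : set (K -> K)) (tau : (K -> K) -> R[i]).
Variables (XT X : biact K) (oneT : XT) (one : X).
Hypothesis TS : inclusion T S tau oneT one.
Let LS := in_S TS.
Let LT := in_T TS.
Let vS : vn_algebra S. Proof. by case: LS. Qed.
Let fS : faithful_normal_tracial_state S tau. Proof. by case: LS. Qed.
Let vT : vn_algebra T. Proof. by case: LT. Qed.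
Let cS := vn_cstar vS.
Let cT := vn_cstar vT.
Let bS := cs_bop cS.
Let bT := cs_bop cT.
Let TsS := in_sub TS.
Implicit Types (x y t u : K -> K) (D : set X) (W : X -> X).
Local Notation hatT := (hat oneT).
Local Notation left_linear := (@left_linear _ _ T).
Local Notation sub_bimod := (@sub_bimod _ _ T X).
Local Notation left_gen := (left_gen T S one).
Local Notation J := (Jop S one).
Local Notation hat := (hat one).
Local Notation la := (@lact _ _ X).
Local Notation ra := (@ract _ _ X).

Definition tbi W := [/\ bounded_op W, forall t z, T t -> W (la t z) = la t (W z)
  & forall t z, T t -> W (ra t z) = ra t (W z)].

Lemma tbi_left W : tbi W -> left_linear W.
Proof. by case. Qed.

Lemma tbi_cstar : cstar tbi.
Proof.
pose A : set (X -> X) := [set la t | t in T] `|` [set ra t | t in T].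
have -> : tbi = commutant A.
  apply/seteqP; split=> [W [bW Wl Wr]|W [bW h]].
    split=> // _ [[t Tt <-]|[t Tt <-]]; apply/funext => z /=; first by rewrite Wl.
    by rewrite Wr.
  split=> // t z Tt; [have hA : A (la t) by left; exists t|have hA : A (ra t) by right; exists t];
    by rewrite -[LHS]/((W \o _) z) -h.
apply: commutant_cstar => _ [[t Tt <-]|[t Tt <-]]; have St := TsS Tt.
- exact: la_bop LS _ St.
- exact: ra_bop LS _ St.
- by left; exists (adj t); [exact: cs_adj|exact: (jr_adj (la_nrep LS).1 St)].
- by right; exists (adj t); [exact: cs_adj|exact: (jr_adj (ra_nrep LS).1 St)].
Qed.

Lemma tbi_J W : tbi W -> tbi (J \o W \o J).
Proof.
move=> [bW Wl Wr]; have lW := bop_lin bW; have [c c0 Wc] := bop_onb bW; split.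
- apply: (@bopI _ _ _ _ c) => [a z w /=|z /=].
    by rewrite (Jop_lin LS) lW (Jop_lin LS) conjCK.
  by rewrite (Jop_hn LS); apply: le_trans (Wc _) _; rewrite (Jop_hn LS).
- move=> t z Tt /=; have Tat := cs_adj cT Tt.
  by rewrite (Jop_la LS _ (TsS Tt)) Wr // (Jop_ra LS _ (TsS Tat)) (adjK (bT Tt)).
- move=> t z Tt /=; have Tat := cs_adj cT Tt.
  by rewrite (Jop_ra LS _ (TsS Tt)) Wl // (Jop_la LS _ (TsS Tat)) (adjK (bT Tt)).
Qed.

Lemma proj_tbi D : sub_bimod D -> tbi (proj D).
Proof.
move=> [cD Dl Dr]; split; first exact: proj_bop.
  move=> t z Tt; have Tat := cs_adj cT Tt; have [St Sat] := (TsS Tt, TsS Tat).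
  apply: (proj_comm cD (bop_lin (la_bop LS St)) (bop_lin (la_bop LS Sat))).
  - by move=> a c; exact: (la_adj LS).
  - by move=> a; exact: Dl.
  - by move=> a; exact: Dl.
move=> t z Tt; have Tat := cs_adj cT Tt; have [St Sat] := (TsS Tt, TsS Tat).
apply: (proj_comm cD (bop_lin (ra_bop LS St)) (bop_lin (ra_bop LS Sat))).
- by move=> a c; exact: (ra_adj LS).
- by move=> a; exact: Dr.
- by move=> a; exact: Dr.
Qed.

Section Frame_trace.
Variables (D : set X) (I : finType) (V : I -> X -> XT).
Hypothesis sD : sub_bimod D.
Hypothesis hV : forall i, left_linear (V i).
Hypothesis sumV : forall z, \sum_i adj (V i) (V i z) = proj D z.
Hypothesis projV : forall i z, V i (proj D z) = V i z.

Let bV i := (hV i).1.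
Let cD : closed_subspace D. Proof. by case: sD. Qed.

Lemma frame_range i w : proj D (adj (V i) w) = adj (V i) w.
Proof.
apply: inner_inj => z; rewrite (proj_sa cD) inner_conj [RHS]inner_conj; congr (_^*).
by rewrite -!(adjP (bV i)) projV.
Qed.

(** The sum is the left T-trace on D of [A'^* A], computed in the frame; right multiplication by [u]
    is a unitary of D and left T-linear, so it preserves this trace. The proof expands by the
    Parseval identity and exchanges factors with [trace_swap]. *)
Lemma frame_trace (A A' : X -> X) u : left_linear A -> left_linear A' -> unitary T u ->
  \sum_i '<<A (ra u (adj (V i) oneT)), A' (ra u (adj (V i) oneT))>> =
  \sum_i '<<A (adj (V i) oneT), A' (adj (V i) oneT)>>.
Proof.
move=> lA lA' [Tu u1 u2]; have Tau := cs_adj cT Tu; have [Su Sau] := (TsS Tu, TsS Tau).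
pose Z := adj A' \o A.
have lZ : left_linear Z.
  by apply: (left_linear_comp _ lA); apply: (left_linear_adj TS _ _ lA'); exact: left_adjX TS.
have ZE z w : '<<A z, A' w>> = '<<Z z, w>>.
  by rewrite inner_conj (adjP lA'.1) -inner_conj.
have lr t : T t -> left_linear (ra t).
  move=> Tt; have St := TsS Tt; split; first exact: (ra_bop LS).
  by move=> s z Ts; rewrite (laraC LS) //; exact: TsS.
have lU i : left_linear (adj (V i)).
  by apply: (left_linear_adj TS _ _ (hV i)); [exact: left_adjX TS|exact: left_adjT TS].
have rr z : ra u (ra (adj u) z) = z.
  by rewrite -[LHS]/((ra u \o ra (adj u)) z) -(raM LS Sau Su) u1 (jr_id (ra_nrep LS).1).
have rr' z : ra (adj u) (ra u z) = z.
  by rewrite -[LHS]/((ra (adj u) \o ra u) z) -(raM LS Su Sau) u2 (jr_id (ra_nrep LS).1).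
under eq_bigr do rewrite ZE; under [RHS]eq_bigr do rewrite ZE.
have Pr z : proj D (ra u z) = ra u (proj D z) by have [_ _ h] := proj_tbi sD; apply: h.
transitivity (\sum_i \sum_k '<<(V i \o ra (adj u) \o Z \o adj (V k)) ((V k \o ra u \o adj (V i)) oneT), oneT>>).
  apply: eq_bigr => i _; rewrite -(inner_suml _ _ (fun k => _ _)).
  have e : \sum_k adj (V k) (V k (ra u (adj (V i) oneT))) = ra u (adj (V i) oneT).
    by rewrite sumV Pr frame_range.
  transitivity '<<(V i \o ra (adj u) \o Z) (ra u (adj (V i) oneT)), oneT>>.
    rewrite /= (adjP (bV i)) (ra_adj LS _ _ Sau) (adjK (bS Su)) //.
  congr ('<<_, _>>); rewrite -{1}e.
  have l : linear (V i \o ra (adj u) \o Z).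
    by apply: bop_lin; apply: bop_comp lZ.1; apply: bop_comp (lr _ Tau).1.
  by rewrite (lin_sum l).
transitivity (\sum_k \sum_i '<<(V k \o ra u \o adj (V i)) ((V i \o ra (adj u) \o Z \o adj (V k)) oneT), oneT>>).
  rewrite exchange_big /=; apply: eq_bigr => k _; apply: eq_bigr => i _.
  apply: (trace_swap TS (c := V i \o ra (adj u) \o Z \o adj (V k)) (d := V k \o ra u \o adj (V i))).
    exact: left_linear_comp (left_linear_comp (left_linear_comp (hV i) (lr _ Tau)) lZ) (lU k).
  exact: left_linear_comp (left_linear_comp (hV k) (lr _ Tu)) (lU i).
apply: eq_bigr => k _; rewrite -(inner_suml _ _ (fun i => _ _)).
have l : linear (V k \o ra u) by apply: bop_lin; apply: bop_comp (lr _ Tu).1.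
transitivity '<<(V k \o ra u) (\sum_i adj (V i) (V i (ra (adj u) (Z (adj (V k) oneT))))), oneT>>.
  by rewrite (lin_sum l).
by rewrite sumV /= -Pr rr projV (adjP (bV k)).
Qed.

(** By [frame_trace] the functionals [y |-> <v_i y, v_i>] of the vectors [v_i = W (adj (V i) oneT)]
    have a sum which is invariant under the unitaries of T. [state_bound] for the right action then
    makes each vector bounded, although it was constructed in L^2(S) only. *)
Lemma frame_bounded W i : tbi W -> exists2 n, S n & W (adj (V i) oneT) = hat n.
Proof.
move=> tW; have lW := tbi_left tW; have [bW Wl Wr] := tW.
have [|C C0 hC] := @state_bound _ _ _ _ _ _ _ _ _ TS X (@ract _ _ X) I (fun i => W (adj (V i) oneT)) (ra_nrep LS).
  move=> u y uT Sy; have [Tu u1 u2] := uT; have Tau := cs_adj cT Tu; have [Su Sau] := (TsS Tu, TsS Tau).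
  rewrite (raM LS (cs_comp cS Su Sy) Sau) (raM LS Su Sy).
  have lA : left_linear (ra y \o W).
    apply: left_linear_comp lW; split; first exact: (ra_bop LS).
    by move=> t z Tt; rewrite (laraC LS) //; exact: TsS.
  rewrite -(frame_trace lA lW uT); apply: eq_bigr => j _ /=.
  by rewrite (ra_adj LS _ _ Sau) (adjK (bS Su)) !Wr.
have [n [Sn _ e]] := bounded_vector LS C0 (hC i).
by exists n.
Qed.

End Frame_trace.

Lemma hn_le_hat (w : XT) (c : R) : 0 <= c -> (forall t, T t -> dot w (hatT t) <= c * hn (hatT t)) -> hn w <= c.
Proof.
move=> c0 h; rewrite leNgt; apply/negP => lt; have w0 := le_lt_trans c0 lt.
pose e := (hn w - c) * hn w / (2 * (c + hn w)); have p : 0 < 2 * (c + hn w) by lra.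
have e0 : 0 < e by rewrite divr_gt0 // mulr_gt0 // subr_gt0.
have [t Tt te] := hat_dense LT w e0; have := h t Tt.
have : hn w ^+ 2 = dot w (hatT t) + dot w (w - hatT t) by rewrite -dotxx -dotDr addrC subrK.
have := dot_CS w (w - hatT t); have : hn (hatT t) <= hn w + hn (w - hatT t).
  by have := hnB w (w - hatT t); rewrite opprB addrC subrK.
have : e * (2 * (c + hn w)) = (hn w - c) * hn w by rewrite /e divfK // gt_eqF.
move: te; set d := hn (w - _); have := hn_ge0 (w - hatT t); rewrite -/d; nra.
Qed.

(** A Pimsner-Popa type basis of D as a left T-module. The coefficient [e i x] is the conditional
    expectation onto T of [x m_i^*], and [lf_exp] is the resulting expansion. *)
Record left_frame D (I : finType) (V : I -> X -> XT) (m : I -> K -> K)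
    (e : I -> (K -> K) -> (K -> K)) : Prop := LeftFrame {
  lf_bimod : sub_bimod D ;
  lf_lin : forall i, left_linear (V i) ;
  lf_sum : forall z, \sum_i adj (V i) (V i z) = proj D z ;
  lf_proj : forall i z, V i (proj D z) = V i z ;
  lf_S : forall i, S (m i) ;
  lf_m : forall i, adj (V i) oneT = hat (m i) ;
  lf_T : forall i x, S x -> T (e i x) ;
  lf_e : forall i x, S x -> V i (hat x) = hatT (e i x) }.

Lemma left_frame_ex D (I : finType) (x : I -> K -> K) : sub_bimod D -> left_gen D x ->
  exists V m e, @left_frame D I V m e.
Proof.
move=> sD gD; have [V [hV sV pV]] := frame_ex TS sD gD.
have idT : tbi idfun by split=> //; exact: bop_id.
pose m i := sval (cid2 (frame_bounded sD hV sV pV i idT)).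
have Sm i : S (m i) by rewrite /m; case: cid2.
have mE i : adj (V i) oneT = hat (m i) by rewrite /m; case: cid2.
have eex i y : {e | S y -> T e /\ V i (hat y) = hatT e}.
  apply/cid; have [Sy|nSy] := pselect (S y); last by exists 0.
  have [c c0 yc] := bop_onb (bS Sy); have [d d0 md] := bop_onb (bS (Sm i)).
  have Sam := cs_adj cS (Sm i).
  have [|e [Te _ he]] := bounded_vector LT (mulr_ge0 c0 d0) (z := V i (hat y)); last by exists e.
  move=> a Ta; have Taa := cs_adj cT Ta; have [Sa Saa] := (TsS Ta, TsS Taa).
  apply: hn_le_hat => [|t Tt]; first by rewrite !mulr_ge0.
  have St := TsS Tt; have Tta := cs_comp cT Tt Taa; have Sta := TsS Tta; have Sat := cs_adj cS St.
  have lU : left_linear (adj (V i)).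
    by apply: (left_linear_adj TS _ _ (hV i)); [exact: left_adjX TS|exact: left_adjT TS].
  (* [V i (hat y)] is the projection onto L^2(T) of the vector of [y m_i^*], so it inherits the
     operator bound of [y m_i^*]. *)
  have E : '<<ract a (V i (hat y)), hatT t>> = '<<hat ((y \o adj (m i)) \o a), hat t>>.
    rewrite (ra_adj LT _ _ Ta) (ra_hat LT Taa Tt) (adjP (hV i).1).
    have -> : adj (V i) (hatT (t \o adj a)) = hat ((t \o adj a) \o m i).
      by rewrite -(la_hat LS Sta (Sm i)) -mE; exact: lU.2.
    have Sm' := Sm i; have S1 := cs_comp cS Sta Sm'.
    rewrite (hat_inner LS Sy S1) (hat_inner LS (cs_comp cS (cs_comp cS Sy Sam) Sa) St).
    rewrite (adj_comp (bS Sta) (bS Sm')) (adj_comp (bS St) (bS Saa)) (adjK (bS Sa)).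
    rewrite -[(adj (m i) \o (a \o adj t)) \o y]/((adj (m i) \o a) \o (adj t \o y)).
    rewrite (trC fS (cs_comp cS Sam Sa) (cs_comp cS Sat Sy)).
    by [].
  rewrite /dot E -/(dot _ _); apply: le_trans (dot_CS _ _) _.
  rewrite (hatT_hn TS Tt) ler_wpM2r // -(hatT_hn TS Ta) -mulrA.
  apply: le_trans (hat_onbl LS (cs_comp cS Sy Sam) Sa (mulr_ge0 c0 d0) _) _; last by rewrite mulrA.
  by apply: onb_comp => //; apply: adj_onb => //; exact: bS.
exists V, m, (fun i y => sval (eex i y)); split=> // i y Sy; by case: (svalP (eex i y)).
Qed.

Section Left_frame_theory.
Variables (D : set X) (I : finType) (V : I -> X -> XT) (m : I -> K -> K) (e : I -> (K -> K) -> (K -> K)).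
Hypothesis F : left_frame D V m e.

Lemma lf_mem i : D (hat (m i)).
Proof.
have [cD _ _] := lf_bimod F.
by rewrite -(lf_m F) -(frame_range (lf_bimod F) (lf_lin F) (lf_proj F)); exact: proj_in.
Qed.

Lemma lf_adj_hat i t : T t -> adj (V i) (hatT t) = hat (t \o m i).
Proof.
move=> Tt; rewrite -(la_hat LS (TsS Tt) (lf_S F i)) -(lf_m F).
have [_ h] : left_linear (adj (V i)); last exact: h.
by apply: (left_linear_adj TS _ _ (lf_lin F i)); [exact: left_adjX TS|exact: left_adjT TS].
Qed.

Lemma lf_exp x : S x -> D (hat x) -> x = \sum_i (e i x \o m i).
Proof.
move=> Sx Dx; have [cD _ _] := lf_bimod F.
have Si i : S (e i x \o m i) by apply: (cs_comp cS); [apply: TsS; exact: (lf_T F)|exact: (lf_S F)].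
apply: (hat_inj LS) => //; first by apply: (cs_sum cS).
rewrite (hat_sum LS) // -{1}(proj_id cD Dx) -(lf_sum F); apply: eq_bigr => i _.
by rewrite (lf_e F) // lf_adj_hat //; exact: (lf_T F).
Qed.

Lemma lf_norm x i : S x -> D (hat x) -> hn (hat (e i x)) <= hn (hat x).
Proof.
move=> Sx Dx; have [cD _ _] := lf_bimod F; have Ti := lf_T F i Sx.
rewrite (hatT_hn TS Ti) -(lf_e F) // -(@ler_pXn2r _ 2) ?nnegrE // -!dotxx.
rewrite -{3}(proj_id cD Dx) -(lf_sum F) dot_suml (bigD1 i) //=.
have E j : dot (adj (V j) (V j (hat x))) (hat x) = dot (V j (hat x)) (V j (hat x)).
  by rewrite dotC -(adj_dot (lf_lin F j).1).
by rewrite E lerDl; apply: sumr_ge0 => j _; rewrite E dotxx sqr_ge0.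
Qed.

Lemma lf_tbi W : tbi W -> exists n : I -> K -> K, forall i, S (n i) /\ W (hat (m i)) = hat (n i).
Proof.
move=> tW; pose h i := cid2 (frame_bounded (lf_bimod F) (lf_lin F) (lf_sum F) (lf_proj F) i tW).
by exists (fun i => sval (h i)) => i; case: (h i) => n /= Sn <-; rewrite (lf_m F).
Qed.

End Left_frame_theory.

End Frames.

(** * The quasi-normalizer *)

Section Quasi_normalizer.
Variables (R : realType) (K : hilbertType R) (T S : set (K -> K)) (tau : (K -> K) -> R[i]).
Variables (XT X : biact K) (oneT : XT) (one : X).
Hypothesis TS : inclusion T S tau oneT one.
Let LS := in_S TS.
Let LT := in_T TS.
Let vS : vn_algebra S. Proof. by case: LS. Qed.
Let vT : vn_algebra T. Proof. by case: LT. Qed.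
Let cS := vn_cstar vS.
Let cT := vn_cstar vT.
Let bS := cs_bop cS.
Let bT := cs_bop cT.
Let TsS := in_sub TS.
Implicit Types (x y t u : K -> K) (D : set X) (W : X -> X).
Local Notation sub_bimod := (@sub_bimod _ _ T X).
Local Notation left_gen := (left_gen T S one).
Local Notation left_frame := (left_frame T S oneT one).
Local Notation J := (Jop S one).
Local Notation hat := (hat one).
Local Notation tbi := (@tbi _ _ T X).
Local Notation Q := (QN T S).

(** One half of the quasi-normalizer condition, with any finite index type; the other half is the
    same condition for the adjoint. *)
Definition left_qn x := exists (I : finType) (u : I -> K -> K), (forall i, S (u i)) /\
  forall t, T t -> exists s : I -> K -> K, (forall i, T (s i)) /\ x \o t = \sum_i (s i \o u i).

Lemma comp_sumr (I : finType) y (F : I -> K -> K) : linear y -> y \o (\sum_i F i) = \sum_i (y \o F i).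
Proof. by move=> ly; apply/funext => v; rewrite sum_opE /= sum_opE (lin_sum ly). Qed.
Lemma comp_suml (I : finType) y (F : I -> K -> K) : (\sum_i F i) \o y = \sum_i (F i \o y).
Proof. by apply/funext => v; rewrite /= !sum_opE. Qed.

Lemma QNP x : Q x <-> [/\ S x, left_qn x & left_qn (adj x)].
Proof.
split=> [[Sx [n [u [Su h]]] [n' [u' [Su' h']]]]|[Sx [I [u [Su h]]] [I' [u' [Su' h']]]]].
  split=> //; first by exists 'I_n, u.
  exists 'I_n', (fun i => adj (u' i)); split=> [i|t Tt]; first exact: cs_adj.
  have [s [Ts e]] := h' _ (cs_adj cT Tt); exists (fun i => adj (s i)); split=> [i|]; first exact: cs_adj.
  rewrite -[t in LHS](adjK (bT Tt)) -(adj_comp (bT (cs_adj cT Tt)) (bS Sx)) e adj_sum => [|i].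
    by apply: eq_bigr => i _; rewrite (adj_comp (bS (Su' i)) (bT (Ts i))).
  by apply: bop_comp; [exact: bS|exact: bT].
split=> //.
  exists #|I|, (fun k => u (enum_val k)); split=> // t Tt; have [s [Ts e]] := h t Tt.
  exists (fun k => s (enum_val k)); split=> //.
  by rewrite e (reindex (@enum_val I I)) //; exact/onW_bij/enum_val_bij.
exists #|I'|, (fun k => adj (u' (enum_val k))); split=> [i|t Tt]; first exact: cs_adj.
have [s [Ts e]] := h' _ (cs_adj cT Tt).
exists (fun k => adj (s (enum_val k))); split=> [i|]; first exact: cs_adj.
have Tat := cs_adj cT Tt; have Sax := cs_adj cS Sx.
rewrite -[t in LHS](adjK (bT Tt)) -[x in LHS](adjK (bS Sx)) -(adj_comp (bS Sax) (bT Tat)) e adj_sum => [|i].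
  rewrite (reindex (@enum_val I' I')) /=; last exact/onW_bij/enum_val_bij.
  by apply: eq_bigr => i _; rewrite (adj_comp (bT (Ts _)) (bS (Su' _))).
by apply: bop_comp; [exact: bT|exact: bS].
Qed.

Lemma QN_S x : Q x -> S x. Proof. by case. Qed.

Lemma QN_adj x : Q x -> Q (adj x).
Proof. by move=> /QNP[Sx h h']; apply/QNP; split=> //; [exact: cs_adj|rewrite (adjK (bS Sx))]. Qed.

Lemma left_qn_lin a x y : left_qn x -> left_qn y -> left_qn (a *: x + y).
Proof.
move=> [I [u [Su h]]] [I' [u' [Su' h']]].
exists (I + I')%type, (fun i => match i with inl i => a *: u i | inr i => u' i end); split=> [[i|i]|t Tt] //.
  exact: csZ.
have [s [Ts e]] := h t Tt; have [s' [Ts' e']] := h' t Tt.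
exists (fun i => match i with inl i => s i | inr i => s' i end); split=> [[i|i]|] //.
rewrite big_sumType /= -e'.
have -> : \sum_i (s i \o (a *: u i)) = a *: (x \o t).
  rewrite e scaler_sumr; apply: eq_bigr => i _; apply/funext => v.
  exact: (linZ (bop_lin (bT (Ts i)))).
by [].
Qed.

Lemma left_qn_comp x y : S x -> S y -> left_qn x -> left_qn y -> left_qn (x \o y).
Proof.
move=> Sx Sy [I [u [Su h]]] [I' [u' [Su' h']]].
exists (I * I')%type, (fun i => u i.1 \o u' i.2); split=> [i|t Tt]; first exact: (cs_comp cS).
have [s' [Ts' e']] := h' t Tt.
have hs j : {s : I -> K -> K | (forall i, T (s i)) /\ x \o s' j = \sum_i (s i \o u i)}.
  by apply/cid; apply: h.
exists (fun i => sval (hs i.2) i.1); split=> [i|]; first by case: (svalP (hs i.2)).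
rewrite -[(x \o y) \o t]/(x \o (y \o t)) e' comp_sumr; last exact: bop_lin (bS Sx).
rewrite -(pair_bigA _ (fun i j => sval (hs j) i \o (u i \o u' j))) /= exchange_big /=.
apply: eq_bigr => j _; have [_ e] := svalP (hs j).
by transitivity ((\sum_i (sval (hs j) i \o u i)) \o u' j); [rewrite -e|rewrite comp_suml].
Qed.

Lemma QN_lin a x y : Q x -> Q y -> Q (a *: x + y).
Proof.
move=> /QNP[Sx h1 h2] /QNP[Sy h3 h4]; apply/QNP; split; [exact: cs_lin|exact: left_qn_lin|].
by rewrite (adj_lin _ (bS Sx) (bS Sy)); exact: left_qn_lin.
Qed.

Lemma QN_comp x y : Q x -> Q y -> Q (x \o y).
Proof.
move=> /QNP[Sx h1 h2] /QNP[Sy h3 h4]; apply/QNP; split; [exact: (cs_comp cS)|exact: left_qn_comp|].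
rewrite (adj_comp (bS Sx) (bS Sy)); apply: left_qn_comp => //; exact: cs_adj.
Qed.

Lemma QN_T t : T t -> Q t.
Proof.
have h s : T s -> left_qn s.
  move=> Ts; exists 'I_1, (fun=> idfun); split=> [_|t' Tt']; first exact: cs_id.
  by exists (fun=> s \o t'); split=> [_|]; [exact: (cs_comp cT)|rewrite big_ord1].
by move=> Tt; apply/QNP; split; [exact: TsS|exact: h|apply: h; exact: cs_adj].
Qed.

Lemma QN_id : Q idfun. Proof. by apply: QN_T; exact: cs_id. Qed.
Lemma QN0 : Q 0. Proof. by apply: QN_T; exact: cs0. Qed.
Lemma QND x y : Q x -> Q y -> Q (x + y).
Proof. by move=> Qx Qy; rewrite -[x]scale1r; apply: QN_lin. Qed.
Lemma QNZ a x : Q x -> Q (a *: x).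
Proof. by move=> Qx; rewrite -[a *: x]addr0; apply: QN_lin => //; exact: QN0. Qed.
Lemma QNB x y : Q x -> Q y -> Q (x - y).
Proof. by move=> Qx Qy; rewrite addrC -scaleN1r; apply: QN_lin. Qed.
Lemma QN_sum (I : finType) (F : I -> K -> K) : (forall i, Q (F i)) -> Q (\sum_i F i).
Proof. by move=> h; elim/big_rec: _ => [|i x _ Qx]; [exact: QN0|exact: QND]. Qed.

(** Generation as a right T-module is expressed as left generation after J, so that one theory of
    left frames serves both sides. *)
Definition finite_bimod D := [/\ sub_bimod D,
  (exists (I : finType) (x : I -> K -> K), left_gen D x)
  & (exists (I : finType) (x : I -> K -> K), left_gen [set z | D (J z)] x)].

Lemma J_csub D : closed_subspace D -> closed_subspace [set z | D (J z)].
Proof.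
move=> [D0 DL cl]; split=> [|a z w /= Dz Dw|].
- by rewrite /= (Jop0 LS).
- by rewrite (Jop_lin LS); apply: DL.
- apply/hclosedP => z /hcvg_dense[u hu uz]; apply: (hcvg_closed cl hu).
  apply: (hcvg_lip (c := 1)) uz => v w.
  by rewrite mul1r -(JopB LS) (Jop_hn LS).
Qed.

Lemma J_sub_bimod D : sub_bimod D -> sub_bimod [set z | D (J z)].
Proof.
move=> [cD Dl Dr]; split=> [|t z Tt /= Dz|t z Tt /= Dz]; first exact: J_csub.
  by rewrite (Jop_la LS _ (TsS Tt)); apply: Dr => //; exact: cs_adj.
by rewrite (Jop_ra LS _ (TsS Tt)); apply: Dl => //; exact: cs_adj.
Qed.

Lemma left_frame_qn D (I : finType) V m e x : @left_frame D I V m e -> S x -> D (hat x) -> left_qn x.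
Proof.
move=> F Sx Dx; exists I, m; split=> [|t Tt]; first exact: (lf_S F).
have St := TsS Tt; have [_ _ Dr] := lf_bimod F.
exists (fun i => e i (x \o t)); split=> [i|]; first by apply: (lf_T F); exact: (cs_comp cS).
by apply: (lf_exp TS F); [exact: (cs_comp cS)|rewrite -(ra_hat LS) //; exact: Dr].
Qed.

(** Expansions in a left frame of D and in one of its image under J are the two finite sums that
    membership in QN_S(T) asks for. *)
Lemma finite_bimod_QN D x : finite_bimod D -> S x -> D (hat x) -> Q x.
Proof.
move=> [sD [I [w gD]] [I' [w' gD']]] Sx Dx; have Sax := cs_adj cS Sx.
have [V [m [e F]]] := left_frame_ex TS sD gD.
have [V' [m' [e' F']]] := left_frame_ex TS (J_sub_bimod sD) gD'.
apply/QNP; split=> //; first exact: left_frame_qn F Sx Dx.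
by apply: (left_frame_qn F' Sax); rewrite /= (Jop_hat LS) // (adjK (bS Sx)).
Qed.

Definition gen_bimod (I : finType) (F : I -> K -> K) : set X :=
  closure (lspan [set z | exists i t s, [/\ T t, T s & z = hat (t \o F i \o s)]]).

Lemma gen_bimod_mem (I : finType) (F : I -> K -> K) i t s : T t -> T s ->
  gen_bimod F (hat (t \o F i \o s)).
Proof. by move=> Tt Ts; apply: subset_closure; apply: lspanS; exists i, t, s. Qed.

Lemma gen_bimod_gen (I : finType) (F : I -> K -> K) i : gen_bimod F (hat (F i)).
Proof. exact: (@gen_bimod_mem I F i _ _ (cs_id cT) (cs_id cT)). Qed.

Lemma gen_sub_bimod (I : finType) (F : I -> K -> K) : (forall i, S (F i)) -> sub_bimod (gen_bimod F).
Proof.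
move=> SF; have cD : closed_subspace (gen_bimod F) := lspan_csub _.
split=> // r z Tr; have Sr := TsS Tr; move: z.
  apply: (lspan_min (preim_csub cD (la_bop LS Sr))) => _ [i [t [s [Tt Ts ->]]]] /=.
  rewrite (la_hat LS Sr); last by apply: (cs_comp cS); [apply: (cs_comp cS)|]; try exact: TsS; exact: SF.
  by rewrite -[r \o _]/((r \o t) \o F i \o s); apply: gen_bimod_mem => //; exact: (cs_comp cT).
apply: (lspan_min (preim_csub cD (ra_bop LS Sr))) => _ [i [t [s [Tt Ts ->]]]] /=.
rewrite (ra_hat LS Sr); last by apply: (cs_comp cS); [apply: (cs_comp cS)|]; try exact: TsS; exact: SF.
by rewrite -[_ \o r]/(t \o F i \o (s \o r)); apply: gen_bimod_mem => //; exact: (cs_comp cT).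
Qed.

Lemma orth_csub (p : X) : closed_subspace [set z | '<<p, z>> = 0].
Proof.
have -> : [set z | '<<p, z>> = 0] = [set z | forall y : X, [set p] y -> '<<z, y>> = 0].
  apply/seteqP; split=> [z /= h _ ->|z /= h]; first by rewrite inner_conj h conjC0.
  by rewrite inner_conj h ?conjC0.
exact: closed_orth.
Qed.

Lemma left_gen_ex (I : finType) (F : I -> K -> K) : (forall i, S (F i)) -> (forall i, left_qn (F i)) ->
  exists (I' : finType) (x : I' -> K -> K), (forall j, S (x j)) /\
    forall p : X, (forall j t, T t -> '<<p, hat (t \o x j)>> = 0) ->
    forall i t s, T t -> T s -> '<<p, hat (t \o F i \o s)>> = 0.
Proof.
move=> SF h; pose I' i : finType := projT1 (cid (h i)).
pose u i : I' i -> K -> K := projT1 (cid (projT2 (cid (h i)))).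
have hu i : (forall j, S (u i j)) /\ forall t, T t -> exists s : I' i -> K -> K,
    (forall j, T (s j)) /\ F i \o t = \sum_j (s j \o u i j) := projT2 (cid (projT2 (cid (h i)))).
exists {i : I & I' i}, (fun j => u (tag j) (tagged j)); split=> [j|p hp i t s Tt Ts].
  by case: (hu (tag j)) => h1 _; exact: h1.
have [Su /(_ s Ts)[r [Tr e]]] := hu i; have St := TsS Tt.
rewrite -[t \o F i \o s]/(t \o (F i \o s)) e comp_sumr; last exact: bop_lin (bT Tt).
rewrite (hat_sum LS) => [|j]; last first.
  by apply: (cs_comp cS) => //; apply: (cs_comp cS) => //; exact: TsS.
rewrite inner_sumr big1 // => j _.
exact: (hp (Tagged I' j) (t \o r j) (cs_comp cT Tt (Tr j))).
Qed.

Lemma gen_finite (I : finType) (F : I -> K -> K) : (forall i, Q (F i)) -> finite_bimod (gen_bimod F).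
Proof.
move=> QF; have SF i := QN_S (QF i); have SaF i := cs_adj cS (SF i).
split; first exact: gen_sub_bimod.
  have [I' [x [Sx h]]] := left_gen_ex SF (fun i => let: And3 _ h _ := (QNP _).1 (QF i) in h).
  exists I', x; split=> // p hp z; move: z; apply: (lspan_min (orth_csub p)).
  by move=> _ [i [t [s [Tt Ts ->]]]]; apply: (h p hp).
have [I' [x [Sx h]]] := left_gen_ex SaF (fun i => let: And3 _ _ h := (QNP _).1 (QF i) in h).
exists I', x; split=> // p hp z /= Dz.
rewrite -(Jop_inner LS); suff : forall w, gen_bimod F w -> '<<w, J p>> = 0 by apply.
have cY : closed_subspace [set w | '<<p, J w>> = 0].
  by have := J_csub (orth_csub p).
move=> w Dw; rewrite -[w](JopK LS) (Jop_inner LS); move: w Dw; apply: (lspan_min cY).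
move=> _ [i [t [s [Tt Ts ->]]]] /=; have [St Ss] := (TsS Tt, TsS Ts).
have Stf := cs_comp cS St (SF i).
rewrite (Jop_hat LS (cs_comp cS Stf Ss)) (adj_comp (bS Stf) (bS Ss)) (adj_comp (bS St) (bS (SF i))).
by rewrite -[adj s \o _]/(adj s \o adj (F i) \o adj t); apply: (h p hp); exact: cs_adj.
Qed.

Lemma left_frame_tbi_exp D (I : finType) V m e W (n : I -> K -> K) x : @left_frame D I V m e -> tbi W ->
  (forall i, S (n i) /\ W (hat (m i)) = hat (n i)) -> S x -> D (hat x) ->
  W (hat x) = hat (\sum_i (e i x \o n i)).
Proof.
move=> F [bW Wl _] hn Sx Dx; have Te i := lf_T F i Sx.
rewrite {1}(lf_exp TS F Sx Dx) !(hat_sum LS) => [|i|i].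
- rewrite (lin_sum (bop_lin bW)); apply: eq_bigr => i _; have [Sn Wm] := hn i.
  by rewrite -(la_hat LS (TsS (Te i)) (lf_S F i)) Wl // Wm (la_hat LS (TsS (Te i)) Sn).
- by apply: (cs_comp cS); [exact: TsS|case: (hn i)].
- by apply: (cs_comp cS); [exact: TsS|exact: (lf_S F)].
Qed.

(** By [frame_bounded], [W] carries the frame elements [m_i] to elements [n_i] of S, while the
    coefficients in T stay the same. *)
Lemma tbi_left_qn W x : tbi W -> Q x -> exists y, [/\ S y, left_qn y & W (hat x) = hat y].
Proof.
move=> tW Qx; have Sx := QN_S Qx.
have [sD [I [w gD]] _] := gen_finite (fun _ : 'I_1 => Qx).
have [V [m [e F]]] := left_frame_ex TS sD gD.
have [n hn] := lf_tbi TS F tW; have Dx := @gen_bimod_gen _ (fun _ : 'I_1 => x) ord0.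
have Sn y : S y -> S (\sum_i (e i y \o n i)).
  move=> Sy; apply: (cs_sum cS) => i _; apply: (cs_comp cS); last by case: (hn i).
  by apply: TsS; exact: (lf_T F).
exists (\sum_i (e i x \o n i)); split; [exact: Sn| |exact: left_frame_tbi_exp F tW hn Sx Dx].
exists I, n; split=> [i|t Tt]; first by case: (hn i).
have St := TsS Tt; have Sxt := cs_comp cS Sx St.
exists (fun i => e i (x \o t)); split=> [i|]; first exact: (lf_T F).
apply: (hat_inj LS); [by apply: (cs_comp cS) => //; exact: Sn|exact: Sn|].
rewrite -(ra_hat LS St (Sn _ Sx)) -(left_frame_tbi_exp F tW hn Sx Dx).
have [_ _ Wr] := tW; have [_ _ Dr] := sD.
by rewrite -Wr // (ra_hat LS St Sx) (left_frame_tbi_exp F tW hn Sxt) // -(ra_hat LS St Sx); exact: Dr.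
Qed.

(** The left condition comes from [W] and the right one from [J W J] at the adjoint. This keeps
    resolvents of T-bimodular operators inside QN_S(T). *)
Lemma tbi_QN W x : tbi W -> Q x -> exists2 y, Q y & W (hat x) = hat y.
Proof.
move=> tW Qx; have Sx := QN_S Qx.
have [y [Sy ly e]] := tbi_left_qn tW Qx.
have [z [Sz lz e']] := tbi_left_qn (tbi_J TS tW) (QN_adj Qx).
exists y => //; apply/QNP; split=> //; suff -> : adj y = z by [].
apply: (hat_inj LS) => //; first exact: cs_adj.
by rewrite -e' /= (Jop_hat LS (cs_adj cS Sx)) (adjK (bS Sx)) e (Jop_hat LS Sy).
Qed.

End Quasi_normalizer.

(** * Bimodular maps *)

Section Bimodule_actions.
Variables (R : realType) (K : hilbertType R) (S : set (K -> K)) (H : biact K).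
Hypothesis bH : bimodule S S H.

Lemma bi_lrep : nrep S (@lact _ _ H).
Proof. by case: bH => [[[[l1 l2] l3 l4 l5] l6] _ _]; split=> //; split=> //; left. Qed.
Lemma bi_rrep : nrep S (@ract _ _ H).
Proof. by case: bH => [_ [[[l1 l2] l3 l4 l5] l6] _]; split=> //; split=> //; right. Qed.
Lemma bi_lM x y : S x -> S y -> @lact _ _ H (x \o y) = lact x \o lact y.
Proof. by case: bH => [[_ h] _ _]; apply: h. Qed.
Lemma bi_rM x y : S x -> S y -> @ract _ _ H (x \o y) = ract y \o ract x.
Proof. by case: bH => [_ [_ h] _]; apply: h. Qed.
Lemma bi_lrC x y (xi : H) : S x -> S y -> lact x (ract y xi) = ract y (lact x xi).
Proof. by case: bH => [_ _ h]; apply: h. Qed.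
Lemma bi_lbop x : S x -> bounded_op (@lact _ _ H x).
Proof. exact: (jr_bop bi_lrep.1). Qed.
Lemma bi_rbop x : S x -> bounded_op (@ract _ _ H x).
Proof. exact: (jr_bop bi_rrep.1). Qed.
Lemma bi_ladj x (xi eta : H) : S x -> '<<lact x xi, eta>> = '<<xi, lact (adj x) eta>>.
Proof. by move=> Sx; rewrite (jr_adj bi_lrep.1 Sx) (adjP (bi_lbop Sx)). Qed.
Lemma bi_radj x (xi eta : H) : S x -> '<<ract x xi, eta>> = '<<xi, ract (adj x) eta>>.
Proof. by move=> Sx; rewrite (jr_adj bi_rrep.1 Sx) (adjP (bi_rbop Sx)). Qed.
End Bimodule_actions.

Section Bimodule_maps.
Variables (R : realType) (K : hilbertType R) (T S : set (K -> K)) (tau : (K -> K) -> R[i]).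
Variables (XT X : biact K) (oneT : XT) (one : X).
Hypothesis TS : inclusion T S tau oneT one.
Let LS := in_S TS.
Let LT := in_T TS.
Let vS : vn_algebra S. Proof. by case: LS. Qed.
Let fS : faithful_normal_tracial_state S tau. Proof. by case: LS. Qed.
Let vT : vn_algebra T. Proof. by case: LT. Qed.
Let cS := vn_cstar vS.
Let cT := vn_cstar vT.
Let bS := cs_bop cS.
Let bT := cs_bop cT.
Let TsS := in_sub TS.
Implicit Types (x y t u : K -> K) (D : set X) (W : X -> X).
Local Notation left_frame := (left_frame T S oneT one).
Local Notation finite_bimod := (finite_bimod T S one).
Local Notation J := (Jop S one).
Local Notation hat := (hat one).
Local Notation la := (@lact _ _ X).
Local Notation ra := (@ract _ _ X).
Local Notation Q := (QN T S).

Section Gram.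
Variables (D : set X) (I : finType) (V : I -> X -> XT) (m : I -> K -> K) (e : I -> (K -> K) -> (K -> K)).
Hypothesis F : left_frame D V m e.

(** Both sides are the conditional expectation onto T of [m_k t^* m_j^*]. *)
Lemma lf_sym j k t : T t -> e j (m k \o adj t) = adj (e k (m j \o t)).
Proof.
move=> Tt; have Tat := cs_adj cT Tt; have [St Sat] := (TsS Tt, TsS Tat).
have Sm i : S (m i) := lf_S F i.
have Sk := cs_comp cS (Sm k) Sat; have Sj := cs_comp cS (Sm j) St.
have Tk := lf_T F k Sj; have Tj := lf_T F j Sk.
apply: (hat_inj LT) => //; first exact: cs_adj.
apply: (hat_ext LT) => a Ta; have Taa := cs_adj cT Ta; have [Sa Saa] := (TsS Ta, TsS Taa).
rewrite (hat_innerC LT Tk Ta) -(lf_e F) // (adjP (lf_lin F j).1) (lf_adj_hat TS F _ Ta).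
rewrite [RHS]inner_conj -(lf_e F) // (adjP (lf_lin F k).1) (lf_adj_hat TS F _ Taa) -inner_conj.
have Saj := cs_comp cS Sa (Sm j); have Sak := cs_comp cS Saa (Sm k).
rewrite (hat_inner LS Sk Saj) (hat_inner LS Sak Sj).
rewrite (adj_comp (bS Sa) (bS (Sm j))) (adj_comp (bS (Sm j)) (bS St)).
have Samj := cs_adj cS (Sm j).
rewrite -[(adj (m j) \o adj a) \o (m k \o adj t)]/((adj (m j) \o (adj a \o m k)) \o adj t).
by rewrite (trC fS (cs_comp cS Samj Sak) Sat).
Qed.

(** Right multiplication by [u] is unitary on D, so the [m_j u] have the same Gram matrix as the
    [m_j]: expand [m_k u^*] in the frame, multiply by [u], and apply [e l]. *)
Lemma lf_gram k l u : unitary T u ->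
  \sum_j (adj (e k (m j \o u)) \o e l (m j \o u)) = e l (m k).
Proof.
move=> [Tu u1 u2]; have Tau := cs_adj cT Tu; have [Su Sau] := (TsS Tu, TsS Tau).
have Sm i : S (m i) := lf_S F i; have Smu j := cs_comp cS (Sm j) Su.
have Te i j : T (e i (m j \o u)) := lf_T F i (Smu j).
have Tae i j : T (adj (e i (m j \o u))) by apply: cs_adj.
have Smk := cs_comp cS (Sm k) Sau; have [_ _ Dr] := lf_bimod F.
have [bV hV] := lf_lin F l.
apply: (hat_inj LT); [by apply: (cs_sum cT) => j _; exact: (cs_comp cT)|exact: (lf_T F)|].
rewrite -(lf_e F) // (hat_sum LT) => [|j]; last exact: (cs_comp cT).
have -> : m k = (\sum_j (e j (m k \o adj u) \o m j)) \o u.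
  rewrite -(lf_exp TS F Smk); first by rewrite -[RHS]/(m k \o (adj u \o u)) u1.
  by rewrite -(ra_hat LS) //; apply: Dr => //; exact: (lf_mem F).
have Sej j : S (e j (m k \o adj u) \o m j).
  by apply: (cs_comp cS) => //; apply: TsS; exact: (lf_T F).
rewrite -(ra_hat LS Su) ?(hat_sum LS) // ?(lin_sum (bop_lin (ra_bop LS Su))) ?(lin_sum (bop_lin bV)); last exact: (cs_sum cS).
apply: eq_bigr => j _; rewrite (ra_hat LS Su (Sej j)) (lf_sym j k Tu).
rewrite -[(adj _ \o m j) \o u]/(adj (e k (m j \o u)) \o (m j \o u)) -(la_hat LS (TsS (Tae k j)) (Smu j)).
by rewrite hV // (lf_e F) // (la_hat LT).
Qed.

End Gram.

Variable H : biact K.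
Hypothesis bH : bimodule S S H.

Record bimod_map (c : (K -> K) -> H) : Prop := BimodMap {
  bm_lin : forall a x y, Q x -> Q y -> c (a *: x + y) = a *: c x + c y ;
  bm_l : forall t x, T t -> Q x -> c (t \o x) = lact t (c x) ;
  bm_r : forall t x, T t -> Q x -> c (x \o t) = ract t (c x) }.

Variable c : (K -> K) -> H.
Hypothesis hc : bimod_map c.

Lemma bm0 : c 0 = 0.
Proof.
have Q0 := QN0 TS; have := bm_lin hc (-1) Q0 Q0.
by rewrite scaler0 addr0 scaleN1r addNr.
Qed.
Lemma bmD x y : Q x -> Q y -> c (x + y) = c x + c y.
Proof. by move=> Qx Qy; have := bm_lin hc 1 Qx Qy; rewrite !scale1r. Qed.
Lemma bm_sum (I : finType) (F : I -> K -> K) : (forall i, Q (F i)) -> c (\sum_i F i) = \sum_i c (F i).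
Proof.
move=> h; suff [] : Q (\sum_i F i) /\ c (\sum_i F i) = \sum_i c (F i) by [].
elim/big_rec2: _ => [|i z x _ [Qx e]]; first by split; [exact: QN0 TS|exact: bm0].
by split; [apply: (QND TS)|rewrite bmD // e].
Qed.
Lemma bmB x y : Q x -> Q y -> c (x - y) = c x - c y.
Proof. by move=> Qx Qy; rewrite addrC -scaleN1r (bm_lin hc) // scaleN1r addrC. Qed.

(* The trace property of a frame of [J D] makes the state
   [sum_j <y c(m_j^* ), c(m_j^* )>] central for [T]. *)
Lemma right_bounded_frame D (I : finType) V m e : finite_bimod D ->
  @left_frame [set z | D (J z)] I V m e ->
  exists2 C : R, 0 <= C & forall j a, S a -> hn (lact a (c (adj (m j)))) <= C * hn (hat a).
Proof.
move=> fD F; have Sm i : S (m i) := lf_S F i; have Sr i := cs_adj cS (Sm i).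
have Qr i : Q (adj (m i)).
  apply: (finite_bimod_QN TS fD) => //; rewrite -(Jop_hat LS) //.
  exact: (lf_mem F i).
have Te i x : S x -> T (e i x) by move=> Sx; exact: (lf_T F).
have Tae i x : S x -> T (adj (e i x)) by move=> Sx; apply: (cs_adj cT); exact: Te.
apply: (@state_bound _ _ _ _ _ _ _ _ _ TS H (@lact _ _ H) I (fun i => c (adj (m i))) (bi_lrep bH)).
move=> u y uT Sy; have [Tu u1 u2] := uT; have Tau := cs_adj cT Tu; have [Su Sau] := (TsS Tu, TsS Tau).
have Smu j := cs_comp cS (Sm j) Su; have [_ _ Dr] := lf_bimod F.
pose v j := c (adj (m j)).
(* The adjoints of the frame elements form a basis of D as a right module, so [u^* v_j] is a
   combination of the [v_k] with coefficients of T acting on the right. *)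
have uv j : lact (adj u) (v j) = \sum_k ract (adj (e k (m j \o u))) (v k).
  rewrite /v -(bm_l hc) // -(adj_comp (bS (Sm j)) (bS Su)).
  have Dj : D (J (hat (m j \o u))).
    by have := Dr u (hat (m j)) Tu (lf_mem F j); rewrite (ra_hat LS).
  rewrite {1}(lf_exp TS F (Smu j) Dj) adj_sum => [|k]; last first.
    by apply: bop_comp; [apply: bT; exact: Te|exact: bS].
  have E k : adj (e k (m j \o u) \o m k) = adj (m k) \o adj (e k (m j \o u)).
    by rewrite (adj_comp (bT (Te k _ (Smu j))) (bS (Sm k))).
  under eq_bigr do rewrite E; rewrite bm_sum => [|k].
    by apply: eq_bigr => k _; rewrite (bm_r hc) //; exact: Tae.
  by apply: (QN_comp TS) => //; apply: (QN_T TS); exact: Tae.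
have step j : '<<lact (u \o y \o adj u) (v j), v j>> = \sum_k \sum_l
    '<<ract (adj (e k (m j \o u)) \o e l (m j \o u)) (lact y (v k)), v l>>.
  rewrite (bi_lM bH (cs_comp cS Su Sy) Sau) (bi_lM bH Su Sy) /= (bi_ladj bH) // uv.
  rewrite (lin_sum (bop_lin (bi_lbop bH Sy))) inner_suml; apply: eq_bigr => k _.
  rewrite inner_sumr; apply: eq_bigr => l _.
  have Sk := TsS (Tae k _ (Smu j)); have Sl := TsS (Te l _ (Smu j)).
  by rewrite (bi_rM bH Sk Sl) /= (bi_radj bH) // (bi_lrC bH).
under eq_bigr do rewrite -/(v _) step; rewrite exchange_big /=.
under eq_bigr do rewrite exchange_big /=.
(* Summation over [j] removes the dependence on [u]. *)
have gram k l : \sum_j '<<ract (adj (e k (m j \o u)) \o e l (m j \o u)) (lact y (v k)), v l>> =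
    '<<ract (e l (m k)) (lact y (v k)), v l>>.
  rewrite -(lf_gram F k l uT) (jr_sum cS (bi_rrep bH).1) => [|j]; last first.
    by apply: (cs_comp cS); apply: TsS; [apply: Tae|apply: Te].
  by rewrite sum_opE inner_suml.
under eq_bigr do under eq_bigr do rewrite gram.
rewrite exchange_big /=; apply: eq_bigr => l _; rewrite -inner_suml -/(v l); congr ('<<_, _>>).
have -> : \sum_k ract (e l (m k)) (lact y (v k)) = lact y (\sum_k ract (e l (m k)) (v k)).
  rewrite (lin_sum (bop_lin (bi_lbop bH Sy))); apply: eq_bigr => k _.
  by rewrite (bi_lrC bH) //; apply: TsS; exact: Te.
congr (lact y _).
have -> : \sum_k ract (e l (m k)) (v k) = c (\sum_k (adj (m k) \o e l (m k))).
  rewrite bm_sum => [|k]; last by apply: (QN_comp TS) => //; apply: (QN_T TS); exact: Te.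
  by apply: eq_bigr => k _; rewrite (bm_r hc) //; exact: Te.
rewrite /v; congr (c _); have S_el k := TsS (Te l _ (Sm k)).
rewrite -[RHS](_ : adj (\sum_k (e k (m l) \o m k)) = _); last by rewrite -(lf_exp TS F (Sm l) (lf_mem F l)).
rewrite adj_sum => [|k]; last by apply: bop_comp; [apply: bT; exact: Te|exact: bS].
apply: eq_bigr => k _; rewrite (adj_comp (bT (Te k _ (Sm l))) (bS (Sm k))).
have := lf_sym F k l (cs_id cT); rewrite adj_id => ->.
by rewrite (adjK (bT (Te l _ (Sm k)))).
Qed.

(** No continuity of [c] is assumed. Expanding [x] in the left frame, and the left frame in the
    right one, writes [c x] as a finite sum of terms [e_j(x) c(r_k) f_kj] with [f_kj] in T, and
    [right_bounded_frame] controls left multiplication on [c(r_k)] in 2-norm. *)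
Lemma bimod_map_bound D : finite_bimod D ->
  exists2 C : R, 0 <= C & forall x, Q x -> D (hat x) -> hn (c x) <= C * hn (hat x).
Proof.
move=> fD; have [sD [I [w gD]] [I' [w' gD']]] := fD.
have [V [m [e F]]] := left_frame_ex TS sD gD.
have [V' [m' [e' F']]] := left_frame_ex TS (J_sub_bimod TS sD) gD'.
have [C0 C00 hC] := right_bounded_frame fD F'.
have Sm i : S (m i) := lf_S F i; have Sm' i : S (m' i) := lf_S F' i.
have Sam i := cs_adj cS (Sm i).
have Qm i : Q (m i) by apply: (finite_bimod_QN TS fD) => //; exact: (lf_mem F i).
have Qr i : Q (adj (m' i)).
  apply: (finite_bimod_QN TS fD); first exact: cs_adj.
  by rewrite -(Jop_hat LS) //; exact: (lf_mem F' i).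
have Te i x : S x -> T (e i x) by move=> Sx; exact: (lf_T F).
pose f k j := adj (e' k (adj (m j))).
have Tf k j : T (f k j) by apply: cs_adj => //; apply: (lf_T F').
have mE j : m j = \sum_k (adj (m' k) \o f k j).
  have Dj : [set z | D (J z)] (hat (adj (m j))).
    by rewrite /= (Jop_hat LS) // (adjK (bS (Sm j))); exact: (lf_mem F j).
  rewrite -{1}(adjK (bS (Sm j))) {1}(lf_exp TS F' (Sam j) Dj) adj_sum => [|k].
    by apply: eq_bigr => k _; rewrite (adj_comp (bT (lf_T F' k (Sam j))) (bS (Sm' k))).
  by apply: bop_comp; [apply: bT; exact: (lf_T F')|exact: bS].
have bd k j : {b : R | 0 <= b /\ onb (@ract _ _ H (f k j)) b}.
  by apply/cid; have [b b0 h] := bop_onb (bi_rbop bH (TsS (Tf k j))); exists b.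
pose b k j := sval (bd k j).
have b0 k j : 0 <= b k j by case: (svalP (bd k j)).
have hb k j : onb (@ract _ _ H (f k j)) (b k j) by case: (svalP (bd k j)).
exists (\sum_j \sum_k b k j * C0).
  by do 2!apply: sumr_ge0 => ? _; rewrite mulr_ge0.
move=> x Qx Dx; have Sx := QN_S Qx.
have xE : c x = \sum_j \sum_k ract (f k j) (lact (e j x) (c (adj (m' k)))).
  rewrite {1}(lf_exp TS F Sx Dx) bm_sum => [|j]; last first.
    by apply: (QN_comp TS) => //; apply: (QN_T TS); exact: Te.
  apply: eq_bigr => j _; have Sej := TsS (Te j _ Sx); rewrite (bm_l hc) //; last exact: Te.
  rewrite {1}mE bm_sum => [|k]; last by apply: (QN_comp TS) => //; apply: (QN_T TS).
  rewrite (lin_sum (bop_lin (bi_lbop bH Sej))); apply: eq_bigr => k _.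
  by rewrite (bm_r hc) // (bi_lrC bH) //; exact: TsS.
have hn_sum (J' : finType) (G : J' -> H) : hn (\sum_i G i) <= \sum_i hn (G i).
  elim/big_rec2: _ => [|i r g _ le]; first by rewrite hn0.
  by apply: le_trans (hnD _ _) _; rewrite lerD2l.
rewrite xE mulr_suml; apply: le_trans (hn_sum _ _) _; apply: ler_sum => j _.
rewrite mulr_suml; apply: le_trans (hn_sum _ _) _; apply: ler_sum => k _.
apply: le_trans (hb k j _) _; rewrite -mulrA ler_wpM2l //.
apply: le_trans (hC k _ (TsS (Te j _ Sx))) _; rewrite ler_wpM2l //.
exact: (lf_norm TS F).
Qed.

Lemma bimod_map_ext D : finite_bimod D -> exists U : X -> H, [/\ bounded_op U,
  (forall x, Q x -> D (hat x) -> U (hat x) = c x),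
  (forall t z, T t -> U (la t z) = lact t (U z)) & (forall t z, T t -> U (ra t z) = ract t (U z))].
Proof.
move=> fD; have [C C0 hC] := bimod_map_bound fD; have [[cD Dl Dr] _ _] := fD; have [D0 DL _] := cD.
pose G z w := exists x, [/\ Q x, D (hat x), z = hat x & w = c x].
have [|a z w z' w' [x [Qx Dx -> ->]] [y [Qy Dy -> ->]]|_ _ [x [Qx Dx -> ->]]|U [bU _ UG U0]] := @ext_op _ _ _ G C C0.
- by exists 0; rewrite (hat0 LS) bm0; split=> //; exact: QN0 TS.
- exists (a *: x + y); rewrite (hat_lin LS _ (QN_S Qx) (QN_S Qy)) (bm_lin hc) //.
  by split=> //; [apply: (QN_lin TS)|exact: DL].
- exact: hC.
exists U; split=> // [x Qx Dx|t z Tt|t z Tt]; first by apply: UG; exists x.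
  have St := TsS Tt; have Tat := cs_adj cT Tt; have Sat := TsS Tat.
  apply: (ext_op_comm (b := la (adj t)) bU UG U0 (la_bop LS St) (bi_lbop bH St)).
  - by move=> v w; exact: (la_adj LS).
  - move=> _ _ [x [Qx Dx -> ->]]; exists (t \o x); have Sx := QN_S Qx.
    rewrite -(la_hat LS) // (bm_l hc) //; split=> //; last exact: Dl.
    by apply: (QN_comp TS) => //; exact: (QN_T TS).
  - move=> _ y [x [Qx Dx -> _]]; have Sx := QN_S Qx; exists (c (adj t \o x)), (adj t \o x).
    rewrite -(la_hat LS) //; split=> //; last exact: Dl.
    by apply: (QN_comp TS) => //; exact: (QN_T TS).
have St := TsS Tt; have Tat := cs_adj cT Tt; have Sat := TsS Tat.
apply: (ext_op_comm (b := ra (adj t)) bU UG U0 (ra_bop LS St) (bi_rbop bH St)).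
- by move=> v w; exact: (ra_adj LS).
- move=> _ _ [x [Qx Dx -> ->]]; exists (x \o t); have Sx := QN_S Qx.
  rewrite -(ra_hat LS) // (bm_r hc) //; split=> //; last exact: Dr.
  by apply: (QN_comp TS) => //; exact: (QN_T TS).
- move=> _ y [x [Qx Dx -> _]]; have Sx := QN_S Qx; exists (c (x \o adj t)), (x \o adj t).
  rewrite -(ra_hat LS) //; split=> //; last exact: Dr.
  by apply: (QN_comp TS) => //; exact: (QN_T TS).
Qed.

End Bimodule_maps.

(** * Multiplicities *)

Section Multiplicity.
Variables (R : realType) (K : hilbertType R) (T S : set (K -> K)) (tau : (K -> K) -> R[i]).
Variables (XT X : biact K) (oneT : XT) (one : X).
Hypothesis TS : inclusion T S tau oneT one.
Let LS := in_S TS.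
Let LT := in_T TS.
Let vS : vn_algebra S. Proof. by case: LS. Qed.
Let fS : faithful_normal_tracial_state S tau. Proof. by case: LS. Qed.
Let vT : vn_algebra T. Proof. by case: LT. Qed.
Let cS := vn_cstar vS.
Let cT := vn_cstar vT.
Let bS := cs_bop cS.
Let TsS := in_sub TS.
Implicit Types (x y t u : K -> K) (D : set X) (W : X -> X).
Local Notation left_frame := (left_frame T S oneT one).
Local Notation finite_bimod := (finite_bimod T S one).
Local Notation J := (Jop S one).
Local Notation hat := (hat one).
Local Notation la := (@lact _ _ X).
Local Notation ra := (@ract _ _ X).
Local Notation Q := (QN T S).

Local Notation tbi := (@tbi _ _ T X).

Section Orthonormal.
Variables (D : set X) (I : finType) (V : I -> X -> XT) (m : I -> K -> K) (e : I -> (K -> K) -> (K -> K)).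
Hypothesis F : left_frame D V m e.

(** An inner product on the restrictions of T-bimodular operators to D: the left T-trace of [B^* A]
    on D. *)
Definition frame_ip (A B : X -> X) : R[i] := \sum_j '<<A (hat (m j)), B (hat (m j))>>.

Lemma frame_ip_lin a A B C : frame_ip (a *: A + B) C = a * frame_ip A C + frame_ip B C.
Proof.
rewrite /frame_ip mulr_sumr -big_split /=; apply: eq_bigr => j _.
by rewrite -[(_ + _) _]/(a *: A _ + B _) inner_linearl.
Qed.

Lemma frame_ip_conj A B : frame_ip A B = (frame_ip B A)^*.
Proof. by rewrite /frame_ip rmorph_sum; apply: eq_bigr => j _; rewrite inner_conj. Qed.

(* The sum commutes with the unitaries of T, hence is a scalar. *)
Lemma frame_central (A A' : X -> X) (n n' : I -> K -> K) : tbi A -> tbi A' ->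
  (forall j, S (n j) /\ A (hat (m j)) = hat (n j)) -> (forall j, S (n' j) /\ A' (hat (m j)) = hat (n' j)) ->
  \sum_j (adj (n' j) \o n j) = frame_ip A A' *: idfun.
Proof.
move=> tA tA' An An'; have Sm j : S (m j) := lf_S F j.
have [Sn nE] : (forall j, S (n j)) /\ forall j, A (hat (m j)) = hat (n j) by split=> j; case: (An j).
have [Sn' nE'] : (forall j, S (n' j)) /\ forall j, A' (hat (m j)) = hat (n' j) by split=> j; case: (An' j).
have San' j := cs_adj cS (Sn' j).
pose b := \sum_j (adj (n' j) \o n j).
have Sb : S b by apply: (cs_sum cS) => j _; exact: (cs_comp cS).
have [lad lad'] := (tbi_left tA, tbi_left tA').
have bu u : unitary T u -> u \o b = b \o u.
  move=> uT; have [Tu u1 u2] := uT; have Tau := cs_adj cT Tu; have [Su Sau] := (TsS Tu, TsS Tau).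
  have Sc := cs_comp cS (cs_comp cS Sau Sb) Su.
  suff E : adj u \o b \o u = b.
    by rewrite -{1}E -[LHS]/((u \o adj u) \o (b \o u)) u2.
  apply: (hat_inj LS) => //; apply: (hat_ext LS) => y Sy; have Say := cs_adj cS Sy.
  have lA : left_linear T (ra (adj y) \o A).
    apply: left_linear_comp lad; split; first exact: (ra_bop LS).
    by move=> t z Tt; rewrite (laraC LS) //; exact: TsS.
  have := frame_trace TS (lf_bimod F) (lf_lin F) (lf_sum F) (lf_proj F) lA lad' uT.
  under eq_bigr do rewrite (lf_m F) /=; under [X in _ = X -> _]eq_bigr do rewrite (lf_m F) /=.
  have [_ _ Ar] := tA; have [_ _ Ar'] := tA'.
  have L j : '<<ra (adj y) (A (ra u (hat (m j)))), A' (ra u (hat (m j)))>> =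
      tau (adj y \o (adj u \o (adj (n' j) \o n j) \o u)).
    have Skj := cs_comp cS (Sn j) Su; have Sij := cs_comp cS (Sn' j) Su.
    rewrite Ar // Ar' // nE nE' (ra_hat LS Su (Sn j)) (ra_hat LS Su (Sn' j)).
    rewrite (ra_hat LS Say Skj) (hat_inner LS (cs_comp cS Skj Say) Sij) (adj_comp (bS (Sn' j)) (bS Su)).
    rewrite -[(adj u \o adj (n' j)) \o _]/((adj u \o (adj (n' j) \o n j) \o u) \o adj y).
    rewrite (trC fS _ Say) //; apply: (cs_comp cS) => //; apply: (cs_comp cS) => //; exact: (cs_comp cS).
  have L' j : '<<ra (adj y) (A (hat (m j))), A' (hat (m j))>> = tau (adj y \o (adj (n' j) \o n j)).
    rewrite nE nE' (ra_hat LS Say (Sn j)) (hat_inner LS (cs_comp cS (Sn j) Say) (Sn' j)).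
    rewrite -[adj (n' j) \o _]/((adj (n' j) \o n j) \o adj y).
    by rewrite (trC fS _ Say) //; exact: (cs_comp cS).
  under eq_bigr do rewrite L; under [X in _ = X -> _]eq_bigr do rewrite L'.
  rewrite (hat_inner LS Sc Sy) (hat_inner LS Sb Sy) => E.
  have lay := bop_lin (bS Say); have lau := bop_lin (bS Sau).
  rewrite /b comp_sumr // comp_suml !comp_sumr // !(tr_sum vS fS) => [|j|j].
  - by under eq_bigr do rewrite -[adj u \o _ \o _]/(adj u \o (adj (n' _) \o n _) \o u).
  - by do 2!apply: (cs_comp cS) => //.
  - by apply: (cs_comp cS) => //; apply: (cs_comp cS) => //; do 2!apply: (cs_comp cS) => //.
have [a ba] := central_scalar TS Sb bu; rewrite -/b ba; congr (_ *: _).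
have : tau b = a by rewrite ba (trZ vS fS) ?(tr1 fS) ?mulr1 //; exact: cs_id.
rewrite /b (tr_sum vS fS) => [<-|j]; last exact: (cs_comp cS).
by apply: eq_bigr => j _; rewrite nE nE' (hat_inner LS).
Qed.

(* The operators [n_kj] with [A_k m_j = n_kj] form an isometry from [K^N] to [K^I]. *)
Lemma multiplicity_bound (N : finType) (A : N -> X -> X) : (forall i, tbi (A i)) ->
  (forall i k, frame_ip (A k) (A i) = (i == k)%:R) -> (#|N| <= #|I|)%N.
Proof.
move=> tA oA; have Sm j : S (m j) := lf_S F j.
pose hn_ i := cid (lf_tbi TS F (tA i)); pose n i : I -> K -> K := sval (hn_ i).
have nP i j : S (n i j) /\ A i (hat (m j)) = hat (n i j) by rewrite /n; case: (hn_ i) => f /= /(_ j).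
have Sn i j : S (n i j) := (nP i j).1; have nE i j := (nP i j).2.
have San i j := cs_adj cS (Sn i j).
pose b i k := \sum_j (adj (n i j) \o n k j).
have bE i k : b i k = (i == k)%:R *: idfun by rewrite -oA; exact: frame_central.
(* [a j] is a diagonal block of the range projection of the isometry, hence at most 1, while the
   traces of all blocks add up to the cardinality of N. *)
pose a j := \sum_k (n k j \o adj (n k j)).
have Sa j : S (a j) by apply: (cs_sum cS) => k _; exact: (cs_comp cS).
have a1 j : onb (a j) 1.
  move=> eta; rewrite mul1r; pose xi k := adj (n k j) eta.
  have aE : a j eta = \sum_k n k j (xi k) by rewrite /a sum_opE.
  have s1 : \sum_k hn (xi k) ^+ 2 = dot (a j eta) eta.
    rewrite aE dot_suml; apply: eq_bigr => k _.
    by rewrite -dotxx (adj_dot (bS (Sn k j))).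
  have s2 : hn (a j eta) ^+ 2 <= \sum_k hn (xi k) ^+ 2.
    have -> : \sum_k hn (xi k) ^+ 2 = \sum_j' hn (\sum_k n k j' (xi k)) ^+ 2.
      have E j' : hn (\sum_k n k j' (xi k)) ^+ 2 =
          \sum_k \sum_i dot ((adj (n i j') \o n k j') (xi k)) (xi i).
        rewrite -dotxx dot_suml; apply: eq_bigr => k _; rewrite dot_sumr; apply: eq_bigr => i _.
        by rewrite [RHS]dotC -(adj_dot (bS (Sn i j'))) dotC.
      under [RHS]eq_bigr do rewrite E; rewrite exchange_big /=; apply: eq_bigr => k _.
      rewrite exchange_big /= (bigD1 k) //= [X in _ + X]big1 ?addr0 => [|i /negbTE ik].
        have := congr1 (fun f => dot (f (xi k)) (xi k)) (bE k k).
        rewrite /b sum_opE dot_suml => ->; rewrite eqxx -dotxx.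
        by rewrite -[(_ *: _) _]/(1 *: xi k) scale1r.
      have := congr1 (fun f => dot (f (xi k)) (xi i)) (bE i k).
      rewrite /b sum_opE dot_suml => ->; rewrite ik -[(_ *: _) _]/(0 *: xi k) scale0r; exact: dot0l.
    by rewrite (bigD1 j) //= -aE lerDl; apply: sumr_ge0 => j' _; exact: sqr_ge0.
  have := dot_CS (a j eta) eta; have := hn_ge0 (a j eta); have := hn_ge0 eta; move: s2; rewrite s1.
  move: (hn (a j eta)) (hn eta) (dot _ _) => p q d h q0 p0 h2; rewrite leNgt; apply/negP; nra.
have tE : \sum_j trR tau (a j) = #|N|%:R.
  rewrite -sum1_card natr_sum.
  have step j : trR tau (a j) = \sum_k complex.Re (tau (n k j \o adj (n k j))).
    by rewrite /trR /a (tr_sum vS fS) ?Re_sum // => k; exact: (cs_comp cS).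
  have E k : \sum_j complex.Re (tau (n k j \o adj (n k j))) = 1.
    have := congr1 (fun f => complex.Re (tau f)) (bE k k).
    rewrite eqxx scale1r (tr1 fS) /b (tr_sum vS fS) => [|j]; last exact: (cs_comp cS).
    rewrite Re_sum => e1; rewrite -[RHS]/(complex.Re (1 : R[i])) -e1.
    by apply: eq_bigr => j _; rewrite (trC fS).
  rewrite [LHS](eq_bigr _ (fun j _ => step j)) exchange_big /=.
  by apply: eq_bigr => k _; rewrite E.
rewrite -(ler_nat R) -tE -sum1_card natr_sum; apply: ler_sum => j _.
rewrite /trR -(hat_one LS (Sa j)) -/(dot _ _); apply: le_trans (dot_CS _ _) _.
by rewrite (hn_one LS) mulr1; apply: (hat_le LS).
Qed.

(** [multiplicity_bound] allows a largest orthonormal family. The part of [B] orthogonal to it could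
    be normalized and added, unless it vanishes on the frame. *)
Lemma orthonormal_basis : exists (N : finType) (A : N -> X -> X), (forall i, tbi (A i)) /\
  forall B, tbi B -> exists a : N -> R[i], forall j, B (hat (m j)) = \sum_i a i *: A i (hat (m j)).
Proof.
have cB := tbi_cstar TS.
pose P k := `[< exists (N : finType) (A : N -> X -> X), [/\ #|N| = k, (forall i, tbi (A i)) &
   (forall i j, frame_ip (A j) (A i) = (i == j)%:R)] >].
have exP : exists k, P k.
  by exists 0%N; apply/asboolP; exists 'I_0, (fun=> idfun); split=> [|[]|[]] //; rewrite card_ord.
have bP k : P k -> (k <= #|I|)%N by move=> /asboolP[N [A [<- tA oA]]]; exact: multiplicity_bound oA.
case: (ex_maxnP exP bP) => k /asboolP[N [A [Nk tA oA]]] maxk.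
exists N, A; split=> // B tB; pose a i := frame_ip B (A i); exists a => j.
pose C := B - \sum_i a i *: A i : X -> X.
have tC : tbi C by apply: (csB cB) => //; apply: (cs_sum cB) => i _; exact: (csZ cB).
have ip_sum (J' : finType) (G : J' -> X -> X) Y : frame_ip (\sum_i G i) Y = \sum_i frame_ip (G i) Y.
  rewrite /frame_ip exchange_big /=; apply: eq_bigr => l _; by rewrite sum_opE inner_suml.
have ip0 Y : frame_ip 0 Y = 0 by rewrite /frame_ip big1 // => l _; exact: inner0l.
have ipZ b Y Y' : frame_ip (b *: Y) Y' = b * frame_ip Y Y'.
  by have := frame_ip_lin b Y 0 Y'; rewrite !ip0 !addr0.
have CA i : frame_ip C (A i) = 0.
  rewrite /C addrC -scaleN1r frame_ip_lin ip_sum (bigD1 i) //= ipZ oA eqxx mulr1 big1 => [|l /negbTE li].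
    by rewrite addr0 mulN1r addNr.
  by rewrite ipZ oA eq_sym li mulr0.
have CC : frame_ip C C = (\sum_j hn (C (hat (m j))) ^+ 2)%:C%C.
  by rewrite rmorph_sum; apply: eq_bigr => l _; rewrite inner_xx.
set s := \sum_j _ in CC; have s0 : 0 <= s by apply: sumr_ge0 => l _; exact: sqr_ge0.
suff s_0 : s = 0.
  have /allP h : all (fun j => hn (C (hat (m j))) ^+ 2 == 0) (index_enum I).
    by have /eqP := s_0; rewrite psumr_eq0 // => l _; exact: sqr_ge0.
  have /eqP := h j (mem_index_enum _); move/eqP; rewrite sqrf_eq0 => /eqP/hn_eq0.
  rewrite -[C (hat (m j))]/(B (hat (m j)) - (\sum_i a i *: A i) (hat (m j))) sum_opE => /eqP.
  by rewrite subr_eq0 => /eqP.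
apply/eqP; rewrite eq_le s0 andbT leNgt; apply/negP => sp.
have conjR (r : R) : (r%:C%C : R[i])^* = r%:C%C.
  by apply/eqP; rewrite eq_complex /= oppr0 !eqxx.
pose q := (Num.sqrt s)^-1; pose C' := q%:C%C *: C.
pose A' (i : option N) := if i is Some i then A i else C'.
have tA' i : tbi (A' i) by case: i => [i|] //=; exact: (csZ cB).
have /maxk : P k.+1.
  apply/asboolP; exists (option N), A'; split=> //; first by rewrite card_option Nk.
  move=> [i|] [l|].
  - by rewrite /= oA.
  - rewrite /=; by rewrite /C' ipZ CA mulr0.
  - by rewrite /= frame_ip_conj /C' ipZ CA mulr0 conjC0.
  - rewrite /= /C' ipZ frame_ip_conj ipZ CC -rmorphM conjR -rmorphM /=.
    by rewrite mulrA -expr2 exprVn sqr_sqrtr // mulVf ?gt_eqF.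
by rewrite ltnn.
Qed.

End Orthonormal.

(** By [orthonormal_basis] the images of [hat z] under all T-bimodular operators span a
    finite-dimensional space of vectors from QN_S(T); D is generated by a spanning family and its
    adjoints. Stability under all T-bimodular operators is what separates D from its complement in
    [form_op]. *)
Lemma isotypic z : Q z -> exists D, [/\ finite_bimod D, D (hat z),
  (forall W w, tbi W -> D w -> D (W w)) & (forall w, D w -> D (J w))].
Proof.
move=> Qz; have Sz := QN_S Qz.
have fD := gen_finite TS (fun _ : 'I_1 => Qz); have [sD [I [w gD]] _] := fD.
have [V [m [e F]]] := left_frame_ex TS sD gD.
have [N [A [tA spanA]]] := orthonormal_basis F.
have Dz : gen_bimod T one (fun _ : 'I_1 => z) (hat z) := gen_bimod_gen TS (F := fun _ : 'I_1 => z) (i := ord0).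
have Te j := TsS (lf_T F j Sz); have Sm j := lf_S F j.
have span B : tbi B -> exists a : N -> R[i], B (hat z) = \sum_i a i *: A i (hat z).
  move=> tB; have [a aE] := spanA B tB; exists a.
  have exp C : tbi C -> C (hat z) = \sum_j la (e j z) (C (hat (m j))).
    move=> [bC Cl _]; rewrite {1}(lf_exp TS F Sz Dz) (hat_sum LS) => [|j]; last exact: (cs_comp cS).
    rewrite (lin_sum (bop_lin bC)); apply: eq_bigr => j _.
    by rewrite -(la_hat LS) // Cl //; exact: (lf_T F).
  rewrite exp //; under [RHS]eq_bigr do rewrite exp // scaler_sumr.
  rewrite exchange_big /=; apply: eq_bigr => j _; rewrite aE (lin_sum (bop_lin (la_bop LS (Te j)))).
  by apply: eq_bigr => i _; rewrite (linZ (bop_lin (la_bop LS (Te j)))).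
pose f i := sval (cid2 (tbi_QN TS (tA i) Qz)).
have Qf i : Q (f i) by rewrite /f; case: cid2.
have fE i : A i (hat z) = hat (f i) by rewrite /f; case: cid2.
pose G (p : N * bool) := if p.2 then adj (f p.1) else f p.1.
have QG p : Q (G p) by rewrite /G; case: p.2 => //; exact: (QN_adj TS).
have SG p := QN_S (QG p).
pose D := gen_bimod T one G; have fG : finite_bimod D := gen_finite TS QG.
have [[cD Dl Dr] _ _] := fG; have [D0 DL _] := cD.
have Dsum (a : N -> R[i]) b : D (\sum_i a i *: hat (G (i, b))).
  elim/big_rec: _ => // i v _ Dv; apply: DL => //; exact: (gen_bimod_gen TS (F := G) (i := (i, b))).
have spanG B : tbi B -> D (B (hat z)).
  by move=> /span[a ->]; under eq_bigr do rewrite fE; exact: (Dsum a false).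
have cB := tbi_cstar TS.
exists D; split=> //.
- exact: (spanG idfun (cs_id cB)).
- move=> W w' tW; have [bW Wl Wr] := tW; move: w'; apply: (lspan_min (preim_csub cD bW)).
  move=> _ [[i b] [t [s [Tt Ts ->]]]] /=; have [St Ss] := (TsS Tt, TsS Ts).
  have -> : hat (t \o G (i, b) \o s) = la t (ra s (hat (G (i, b)))).
    by rewrite (ra_hat LS Ss (SG _)) (la_hat LS) //; exact: (cs_comp cS).
  rewrite Wl // Wr //; apply: Dl => //; apply: Dr => //.
  case: b; rewrite /G /=; last by rewrite -fE; apply: (spanG (W \o A i)); exact: (cs_comp cB).
  rewrite -(Jop_hat LS (QN_S (Qf i))) -fE -[W _](JopK LS).
  have [a ae] := span _ (cs_comp cB (tbi_J TS tW) (tA i)).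
  have -> : J (W (J (A i (hat z)))) = \sum_i a i *: A i (hat z) := ae.
  rewrite (Jop_sum LS); under eq_bigr do rewrite (JopZ LS) fE (Jop_hat LS (QN_S (Qf _))).
  exact: (Dsum (fun i => (a i)^* ) true).
- apply: (lspan_min (J_csub TS cD)) => _ [[i b] [t [s [Tt Ts ->]]]] /=.
  have [St Ss] := (TsS Tt, TsS Ts); have Sf := QN_S (Qf i).
  have Stg := cs_comp cS St (SG (i, b)).
  rewrite (Jop_hat LS (cs_comp cS Stg Ss)) (adj_comp (bS Stg) (bS Ss)) (adj_comp (bS St) (bS (SG _))).
  have -> : adj (G (i, b)) = G (i, ~~ b) by rewrite /G; case: (b) => //=; exact: adjK (bS Sf).
  apply: subset_closure; apply: lspanS; exists (i, ~~ b), (adj s), (adj t).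
  by split=> //; exact: cs_adj.
Qed.

End Multiplicity.

(** * Moments *)

(** Log-convexity makes the ratios of consecutive terms nondecreasing, so growth of order [b^k],
    with whatever constant [C], already bounds the first ratio. This turns asymptotic estimates into
    sharp ones. *)
Lemma log_convex_growth (R : realType) (mu : nat -> R) (C b : R) : (forall k, 0 <= mu k) -> 0 <= b ->
  (forall k, mu k.+1 ^+ 2 <= mu k * mu k.+2) -> (forall k, mu k <= C * b ^+ k) -> mu 1%N <= b * mu 0%N.
Proof.
move=> mu0 b0 lc bd; rewrite leNgt; apply/negP => lt.
have p0 : 0 < mu 0%N.
  rewrite lt_def mu0 andbT; apply/eqP => e; have := lc 0%N; rewrite e mul0r.
  have := mu0 1%N; move: lt; rewrite e mulr0; nra.
pose r := mu 1%N / mu 0%N; have rb : b < r by rewrite ltr_pdivlMr.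
have r0 : 0 < r by apply: le_lt_trans rb.
have step k : 0 < mu k /\ r * mu k <= mu k.+1.
  elim: k => [|k [pk ik]]; first by rewrite /r divfK ?gt_eqF.
  have pk1 : 0 < mu k.+1 by apply: lt_le_trans ik; rewrite mulr_gt0.
  split=> //; rewrite -(ler_pM2l pk); apply: le_trans (lc k); rewrite expr2 mulrA.
  by rewrite ler_wpM2r // mulrC.
have low k : r ^+ k * mu 0%N <= mu k.
  elim: k => [|k ik]; first by rewrite expr0 mul1r.
  rewrite exprS -mulrA; apply: le_trans (step k).2; by rewrite ler_wpM2l // ltW.
have [b_0|bn0] := eqVneq b 0.
  have := le_trans (low 1%N) (bd 1%N); rewrite b_0 expr1 mulr0; have := mulr_gt0 r0 p0; lra.
have bp : 0 < b by rewrite lt_def bn0.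
pose d := r / b - 1; have d0 : 0 < d by rewrite subr_gt0 ltr_pdivlMr // mul1r.
have bern k : 1 + k%:R * d <= (r / b) ^+ k.
  elim: k => [|k ik]; first by rewrite mul0r addr0 expr0.
  have e : r / b = 1 + d by rewrite /d addrC subrK.
  rewrite exprS e; rewrite e in ik.
  have d1 : 0 <= 1 + d by lra.
  have := ler_wpM2l d1 ik.
  apply: le_trans; rewrite -natr1; have := mulr_ge0 (ler0n R k) (sqr_ge0 d); lra.
pose A := C / (mu 0%N * d); have [k hk] : exists k : nat, A < k%:R.
  by exists (Num.truncn A).+1; apply: truncnS_gt.
have := le_trans (low k) (bd k); have := bern k; rewrite expr_div_n ler_pdivlMr ?exprn_gt0 // => h1 h2.
have h3 : (1 + k%:R * d) * mu 0%N <= C.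
  rewrite -(ler_pM2r (exprn_gt0 k bp)) mulrAC; apply: le_trans h2; by rewrite ler_pM2r.
move: hk; rewrite /A ltr_pdivrMr ?mulr_gt0 //; lra.
Qed.

Section Powers.
Variables (R : realType) (H : hilbertType R) (N : set (H -> H)) (tr : (H -> H) -> R).
Hypothesis cN : cstar N.
Hypothesis tN : rtrace N tr.

Definition pw (W : H -> H) k : H -> H := iter k W.

Lemma pw_N W k : N W -> N (pw W k).
Proof. by move=> NW; elim: k => [|k ik]; [exact: cs_id|exact: (cs_comp cN)]. Qed.
Lemma pwD W j k : pw W (j + k) = pw W j \o pw W k.
Proof. by apply/funext => v; rewrite /pw /= iterD. Qed.
Lemma pwSr W k : pw W k.+1 = pw W k \o W.
Proof. by rewrite -addn1 pwD. Qed.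
Lemma pw_sa W k : sa W -> sa (pw W k).
Proof.
move=> sW; elim: k => [|k ik]; first exact: sa_id.
exact: (sa_comp sW ik (pwSr W k)).
Qed.

Lemma rt_CS a b : N a -> N b -> tr (adj a \o b) = tr (adj b \o a) ->
  tr (adj a \o b) ^+ 2 <= tr (adj a \o a) * tr (adj b \o b).
Proof.
move=> Na Nb e; have [Naa Nab] := (cs_adj cN Na, cs_adj cN Nb).
have [ba bb] := (cs_bop cN Na, cs_bop cN Nb); have [baa bab] := (cs_bop cN Naa, cs_bop cN Nab).
apply: quad_ge0 => [|t]; first exact: (rt_sqr tN).
have -> : tr (adj a \o a) + 2 * t * tr (adj a \o b) + t ^+ 2 * tr (adj b \o b) =
    tr (adj (t%:C%C *: b + a) \o (t%:C%C *: b + a)); last by apply: (rt_sqr tN); exact: cs_lin.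
have -> : adj (t%:C%C *: b + a) \o (t%:C%C *: b + a) = (t ^+ 2)%:C%C *: (adj b \o b) +
    (t%:C%C *: (adj a \o b) + (t%:C%C *: (adj b \o a) + (adj a \o a))).
  have -> : adj (t%:C%C *: b + a) = t%:C%C *: adj b + adj a.
    rewrite (adj_lin _ bb ba); congr (_ *: _ + _).
    by apply/eqP; rewrite eq_complex /= oppr0 !eqxx.
  apply/funext => z; rewrite -[LHS]/(t%:C%C *: adj b (t%:C%C *: b z + a z) + adj a (t%:C%C *: b z + a z)).
  rewrite (bop_lin bab) (bop_lin baa) -[RHS]/((t ^+ 2)%:C%C *: adj b (b z) +
    (t%:C%C *: adj a (b z) + (t%:C%C *: adj b (a z) + adj a (a z)))).
  by hvec.
have Nc x y : N x -> N y -> N (x \o y) by exact: (cs_comp cN).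
have Nl (s : R) x y : N x -> N y -> N (s%:C%C *: x + y) by exact: (cs_lin cN).
rewrite !(rt_lin tN) ?e; [ring| | | | | |]; do ?[by apply: (Nc)|apply: (Nl)|apply: (Nc)] => //.
Qed.

(** The last hypothesis gives [tr(W^(2m+2)) <= tr(V W^(2m+1))], and Cauchy-Schwarz bounds the square
    of the latter by [tr(W^(2m+2))] times [B^2 tr(W^(2m))]; so the even moments grow at most like
    [B^(2m)]. [log_convex_growth], for the squared 2-norms of [W^k a], then bounds [W a] by B times
    [a] in 2-norm, and [trace_psd] yields the operator bound. *)
Lemma moment_bound W V (B : R) : N W -> sa W -> N V -> sa V -> 0 <= B -> onb V B ->
  (forall m, 0 <= tr (pw W m.*2.+1 \o (V - W))) -> onb W B.
Proof.
move=> NW sW NV sV B0 VB h; have NB2 : N ((B ^+ 2)%:C%C *: idfun) by apply: (csZ cN); exact: cs_id.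
have pN k : N (pw W k) := pw_N k NW; have ps k := pw_sa k sW.
have Nc x y : N x -> N y -> N (x \o y) by exact: (cs_comp cN).
have sqr k : tr (adj (pw W k) \o pw W k) = tr (pw W k.*2) by rewrite (ps k).2 -pwD addnn.
have t0 k : 0 <= tr (pw W k.*2) by rewrite -sqr; exact: (rt_sqr tN).
have bndl (x y : H -> H) c : N x -> N y -> 0 <= c -> onb x c ->
    tr (adj (x \o y) \o (x \o y)) <= c ^+ 2 * tr (adj y \o y).
  move=> Nx Ny c0 xc; have [bx by_] := (cs_bop cN Nx, cs_bop cN Ny); have Nay := cs_adj cN Ny.
  rewrite -(rtZ cN tN) //; last exact: (Nc).
  apply: (rt_le cN tN); [by apply: (Nc); [apply: cs_adj => //; exact: (Nc)|exact: (Nc)]|by apply: (csZ cN); exact: (Nc)|].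
  have := psd_conj by_ (psd_sub_adj bx c0 xc); rewrite (adj_comp bx by_).
  suff -> : adj y \o ((c ^+ 2)%:C%C *: idfun - (adj x \o x)) \o y =
    (c ^+ 2)%:C%C *: (adj y \o y) - (adj y \o adj x \o (x \o y)) by [].
  apply/funext => z; rewrite -[LHS]/(adj y ((c ^+ 2)%:C%C *: y z - adj x (x (y z)))).
  have ly := bop_lin (cs_bop cN Nay); by rewrite (linB ly) (linZ ly).
have step m : tr (pw W m.+1.*2) <= B ^+ 2 * tr (pw W m.*2).
  have Nb := Nc _ _ NV (pN m).
  have e1 : tr (adj (pw W m.+1) \o (V \o pw W m)) = tr (V \o pw W m.*2.+1).
    rewrite (ps _).2 (rt_C tN) // -[(V \o pw W m) \o _]/(V \o (pw W m \o pw W m.+1)).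
    by rewrite -pwD addnS addnn.
  have e2 : tr (adj (V \o pw W m) \o pw W m.+1) = tr (V \o pw W m.*2.+1).
    rewrite (adj_comp sV.1 (ps m).1) sV.2 (ps m).2 -[(pw W m \o V) \o _]/(pw W m \o (V \o pw W m.+1)).
    rewrite (rt_C tN) //; last exact: (Nc).
    by rewrite -[(V \o pw W m.+1) \o _]/(V \o (pw W m.+1 \o pw W m)) -pwD addSn addnn.
  have := rt_CS (pN m.+1) Nb (etrans e1 (esym e2)); rewrite e1 sqr => cs.
  have l1 : tr (pw W m.+1.*2) <= tr (V \o pw W m.*2.+1).
    have := h m; have -> : pw W m.*2.+1 \o (V - W) = (pw W m.*2.+1 \o V) - (pw W m.*2.+1 \o W).
      by apply/funext => z; rewrite -[LHS]/(pw W m.*2.+1 (V z - W z)) (linB (bop_lin (ps _).1)).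
    rewrite (rtB cN tN); [|exact: (Nc)|exact: (Nc)].
    by rewrite -pwSr -doubleS (rt_C tN) // subr_ge0.
  have l2 := bndl V (pw W m) B NV (pN m) B0 VB; rewrite sqr in l2.
  have := t0 m.+1; have := t0 m; move: l1 l2 cs; set a := tr (pw W m.+1.*2); set v := tr (V \o _).
  set b := tr (pw W m.*2); set d := tr (adj _ \o _) => l1 l2 cs b0 a0.
  have : a ^+ 2 <= a * (B ^+ 2 * b).
    apply: le_trans (_ : v ^+ 2 <= _); first by rewrite ler_pXn2r ?nnegrE // (le_trans a0).
    by apply: le_trans cs _; rewrite ler_wpM2l.
  have [->|an0] := eqVneq a 0; first by rewrite mulr_ge0 ?sqr_ge0.
  by rewrite expr2 ler_pM2l // lt_def an0.
have tB m : tr (pw W m.*2) <= (B ^+ 2) ^+ m * tr idfun.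
  elim: m => [|m im]; first by rewrite expr0 mul1r.
  apply: le_trans (step m) _; rewrite (exprS (B ^+ 2) m) -mulrA ler_wpM2l ?sqr_ge0 //.
have key a : N a -> tr (adj (W \o a) \o (W \o a)) <= B ^+ 2 * tr (adj a \o a).
  move=> Na; have ba := cs_bop cN Na; have [c c0 ac] := bop_onb (adj_bop ba); have Naa := cs_adj cN Na.
  pose mu k := tr (adj (pw W k \o a) \o (pw W k \o a)).
  apply: (@log_convex_growth _ mu (c ^+ 2 * tr idfun)) => [k||k|k].
  - by apply: (rt_sqr tN); exact: (Nc).
  - exact: sqr_ge0.
  - have E : adj (pw W k \o a) \o (pw W k.+2 \o a) = adj (pw W k.+1 \o a) \o (pw W k.+1 \o a).
      rewrite !(adj_comp (ps _).1 ba) !(ps _).2.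
      rewrite -[(adj a \o pw W k) \o _]/(adj a \o (pw W k \o pw W k.+2) \o a).
      by rewrite -[(adj a \o pw W k.+1) \o _]/(adj a \o (pw W k.+1 \o pw W k.+1) \o a) -!pwD addnS.
    have E' : adj (pw W k.+2 \o a) \o (pw W k \o a) = adj (pw W k.+1 \o a) \o (pw W k.+1 \o a).
      rewrite !(adj_comp (ps _).1 ba) !(ps _).2.
      rewrite -[(adj a \o pw W k.+2) \o _]/(adj a \o (pw W k.+2 \o pw W k) \o a).
      by rewrite -[(adj a \o pw W k.+1) \o _]/(adj a \o (pw W k.+1 \o pw W k.+1) \o a) -!pwD !addSn addnS.
    have := @rt_CS (pw W k \o a) (pw W k.+2 \o a) (Nc _ _ (pN k) Na) (Nc _ _ (pN k.+2) Na).
    by rewrite E E'; apply.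
  - rewrite mulrAC -mulrA.
    have e : mu k = tr (adj (adj a \o pw W k) \o (adj a \o pw W k)).
      rewrite /mu (rt_C tN) ?(adj_comp (ps _).1 ba) ?(adj_comp (adj_bop ba) (ps k).1) ?(adjK ba) ?(ps k).2 //.
        by apply: (Nc).
      by apply: (Nc).
    rewrite e; apply: le_trans (bndl _ _ _ Naa (pN k) c0 ac) _; rewrite sqr.
    by apply: ler_wpM2l; [exact: sqr_ge0|exact: tB].
have sB : sa ((B ^+ 2)%:C%C *: idfun - (W \o W)).
  by apply: saB; [apply: saZ; exact: sa_id|exact: sa_comp].
have NWW := Nc _ _ NW NW.
have p : psd ((B ^+ 2)%:C%C *: idfun - (W \o W)).
  apply: (trace_psd cN tN) => //; first exact: (csB cN).
  move=> a Na; have Naa := cs_adj cN Na; have la_ := bop_lin (cs_bop cN Naa).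
  have -> : adj a \o (((B ^+ 2)%:C%C *: idfun - (W \o W)) \o a) =
      (B ^+ 2)%:C%C *: (adj a \o a) - (adj (W \o a) \o (W \o a)).
    rewrite (adj_comp sW.1 (cs_bop cN Na)) sW.2; apply/funext => z.
    by rewrite -[LHS]/(adj a ((B ^+ 2)%:C%C *: a z - W (W (a z)))) (linB la_) (linZ la_).
  have N1 := Nc _ _ Naa Na; have N2 := Nc _ _ NW Na.
  rewrite (rtB cN tN) ?(rtZ cN tN) ?subr_ge0 //; first exact: key.
    exact: (csZ cN).
  by apply: (Nc) => //; exact: cs_adj.
move=> z; rewrite -(@ler_pXn2r _ 2) ?nnegrE ?mulr_ge0 // exprMn -subr_ge0.
have := p.2 z; rewrite -[(_ - _) z]/((B ^+ 2)%:C%C *: z - W (W z)) dotBl dotZl dotxx.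
by rewrite (sa_dot sW) dotxx.
Qed.

End Powers.

(* With [p_n = sum_{i+j=n} L^i R^j] one has
   [2 p_2m = L^2m + R^2m + (L + R)^2 sum_{l<m} L^2l R^2(m-1-l)]. *)
Lemma comm_powers_ge0 (R : realType) (H : hilbertType R) (L P : H -> H) (p : nat -> H -> H) m eta :
  linear L -> linear P -> (forall x y, dot (L x) y = dot x (L y)) ->
  (forall x y, dot (P x) y = dot x (P y)) -> (forall x, L (P x) = P (L x)) ->
  (forall x, p 0%N x = x) -> (forall n x, p n.+1 x = L (p n x) + iter n.+1 P x) ->
  0 <= dot (p m.*2 eta) eta.
Proof.
move=> lL lP sL sP LP p0 pS.
have sk (F : H -> H) : (forall x y, dot (F x) y = dot x (F y)) ->
    forall j y z, dot (iter j F y) z = dot y (iter j F z).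
  by move=> sF; elim=> //= j ij y z; rewrite sF ij -iterSr.
have sq (F : H -> H) : (forall x y, dot (F x) y = dot x (F y)) -> forall j x, 0 <= dot (iter j.*2 F x) x.
  by move=> sF j x; rewrite -addnn iterD (sk F) // dotxx sqr_ge0.
pose G z := L z + P z.
have GP z : G (P z) = P (G z) by rewrite /G (linD lP) LP.
have GPi k z : G (iter k P z) = iter k P (G z) by elim: k => //= k <-; rewrite GP.
have GL z : G (L z) = L (G z) by rewrite /G (linD lL) LP.
have sG x y : dot (G x) y = dot x (G y) by rewrite /G dotDl dotDr sL sP.
have GE z : G z = L z + P z by [].
clearbody G.
have LPi k z : L (iter k P z) = iter k P (L z) by elim: k => //= k <-; rewrite LP.
pose u := fix u m : H -> H := if m is k.+1 then fun x => L (L (u k x)) + G (G (iter k.*2 P x)) else fun=> 0.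
have lu k x : u k (L x) = L (u k x).
  elim: k x => [|k ik] x /=; first by rewrite (lin0 lL).
  by rewrite ik -LPi !GL (linD lL).
have u0 k x : 0 <= dot (u k x) x.
  elim: k x => [|k ik] x /=; first by rewrite dot0l.
  rewrite dotDl; apply: addr_ge0; first by rewrite sL -lu; exact: ik.
  have [y yE] : exists y, iter k P x = y by exists (iter k P x).
  by rewrite -addnn iterD yE !GPi (sk P) // yE sG dotxx sqr_ge0.
have pE k x : p k.*2 x + p k.*2 x = u k x + (iter k.*2 L x + iter k.*2 P x).
  elim: k => [|k ik]; first by rewrite p0 /= add0r.
  rewrite doubleS !pS !(linD lL) /= -/(u k).
  have -> : L (L (p k.*2 x)) + L (iter k.*2.+1 P x) + iter k.*2.+2 P x +
      (L (L (p k.*2 x)) + L (iter k.*2.+1 P x) + iter k.*2.+2 P x) =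
      L (L (p k.*2 x + p k.*2 x)) + (L (P (iter k.*2 P x)) + P (P (iter k.*2 P x)) +
      (L (P (iter k.*2 P x)) + P (P (iter k.*2 P x)))).
    by rewrite !(linD lL) /=; hvec.
  rewrite ik !(linD lL) !GE !(linD lL) !(linD lP) -!LP; hvec.
have : 0 <= dot (p m.*2 eta + p m.*2 eta) eta.
  by rewrite pE !dotDl !addr_ge0 // sq.
by rewrite dotDl; lra.
Qed.

(** * Resolvents of derivations *)

Lemma quad_cvg_ge0 (R : realType) (H : hilbertType R) (B : H -> H) (u : nat -> H) z : bounded_op B ->
  hcvg u z -> (forall n, 0 <= dot (B (u n)) (u n)) -> 0 <= dot (B z) z.
Proof.
move=> bB uz h; have [c c0 Bc] := bop_onb bB; rewrite leNgt; apply/negP => lt.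
set m := c * (hn z + hn z + 1) + 1.
have m0 : 0 < m by rewrite ltr_wpDl // mulr_ge0 // !addr_ge0.
pose e := Num.min 1 (- dot (B z) z / m).
have e0 : 0 < e by rewrite lt_min ltr01 divr_gt0 // oppr_gt0.
have [n hN] := uz _ e0; have {hN} := hN n (leqnn _); move: (h n); rewrite -{1 2}(subrK z (u n)); set w := u n - z => hz w1; clearbody w.
have we : hn w < 1 by apply: lt_le_trans w1 _; rewrite ge_min lexx.
have wm : hn w * m < - dot (B z) z.
  by rewrite -ltr_pdivlMr //; apply: lt_le_trans w1 _; rewrite ge_min lexx orbT.
move: hz; rewrite (linD (bop_lin bB)) dotDl !dotDr.
have b1 : dot (B z) w <= c * hn z * hn w.
  by apply: le_trans (dot_CS _ _) _; rewrite ler_wpM2r.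
have b2 : dot (B w) z <= c * hn w * hn z.
  by apply: le_trans (dot_CS _ _) _; rewrite ler_wpM2r.
have b3 : dot (B w) w <= c * hn w * hn w.
  by apply: le_trans (dot_CS _ _) _; rewrite ler_wpM2r.
have := hn_ge0 w; have := hn_ge0 z; rewrite /m in wm; have : c * hn w * hn w <= c * hn w * 1.
  by rewrite ler_wpM2l ?mulr_ge0 // ltW.
nra.
Qed.

Section Resolvents.
Variables (R : realType) (K : hilbertType R) (T S : set (K -> K)) (tau : (K -> K) -> R[i]).
Variables (XT X : biact K) (oneT : XT) (one : X).
Hypothesis TS : inclusion T S tau oneT one.
Let LS := in_S TS.
Let LT := in_T TS.
Let vS : vn_algebra S. Proof. by case: LS. Qed.
Let vT : vn_algebra T. Proof. by case: LT. Qed.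
Let cS := vn_cstar vS.
Let cT := vn_cstar vT.
Let bS := cs_bop cS.
Let TsS := in_sub TS.
Implicit Types (x y t u : K -> K) (D : set X) (W : X -> X).
Local Notation J := (Jop S one).
Local Notation hat := (hat one).
Local Notation la := (@lact _ _ X).
Local Notation ra := (@ract _ _ X).
Local Notation Q := (QN T S).

Local Notation tbi := (@tbi _ _ T X).
Variable H : biact K.
Hypothesis bH : bimodule S S H.
Hypothesis qr : quasi_regular T S.

Lemma QN_dense (H' : hilbertType R) (f g : X -> H') : bounded_op f -> bounded_op g ->
  (forall x, Q x -> f (hat x) = g (hat x)) -> f = g.
Proof.
move=> bf bg fg; apply: (@op_ext_orth _ _ _ [set hat x | x in Q]) => // [_ [x Qx <-]|z h]; first exact: fg.
have d := dense_subalgebra LS (fun x => @QN_S _ _ T S x) (QN_id TS) (QN_lin TS) (QN_comp TS) (QN_adj TS) qr.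
by rewrite (dense_ext d h) (lin0 (bop_lin bf)) (lin0 (bop_lin bg)).
Qed.

Lemma QN_approx (z : X) : exists2 x : nat -> K -> K, forall n, Q (x n) & hcvg (fun n => hat (x n)) z.
Proof.
have d := dense_subalgebra LS (fun x => @QN_S _ _ T S x) (QN_id TS) (QN_lin TS) (QN_comp TS) (QN_adj TS) qr.
have [|u hu uz] := @hcvg_dense _ _ [set hat x | x in Q] z.
  by apply/hclosureP; rewrite d.
exists (fun n => sval (cid2 (hu n))) => [n|]; first by case: cid2.
by have -> : (fun n => hat (sval (cid2 (hu n)))) = u by apply/funext => n; case: cid2.
Qed.

Lemma tbi_adj_comp (U U' : X -> H) : bounded_op U -> bounded_op U' ->
  (forall t z, T t -> U (la t z) = lact t (U z)) -> (forall t z, T t -> U (ra t z) = ract t (U z)) ->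
  (forall t z, T t -> U' (la t z) = lact t (U' z)) -> (forall t z, T t -> U' (ra t z) = ract t (U' z)) ->
  tbi (adj U' \o U).
Proof.
move=> bU bU' Ul Ur Ul' Ur'; split=> [|t z Tt|t z Tt]; first by apply: bop_comp => //; exact: adj_bop.
  have Tat := cs_adj cT Tt; have [St Sat] := (TsS Tt, TsS Tat).
  apply: inner_inj => w; rewrite /= Ul // inner_conj -(adjP bU') -inner_conj (bi_ladj bH) // -Ul' //.
  by rewrite (la_adj LS) // inner_conj (adjP bU') -inner_conj.
have Tat := cs_adj cT Tt; have [St Sat] := (TsS Tt, TsS Tat).
apply: inner_inj => w; rewrite /= Ur // inner_conj -(adjP bU') -inner_conj (bi_radj bH) // -Ur' //.
by rewrite (ra_adj LS) // inner_conj (adjP bU') -inner_conj.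
Qed.

Variable c : (K -> K) -> H.
Hypothesis hc : bimod_map T S c.

(** The second term makes the form invariant under J, so that resolvents commute with the
    adjoint. *)
Definition dform x y : R[i] := '<<c x, c y>> + '<<c (adj y), c (adj x)>>.

Lemma dform_conj x y : dform x y = (dform y x)^*.
Proof. by rewrite /dform rmorphD (inner_conj (c y) (c x)) (inner_conj (c (adj x)) (c (adj y))). Qed.

Lemma dform_lin a x y z : Q x -> Q y -> dform (a *: x + y) z = a * dform x z + dform y z.
Proof.
move=> Qx Qy; have [Qax Qay] := (QN_adj TS Qx, QN_adj TS Qy); have [bx by_] := (bS (QN_S Qx), bS (QN_S Qy)).
rewrite /dform (bm_lin hc) // (adj_lin _ bx by_) (bm_lin hc) // innerDl innerZl innerDr innerZr conjCK; ring.
Qed.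

Lemma dformB x y z : Q x -> Q y -> dform (x - y) z = dform x z - dform y z.
Proof. by move=> Qx Qy; rewrite -[in LHS](addrC (- y)) -[in LHS]scaleN1r dform_lin // mulN1r addrC. Qed.

Lemma dformBr x y z : Q y -> Q z -> dform x (y - z) = dform x y - dform x z.
Proof. by move=> Qy Qz; rewrite dform_conj dformB // rmorphB /= -(dform_conj x y) -(dform_conj x z). Qed.

Lemma dform_ge0 x : 0 <= complex.Re (dform x x).
Proof. by rewrite /dform ReD !inner_xx addr_ge0 // sqr_ge0. Qed.

(** For [v] in D and [w] orthogonal to D, [<c v, c w>] pairs [w] with the image of [v] under a
    T-bimodular operator, which stays in D. So only the component of [y] in D matters, and there
    [bimod_map_ext] represents the form. *)
Lemma form_op z : Q z -> exists A D, [/\ tbi A, psd A, D (hat z),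
  (forall x y, Q x -> D (hat x) -> Q y -> '<<A (hat x), hat y>> = dform x y)
  & (forall W w, tbi W -> D w -> D (W w))].
Proof.
move=> Qz; have [D [fD Dz Winv Jinv]] := isotypic TS Qz; have [sD _ _] := fD; have [cD Dl Dr] := sD.
have [U [bU Uc Ul Ur]] := bimod_map_ext TS bH hc fD.
pose B := adj U \o U; have tB : tbi B by exact: tbi_adj_comp.
have pB : psd B by exact: psd_adj_comp.
(* [B] represents the first term of [dform] and [B'] the second. *)
pose B' := J \o B \o J; have tB' : tbi B' := tbi_J TS tB.
have pB' : psd B'.
  have [bB' _ _] := tB'; split; first apply: saI => // xi eta.
    rewrite /B' /= -{1}[eta](JopK LS) (Jop_inner LS) -(sa_inner pB.1).
    by rewrite -[in RHS](JopK LS xi) (Jop_inner LS).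
  move=> xi; rewrite /B' /= -{2}[xi](JopK LS) /dot (Jop_inner LS) -/(dot _ _) dotC; exact: pB.2.
have tP := proj_tbi TS sD; have bP := proj_bop cD.
pose A := proj D \o (B + B') \o proj D.
have cB := tbi_cstar TS.
have tA : tbi A by do 2!apply: (cs_comp cB) => //; exact: (csD cB).
have pA : psd A by have := psd_conj bP (psdD pB pB'); rewrite (adj_proj cD).
exists A, D; split=> // x y Qx Dx Qy; have [Sx Sy] := (QN_S Qx, QN_S Qy).
have [y1 Qy1 y1E] := tbi_QN TS tP Qy; have Sy1 := QN_S Qy1.
have Dy1 : D (hat y1) by rewrite -y1E; exact: proj_in.
have orth (v w : K -> K) : Q v -> D (hat v) -> Q w -> (forall a, D a -> '<<a, hat w>> = 0) -> '<<c v, c w>> = 0.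
  move=> Qv Dv Qw h; have fw := gen_finite TS (fun _ : 'I_1 => Qw).
  have [U2 [bU2 Uc2 Ul2 Ur2]] := bimod_map_ext TS bH hc fw.
  rewrite -(Uc _ Qv Dv) -(Uc2 _ Qw); last exact: (gen_bimod_gen TS (F := fun _ : 'I_1 => w) (i := ord0)).
  rewrite inner_conj (adjP bU2) -inner_conj; apply: h.
  by apply: (Winv (adj U2 \o U)) => //; exact: tbi_adj_comp.
have Q2 := QNB TS Qy Qy1.
have orth2 a : D a -> '<<a, hat (y - y1)>> = 0.
  move=> Da; rewrite (hatB LS Sy Sy1) -y1E innerBr -(proj_sa cD) (proj_id cD Da) subrr //.
have E1 : '<<c x, c y>> = '<<c x, c y1>>.
  have := orth _ _ Qx Dx Q2 orth2; rewrite (bmB hc) // innerBr => /eqP; by rewrite subr_eq0 => /eqP.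
have Jx : D (hat (adj x)) by rewrite -(Jop_hat LS) //; exact: Jinv.
have Jy1 : D (hat (adj y1)) by rewrite -(Jop_hat LS) //; exact: Jinv.
have [Qax [Qay Qay1]] := (QN_adj TS Qx, (QN_adj TS Qy, QN_adj TS Qy1)).
have E2 : '<<c (adj y), c (adj x)>> = '<<c (adj y1), c (adj x)>>.
  have h : '<<c (adj x), c (adj (y - y1))>> = 0.
    apply: orth => //; first exact: (QN_adj TS).
    move=> a Da; rewrite -(Jop_hat LS (QN_S Q2)) -[a](JopK LS) (Jop_inner LS) inner_conj orth2 ?conjC0 //.
    exact: Jinv.
  move: h; rewrite (adjB (bS Sy) (bS Sy1)) (bmB hc) // inner_conj innerBl => h.
  apply/eqP; rewrite -subr_eq0; apply/eqP.
  by rewrite -[LHS]conjCK h conjC0.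
rewrite /dform E1 E2 /A /= (proj_sa cD) y1E (proj_id cD Dx) -[(_ + _) (hat x)]/(B (hat x) + B' (hat x)) innerDl.
congr (_ + _); first by rewrite /B /= inner_conj -(adjP bU) -inner_conj (Uc _ Qx Dx) (Uc _ Qy1 Dy1).
rewrite /B' /B /= (Jop_hat LS Sx) -[hat y1](JopK LS) (Jop_inner LS) (Jop_hat LS Sy1).
by rewrite -(adjP bU) (Uc _ Qay1 Jy1) (Uc _ Qax Jx).
Qed.

Variable eps : R.
Hypothesis e0 : 0 < eps.

(** The weak form of [x = (1 + eps Delta) r], with Delta the operator of the form; testing against
    QN_S(T) avoids any domain of Delta. *)
Definition is_res x r := Q r /\ forall z, Q z -> '<<hat x - hat r, hat z>> = eps%:C%C * dform r z.

(** On the component of [x] the form is given by a bounded T-bimodular [A]; the inverse of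
    [1 + eps A] is again T-bimodular, hence preserves both D and QN_S(T). *)
Lemma res_ex x : Q x -> exists r, is_res x r.
Proof.
move=> Qx; have [A [D [tA pA Dx hA Winv]]] := form_op Qx; have cB := tbi_cstar TS.
have tI : tbi (idfun + eps%:C%C *: A) by apply: (csD cB); [exact: cs_id|exact: csZ].
have E z : dot ((idfun + eps%:C%C *: A) z) z = hn z ^+ 2 + eps * dot (A z) z.
  by rewrite -[(_ + _) z]/(z + eps%:C%C *: A z) dotDl dotZl dotxx.
have p : psd (idfun + eps%:C%C *: A).
  apply: psdD; last exact: psdZ (ltW e0) pA.
  by split=> [|z]; [exact: sa_id|rewrite dotxx sqr_ge0].
have [|Y [tY _ AY _]] := cs_inv cB (ltr01 : 0 < 1 :> R) tI p.
  by move=> z; rewrite E mul1r lerDl mulr_ge0 ?(ltW e0) //; exact: pA.2.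
have [r Qr rE] := tbi_QN TS tY Qx; exists r; split=> // z Qz.
have Dr : D (hat r) by rewrite -rE; exact: Winv.
have -> : hat x = hat r + eps%:C%C *: A (hat r).
  by rewrite -rE; have := congr1 (fun f => f (hat x)) AY.
by rewrite addrC addKr innerZl hA.
Qed.

Lemma res_uniq x r r' : is_res x r -> is_res x r' -> r = r'.
Proof.
move=> [Qr h] [Qr' h']; have [Sr Sr'] := (QN_S Qr, QN_S Qr'); have Qd := QNB TS Qr Qr'.
apply: (hat_inj LS) => //; apply/eqP; rewrite -subr_eq0 -(hatB LS) //; apply/eqP/hn_eq0/eqP.
rewrite -sqrf_eq0 -dotxx; apply/eqP/le_anti; rewrite {2}dotxx sqr_ge0 andbT.
have E : '<<hat (r - r'), hat (r - r')>> = - (eps%:C%C * dform (r - r') (r - r')).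
  rewrite (dformB (r - r') Qr Qr') mulrBr -h // -h' // -innerBl -innerNl {1}(hatB LS) //.
  by rewrite opprB; congr ('<< _, _ >>); rewrite opprB [RHS]addrC addrA addrNK.
by rewrite /dot E ReN ReRM oppr_le0 mulr_ge0 ?(ltW e0) ?dform_ge0.
Qed.

Definition res x := xget 0 (is_res x).

Lemma resP x : Q x -> is_res x (res x).
Proof. by move=> /res_ex[r hr]; exact: (xgetPex 0 (ex_intro _ r hr)). Qed.

Lemma res_eq x r : Q x -> is_res x r -> res x = r.
Proof. by move=> Qx; apply: res_uniq; exact: resP. Qed.

Lemma res_QN x : Q x -> Q (res x). Proof. by move=> /resP[]. Qed.

Lemma res_lin a x y : Q x -> Q y -> res (a *: x + y) = a *: res x + res y.
Proof.
move=> Qx Qy; have [Qrx hx] := resP Qx; have [Qry hy] := resP Qy.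
apply: res_eq; first exact: (QN_lin TS).
split=> [|z Qz]; first exact: (QN_lin TS).
rewrite (hat_lin LS _ (QN_S Qx) (QN_S Qy)) (hat_lin LS _ (QN_S Qrx) (QN_S Qry)) dform_lin //.
have -> : a *: hat x + hat y - (a *: hat (res x) + hat (res y)) = a *: (hat x - hat (res x)) + (hat y - hat (res y)).
  by rewrite opprD addrACA scalerBr.
by rewrite innerDl innerZl hx // hy //; ring.
Qed.

Lemma res_adj x : Q x -> res (adj x) = adj (res x).
Proof.
move=> Qx; have [Qr h] := resP Qx; have [Sx Sr] := (QN_S Qx, QN_S Qr).
apply: res_eq; first exact: (QN_adj TS).
split=> [|z Qz]; first exact: (QN_adj TS).
have Qaz := QN_adj TS Qz; have Sz := QN_S Qz.
rewrite -!(Jop_hat LS) // -(JopB LS) -[hat z](JopK LS) (Jop_inner LS) (Jop_hat LS) //.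
rewrite inner_conj h // rmorphM /= -dform_conj /dform (adjK (bS Sz)) (adjK (bS Sr)) addrC.
by congr (_ * _); apply/eqP; rewrite eq_complex /= oppr0 !eqxx.
Qed.

Lemma res_l t x : T t -> Q x -> res (t \o x) = t \o res x.
Proof.
move=> Tt Qx; have [Qr h] := resP Qx; have Tat := cs_adj cT Tt; have [St Sat] := (TsS Tt, TsS Tat).
have [Qt Qat] := (QN_T TS Tt, QN_T TS Tat); have [Sx Sr] := (QN_S Qx, QN_S Qr).
apply: res_eq; first exact: (QN_comp TS).
split=> [|z Qz]; first exact: (QN_comp TS).
have Sz := QN_S Qz; have Qaz := QN_adj TS Qz; have Qar := QN_adj TS Qr.
rewrite -(la_hat LS St Sx) -(la_hat LS St Sr) -(linB (bop_lin (la_bop LS St))) (la_adj LS) // (la_hat LS) // h; last exact: (QN_comp TS).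
congr (_ * _); rewrite /dform (bm_l hc Tt Qr) (bm_l hc Tat Qz) (bi_ladj bH) //; congr (_ + _).
rewrite (adj_comp (bS St) (bS Sr)) (adj_comp (bS Sat) (bS Sz)) (adjK (bS St)).
by rewrite (bm_r hc Tat Qar) (bm_r hc Tt Qaz) (bi_radj bH).
Qed.

Lemma res_r t x : T t -> Q x -> res (x \o t) = res x \o t.
Proof.
move=> Tt Qx; have Tat := cs_adj cT Tt; have [St Sat] := (TsS Tt, TsS Tat); have Qax := QN_adj TS Qx.
have Qr := res_QN Qx; have [Sx Sr] := (QN_S Qx, QN_S Qr); have [bt bat] := (bS St, bS Sat).
have -> : x \o t = adj (adj t \o adj x).
  by rewrite (adj_comp bat (adj_bop (bS Sx))) (adjK bt) (adjK (bS Sx)).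
rewrite res_adj; last by apply: (QN_comp TS) => //; exact: (QN_T TS).
rewrite res_l // (adj_comp bat (bS (QN_S (res_QN Qax)))) (adjK bt).
by rewrite res_adj // (adjK (bS Sr)).
Qed.

Lemma res_sym x y : Q x -> Q y -> '<<hat (res x), hat y>> = '<<hat x, hat (res y)>>.
Proof.
move=> Qx Qy; have [Qr h] := resP Qx; have [Qs h'] := resP Qy.
have := h _ Qs; rewrite innerBl => /eqP; rewrite subr_eq => /eqP ->.
have /eqP := h' _ Qr; rewrite innerBl subr_eq => /eqP e.
rewrite inner_conj e rmorphD rmorphM /= -dform_conj -inner_conj; congr (_ * _ + _).
by apply/eqP; rewrite eq_complex /= oppr0 !eqxx.
Qed.

Lemma res_dot x : Q x -> dot (hat x) (hat (res x)) = hn (hat (res x)) ^+ 2 + eps * complex.Re (dform (res x) (res x)).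
Proof.
move=> Qx; have [Qr h] := resP Qx; rewrite -ReRM -h // -/(dot _ _) dotBl dotxx; ring.
Qed.

Lemma res_hn x : Q x -> hn (hat (res x)) <= hn (hat x).
Proof.
move=> Qx; have := res_dot Qx; have := dot_CS (hat x) (hat (res x)).
have := mulr_ge0 (ltW e0) (dform_ge0 (res x)); have := hn_ge0 (hat (res x)); have := hn_ge0 (hat x).
move=> p0 r0 q0 cs e; rewrite leNgt; apply/negP => lt; nra.
Qed.

Lemma res_close x : Q x -> hn (hat x - hat (res x)) ^+ 2 <= eps * complex.Re (dform x x).
Proof.
move=> Qx; have [Qr h] := resP Qx; set r := res x in Qr h *.
have e1 : hn (hat x - hat r) ^+ 2 = eps * (complex.Re (dform r x) - complex.Re (dform r r)).
  by rewrite -dotxx dotBr /dot !h // !ReRM; ring.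
rewrite e1 ler_pM2l //.
(* Nonnegativity of the form at [x - r] bounds the mixed term by the mean of the diagonal ones. *)
have := dform_ge0 (x - r); have Qd := QNB TS Qx Qr.
rewrite dformB // !dformBr // !ReB (dform_conj x r).
have -> (a : R[i]) : complex.Re a^* = complex.Re a by case: a.
have := dform_ge0 r; have := dform_ge0 x; set a := complex.Re _; set b := complex.Re _; set d := complex.Re _; lra.
Qed.

Hypothesis cd : forall x y, Q x -> Q y -> c (x \o y) = lact x (c y) + ract y (c x).

Lemma der_id : c idfun = 0.
Proof.
have Q1 := QN_id TS; have := cd Q1 Q1; have [[[[_ l1] _ _ _] _] [[[_ r1] _ _ _] _] _] := bH; rewrite l1 r1.
move=> /eqP; rewrite -[X in X == _]/(c idfun) -[X in _ == X]/(c idfun + c idfun).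
by rewrite -subr_eq subrr eq_sym => /eqP.
Qed.

Lemma res_id : res idfun = idfun.
Proof.
have Q1 := QN_id TS; apply: res_eq => //; split=> // z Qz.
by rewrite subrr inner0l /dform der_id adj_id der_id inner0l inner0r addr0 mulr0.
Qed.

Lemma resL_ex : exists U : X -> X, [/\ bounded_op U, onb U 1 & forall x, Q x -> U (hat x) = hat (res x)].
Proof.
have [||||U [bU U1 h _]] := @ext_op _ X X (fun z w => exists x, [/\ Q x, z = hat x & w = hat (res x)]) 1.
- exact: ler01.
- exists 0; have Q0 := QN0 TS; split=> //; first by rewrite (hat0 LS).
  have := res_lin (-1) Q0 Q0; rewrite scaler0 addr0 => ->.
  by rewrite scaleN1r addNr (hat0 LS).
- move=> a _ _ _ _ [x [Qx -> ->]] [y [Qy -> ->]]; exists (a *: x + y); split; first exact: (QN_lin TS).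
    by rewrite (hat_lin LS _ (QN_S Qx) (QN_S Qy)).
  by rewrite res_lin // (hat_lin LS _ (QN_S (res_QN Qx)) (QN_S (res_QN Qy))).
- by move=> _ _ [x [Qx -> ->]]; rewrite mul1r; exact: res_hn.
by exists U; split=> // x Qx; apply: h; exists x.
Qed.

Definition resL : X -> X := sval (cid resL_ex).

Lemma resL_bop : bounded_op resL. Proof. by rewrite /resL; case: cid => U []. Qed.
Lemma resL_onb : onb resL 1. Proof. by rewrite /resL; case: cid => U []. Qed.
Lemma resL_hat x : Q x -> resL (hat x) = hat (res x). Proof. by rewrite /resL; case: cid => U [] ? ? h /h. Qed.

Lemma resL_tbi : tbi resL.
Proof.
have bR := resL_bop; split=> // t z Tt; have Qt := QN_T TS Tt; have St := TsS Tt.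
  have lb := la_bop LS St.
  suff E : resL \o la t = la t \o resL by exact: (congr1 (fun f => f z) E).
  apply: QN_dense => [||x Qx]; try exact: bop_comp.
  rewrite /= (la_hat LS St (QN_S Qx)) !resL_hat //; last exact: (QN_comp TS).
  by rewrite res_l // (la_hat LS St (QN_S (res_QN Qx))).
have rb := ra_bop LS St.
have E : resL \o ra t = ra t \o resL.
  apply: QN_dense => [||x Qx]; try exact: bop_comp.
  rewrite /= (ra_hat LS St (QN_S Qx)) !resL_hat //; last exact: (QN_comp TS).
  by rewrite res_r // (ra_hat LS St (QN_S (res_QN Qx))).
exact: (congr1 (fun f => f z) E).
Qed.

Lemma resL_J z : resL (J z) = J (resL z).
Proof.
have [bJ _ _] := tbi_J TS resL_tbi.
have E : J \o resL \o J = resL.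
  apply: QN_dense => // [|x Qx]; first exact: resL_bop.
  have Qax := QN_adj TS Qx; have Sr := QN_S (res_QN Qx).
  rewrite /= (Jop_hat LS (QN_S Qx)) !resL_hat // res_adj // (Jop_hat LS (cs_adj cS Sr)).
  by rewrite (adjK (bS Sr)).
by rewrite -[X in J (X z)]E /= (JopK LS).
Qed.

Lemma resL_sa : sa resL.
Proof.
have bR := resL_bop; split=> //; apply: QN_dense => // [|x Qx]; first exact: adj_bop.
apply/eqP; rewrite -subr_eq0; apply/eqP.
have d := dense_subalgebra LS (fun x => @QN_S _ _ T S x) (QN_id TS) (QN_lin TS) (QN_comp TS) (QN_adj TS) qr.
apply: (dense_ext d) => _ [y Qy <-]; rewrite innerBl inner_conj -(adjP bR) -inner_conj !resL_hat //.
by rewrite res_sym // subrr.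
Qed.

Lemma resL_psd : psd resL.
Proof.
split; first exact: resL_sa.
move=> z; have [x Qx xz] := QN_approx z; have bR := resL_bop.
apply: (quad_cvg_ge0 bR xz) => n; rewrite resL_hat // dotC res_dot //.
by rewrite addr_ge0 ?sqr_ge0 ?mulr_ge0 ?dform_ge0 ?(ltW e0).
Qed.

End Resolvents.

(** * Complete positivity of the resolvents *)

Section Complete_positivity.
Variables (R : realType) (K : hilbertType R) (T S : set (K -> K)) (tau : (K -> K) -> R[i]).
Variables (XT X : biact K) (oneT : XT) (one : X).
Hypothesis TS : inclusion T S tau oneT one.
Let LS := in_S TS.
Let vS : vn_algebra S. Proof. by case: LS. Qed.
Let fS : faithful_normal_tracial_state S tau. Proof. by case: LS. Qed.
Let cS := vn_cstar vS.
Let bS := cs_bop cS.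
Let TsS := in_sub TS.
Implicit Types (x y t u : K -> K) (D : set X).
Local Notation J := (Jop S one).
Local Notation hat := (hat one).
Local Notation la := (@lact _ _ X).
Local Notation ra := (@ract _ _ X).
Local Notation Q := (QN T S).

Variable H : biact K.
Hypothesis bH : bimodule S S H.
Hypothesis qr : quasi_regular T S.
Variable c : (K -> K) -> H.
Hypothesis hc : bimod_map T S c.
Hypothesis cd : forall x y, Q x -> Q y -> c (x \o y) = lact x (c y) + ract y (c x).
Variable eps : R.
Hypothesis e0 : 0 < eps.
Local Notation res := (res T S one c eps).
Local Notation resL := (resL TS bH hc e0).
Let QS x : Q x -> S x := @QN_S _ _ T S x.
Let tS := tau_rtrace LS.

(** * The derivation and its resolvents on matrices over QN_S(T) *)

Section Matrices.
Variable I : finType.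
Local Notation KI := (hpow K I).
Local Notation HI := (hpow H (I * I)%type).
Implicit Types (V W Y A : KI -> KI) (xi eta : HI).
Let cM : cstar (matN (I:=I) S) := mat_cstar I cS.
Let tM : rtrace (matN (I:=I) S) (mat_tr (trR tau)) := mat_rtrace I cS tS.

(** Applied entrywise, [c] is a derivation into matrices over the bimodule, on which [Lmx] and [Pmx]
    are the commuting left and right multiplications. *)
Definition cmx W : HI := [ffun p => c (entry W p.1 p.2)].
Definition Lmx W (eta : HI) : HI := [ffun p => \sum_k lact (entry W p.1 k) (eta (k, p.2))].
Definition Pmx W (eta : HI) : HI := [ffun p => \sum_k ract (entry W k p.2) (eta (p.1, k))].

Lemma matQ_S W : matN Q W -> matN S W.
Proof. by move=> [bW h]; split=> // i j; apply: QS. Qed.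

Lemma matQ_comp W Y : matN Q W -> matN Q Y -> matN Q (W \o Y).
Proof.
move=> [bW hW] [bY hY]; split=> [|i j]; first exact: bop_comp.
by rewrite (entry_comp _ _ _ (bop_lin bW)); apply: (QN_sum TS) => k; apply: (QN_comp TS).
Qed.

Lemma matQ_pw W n : matN Q W -> matN Q (pw W n).
Proof.
move=> QW; elim: n => [|n ih]; last exact: matQ_comp.
split=> [|i j]; first exact: bop_id.
by rewrite entry_id; case: eqP => _; [exact: QN_id TS|exact: QN0 TS].
Qed.

Lemma cmx_comp W Y : matN Q W -> matN Q Y -> cmx (W \o Y) = Lmx W (cmx Y) + Pmx Y (cmx W).
Proof.
move=> [bW hW] [bY hY]; apply/ffunP => -[i j]; rewrite !ffunE /= (entry_comp _ _ _ (bop_lin bW)).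
rewrite (bm_sum TS hc); last by move=> k; apply: (QN_comp TS).
by rewrite -big_split; apply: eq_bigr => k _; rewrite !ffunE /= cd.
Qed.

Lemma Lmx_lin W : matN S W -> linear (Lmx W).
Proof.
move=> [bW hW] a x y; apply/ffunP => p; rewrite !ffunE scaler_sumr -big_split.
by apply: eq_bigr => k _; rewrite !ffunE (bop_lin (bi_lbop bH (hW _ _))).
Qed.

Lemma Pmx_lin W : matN S W -> linear (Pmx W).
Proof.
move=> [bW hW] a x y; apply/ffunP => p; rewrite !ffunE scaler_sumr -big_split.
by apply: eq_bigr => k _; rewrite !ffunE (bop_lin (bi_rbop bH (hW _ _))).
Qed.

Lemma Lmx_sym W (x y : HI) : matN S W -> sa W -> dot (Lmx W x) y = dot x (Lmx W y).
Proof.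
move=> [bW hW] [_ sW]; rewrite !hpow_dot.
have E k i v w : dot (lact (entry W i k) v) w = dot v (@lact _ _ H (entry W k i) w).
  by rewrite /dot (bi_ladj bH) // -entry_adj // sW.
rewrite (eq_bigr (fun p : I * I => \sum_k dot (x (k, p.2)) (lact (entry W k p.1) (y (p.1, p.2))))); last first.
  by move=> [i j] _; rewrite ffunE dot_suml; apply: eq_bigr => k _; rewrite E.
rewrite [RHS](eq_bigr (fun p : I * I => \sum_k dot (x (p.1, p.2)) (lact (entry W p.1 k) (y (k, p.2))))); last first.
  by move=> [i j] _; rewrite ffunE dot_sumr.
rewrite -(pair_bigA _ (fun i j => \sum_k dot (x (k, j)) (lact (entry W k i) (y (i, j))))).
rewrite -(pair_bigA _ (fun i j => \sum_k dot (x (i, j)) (lact (entry W i k) (y (k, j))))) /=.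
by rewrite exchange_big [RHS]exchange_big; apply: eq_bigr => j _; rewrite exchange_big.
Qed.

Lemma Pmx_sym W (x y : HI) : matN S W -> sa W -> dot (Pmx W x) y = dot x (Pmx W y).
Proof.
move=> [bW hW] [_ sW]; rewrite !hpow_dot.
have E k i v w : dot (ract (entry W i k) v) w = dot v (@ract _ _ H (entry W k i) w).
  by rewrite /dot (bi_radj bH) // -entry_adj // sW.
rewrite (eq_bigr (fun p : I * I => \sum_k dot (x (p.1, k)) (ract (entry W p.2 k) (y (p.1, p.2))))); last first.
  by move=> [i j] _; rewrite ffunE dot_suml; apply: eq_bigr => k _; rewrite E.
rewrite [RHS](eq_bigr (fun p : I * I => \sum_k dot (x (p.1, p.2)) (ract (entry W k p.2) (y (p.1, k))))); last first.
  by move=> [i j] _; rewrite ffunE dot_sumr.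
rewrite -(pair_bigA _ (fun i j => \sum_k dot (x (i, k)) (ract (entry W j k) (y (i, j))))).
rewrite -(pair_bigA _ (fun i j => \sum_k dot (x (i, j)) (ract (entry W k j) (y (i, k))))) /=.
by apply: eq_bigr => i _; rewrite exchange_big.
Qed.

Lemma LPmx W (x : HI) : matN S W -> Lmx W (Pmx W x) = Pmx W (Lmx W x).
Proof.
move=> [bW hW]; apply/ffunP => p; rewrite !ffunE.
transitivity (\sum_k \sum_l ract (entry W l p.2) (lact (entry W p.1 k) (x (k, l)))).
  apply: eq_bigr => k _; rewrite ffunE (lin_sum (bop_lin (bi_lbop bH (hW _ _)))).
  by apply: eq_bigr => l _; rewrite (bi_lrC bH).
rewrite exchange_big; apply: eq_bigr => l _.
by rewrite ffunE (lin_sum (bop_lin (bi_rbop bH (hW _ _)))).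
Qed.

Lemma Pmx_comp W Y (x : HI) : matN S W -> matN S Y -> Pmx (W \o Y) x = Pmx Y (Pmx W x).
Proof.
move=> [bW hW] [bY hY]; apply/ffunP => p; rewrite !ffunE.
transitivity (\sum_k \sum_l ract (entry Y l p.2) (ract (entry W k l) (x (p.1, k)))).
  apply: eq_bigr => k _; rewrite (entry_comp _ _ _ (bop_lin bW)).
  rewrite (jr_sum cS (bi_rrep bH).1) ?sum_opE => [|l]; last exact: (cs_comp cS).
  by apply: eq_bigr => l _; rewrite (bi_rM bH).
rewrite exchange_big; apply: eq_bigr => l _.
by rewrite ffunE (lin_sum (bop_lin (bi_rbop bH (hY _ _)))).
Qed.

Lemma Pmx_pw W n (x : HI) : matN S W -> Pmx (pw W n.+1) x = iter n.+1 (Pmx W) x.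
Proof.
move=> SW; elim: n x => [|n ih] x //; rewrite -[pw W n.+2]/(W \o pw W n.+1) Pmx_comp //; last exact: (pw_N cM).
by rewrite ih -iterSr.
Qed.

(** The sum of [L^i P^j] over [i + j = n], in the recursive form that the Leibniz rule produces for
    [c(W^(n+1))]. Odd powers of W give even [n], where [comm_powers_ge0] applies. *)
Fixpoint dpow (L P : HI -> HI) n (x : HI) : HI := if n is k.+1 then L (dpow L P k x) + iter n P x else x.

Lemma cmx_pw W n : matN Q W -> cmx (pw W n.+1) = dpow (Lmx W) (Pmx W) n (cmx W).
Proof.
move=> QW; elim: n => [|n ih] //=; have QWn := matQ_pw n.+1 QW.
by rewrite -[pw W n.+2]/(W \o pw W n.+1) cmx_comp // ih (Pmx_pw _ _ (matQ_S QW)).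
Qed.

Lemma cmx_pos W m : matN Q W -> sa W -> 0 <= dot (cmx (pw W m.*2.+1)) (cmx W).
Proof.
move=> QW sW; have SW := matQ_S QW; rewrite cmx_pw //.
apply: (@comm_powers_ge0 _ _ (Lmx W) (Pmx W) (dpow (Lmx W) (Pmx W))) => //.
- exact: Lmx_lin.
- exact: Pmx_lin.
- by move=> x y; apply: Lmx_sym.
- by move=> x y; apply: Pmx_sym.
- by move=> x; apply: LPmx.
Qed.

Definition resmx V : KI -> KI := mx_op (fun i j => res (entry V i j)).

Lemma entry_resmx V i j : matN Q V -> entry (resmx V) i j = res (entry V i j).
Proof. by move=> [_ hV]; rewrite (entry_mx_op cS) // => k l; apply: QS; apply: (res_QN TS bH hc e0). Qed.

Lemma resmx_Q V : matN Q V -> matN Q (resmx V).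
Proof.
move=> QV; split=> [|i j].
  have [] // := mx_op_mat cS (x := fun i j => res (entry V i j)).
  by move=> i j; apply: QS; apply: (res_QN TS bH hc e0); case: QV.
by rewrite entry_resmx //; apply: (res_QN TS bH hc e0); case: QV.
Qed.

Lemma resmx_sa V : matN Q V -> sa V -> sa (resmx V).
Proof.
move=> QV sV; have [bR _] := resmx_Q QV; split=> //.
apply: entry_ext => [||i j]; [exact: bop_lin (adj_bop bR)|exact: bop_lin|].
rewrite entry_adj // !entry_resmx // -(res_adj TS bH hc e0); last by case: QV.
by rewrite -entry_adj ?sV.2 //; case: sV.
Qed.

Lemma entryB V W i j : entry (V - W) i j = entry V i j - entry W i j.
Proof. by apply/funext => v; rewrite /entry -[(V - W) _]/(V _ - W _) !ffunE. Qed.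

(** The weak equation of the resolvent, tested with the entries of A. For self-adjoint matrices the
    two terms of [dform] have the same sum, whence the factor 2. *)
Lemma resmx_tr V A : matN Q V -> sa V -> matN Q A -> sa A ->
  mat_tr (trR tau) (A \o (V - resmx V)) = eps * (dot (cmx A) (cmx (resmx V)) *+ 2).
Proof.
move=> QV sV QA sA; have QR := resmx_Q QV; have sR := resmx_sa QV sV.
rewrite (mat_tr_comp cS tS (matQ_S QA) (csB cM (matQ_S QV) (matQ_S QR))).
have E i j : trR tau (entry A i j \o entry (V - resmx V) j i) =
    eps * (dot (c (entry (resmx V) j i)) (c (entry A j i)) + dot (c (entry A i j)) (c (entry (resmx V) i j))).
  have [QVji QAji] : Q (entry V j i) /\ Q (entry A j i) by case: QV; case: QA.
  have QRji : Q (entry (resmx V) j i) by case: QR.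
  have aA : adj (entry A j i) = entry A i j by rewrite -entry_adj ?sA.2 //; case: sA.
  have aR : adj (entry (resmx V) j i) = entry (resmx V) i j by rewrite -entry_adj ?sR.2 //; case: sR.
  rewrite entryB /trR -aA -(hat_inner LS) ?(hatB LS); try by do ?[apply: (csB cS)|apply: QS].
  have [_] := resP TS bH hc e0 QVji; rewrite -entry_resmx // => -> //.
  by rewrite ReRM /dform ReD aA aR.
rewrite (eq_bigr (fun i => \sum_j eps * (dot (c (entry (resmx V) j i)) (c (entry A j i)) +
  dot (c (entry A i j)) (c (entry (resmx V) i j))))); last by move=> i _; apply: eq_bigr => j _; exact: E.
rewrite -(eq_bigr _ (fun i _ => mulr_sumr _ _ _ _)) -mulr_sumr; congr (_ * _).
under eq_bigr => i _ do rewrite big_split.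
rewrite big_split /= exchange_big.
have D : dot (cmx A) (cmx (resmx V)) = \sum_i \sum_j dot (c (entry A i j)) (c (entry (resmx V) i j)).
  by rewrite hpow_dot pair_bigA; apply: eq_bigr => p _; rewrite !ffunE.
rewrite -D mulr2n; congr (_ + _); rewrite D; apply: eq_bigr => i _; apply: eq_bigr => j _.
exact: dotC.
Qed.

(** If V lies between 0 and B, then [V' = B - V] has norm at most B, and so has its resolvent by
    [moment_bound] and [cmx_pos]. Since the resolvent is unital, that of V is B minus that of [V'],
    hence positive. *)
Lemma resmx_psd V : matN Q V -> psd V -> psd (resmx V).
Proof.
move=> QV pV; have sV := pV.1; have [B B0 VB] := bop_onb sV.1.
pose V' := B%:C%C *: idfun - V; have sV' : sa V' by apply: saB => //; apply: saZ; exact: sa_id.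
have QV' : matN Q V'.
  split=> [|i j]; first exact: sV'.1.
  have -> : V' = B%:C%C *: idfun + - V by [].
  rewrite /V' entryB; apply: (QNB TS); last by case: QV.
  have -> : entry (B%:C%C *: idfun : KI -> KI) i j = B%:C%C *: (if i == j then idfun else 0).
    apply/funext => v; rewrite /entry -[(_ *: _) _]/(B%:C%C *: hin j v) !ffunE.
    by case: eqP => // _; rewrite scaler0.
  by apply: (QNZ TS); case: eqP => _; [exact: QN_id TS|exact: QN0 TS].
have RE : resmx V' = B%:C%C *: idfun - resmx V.
  have [lR lR'] := (bop_lin (resmx_Q QV').1, bop_lin (resmx_Q QV).1).
  apply: entry_ext => // [|i j].
    by apply: bop_lin; apply: (saB _ (resmx_sa QV sV)).1; apply: saZ; exact: sa_id.
  have Qv : Q (entry V i j) by case: QV.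
  have res0 : res 0 = 0.
    have := res_lin TS bH hc e0 (-1) (QN0 TS) (QN0 TS).
    by rewrite scaler0 addr0 scaleN1r addNr.
  have resN x : Q x -> res (- x) = - res x.
    by move=> Qx; have := res_lin TS bH hc e0 (-1) Qx (QN0 TS); rewrite res0 !addr0 !scaleN1r.
  have e (k : KI -> KI) : entry (B%:C%C *: idfun - k) i j = B%:C%C *: (if i == j then idfun else 0) + entry (- k) i j.
    by rewrite entry_lin entry_id.
  have eN (k : KI -> KI) : entry (- k) i j = - entry k i j.
    by apply/funext => v; rewrite /entry -[(- k) _]/(- k _) !ffunE.
  rewrite entry_resmx // /V' !e !eN entry_resmx // (res_lin TS bH hc e0); last 2 first.
  - by case: eqP => _; [exact: QN_id TS|exact: QN0 TS].
  - by have := QNB TS (QN0 TS) Qv; rewrite sub0r.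
  by rewrite resN //; case: eqP => _; rewrite ?(res_id TS bH hc e0 cd) ?res0.
have V'B : onb V' B.
  apply: sa_onb => // xi; rewrite -[V' xi]/(B%:C%C *: xi - V xi) dotBl dotZl dotxx.
  have := pV.2 xi; have := onb_le xi VB => h1 h2; rewrite ger0_norm; lra.
have : onb (resmx V') B.
  apply: (@moment_bound _ _ _ _ cM tM (resmx V') V') => //; try by apply: matQ_S => //; exact: resmx_Q.
    exact: resmx_sa.
  move=> m; rewrite resmx_tr //; [|exact: matQ_pw (resmx_Q QV')|exact: pw_sa (resmx_sa QV' sV')].
  by rewrite mulr_ge0 ?(ltW e0) // mulrn_wge0 // cmx_pos //; [exact: resmx_Q|exact: resmx_sa].
move=> RB; split=> [|xi]; first exact: resmx_sa.
have := onb_le xi RB; rewrite RE -[(_ - _) xi]/(B%:C%C *: xi - resmx V xi) dotBl dotZl dotxx; lra.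
Qed.

End Matrices.

Lemma scalar_psd x : Q x -> psd x -> psd (res x).
Proof.
move=> Qx px; pose V : hpow K 'I_1 -> hpow K 'I_1 := mx_op (fun _ _ => x).
have QV : matN Q V.
  have [bV _] := mx_op_mat (I := 'I_1) cS (fun _ _ => QS Qx).
  by split=> // i j; rewrite (entry_mx_op cS) // => _ _; exact: QS.
have EV i j : entry V i j = x by rewrite (entry_mx_op cS) // => _ _; exact: QS.
have pV : psd V.
  split; first split; first exact: QV.1.
    apply: entry_ext => [||i j]; [exact: bop_lin (adj_bop QV.1)|exact: bop_lin QV.1|].
    by rewrite entry_adj ?EV ?px.1.2 //; exact: QV.1.
  by move=> xi; rewrite hpow_dot big_ord1 ffunE big_ord1; exact: px.2.
have [[bR aR] pR] := resmx_psd QV pV.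
have ER : entry (resmx V) ord0 ord0 = res x by rewrite entry_resmx ?EV.
rewrite -ER; split; first split; first exact: entry_bop.
  by rewrite -entry_adj // aR.
move=> v; have := pR (hin ord0 v); rewrite hpow_dot big_ord1.
by rewrite [hin ord0 v ord0]ffunE eqxx.
Qed.

Lemma hat_dense_le (w : X) C : 0 <= C -> (forall b, S b -> dot w (hat b) <= C * hn (hat b)) -> hn w <= C.
Proof.
move=> C0 h; rewrite leNgt; apply/negP => lt.
have w0 : 0 < hn w by apply: le_lt_trans lt.
have p : 0 < hn w + C by rewrite ltr_wpDr.
have e0' : 0 < hn w * (hn w - C) / (hn w + C) by rewrite divr_gt0 // mulr_gt0 // subr_gt0.
have [b Sb] := hat_dense LS w e0'; rewrite ltr_pdivlMr //.
have := h b Sb; have e1 : hat b = w - (w - hat b) by rewrite opprB addrC subrK.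
have := hnB w (w - hat b); have := dot_CS w (w - hat b); have := hn_ge0 (w - hat b).
rewrite -e1 => h1 h2 h3; rewrite {1}e1 dotBr dotxx => h4 h5.
have := ler_wpM2l C0 h3; nra.
Qed.

Lemma hat_dense_leQ (w : X) C : 0 <= C -> (forall b, Q b -> dot w (hat b) <= C * hn (hat b)) -> hn w <= C.
Proof.
move=> C0 h; apply: hat_dense_le => // b Sb; have [u Qu ub] := QN_approx TS qr (hat b).
rewrite leNgt; apply/negP => lt; set d := dot w (hat b) - C * hn (hat b).
have d0 : 0 < d by rewrite subr_gt0.
have p : 0 < hn w + C + 1 by rewrite ltr_wpDl // addr_ge0.
have [n hN] := ub _ (divr_gt0 d0 p); have := hN n (leqnn _); rewrite ltr_pdivlMr //.
have := h _ (Qu n); have := dot_CS w (hat b - hat (u n)); rewrite dotBr (hnC (hat b)).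
have := hnD (hat (u n) - hat b) (hat b); rewrite subrK; have := hn_ge0 (hat (u n) - hat b).
move=> h1 h2 h3 h4 h5; have := ler_wpM2l C0 h2; rewrite /d in h5; nra.
Qed.

Lemma ra_form (z : X) a b : S a -> S b -> '<<ra a z, hat b>> = '<<z, hat (b \o adj a)>>.
Proof. by move=> Sa Sb; rewrite (ra_adj LS) // (ra_hat LS) //; exact: (cs_adj cS). Qed.

Lemma dot_J (z w : X) : dot z (J w) = dot w (J z).
Proof. by rewrite -{1}(JopK LS z) /dot (Jop_inner LS). Qed.

(* A vector fixed by J defines the Hermitian form (a, b) |-> <z a, b>. *)
Lemma hermitian_bounded (z : X) C : 0 <= C -> J z = z ->
  (forall a, Q a -> `|dot (ra a z) (hat a)| <= C * hn (hat a) ^+ 2) -> exists2 y, S y & hat y = z.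
Proof.
move=> C0 Jz h.
have sym a b : Q a -> Q b -> dot (ra a z) (hat b) = dot (ra b z) (hat a).
  move=> /QS Sa /QS Sb; have [Saa Sab] := (cs_adj cS Sa, cs_adj cS Sb).
  have Sc := cs_comp cS Sb Saa.
  rewrite /dot !ra_form // -!/(dot _ _) dotC -{1}Jz dot_J (Jop_hat LS Sc).
  by rewrite (adj_comp (bS Sb) (bS Saa)) (adjK (bS Sa)).
have rD a b w : S a -> S b -> ra (a + b) w = ra a w + ra b w.
  by move=> Sa Sb; have [jp _] := ra_nrep LS; rewrite (jrD jp).
have rZ (t : R) a w : S a -> ra (t%:C%C *: a) w = t%:C%C *: ra a w.
  by move=> Sa; have [jp _] := ra_nrep LS; rewrite (jrZ cS jp).
have B a b : Q a -> Q b -> dot (ra a z) (hat b) <= C * hn (hat a) * hn (hat b).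
  move=> Qa Qb; have [Sa Sb] := (QS Qa, QS Qb).
  have key (t : R) : 0 <= C * hn (hat b) ^+ 2 + 2 * t * - dot (ra a z) (hat b) + t ^+ 2 * (C * hn (hat a) ^+ 2).
    have Qta := QNZ TS t%:C%C Qa; have Sta := QS Qta.
    have h1 := h _ (QND TS Qta Qb); have h2 := h _ (QNB TS Qta Qb).
    have e w : ra (t%:C%C *: a - b) w = t%:C%C *: ra a w - ra b w.
      have [jp _] := ra_nrep LS; by rewrite (jrB cS jp) // -rZ.
    move: h1 h2; rewrite rD // (hatD LS Sta Sb) e (hatB LS Sta Sb) rZ // (hatZ LS _ Sa) -!dotxx.
    rewrite !(dotDl, dotDr, dotZl, dotZr, dotNl, dotNr) (dotC (hat b) (hat a)) (sym b a) //.
    rewrite !ler_norml => /andP[_ h1] /andP[h2 _].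
    by nra.
  have /quad_ge0/(_ key) : 0 <= C * hn (hat b) ^+ 2 by rewrite mulr_ge0 ?sqr_ge0.
  rewrite sqrrN => k.
  have p : 0 <= C * hn (hat a) * hn (hat b) by rewrite !mulr_ge0.
  apply: le_trans (ler_norm _) _; rewrite -(@ler_pXn2r _ 2) ?nnegrE // real_normK ?num_real //.
  by apply: le_trans k _; rewrite !expr2 le_eqVlt; apply/orP; left; apply/eqP; ring.
have [||y [Sy _ yz]] := @bounded_vector _ _ _ _ _ _ LS z C => //; last by exists y.
have BQ a : Q a -> hn (ra a z) <= C * hn (hat a).
  by move=> Qa; apply: hat_dense_leQ => [|b Qb]; [rewrite mulr_ge0|exact: B].
move=> a Sa; apply: hat_dense_le => [|b Sb]; first by rewrite mulr_ge0.
have Sab := cs_adj cS Sb.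
(* J moves [b] to the side of the module action, so that the density of QN_S(T) can be used in each
   variable separately. *)
have E x : S x -> dot (ra x z) (hat b) = dot (J (la (adj b) z)) (hat x).
  move=> Sx; have Sax := cs_adj cS Sx.
  rewrite /dot ra_form // -(la_hat LS Sb Sax) (la_adjr LS) // -(Jop_hat LS Sx) -/(dot _ _).
  by rewrite dot_J dotC.
rewrite E //; apply: le_trans (dot_CS _ _) _.
rewrite [leRHS]mulrAC; apply: ler_wpM2r => //; apply: hat_dense_leQ => [|x Qx]; first by rewrite mulr_ge0.
rewrite -(E _ (QS Qx)); apply: le_trans (dot_CS _ _) _.
by rewrite [leRHS]mulrAC; apply: ler_wpM2r => //; exact: BQ.
Qed.

(** For self-adjoint [y] bounded by C, the form of [resL (hat y)] at [a] is the trace of [y] against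
    the resolvent of [a a^*], a positive operator of trace [hn (hat a) ^+ 2]. It is thus at most C
    times that number, and [hermitian_bounded] applies; the general case follows from real and
    imaginary parts. *)
Lemma phi_ex x : S x -> exists2 y, S y & hat y = resL (hat x).
Proof.
have bR := resL_bop TS bH hc e0; have pR := resL_psd TS bH qr hc e0.
have sa_case y : S y -> sa y -> exists2 w, S w & hat w = resL (hat y).
  move=> Sy sy; have [C C0 yC] := bop_onb sy.1; apply: (@hermitian_bounded _ C) => //.
    by rewrite -(resL_J TS bH qr hc e0) (Jop_hat LS Sy) sy.2.
  move=> a Qa; have Sa := QS Qa; have Qaa := QN_adj TS Qa; have Saa := QS Qaa.
  pose p := a \o adj a; have Qp : Q p by exact: (QN_comp TS).
  have pp : psd p by have := psd_adj_comp (bS Saa); rewrite (adjK (bS Sa)).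
  have Qr := res_QN TS bH hc e0 Qp; have Sr := QS Qr; have pr := scalar_psd Qp pp.
  have E v : S v -> dot (resL (hat v)) (hat p) = trR tau (res p \o v).
    move=> Sv; rewrite (sa_dot pR.1) (resL_hat TS bH hc e0 Qp) /dot (hat_inner LS) //.
    by rewrite pr.1.2.
  have Ey : dot (ra a (resL (hat y))) (hat a) = trR tau (res p \o y).
    by rewrite -E // /dot ra_form.
  have S1 := cs_id cS.
  have E1 : hn (hat a) ^+ 2 = trR tau (res p).
    rewrite -[res p]/(res p \o idfun) -E // (resL_hat TS bH hc e0 (QN_id TS)).
    rewrite (res_id TS bH hc e0 cd) /dot -(hat_hn_adj LS Sa) -dotxx /dot (hat_inner LS) //.
    by rewrite (hat_inner LS S1 (QS Qp)) pp.1.2 (adjK (bS Sa)).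
  have pos (s : R) : `|s| = 1 -> 0 <= trR tau (res p \o (C%:C%C *: idfun + s%:C%C *: y)).
    move=> s1; apply: (rt_mul_psd cS tS) => //.
      by apply: (csD cS); apply: (csZ cS).
    split=> [|xi]; first by apply: saD; apply: saZ => //; exact: sa_id.
    rewrite -[(_ + _) xi]/(C%:C%C *: xi + s%:C%C *: y xi) dotDl !dotZl dotxx.
    have b : `|s * dot (y xi) xi| <= C * hn xi ^+ 2.
      by rewrite normrM s1 mul1r ler_norml onb_ge // onb_le.
    by move: b; rewrite ler_norml => /andP[]; lra.
  have lin (s : R) : trR tau (res p \o (C%:C%C *: idfun + s%:C%C *: y)) = C * hn (hat a) ^+ 2 + s * trR tau (res p \o y).
    have -> : res p \o (C%:C%C *: idfun + s%:C%C *: y) = C%:C%C *: res p + s%:C%C *: (res p \o y).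
      apply/funext => v; have lr := bop_lin (bS Sr).
      by rewrite -[LHS]/(res p (C%:C%C *: v + s%:C%C *: y v)) (linD lr) !(linZ lr).
    rewrite (rtD tS) ?(rtZ cS tS) ?E1 //; first exact: (cs_comp cS).
      exact: (csZ cS).
    by apply: (csZ cS); exact: (cs_comp cS).
  rewrite Ey ler_norml; have := pos 1 (normr1 _); have := pos (-1) (normrN1 _).
  by rewrite !lin; lra.
move=> Sx; have Sax := cs_adj cS Sx; have [bx bax] := (bS Sx, bS Sax).
pose x1 := x + adj x; pose x2 : K -> K := 'i%C *: (adj x - x).
have [S1 S2] : S x1 /\ S x2 by split; [exact: (csD cS)|apply: (csZ cS); exact: (csB cS)].
have [|w1 Sw1 e1] := sa_case x1 S1.
  by split; [exact: bS|rewrite adjD // (adjK bx) addrC].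
have [|w2 Sw2 e2] := sa_case x2 S2.
  split; first exact: bS.
  rewrite adjZ ?adjB ?(adjK bx) //; last by apply: bS; exact: (csB cS).
  have -> : ('i%C : R[i])^* = - 'i%C by apply/eqP; rewrite eq_complex /= oppr0 !eqxx.
  by rewrite scaleNr -scalerN opprB.
have xE : x = (2^-1 : R)%:C%C *: x1 + 'i%C *: ((2^-1 : R)%:C%C *: x2) := half_sum x (adj x).
have [lR SZ] := (bop_lin bR, csZ cS).
exists ((2^-1 : R)%:C%C *: w1 + 'i%C *: ((2^-1 : R)%:C%C *: w2)).
  by apply: (cs_lin cS) => //; apply: (SZ); apply: (SZ).
have [h1 h2] := (SZ (2^-1 : R)%:C%C _ Sw2, SZ (2^-1 : R)%:C%C _ S2); clearbody x1 x2.
rewrite [in RHS]xE (hat_lin LS _ Sw1 (SZ _ _ h1)) (hat_lin LS _ S1 (SZ _ _ h2)) !(hatZ LS) //.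
by rewrite lR !(linZ lR) e1 e2.
Qed.

Definition phi x : K -> K := xget 0 [set y | S y /\ hat y = resL (hat x)].

Lemma phiP x : S x -> S (phi x) /\ hat (phi x) = resL (hat x).
Proof.
move=> /phi_ex[y Sy yE]; have h : exists y, [set y | S y /\ hat y = resL (hat x)] y by exists y.
exact: (xgetPex 0 h).
Qed.

Lemma phi_S x : S x -> S (phi x). Proof. by move=> /phiP[]. Qed.
Lemma phi_hat x : S x -> hat (phi x) = resL (hat x). Proof. by move=> /phiP[]. Qed.

Lemma phi_lin a x y : S x -> S y -> phi (a *: x + y) = a *: phi x + phi y.
Proof.
move=> Sx Sy; have [Sp Sp'] := (phi_S Sx, phi_S Sy); have Sl := cs_lin cS a Sx Sy.
apply: (hat_inj LS); [exact: phi_S|exact: (cs_lin cS)|].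
by rewrite phi_hat // !(hat_lin LS) // (bop_lin (resL_bop TS bH hc e0)) !phi_hat.
Qed.

Lemma phi_adj x : S x -> phi (adj x) = adj (phi x).
Proof.
move=> Sx; have Sp := phi_S Sx; have Sax := cs_adj cS Sx.
apply: (hat_inj LS); [exact: phi_S|exact: (cs_adj cS)|].
by rewrite phi_hat // -(Jop_hat LS Sx) (resL_J TS bH qr hc e0) -phi_hat // (Jop_hat LS).
Qed.

Lemma phi_bimod t x s : T t -> S x -> T s -> phi (t \o x \o s) = t \o phi x \o s.
Proof.
move=> Tt Sx Ts; have Sp := phi_S Sx; have [St Ss] := (TsS Tt, TsS Ts).
have [_ Rl Rr] := resL_tbi TS bH qr hc e0; have [Stx Stp] := (cs_comp cS St Sx, cs_comp cS St Sp).
have [Stxs Stps] := (cs_comp cS Stx Ss, cs_comp cS Stp Ss).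
apply: (hat_inj LS) => //; first exact: phi_S.
rewrite (phi_hat Stxs) -(ra_hat LS Ss Stx) -(la_hat LS St Sx) (Rr _ _ Ts) (Rl _ _ Tt) -(phi_hat Sx).
by rewrite (la_hat LS St Sp) (ra_hat LS Ss Stp).
Qed.

Lemma phi_tr x : S x -> trR tau (phi x) = trR tau x.
Proof.
move=> Sx; rewrite /trR -!(hat_one LS) // ?phi_hat //; last exact: phi_S.
have := resL_hat TS bH hc e0 (QN_id TS); rewrite (res_id TS bH hc e0 cd) (hat_id LS) => e.
by rewrite -!/(dot _ _) (sa_dot (resL_psd TS bH qr hc e0).1) e.
Qed.

Lemma quad_matrix_psd n (x : 'I_n -> 'I_n -> K -> K) : (forall i j, S (x i j)) ->
  (forall xi : 'I_n -> K, 0 <= \sum_i \sum_j '<< x i j (xi j), xi i >>) -> psd (mx_op x).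
Proof.
move=> Sx h; have [bX _] := mx_op_mat cS Sx; apply: pos_psd => // xi.
rewrite hpow_inner; have := h xi; congr (_ <= _); apply: eq_bigr => i _.
by rewrite ffunE inner_suml.
Qed.

(* On a column a with entries in Q the form of phi(X) is the trace of the
   product of X with the resolvent of the positive matrix (a_i a_j^* ). *)
Lemma phi_column n (x : 'I_n -> 'I_n -> K -> K) (a : 'I_n -> K -> K) : (forall i j, S (x i j)) -> psd (mx_op x) ->
  (forall i, Q (a i)) -> 0 <= \sum_i \sum_j dot (la (phi (x i j)) (hat (a j))) (hat (a i)).
Proof.
move=> Sx px Qa; pose v i j := a i \o adj (a j).
have Qv i j : Q (v i j) by apply: (QN_comp TS) => //; exact: (QN_adj TS).
have Sv i j := QS (Qv i j); pose V := mx_op v; have Sa i := QS (Qa i).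
have QV : matN Q V.
  have [bV _] := mx_op_mat cS Sv; split=> // i j; by rewrite (entry_mx_op cS) //.
have pV : psd V.
  split; first split; first exact: QV.1.
    apply: entry_ext => [||i j]; [exact: bop_lin (adj_bop QV.1)|exact: bop_lin QV.1|].
    rewrite entry_adj ?(entry_mx_op cS) //; last exact: QV.1.
    by rewrite (adj_comp (bS (Sa j)) (adj_bop (bS (Sa i)))) (adjK (bS (Sa i))).
  move=> xi; rewrite hpow_dot.
  have -> : \sum_i dot (V xi i) (xi i) = hn (\sum_j adj (a j) (xi j)) ^+ 2.
    rewrite -dotxx dot_sumr; apply: eq_bigr => i _; rewrite -(adj_dot (bS (Sa i))) ffunE.
    by rewrite (lin_sum (bop_lin (bS (Sa i)))).
  exact: sqr_ge0.
have pR := resmx_psd QV pV; have QR := resmx_Q QV.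
have -> : \sum_i \sum_j dot (la (phi (x i j)) (hat (a j))) (hat (a i)) =
    mat_tr (trR tau) (resmx V \o mx_op x); last first.
  apply: (rt_mul_psd (mat_cstar _ cS) (mat_rtrace _ cS tS)) => //; first exact: matQ_S.
  exact: mx_op_mat.
rewrite (mat_tr_comp cS tS (matQ_S QR) (mx_op_mat cS Sx)) exchange_big.
apply: eq_bigr => j _; apply: eq_bigr => i _; rewrite entry_resmx // !(entry_mx_op cS) //.
have [Sp Saj Sr] : [/\ S (phi (x i j)), S (adj (a j)) & S (res (v i j))].
  by split; [exact: phi_S|exact: (cs_adj cS)|exact: QS (res_QN TS bH hc e0 (Qv i j))].
rewrite (la_hat LS Sp (Sa j)) -(ra_hat LS (Sa j) Sp) /dot ra_form // -/(dot _ _) (phi_hat (Sx i j)).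
rewrite (sa_dot (resL_psd TS bH qr hc e0).1) (resL_hat TS bH hc e0 (Qv i j)) /dot (hat_inner LS) //.
rewrite -(res_adj TS bH hc e0) // /trR; congr (complex.Re (tau (res _ \o _))).
by rewrite (adj_comp (bS (Sa i)) (bS Saj)) (adjK (bS (Sa j))).
Qed.

(** By [trace_psd] over matrices, positivity is tested on matrices A, one column at a time; columns
    over QN_S(T) are settled by [phi_column] and are dense. *)
Lemma phi_cp : completely_positive S phi.
Proof.
move=> n x Sx h xi; have px := quad_matrix_psd Sx h; have Sp i j := phi_S (Sx i j).
suff pY : psd (mx_op (fun i j => phi (x i j))).
  have := psd_pos pY (finfun xi); rewrite hpow_inner; congr (_ <= _); apply: eq_bigr => i _.
  by rewrite !ffunE inner_suml; apply: eq_bigr => j _; rewrite ffunE.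
have NY := mx_op_mat cS Sp; have NX := mx_op_mat cS Sx.
apply: (trace_psd (mat_cstar _ cS) (mat_rtrace _ cS tS)) => //.
  split; first exact: NY.1.
  apply: entry_ext => [||i j]; [exact: bop_lin (adj_bop NY.1)|exact: bop_lin NY.1|].
  rewrite entry_adj ?(entry_mx_op cS) //; last exact: NY.1.
  by rewrite -phi_adj // -[in LHS](entry_mx_op cS j i Sx) -entry_adj ?px.1.2 ?(entry_mx_op cS) //; exact: NX.1.
move=> A NA; have [bA SA] := NA; have cM : cstar (matN S) := mat_cstar 'I_n cS.
rewrite (mat_tr_comp cS tS) //; [|exact: (cs_adj cM)|exact: (cs_comp cM)].
apply: sumr_ge0 => k _.
pose Lp : hpow X 'I_n -> hpow X 'I_n := mx_op (fun i j => la (phi (x i j))).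
have cB : cstar (fun f : X -> X => bounded_op f).
  split=> [//||a f g|f g|f|f]; [exact: bop_id|exact: bop_linear|exact: bop_comp|exact: adj_bop|exact: bop_lim].
have [bL _] := mx_op_mat cB (x := fun i j => la (phi (x i j))) (fun i j => la_bop LS (Sp i j)).
pose z : hpow X 'I_n := [ffun i => hat (entry A i k)].
have -> : \sum_i trR tau (entry (adj A) k i \o entry (mx_op (fun i j => phi (x i j)) \o A) i k) = dot (Lp z) z.
  rewrite hpow_dot; apply: eq_bigr => i _; rewrite entry_adj // (entry_comp _ _ _ (bop_lin NY.1)).
  have Sq : S (\sum_j (entry (mx_op (fun i j => phi (x i j))) i j \o entry A j k)).
    by apply: (cs_sum cS) => j _; apply: (cs_comp cS) => //; case: NY.
  rewrite /trR -(hat_inner LS) // -/(dot _ _) (hat_sum LS); last first.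
    by move=> j; apply: (cs_comp cS) => //; case: NY.
  rewrite !ffunE; congr dot; apply: eq_bigr => j _.
  by rewrite (entry_mx_op cS) // -(la_hat LS) // ffunE.
pose u i := sval (cid2 (QN_approx TS qr (z i))).
have Qu i m : Q (u i m) by rewrite /u; case: cid2.
have uz i : hcvg (fun m => hat (u i m)) (z i) by rewrite /u; case: cid2.
apply: (@quad_cvg_ge0 _ _ Lp (fun m => [ffun i => hat (u i m)] : hpow X 'I_n)) => //.
  apply: hpow_hcvg => i; have -> : (fun m => ([ffun i => hat (u i m)] : hpow X 'I_n) i) = fun m => hat (u i m).
    by apply/funext => m; rewrite ffunE.
  exact: uz.
move=> m; have := phi_column Sx px (fun i => Qu i m); congr (_ <= _).
rewrite hpow_dot; apply: eq_bigr => i _; rewrite !ffunE dot_suml; apply: eq_bigr => j _.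
by rewrite ffunE.
Qed.

Lemma phi_psd x : S x -> psd x -> psd (phi x).
Proof.
move=> Sx px; apply: pos_psd => [|xi]; first by apply: bS; exact: phi_S.
have := @phi_cp 1%N (fun _ _ => x) (fun _ _ => Sx) _ (fun _ => xi); rewrite !big_ord1; apply=> eta.
by rewrite !big_ord1; exact: psd_pos.
Qed.

Lemma phiB x y : S x -> S y -> phi (x - y) = phi x - phi y.
Proof. by move=> Sx Sy; rewrite -[in LHS](addrC (- y)) -scaleN1r phi_lin // scaleN1r addrC. Qed.

(** [phi] preserves the trace. For a sequence in D whose traces approach that of [x], the
    differences between [phi x] and the images decrease to a positive operator of trace 0, that is,
    to 0. *)
Lemma phi_normal : normal_map S phi.
Proof.
move=> D x DS Sx inc; have [[d0 Dd0] Dp dir sup] := inc.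
have pd d : D d -> psd d by move=> Dd; apply: pos_psd; [exact: bS (DS _ Dd)|exact: Dp].
have sub d d' : S d -> S d' -> pos_op (d \- d') -> psd (d - d').
  by move=> Sd Sd'; apply: pos_psd; exact: bS (csB cS Sd Sd').
have le d : D d -> psd (x - d).
  move=> Dd; apply: (sub) => // [|v]; first exact: DS.
  have [ub _] := sup v; rewrite -[(x \- d) v]/(x v - d v) innerBl subr_ge0; apply: ub.
  by exists d.
have px : psd x by have := psdD (le _ Dd0) (pd _ Dd0); rewrite subrK.
have pp d d' : S d -> S d' -> psd (d - d') -> psd (phi d - phi d').
  by move=> Sd Sd' p; rewrite -phiB //; apply: phi_psd => //; exact: (csB cS).
have [_ _ _ _ /(_ _ _ DS Sx inc) st] := fS.
have im d : D d -> complex.Im (tau d) = 0.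
  by move=> Dd; have := tr_pos vS fS (DS _ Dd) (pd _ Dd); rewrite lecE => /andP[/eqP].
have [||_ _ near] := sup_complex _ _ st; first by move=> _ [d Dd <-]; exact: im.
  by exists (tau d0), d0.
have near' (e : R) : 0 < e -> exists2 d, D d & trR tau x - e < trR tau d.
  by move=> /near[_ [d Dd <-] h]; exists d.
(* Each new term dominates the preceding one and exhausts the trace of [x] up to [1 / (n + 1)]. *)
have step n d : exists d', D d -> [/\ D d', psd (d' - d) & trR tau x - n.+1%:R^-1 < trR tau d'].
  have [Dd|nDd] := pselect (D d); last by exists d.
  have n0 : 0 < n.+1%:R^-1 :> R by rewrite invr_gt0 ltr0n.
  have [d' Dd' h] := near' _ n0; have [e [De ed ed']] := dir _ _ Dd Dd'.
  have [Sd Sd' Se] := And3 (DS _ Dd) (DS _ Dd') (DS _ De).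
  exists e => _; split=> //; first exact: sub.
  by apply: lt_le_trans h _; apply: (rt_le cS tS) => //; exact: sub.
pose g := fix g n := if n is k.+1 then sval (cid (step k (g k))) else d0.
have Dg n : D (g n).
  by elim: n => [|n ih] //=; case: cid => d' /= /(_ ih)[].
have gs n : psd (g n.+1 - g n) /\ trR tau x - n.+1%:R^-1 < trR tau (g n.+1).
  by rewrite [g n.+1]/=; case: cid => d' /= /(_ (Dg n))[].
have Sg n := DS _ (Dg n); have Sa n := csB cS (phi_S Sx) (phi_S (Sg n)).
pose a n := phi x - phi (g n).
have ad n : psd (a n - a n.+1).
  have -> : a n - a n.+1 = phi (g n.+1) - phi (g n) by rewrite /a opprB addrC addrA subrK.
  by apply: pp => //; exact: (gs n).1.
have pa n : psd (a n) by apply: pp => //; exact: le.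
have [y py ya] := mono_lim pa ad.
have Sy : S y by apply: (vn_slim vS Sa _ ya); case: py => -[].
have dec m n : psd (a n - a (n + m)%N).
  by elim: m => [|m ih]; [rewrite addn0 subrr; exact: psd0|rewrite addnS; exact: (psd_le_trans (ad _) ih)].
have ya_le n : psd (a n - y).
  split=> [|xi]; first by apply: saB; [case: (pa n)|case: py].
  rewrite -[(_ - _) xi]/(a n xi - y xi) dotBl subr_ge0.
  apply: (@hcvg_dot_le _ _ (fun m => a (n + m)%N xi)) => [m|].
    have := (dec m n).2 xi; rewrite -[(_ - _) xi]/(a n xi - a (n + m)%N xi) dotBl subr_ge0; exact.
  by apply: (hcvg_sub (ya xi)) => m; exists (n + m)%N; rewrite leq_addl.
have y0 : y = 0.
  apply: (tr_psd0 vS fS) => //; apply/le_anti; rewrite (rt_psd cS tS) // andbT.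
  apply/ler_addgt0Pr => e /harm_small[n hn_]; rewrite add0r; apply: le_trans (ltW hn_).
  apply: le_trans (rt_le cS tS Sy (Sa n.+1) (ya_le n.+1)) _.
  rewrite (rtB cS tS) ?phi_tr //; try exact: phi_S.
  have := (gs n).2; set s := n.+1%:R^-1; lra.
have lim xi : hcvg (fun n => phi (g n) xi) (phi x xi).
  have -> : (fun n => phi (g n) xi) = (fun n => phi x xi - a n xi).
    by apply/funext => n; rewrite /a -[(_ - _) xi]/(phi x xi - phi (g n) xi) opprB addrC subrK.
  rewrite -[X in hcvg _ X]subr0; apply: hcvgB; first exact: hcvg_cst.
  by have := ya xi; rewrite y0.
have pphi d : D d -> psd (phi d) by move=> Dd; apply: phi_psd; [exact: DS|exact: pd].
have ppx := phi_psd Sx px.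
split.
- by exists (phi d0), d0.
- by move=> _ [d Dd <-]; apply: psd_pos; exact: pphi.
- move=> _ _ [d Dd <-] [d' Dd' <-]; have [e [De ed ed']] := dir _ _ Dd Dd'.
  have [Sd Sd' Se] := And3 (DS _ Dd) (DS _ Dd') (DS _ De).
  by exists (phi e); split; [exists e|apply: psd_pos; apply: pp => //; exact: sub|apply: psd_pos; apply: pp => //; exact: sub].
move=> xi; rewrite (sa_im xi ppx.1); split.
  move=> _ [_ [d Dd <-] <-]; rewrite (sa_im xi (pphi _ Dd).1) lecR.
  have := (pp _ _ Sx (DS _ Dd) (le _ Dd)).2 xi.
  by rewrite -[(_ - _) xi]/(phi x xi - phi d xi) dotBl subr_ge0.
move=> z h; have gb n := h _ (ex_intro2 _ _ (phi (g n)) (ex_intro2 _ _ (g n) (Dg n) erefl) erefl).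
have : z = (complex.Re z)%:C%C.
  by have := gb 0%N; rewrite (sa_im xi (pphi _ (Dg _)).1) lecE /= => /andP[/eqP]; case: z {h gb} => u v /= ->.
move=> ->; rewrite lecR; apply: (hcvg_dot_le _ (lim xi)) => n.
by have := gb n; rewrite (sa_im xi (pphi _ (Dg _)).1) lecE => /andP[].
Qed.

Lemma phi_normal_bimodular_cp : normal_bimodular_cp T S phi.
Proof.
split; [|exact: phi_normal|exact: phi_cp|exact: phi_bimod].
by split; [exact: phi_S|move=> a x y; exact: phi_lin].
Qed.

End Complete_positivity.

Lemma property_T_resolvent (R : realType) (K : hilbertType R) (T S : set (K -> K)) (tau : (K -> K) -> R[i])
    (XT X : biact K) (oneT : XT) (one : X) (TS : inclusion T S tau oneT one) (H : biact K)
    (bH : bimodule S S H) (c : (K -> K) -> H) (hc : bimod_map T S c) (d : R) : quasi_regular T S ->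
  (forall x y, QN T S x -> QN T S y -> c (x \o y) = lact x (c y) + ract y (c x)) ->
  property_T_relative T S tau -> 0 < d ->
  exists (eps : R) (e0 : 0 < eps), forall x, S x -> Defs.contraction x ->
    hn (resL TS bH hc e0 (hat one x) - hat one x) <= d.
Proof.
move=> qr cd pT d0; have LS := in_S TS; have vS : vn_algebra S by case: LS.
have cS := vn_cstar vS; have p0 n : 0 < n.+1%:R^-1 :> R by rewrite invr_gt0 ltr0n.
(* The resolvents at [eps = 1 / (n + 1)] form the net to which property (T) is applied. *)
pose Phi n := phi TS bH hc (p0 n).
have E n x : S x -> norm2 tau (Phi n x \- x) = hn (resL TS bH hc (p0 n) (hat one x) - hat one x).
  move=> Sx; have Sp := phi_S TS bH qr hc cd (p0 n) Sx.
  rewrite (norm2_hat LS (csB cS Sp Sx)) -(phi_hat TS bH qr hc cd (p0 n) Sx).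
  by rewrite -(hatB LS Sp Sx).
have [||x Sx e e0|N hN] := pT nat (fun m n => (m <= n)%N) Phi _ _ _ d d0.
- split=> [|//|i j k|i j]; [exact: (inhabits 0%N)|exact: leq_trans|].
  by exists (maxn i j); rewrite leq_maxl leq_maxr.
- by move=> n; exact: phi_normal_bimodular_cp.
- have [u Qu ux] := QN_approx TS qr (hat one x).
  have e4 : 0 < e / 4 by rewrite divr_gt0.
  have [m /(_ m (leqnn _)) hm] := ux _ e4.
  pose B := complex.Re (dform c (u m) (u m)); have B0 : 0 <= B := dform_ge0 c (u m).
  have p : 0 < B + 1 by rewrite ltr_wpDl.
  have s0 : 0 < (e / 4) ^+ 2 / (B + 1) by rewrite divr_gt0 // exprn_gt0.
  have [n0 hn0] := harm_small s0; exists n0 => n nn; rewrite E //.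
  have pn : n.+1%:R^-1 < (e / 4) ^+ 2 / (B + 1).
    by apply: le_lt_trans hn0; rewrite lef_pV2 ?posrE ?ltr0n // ler_nat ltnS.
  set RR := resL _ _ _ _; have bR : bounded_op RR := resL_bop _ _ _ _.
  have -> : RR (hat one x) - hat one x = RR (hat one x - hat one (u m)) +
      ((hat one (u m) - hat one x) - (hat one (u m) - RR (hat one (u m)))).
    by rewrite (linB (bop_lin bR)) opprB addrC addrA; hvec.
  apply: le_trans (hnD _ _) _; apply: le_trans (lerD (lexx _) (hnB _ _)) _.
  have h1 := resL_onb TS bH hc (p0 n) (hat one x - hat one (u m)).
  have h2 : hn (hat one (u m) - RR (hat one (u m))) <= e / 4.
    rewrite -(@ler_pXn2r _ 2) ?nnegrE ?(ltW e4) // /RR (resL_hat TS bH hc (p0 n) (Qu m)).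
    apply: le_trans (res_close TS bH hc (p0 n) (Qu m)) _; rewrite -/B.
    have := pn; rewrite ltr_pdivlMr //; set s := n.+1%:R^-1 => h; have s1 : 0 < s := p0 n; nra.
  move: h1; rewrite -/RR mul1r (hnC (hat one x)); lra.
exists N.+1%:R^-1, (p0 N) => x Sx cx; rewrite -E // -lee_fin.
by apply: le_trans (hN N (leqnn _)); apply: ereal_sup_ubound; exists x.
Qed.

(** * The spectral gap *)

Lemma dot_i (R : realType) (H : hilbertType R) (x y : H) : dot ('i%C *: x) ('i%C *: y) = dot x y.
Proof.
rewrite /dot innerZl innerZr mulrA; have -> : 'i%C * ('i%C)^* = 1 :> R[i]; last by rewrite mul1r.
by apply/eqP; rewrite eq_complex /=; apply/andP; split; apply/eqP; ring.
Qed.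

(** Summing over the phases 1, -1, i, -i cancels all cross terms, including the one between [p] and
    [q]; in the application [q = J p]. *)
Lemma phase_sum (R : realType) (H : hilbertType R) (b p q : H) :
  hn (b + (p + q)) ^+ 2 + hn (b - (p + q)) ^+ 2 + hn (b + 'i%C *: (p - q)) ^+ 2 + hn (b - 'i%C *: (p - q)) ^+ 2 =
  4 * (hn b ^+ 2 + hn p ^+ 2 + hn q ^+ 2).
Proof.
rewrite -!dotxx !(dotDl, dotDr, dotNl, dotNr) !dot_i !(dotDl, dotDr, dotNl, dotNr); ring.
Qed.

Lemma phase_sum0 (R : realType) (H : hilbertType R) (b p : H) :
  hn (b + p) ^+ 2 + hn (b - p) ^+ 2 + hn (b + 'i%C *: p) ^+ 2 + hn (b - 'i%C *: p) ^+ 2 =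
  4 * (hn b ^+ 2 + hn p ^+ 2).
Proof. by have := phase_sum b p 0; rewrite !addr0 subr0 hn0 expr0n addr0. Qed.

Section Spectral_gap.
Variables (R : realType) (K : hilbertType R) (T S : set (K -> K)) (tau : (K -> K) -> R[i]).
Variables (XT X : biact K) (oneT : XT) (one : X).
Hypothesis TS : inclusion T S tau oneT one.
Let LS := in_S TS.
Let LT := in_T TS.
Let vS : vn_algebra S. Proof. by case: LS. Qed.
Let fS : faithful_normal_tracial_state S tau. Proof. by case: LS. Qed.
Let vT : vn_algebra T. Proof. by case: LT. Qed.
Let cS := vn_cstar vS.
Let cT := vn_cstar vT.
Let bS := cs_bop cS.
Let TsS := in_sub TS.
Implicit Types (x y t u : K -> K) (D : set X).
Local Notation finite_bimod := (finite_bimod T S one).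
Local Notation J := (Jop S one).
Local Notation hat := (hat one).
Local Notation la := (@lact _ _ X).
Local Notation ra := (@ract _ _ X).
Local Notation Q := (QN T S).

Local Notation tbi := (@tbi _ _ T X).
Let QS x : Q x -> S x := @QN_S _ _ T S x.

Lemma im_tau p : S p -> sa p -> complex.Im (tau p) = 0.
Proof.
move=> Sp sp; have e : '<<one, hat p>> = tau p.
  by have := hat_inner LS (cs_id cS) Sp; rewrite (hat_id LS) sp.2.
have := inner_conj (hat p) one; rewrite e (hat_one LS Sp); case: (tau p) => a b.
by move=> /eqP; rewrite eq_complex /= => /andP[_ /eqP]; lra.
Qed.

(* Otherwise the elements x of a ball with tau x = tau p on which all the
   functionals x |-> <u x u^*, q> are large form a convex set without scalars. *)
Lemma ergodic_choice p q (e : R) : S p -> sa p -> S q -> 0 < e ->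
  exists2 u, unitary T u & dot (hat (u \o p \o adj u)) (hat q) <= trR tau p * trR tau q + e.
Proof.
move=> Sp sp Sq e0; apply: contrapT => none.
pose L := trR tau p * trR tau q + e.
have big u : unitary T u -> L <= dot (hat (u \o p \o adj u)) (hat q).
  by move=> uT; rewrite leNgt; apply/negP => /ltW h; apply: none; exists u.
have [c c0 pc] := bop_onb sp.1.
have conjE u x : unitary T u -> S x -> hat (u \o x \o adj u) = la u (ra (adj u) (hat x)).
  move=> uT Sx; have [Su _ _] := unitary_sub TS uT; have Sau := cs_adj cS Su.
  by rewrite (ra_hat LS Sau Sx) (la_hat LS Su (cs_comp cS Sx Sau)).
pose C := [set x | [/\ S x, onb x c, '<<hat x, one>> = tau p
  & forall u, unitary T u -> L <= dot (la u (ra (adj u) (hat x))) (hat q)]].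
have [|||||a [_ _ ta ha]] := @ergodic_scalar _ _ _ _ _ _ _ _ _ TS C.
- by move=> x [].
- exists p; split=> //; first by rewrite (hat_one LS).
  by move=> u uT; rewrite -conjE //; exact: big.
- apply/hclosedP => z /hcvg_dense[w hw wz].
  pose x n := sval (cid2 (hw n)).
  have [h1 h2] : (forall n, C (x n)) /\ (fun n => hat (x n)) = w.
    by split=> [n|]; [|apply/funext => n]; rewrite /x; case: cid2.
  rewrite -h2 in wz.
  have Sx n : S (x n) by case: (h1 n).
  have xc n : onb (x n) c by case: (h1 n).
  have [g [phi [Sg gc np hg hs]]] := ball_complete LS c0 Sx xc (hcvg_cauchy wz).
  exists g; last exact: hcvg_uniq hg wz.
  split=> //.
    rewrite -(hat_one LS Sp); apply: (hcvg_inner2 hg (hcvg_cst (hat p))) => n.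
    by rewrite (hat_one LS Sp); case: (h1 n).
  move=> u uT; have [Su _ _] := unitary_sub TS uT; have Sau := cs_adj cS Su.
  have b : bounded_op (la u \o ra (adj u)) by exact: (bop_comp (la_bop LS Su) (ra_bop LS Sau)).
  by apply: (hcvg_dot_ge _ (bop_hcvg b hg)) => n; case: (h1 n) => _ _ _; exact.
- move=> _ _ t t01 [x [Sx xc tx hx] <-] [z [Sz zc tz hz] <-].
  have [g [Sg gc] gE] := ball_conv LS c0 t01 (ex_intro2 _ _ x (conj Sx xc) erefl) (ex_intro2 _ _ z (conj Sz zc) erefl).
  exists g => //; split=> //; rewrite gE.
    by rewrite innerDl innerZl innerBl tx tz subrr mulr0 addr0.
  move=> u uT; have [Su _ _] := unitary_sub TS uT; have Sau := cs_adj cS Su.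
  have [ll lr] := (bop_lin (la_bop LS Su), bop_lin (ra_bop LS Sau)).
  rewrite (linD lr) (linD ll) (linZ lr) (linZ ll) (linB lr) (linB ll) dotDl dotZl dotBl.
  by have := hx _ uT; have := hz _ uT; case/andP: t01; nra.
- move=> u x uT [Sx xc tx hx]; have [Su u1 u2] := unitary_sub TS uT; have Sau := cs_adj cS Su.
  have Sux := cs_comp cS Su Sx; have uS := unitary_sub TS uT.
  split; first exact: (cs_comp cS).
  + move=> w; have bu := bS Su; have bau := bS Sau.
    rewrite (unitary_isom _ bu u1); apply: le_trans (xc _) _.
    by rewrite (unitary_isom _ bau) // (adjK bu).
  + rewrite (hat_one LS (cs_comp cS Sux Sau)) -tx (hat_one LS Sx) (trC fS Sux Sau).
    by rewrite -[adj u \o (u \o x)]/((adj u \o u) \o x) u1.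
  move=> v vu; have [Tv v1 v2] := vu; have [Tu _ _] := uT; have [Sv Sav] := (TsS Tv, cs_adj cS (TsS Tv)).
  have vuT : unitary T (v \o u).
    split; [exact: (cs_comp cT)| |]; rewrite (adj_comp (bS Sv) (bS Su)).
      by rewrite -[_ \o (v \o u)]/(adj u \o (adj v \o v) \o u) v1.
    by rewrite -[(v \o u) \o _]/(v \o (u \o adj u) \o adj v) u2.
  have := hx _ vuT; rewrite -!conjE //; last exact: (cs_comp cS).
  by rewrite (adj_comp (bS Sv) (bS Su)).
have S1 := cs_id cS; have u1 : unitary T idfun by split; [exact: cs_id|rewrite adj_id|rewrite adj_id].
have aE : a = (trR tau p)%:C%C.
  move: ta; rewrite (hat_one LS (csZ cS _ S1)) (trZ vS fS _ S1) (tr1 fS) mulr1 => ->.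
  by have := im_tau Sp sp; rewrite /trR; case: (tau p) => r i /= ->.
have := ha _ u1; rewrite adj_id (jr_id (la_nrep LS).1) (jr_id (ra_nrep LS).1) aE /=.
rewrite (hatZ LS _ S1) dotZl (hat_id LS) dotC {1}/dot (hat_one LS Sq) /L -/(trR tau q).
lra.
Qed.

Variable W : X -> X.
Hypothesis tW : tbi W.
Hypothesis pW : psd W.
Hypothesis W1 : onb W 1.
Hypothesis Wsmall : forall x, S x -> onb x 1 -> hn (W (hat x)) <= 4^-1.

(** The part of the bound in [gap_list] that depends on the partial sum [y]: [r] and [rho] are the
    sums of [m^* m] and of [hn (hat m) ^+ 2] over the operators [m] still to be added. Choosing one
    summand at a time so that this quantity never exceeds its expected value replaces random
    coefficients. *)
Definition gap_form (al rho : R) r y : R :=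
  al * hn (hat ((adj y \o y) + r)) ^+ 2 + 2 * al * rho * hn (hat y) ^+ 2 - hn (W (hat y)) ^+ 2.

(** If all four phases violated the bound, their sum would contradict [phase_sum] and
    [phase_sum0]. *)
Lemma phase_choice (al rho : R) r y v : S r -> S y -> S v -> exists p : R[i],
  gap_form al rho r (y + p *: v) <=
    al * (hn (hat ((adj y \o y) + (adj v \o v) + r)) ^+ 2 + 2 * hn (hat (adj y \o v)) ^+ 2)
    + 2 * al * rho * (hn (hat y) ^+ 2 + hn (hat v) ^+ 2) - (hn (W (hat y)) ^+ 2 + hn (W (hat v)) ^+ 2).
Proof.
move=> Sr Sy Sv; have [Say Sav] := (cs_adj cS Sy, cs_adj cS Sv); have lW := bop_lin pW.1.1.
have [Syy Svv Syv Svy] := And4 (cs_comp cS Say Sy) (cs_comp cS Sav Sv) (cs_comp cS Say Sv) (cs_comp cS Sav Sy).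
set B := (adj y \o y) + (adj v \o v) + r; set z := adj y \o v.
have SB : S B by apply: (csD cS) => //; exact: (csD cS).
have zJ : hat (adj v \o y) = J (hat z).
  by rewrite (Jop_hat LS Syv) (adj_comp (bS Say) (bS Sv)) (adjK (bS Sy)).
have E (p q : R[i]) : p^* = q -> p * q = 1 ->
    hat ((adj (y + p *: v) \o (y + p *: v)) + r) = hat B + (p *: hat z + q *: J (hat z)).
  move=> <- p1; have Sp1 := cs_lin cS p Syv (csZ cS p^* Svy).
  rewrite -zJ -(hatZ LS p^* Svy) -(hat_lin LS p Syv (csZ cS p^* Svy)) -(hatD LS SB Sp1); congr hat.
  have [by_ bv] := (bS Sy, bS Sv); have [lay lav] := (bop_lin (bS Say), bop_lin (bS Sav)).
  have -> : adj (y + p *: v) = adj y + p^* *: adj v.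
    by rewrite [y + _]addrC (adj_lin _ bv by_) addrC.
  apply/funext => xi.
  rewrite -[LHS]/(adj y (y xi + p *: v xi) + p^* *: adj v (y xi + p *: v xi) + r xi).
  rewrite (linD lay) (linD lav) (linZ lay) (linZ lav) scalerDr scalerA (mulrC p^*) p1 scale1r.
  rewrite -[RHS]/(adj y (y xi) + adj v (v xi) + r xi + (p *: adj y (v xi) + p^* *: adj v (y xi))).
  by cvec.
have i2 : ('i%C : R[i])^* = - 'i%C by apply/eqP; rewrite eq_complex /= oppr0 !eqxx.
have ii : 'i%C * 'i%C = -1 :> R[i] by rewrite -expr2 sqr_i.
have n1 : (-1 : R[i])^* = -1 by rewrite rmorphN rmorph1.
have X1 := E 1 1 (conjC1 _) (mulr1 _).
have X2 := E (-1) (-1) n1 (etrans (mulrNN _ _) (mulr1 _)).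
have i3 : 'i%C * - 'i%C = 1 :> R[i] by rewrite mulrN ii opprK.
have i4 : (- 'i%C : R[i])^* = 'i%C by rewrite rmorphN /= i2 opprK.
have X3 := E _ _ i2 i3; have X4 := E _ _ i4 (etrans (mulrC _ _) i3).
have hv (p : R[i]) : hat (y + p *: v) = hat y + p *: hat v by rewrite (hatD LS Sy (csZ cS p Sv)) (hatZ LS p Sv).
have Wv (p : R[i]) : W (hat (y + p *: v)) = W (hat y) + p *: W (hat v) by rewrite hv (linD lW) (linZ lW).
have s1 := phase_sum (hat B) (hat z) (J (hat z)).
have s2 := phase_sum0 (hat y) (hat v).
have s3 := phase_sum0 (W (hat y)) (W (hat v)).
rewrite (Jop_hn LS) in s1.
apply: contrapT => none.
have lt (p : R[i]) : al * (hn (hat B) ^+ 2 + 2 * hn (hat z) ^+ 2)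
    + 2 * al * rho * (hn (hat y) ^+ 2 + hn (hat v) ^+ 2) - (hn (W (hat y)) ^+ 2 + hn (W (hat v)) ^+ 2)
    < gap_form al rho r (y + p *: v).
  by rewrite ltNge; apply/negP => h; apply: none; exists p.
have := lt 1; have := lt (-1); have := lt 'i%C; have := lt (- 'i%C).
have e1 : hat B - (hat z + J (hat z)) = hat B + ((-1) *: hat z + (-1) *: J (hat z)) by cvec.
have e2 : hat B + 'i%C *: (hat z - J (hat z)) = hat B + ('i%C *: hat z + (- 'i%C) *: J (hat z)) by cvec.
have e3 : hat B - 'i%C *: (hat z - J (hat z)) = hat B + ((- 'i%C) *: hat z + 'i%C *: J (hat z)) by cvec.
rewrite /gap_form !Wv !hv X1 X2 X3 X4 -e1 -e2 -e3 !(scaleNr, scale1r).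
have t1 := congr1 (fun k => al * k) s1; have t2 := congr1 (fun k => 2 * al * rho * k) s2.
move: t1 t2 s3; rewrite /= !mulrDr; lra.
Qed.

Lemma unitary_hn u (z : X) : unitary S u -> hn (la u z) = hn z.
Proof.
move=> [Su u1 _]; apply: (hn_eq X) => //; have Sau := cs_adj cS Su.
rewrite -!dotxx /dot (la_adj LS) // -[la (adj u) (la u z)]/((la (adj u) \o la u) z) -(laM LS) //.
by rewrite u1 (jr_id (la_nrep LS).1).
Qed.

(** Take [v = u^* n] with [u] from [ergodic_choice] for [y y^*] and [n n^*], up to a phase. The
    squared 2-norm of [y^* v] is then almost at most the product of those of [y] and [n], as for
    independent variables, while [v^* v] and the norm of [W v] are those of [n]. *)
Lemma gap_step (al rho e : R) r y n : 0 < al -> 0 < e -> S r -> S y -> S n -> exists2 v, S v &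
  gap_form al rho r (y + v) <= al * (hn (hat ((adj y \o y) + (adj n \o n) + r)) ^+ 2
    + 2 * (hn (hat y) ^+ 2 * hn (hat n) ^+ 2))
    + 2 * al * rho * (hn (hat y) ^+ 2 + hn (hat n) ^+ 2) - (hn (W (hat y)) ^+ 2 + hn (W (hat n)) ^+ 2) + e.
Proof.
move=> al0 e0 Sr Sy Sn; have [Say San] := (cs_adj cS Sy, cs_adj cS Sn).
have [by_ bn] := (bS Sy, bS Sn); have [bay ban] := (bS Say, bS San).
have [Syy Snn] := (cs_comp cS Sy Say, cs_comp cS Sn San).
have sp : psd (y \o adj y) by have := psd_adj_comp bay; rewrite (adjK by_).
have sq : psd (n \o adj n) by have := psd_adj_comp ban; rewrite (adjK bn).
have e2 : 0 < e / (2 * al) by rewrite divr_gt0 // mulr_gt0.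
have [u uT hu] := ergodic_choice Syy sp.1 Snn e2.
have uS := unitary_sub TS uT; have [Su u1 u2] := uS; have Sau := cs_adj cS Su.
have [bu bau] := (bS Su, bS Sau); have auS := unitary_adj cS uS.
pose v := adj u \o n; have Sv : S v := cs_comp cS Sau Sn.
have av : adj v = adj n \o u by rewrite /v (adj_comp bau bn) (adjK bu).
have vv : adj v \o v = adj n \o n by rewrite av -[LHS]/(adj n \o (u \o adj u) \o n) u2.
have hv : hn (hat v) = hn (hat n) by rewrite /v -(la_hat LS Sau Sn) unitary_hn.
have hW : hn (W (hat v)) = hn (W (hat n)).
  have [_ Wl _] := tW; have [Tau _ _] := unitary_adj cT uT.
  by rewrite /v -(la_hat LS Sau Sn) Wl // unitary_hn.
have hy : trR tau (y \o adj y) = hn (hat y) ^+ 2.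
  by rewrite -(hat_hn_adj LS Sy) (hat_hn2 LS Say) (adjK by_).
have hn_ : trR tau (n \o adj n) = hn (hat n) ^+ 2.
  by rewrite -(hat_hn_adj LS Sn) (hat_hn2 LS San) (adjK bn).
have Syv := cs_comp cS Say Sv.
have hyv : hn (hat (adj y \o v)) ^+ 2 <= hn (hat y) ^+ 2 * hn (hat n) ^+ 2 + e / (2 * al).
  rewrite -hy -hn_; apply: le_trans hu; rewrite le_eqVlt; apply/orP; left; apply/eqP.
  have Sc := cs_comp cS (cs_comp cS Su Syy) Sau.
  rewrite (hat_hn2 LS Syv) /dot (hat_inner LS Sc Snn) sq.1.2 /trR (adj_comp bay (bS Sv)) (adjK by_) av.
  rewrite -[(adj n \o u) \o y \o _]/(adj n \o ((u \o (y \o adj y) \o adj u) \o n)).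
  rewrite (trC fS San (cs_comp cS Sc Sn)) -[(_ \o n) \o adj n]/((u \o (y \o adj y) \o adj u) \o (n \o adj n)).
  by rewrite (trC fS Sc Snn).
have [p hp] := phase_choice al rho Sr Sy Sv; exists (p *: v); first exact: (csZ cS).
apply: le_trans hp _; rewrite vv hv hW.
have := ler_wpM2l (ltW al0) hyv; rewrite mulrDr.
have -> : al * (e / (2 * al)) = e / 2 by field; rewrite gt_eqF.
rewrite !mulrDr; lra.
Qed.

(** For [y = 0] the fourth moment is bounded as for a sum with independent random coefficients: the
    square of the 2-norm of the sum of the [n^* n], plus the square of the sum of the
    [hn (hat n) ^+ 2]. *)
Lemma gap_list (al : R) (s : seq (K -> K)) : 0 < al -> (forall n, n \in s -> S n) -> forall y e, S y -> 0 < e ->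
  exists2 z, S z & al * hn (hat (adj z \o z)) ^+ 2 - hn (W (hat z)) ^+ 2 <=
    al * (hn (hat ((adj y \o y) + \sum_(n <- s) (adj n \o n))) ^+ 2
      + 2 * (\sum_(n <- s) hn (hat n) ^+ 2) * hn (hat y) ^+ 2 + (\sum_(n <- s) hn (hat n) ^+ 2) ^+ 2)
    - hn (W (hat y)) ^+ 2 - \sum_(n <- s) hn (W (hat n)) ^+ 2 + e.
Proof.
move=> al0; elim: s => [|n s ih] Ss y e Sy e0.
  exists y => //; rewrite !big_nil addr0 !mulr0 mul0r !addr0 expr0n /= addr0 subr0.
  by rewrite lerDl ltW.
have Sn : S n by apply: Ss; rewrite mem_head.
have {}Ss m : m \in s -> S m by move=> ms; apply: Ss; rewrite inE ms orbT.
have Sr : S (\sum_(m <- s) (adj m \o m)).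
  rewrite big_seq; apply: (cs_sum cS) => m ms; apply: (cs_comp cS); last exact: Ss.
  by apply: (cs_adj cS); exact: Ss.
have e2 : 0 < e / 2 by rewrite divr_gt0.
set r := \sum_(m <- s) (adj m \o m) in Sr ih *.
have [v Sv hv] := gap_step (\sum_(m <- s) hn (hat m) ^+ 2) al0 e2 Sr Sy Sn.
have [z Sz hz] := ih Ss (y + v) _ (csD cS Sy Sv) e2.
exists z => //; apply: le_trans hz _; rewrite !big_cons -/r.
have E : (adj y \o y) + (adj n \o n) + r = (adj y \o y) + ((adj n \o n) + r) by rewrite addrA.
move: hv; rewrite /gap_form E.
set rho := \sum_(m <- s) _; set b := \sum_(m <- s) _; set P := hn (hat (_ + (_ + r))).
set N := hn (hat n) ^+ 2; set Y := hn (hat y) ^+ 2 => hv.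
have N0 : 0 <= al * N ^+ 2 by rewrite mulr_ge0 ?sqr_ge0 // ltW.
rewrite !mulrDr in hv *; nra.
Qed.

(* With [s = sqrt A] the operator [y (1 + y^* y / (4 A))^-1] has norm at most [s]. *)
Lemma truncation_bound y (A : R) : S y -> 0 < A ->
  hn (W (hat y)) ^+ 2 <= A / 8 + hn (hat (adj y \o y)) ^+ 2 / (8 * A).
Proof.
move=> Sy A0; have by_ := bS Sy; have Say := cs_adj cS Sy; pose h := adj y \o y.
have Sh : S h := cs_comp cS Say Sy; have ph : psd h := psd_adj_comp by_.
pose s := Num.sqrt A; have s0 : 0 < s by rewrite sqrtr_gt0.
have ss : s ^+ 2 = A by rewrite sqr_sqrtr // ltW.
(* The maximum of [l / (1 + th l)^2] over nonnegative [l] is [1 / (4 th) = A], which bounds the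
   square of the norm of [x = y g]. *)
pose th := (4 * A)^-1; have th0 : 0 < th by rewrite invr_gt0 mulr_gt0.
pose G := idfun + th%:C%C *: h.
have SG : S G by apply: (csD cS); [exact: cs_id|exact: (csZ cS)].
have lh := bop_lin ph.1.1.
have GE v : G v = v + th%:C%C *: h v by [].
have pG : psd G.
  by apply: psdD (psdZ (ltW th0) ph); split=> [|v]; [exact: sa_id|rewrite dotxx sqr_ge0].
have [|g [Sg pg Gg gG]] := cs_inv cS ltr01 SG pG.
  by move=> v; rewrite GE dotDl dotZl dotxx mul1r lerDl mulr_ge0 ?(ltW th0) //; exact: ph.2.
have gE v : g v + th%:C%C *: h (g v) = v by have := congr1 (fun f => f v) Gg; rewrite /= GE.
have Gh : h \o G = G \o h.
  by apply/funext => v; rewrite /= !GE (linD lh) (linZ lh).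
have hg : h \o g = g \o h.
  transitivity ((g \o G) \o (h \o g)); first by rewrite gG.
  transitivity (g \o (h \o G) \o g); first by rewrite Gh.
  by rewrite -[LHS]/((g \o h) \o (G \o g)) Gg.
pose x := y \o g; have Sx : S x := cs_comp cS Sy Sg.
have tA : 4 * th * A = 1 by rewrite /th mulrAC mulfV // gt_eqF // mulr_gt0.
have xs : onb x s.
  move=> v; rewrite -(@ler_pXn2r _ 2) ?nnegrE ?mulr_ge0 ?(ltW s0) // exprMn ss.
  set w := g v; have -> : hn (x v) ^+ 2 = dot (h w) w.
    by rewrite -dotxx -[x v]/(y w) (adj_dot by_) dotC.
  have vE : v = w + th%:C%C *: h w by rewrite gE.
  have -> : hn v ^+ 2 = hn w ^+ 2 + 2 * th * dot (h w) w + th ^+ 2 * hn (h w) ^+ 2.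
    rewrite -!dotxx [in LHS]vE !(dotDl, dotDr, dotZl, dotZr) (dotC w); ring.
  have := dot_CS (h w) w; have := ph.2 w; set d := dot _ _; set p := hn (h w); set q := hn w => d0 dpq.
  have k : 4 * th * d <= q ^+ 2 + 2 * th * d + th ^+ 2 * p ^+ 2.
    have := sqr_ge0 (q - th * p); have := ler_wpM2l (ltW th0) dpq; nra.
  by have := ler_wpM2l (ltW A0) k; rewrite mulrA [A * _]mulrC tA mul1r.
have Sxh := cs_comp cS Sx Sh.
have yE : y = x + th%:C%C *: (x \o h).
  have lx := bop_lin (bS Sx); transitivity (x \o G); first by rewrite -[x \o G]/(y \o (g \o G)) gG.
  by apply/funext => v; rewrite /= GE (linD lx) (linZ lx).
have Wx : hn (W (hat x)) <= s / 4.
  have si0 : 0 < s^-1 by rewrite invr_gt0.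
  have := Wsmall (csZ cS (s^-1)%:C%C Sx); rewrite (hatZ LS _ Sx) (linZ (bop_lin pW.1.1)) hnZr ger0_norm ?(ltW si0) //.
  rewrite mulrC ler_pdivrMr // [4^-1 * s]mulrC; apply=> v.
  have -> : hn (((s^-1)%:C%C *: x) v) = s^-1 * hn (x v).
    by rewrite -[(_ *: x) v]/((s^-1)%:C%C *: x v) hnZr ger0_norm // ltW.
  by rewrite mul1r mulrC ler_pdivrMr // mulrC; exact: xs.
have Wy : hn (W (hat y)) <= s / 4 + th * (s * hn (hat h)).
  rewrite {1}yE (hatD LS Sx (csZ cS _ Sxh)) (hatZ LS _ Sxh) (linD (bop_lin pW.1.1)).
  apply: le_trans (hnD _ _) (lerD Wx _); rewrite (linZ (bop_lin pW.1.1)) hnZr ger0_norm ?ler_pM2l ?(ltW th0) //.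
  apply: le_trans (W1 _) _; rewrite mul1r; apply: (hat_onbl LS) => //; exact: ltW.
have N0 := hn_ge0 (hat h); have h0 := hn_ge0 (W (hat y)).
apply: le_trans (_ : (s / 4 + th * (s * hn (hat h))) ^+ 2 <= _).
  by rewrite ler_pXn2r ?nnegrE // (le_trans h0).
have -> : hn (hat h) ^+ 2 / (8 * A) = 2 * th ^+ 2 * A * hn (hat h) ^+ 2 by rewrite /th; field; rewrite gt_eqF.
(* [(p + q)^2 <= 2 p^2 + 2 q^2] with [p = s / 4]; both factors 8 in the statement come from here. *)
rewrite -ss; have := sqr_ge0 (s / 4 - th * (s * hn (hat h))); lra.
Qed.

(** The [n k i] come from [W^k] applied to a frame of the bimodule generated by [x], and [a k] is
    the sum of their squared 2-norms. If each step from [a k] to [a k.+1] loses a factor 9/16, [W^k]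
    decays like [(3/4)^k] on [x], and [log_convex_growth] concludes. Otherwise the family at a step
    that loses less, whose sum of [n^* n] is scalar by [frame_central], contradicts
    [truncation_bound]. *)
Lemma spectral_gap : quasi_regular T S -> onb W (3 / 4).
Proof.
move=> qr; have lW := bop_lin pW.1.1; have tWk k : tbi (pw W k) := pw_N (tbi_cstar TS) k tW.
have sWk k : sa (pw W k) := pw_sa k pW.1.
suff QW x : Q x -> hn (W (hat x)) <= 3 / 4 * hn (hat x).
  move=> z; have [x Qx xz] := QN_approx TS qr z.
  pose B := ((3 / 4) ^+ 2)%:C%C *: idfun - (W \o W).
  have bB : bounded_op B by apply: (saB (saZ _ (sa_id X)) (sa_comp pW.1 pW.1 erefl)).1.
  have BE v : dot (B v) v = (3 / 4) ^+ 2 * hn v ^+ 2 - hn (W v) ^+ 2.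
    by rewrite -[B v]/(((3 / 4) ^+ 2)%:C%C *: v - W (W v)) dotBl dotZl -!dotxx (sa_dot pW.1).
  have := quad_cvg_ge0 bB xz; rewrite BE subr_ge0 -exprMn ler_pXn2r ?nnegrE ?mulr_ge0 //; apply=> n.
  rewrite BE subr_ge0 -exprMn ler_pXn2r ?nnegrE ?mulr_ge0 //; exact: QW.
move=> Qx; have Sx := QS Qx; pose D := gen_bimod T one (fun _ : 'I_1 => x).
have fD : finite_bimod D := gen_finite TS (fun _ : 'I_1 => Qx).
have Dx : D (hat x) := gen_bimod_gen TS (F := fun _ : 'I_1 => x) (i := ord0).
have [sD [I [g gD]] _] := fD; have [V [m [e F]]] := left_frame_ex TS sD gD.
pose n k := sval (cid (lf_tbi TS F (tWk k))).
have nP k i : S (n k i) /\ pw W k (hat (m i)) = hat (n k i) by rewrite /n; case: cid => f /= /(_ i).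
pose a k : R := \sum_i hn (hat (n k i)) ^+ 2.
have a0 k : 0 <= a k by apply: sumr_ge0 => i _; exact: sqr_ge0.
have Wn k i : W (hat (n k i)) = hat (n k.+1 i) by rewrite -!(nP _ _).2.
have adec k : a k.+1 <= a k.
  by apply: ler_sum => i _; rewrite -Wn ler_pXn2r ?nnegrE //; have := W1 (hat (n k i)); rewrite mul1r.
have [[k hk]|small] := pselect (exists k, 9 / 16 * a k < a k.+1); last first.
  pose C i := sval (cid2 (bop_onb (bS (TsS (lf_T F i Sx))))).
  have [C0 eC] : (forall i, 0 <= C i) /\ forall i, onb (e i x) (C i).
    by split=> i; rewrite /C; case: cid2.
  (* The summand 1 ensures that [a 0] is at most [s^2]. *)
  pose s := a 0%N + 1; have s0 : 0 <= s by rewrite addr_ge0.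
  have geo k : a k <= ((3 / 4) ^+ k * s) ^+ 2.
    elim: k => [|k ih].
      by rewrite expr0 mul1r /s; have := a0 0%N; move: (a 0%N) => t; nra.
    have h : a k.+1 <= 9 / 16 * a k by rewrite leNgt; apply/negP => lt; apply: small; exists k.
    apply: le_trans h _; have := ler_wpM2l (_ : 0 <= 9 / 16 :> R) ih; move=> /(_ _)/le_trans; apply; first by lra.
    rewrite (exprS _ k) -mulrA; move: (_ * s) => t; rewrite exprMn; lra.
  have := @log_convex_growth _ (fun k => hn (pw W k (hat x))) ((\sum_i C i) * s) (3 / 4); apply.
  - by [].
  - lra.
  - move=> k; rewrite -dotxx -[pw W k.+1 (hat x)]/(W (pw W k (hat x))) {1}(sa_dot pW.1).
    by apply: le_trans (dot_CS _ _) _.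
  move=> k; rewrite (left_frame_tbi_exp TS F (tWk k) (nP k) Sx Dx).
  have Tx i := lf_T F i Sx; have Sn i := (nP k i).1; have Se i := TsS (Tx i).
  rewrite (hat_sum LS); last by move=> i; exact: (cs_comp cS).
  apply: le_trans (_ : \sum_i hn (hat (e i x \o n k i)) <= _).
    elim/big_rec2: _ => [|i b z _ h]; first by rewrite hn0.
    by apply: le_trans (hnD _ _) _; rewrite lerD2l.
  rewrite -mulrA mulr_suml; apply: ler_sum => i _.
  apply: le_trans (hat_onbl LS (Se i) (Sn i) (C0 i) (eC i)) _; apply: ler_wpM2l => //.
  have k0 : 0 <= (3 / 4) ^+ k :> R by apply: exprn_ge0; lra.
  rewrite mulrC -(@ler_pXn2r _ 2) ?nnegrE ?(mulr_ge0 k0) //.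
  by apply: le_trans (geo k); rewrite /a (bigD1 i) //= lerDl; apply: sumr_ge0 => j _; exact: sqr_ge0.
set A := a k in hk; have A0 : 0 < A.
  rewrite lt_def a0 andbT; apply/eqP => A0; have := adec k; rewrite -/A.
  by move: hk; rewrite A0 mulr0; lra.
have Sn i : S (n k i) := (nP k i).1.
pose l := [seq n k i | i <- enum I].
have Sl y : y \in l -> S y by move=> /mapP[i _ ->].
have sumE (U : nmodType) (f : (K -> K) -> U) : \sum_(y <- l) f y = \sum_i f (n k i).
  by rewrite big_map big_enum.
(* This weight is the coefficient of the fourth moment in [truncation_bound], so that the two fourth
   moments cancel. *)
have al0 : 0 < (8 * A)^-1 by rewrite invr_gt0 mulr_gt0.
have e0 : 0 < A / 16 by rewrite divr_gt0.
have [y Sy hy] := gap_list al0 Sl (cs0 cS) e0.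
have tr := truncation_bound Sy A0.
have rE : \sum_i (adj (n k i) \o n k i) = A%:C%C *: idfun.
  rewrite (frame_central TS F (tWk k) (tWk k) (nP k) (nP k)); congr (_ *: _).
  rewrite /frame_ip /A /a rmorph_sum; apply: eq_bigr => i _; rewrite (nP k i).2.
  by rewrite inner_xx.
move: hy; rewrite !sumE -/(a k) -/A rE (hat0 LS) (lin0 lW) hn0 expr0n /= !mulr0 addr0 subr0.
have z0 : adj (0 : K -> K) \o (0 : K -> K) = 0.
  by apply/funext => v; rewrite /= (lin0 (bop_lin (bS (cs_adj cS (cs0 cS))))).
rewrite z0 add0r (hatZ LS _ (cs_id cS)) (hat_id LS) hnZr (hn_one LS) mulr1 ger0_norm ?(ltW A0) //.
have -> : \sum_i hn (W (hat (n k i))) ^+ 2 = a k.+1 by apply: eq_bigr => i _; rewrite Wn.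
have -> : (8 * A)^-1 * (A ^+ 2 + A ^+ 2) = A / 4 by field; rewrite gt_eqF.
(* Altogether [a k.+1 <= (1/4 + 1/16 + 1/8) A = 7/16 A], against [hk]. *)
by move: tr hk; rewrite [_ / (8 * A)]mulrC; lra.
Qed.

End Spectral_gap.

(** * Bounded derivations are inner *)

(** [s] is the square of the circumradius. The sets of admissible centers for slightly larger radii
    are closed, bounded and midpoint convex, so [hilbert_fip] gives a common point; the
    parallelogram law makes it unique. *)
Lemma circumcenter (R : realType) (H : hilbertType R) (A : set H) (B : R) : A !=set0 ->
  (forall a, A a -> hn a <= B) -> exists s eta, (forall a, A a -> hn (eta - a) ^+ 2 <= s) /\
    forall eta', (forall a, A a -> hn (eta' - a) ^+ 2 <= s) -> eta' = eta.
Proof.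
move=> [a0 Aa0] AB; pose E s := [set eta | forall a, A a -> hn (eta - a) ^+ 2 <= s].
pose I := [set s | E s !=set0].
have B0 : 0 <= B := le_trans (hn_ge0 _) (AB _ Aa0).
have I0 s : I s -> 0 <= s by move=> [eta h]; apply: le_trans (h _ Aa0); exact: sqr_ge0.
have hI : has_inf I.
  split; last by exists 0.
  exists (B ^+ 2), 0 => a /AB h; rewrite sub0r hnN ler_pXn2r ?nnegrE //.
pose s := inf I.
have mid t x y : E t x -> E t y -> E (t - hn (x - y) ^+ 2 / 4) ((2^-1 : R)%:C%C *: (x + y)).
  move=> Ex Ey a Aa; have := hmid2 a x y; have := parallelogram (a - x) (a - y).
  have := Ex _ Aa; have := Ey _ Aa; rewrite !(hnC a) !(hnC _ a).
  have -> : a - x - (a - y) = - (x - y) by rewrite opprB opprB addrC addrA subrK.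
  rewrite hnN; lra.
have mono t t' : t <= t' -> E t `<=` E t' by move=> tt x Ex a /Ex/le_trans; apply.
pose C (n : nat) := E (s + n.+1%:R^-1).
have p0 (n : nat) : 0 < n.+1%:R^-1 :> R by rewrite invr_gt0 ltr0n.
have s0 : 0 <= s by apply: lb_le_inf; [case: hI|exact: I0].
have [|||eta hE] := @hilbert_fip _ _ nat C (hn a0 + (s + 2)) 0%N.
- move=> n; split.
  + apply/hclosedP => x h a Aa; rewrite leNgt; apply/negP => lt.
    have t0 : 0 <= s + n.+1%:R^-1 by rewrite addr_ge0 // ltW.
    pose w := Num.sqrt (s + n.+1%:R^-1).
    have wlt : w < hn (x - a) by rewrite -(@ltr_pXn2r _ 2) ?nnegrE ?sqrtr_ge0 // sqr_sqrtr.
    have [|y Ey xy] := h (hn (x - a) - w); first by rewrite subr_gt0.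
    have : hn (y - a) <= w.
      by rewrite -(@ler_pXn2r _ 2) ?nnegrE ?sqrtr_ge0 // sqr_sqrtr //; exact: Ey.
    by have := hnD (x - y) (y - a); rewrite subrKA; lra.
  + have [t [x Ex] lt] := inf_adherent (p0 n) hI; exists x; exact: mono (ltW lt) _ Ex.
  + move=> x y Ex Ey; apply: mono (mid _ _ _ Ex Ey); rewrite gerBl divr_ge0 ?sqr_ge0 //.
- move=> n x Ex; have := Ex _ Aa0; have := hnD (x - a0) a0; rewrite subrK => h1 h2.
  have n1 : n.+1%:R^-1 <= 1 :> R by rewrite invf_le1 ?ltr0n // ler1n.
  have := hn_ge0 (x - a0); move: (n.+1%:R^-1) n1 h2 => r r1; nra.
- move=> i j; exists (maxn i j) => x Ex; split; apply: mono Ex; rewrite lerD2l lef_pV2 ?posrE ?ltr0n // ler_nat ltnS.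
    exact: leq_maxl.
  exact: leq_maxr.
have Es : E s eta.
  move=> a Aa; apply/ler_addgt0Pr => e /harm_small[n hn_].
  by apply: le_trans (hE n a Aa) _; rewrite lerD2l ltW.
exists s, eta; split=> // eta' Es'.
have : I (s - hn (eta' - eta) ^+ 2 / 4) by exists ((2^-1 : R)%:C%C *: (eta' + eta)); exact: mid.
move=> /(ge_inf (proj2 hI)); rewrite -/s => h.
apply/eqP; rewrite -subr_eq0; apply/eqP/hn_eq0/eqP; rewrite -sqrf_eq0 eq_le sqr_ge0 andbT.
by move: h; lra.
Qed.

Section Inner_derivations.
Variables (R : realType) (K : hilbertType R) (T S : set (K -> K)) (tau : (K -> K) -> R[i]).
Variables (XT X : biact K) (oneT : XT) (one : X).
Hypothesis TS : inclusion T S tau oneT one.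
Let LS := in_S TS.
Let vS : vn_algebra S. Proof. by case: LS. Qed.
Let cS := vn_cstar vS.
Let bS := cs_bop cS.
Let TsS := in_sub TS.
Implicit Types (x y t u : K -> K) (D : set X).
Local Notation hat := (hat one).
Local Notation Q := (QN T S).

Local Notation tbi := (@tbi _ _ T X).
Variable H : biact K.
Hypothesis bH : bimodule S S H.
Hypothesis qr : quasi_regular T S.
Variable c : (K -> K) -> H.
Hypothesis hc : bimod_map T S c.
Hypothesis cd : forall x y, Q x -> Q y -> c (x \o y) = lact x (c y) + ract y (c x).
Let QS x : Q x -> S x := @QN_S _ _ T S x.

Lemma contraction_onb x : onb x 1 -> Defs.contraction x.
Proof. by move=> h xi; rewrite !hnE lecR; have := h xi; rewrite mul1r. Qed.

(** The gap gives [P >= 1/4], so each [y] in QN_S(T) is the resolvent of some [x] in it with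
    [hn (hat x) <= 4 * hn (hat y)]. The energy identity [res_dot] yields [eps * hn (c y) ^+ 2 <= <x,
    y> <= 4 * hn (hat y) ^+ 2], whence the constant [2 / sqrt eps]. *)
Lemma der_bounded : property_T_relative T S tau ->
  exists2 C : R, 0 <= C & forall y, Q y -> hn (c y) <= C * hn (hat y).
Proof.
move=> pT; have [|eps [e0 small]] := property_T_resolvent TS bH hc qr cd pT (_ : 0 < 4^-1).
  by rewrite invr_gt0.
pose P := resL TS bH hc e0; have pP : psd P := resL_psd TS bH qr hc e0.
have tP : tbi P := resL_tbi TS bH qr hc e0; have cB := tbi_cstar TS.
have P1 : onb P 1 := resL_onb TS bH hc e0.
pose W := idfun - P; have WE z : W z = z - P z by [].
have tW : tbi W by apply: (csB cB) => //; exact: (cs_id cB).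
have pW : psd W.
  split=> [|z]; first by apply: saB pP.1; exact: sa_id.
  by rewrite WE dotBl dotxx subr_ge0; have := onb_le z P1; rewrite mul1r.
have W1 : onb W 1.
  apply: psd_onb => // z; rewrite WE dotBl dotxx mul1r gerBl; exact: pP.2.
have Ws x : S x -> onb x 1 -> hn (W (hat x)) <= 4^-1.
  by move=> Sx x1; rewrite WE hnC; apply: small => //; exact: contraction_onb.
have gap := spectral_gap TS tW pW W1 Ws qr.
have [||Y [tY _ PY _]] := @cs_inv _ _ _ cB P 4^-1 _ tP pP; first by rewrite invr_gt0.
  by move=> z; have := onb_le z gap; rewrite WE dotBl dotxx; lra.
exists (2 / Num.sqrt eps); first by rewrite divr_ge0 ?sqrtr_ge0.
move=> y Qy; have [x Qx xE] := tbi_QN TS tY Qy.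
have Px : P (hat x) = hat y by rewrite -xE; exact: (congr1 (fun f => f (hat y)) PY).
have ry : res T S one c eps x = y.
  have Qr := res_QN TS bH hc e0 Qx; apply: (hat_inj LS); [exact: QS|exact: QS|].
  by rewrite -(resL_hat TS bH hc e0 Qx).
have xy : hn (hat x) <= 4 * hn (hat y).
  have := gap (hat x); rewrite WE Px; have := hnD (hat x - hat y) (hat y); rewrite subrK; lra.
have := res_dot TS bH hc e0 Qx; rewrite ry => e.
have cy : hn (c y) ^+ 2 <= complex.Re (dform c y y).
  by rewrite /dform ReD !inner_xx /= lerDl sqr_ge0.
have s0 : 0 < Num.sqrt eps by rewrite sqrtr_gt0.
have ss : Num.sqrt eps ^+ 2 = eps by rewrite sqr_sqrtr // ltW.
rewrite mulrAC ler_pdivlMr // -(@ler_pXn2r _ 2) ?nnegrE ?mulr_ge0 ?(ltW s0) // !exprMn ss.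
have := dot_CS (hat x) (hat y); have := ler_wpM2l (ltW e0) cy; have := hn_ge0 (hat y).
have := ler_wpM2r (hn_ge0 (hat y)) xy; have := sqr_ge0 (hn (hat y)); move: e; lra.
Qed.

(** Square roots, and with them unitaries, may leave QN_S(T); its norm closure is a C*-algebra and
    therefore spanned by its unitaries. *)
Definition norm_closure : set (K -> K) := [set x | S x /\ forall e : R, 0 < e -> exists2 q, Q q & onb (x - q) e].

Lemma QN_norm_closure x : Q x -> norm_closure x.
Proof. by move=> Qx; split=> [|e e0]; [exact: QS|exists x => // v; rewrite -[(x - x) v]/(x v - x v) subrr hn0 mulr_ge0 // ltW]. Qed.

Lemma norm_closure_cstar : cstar norm_closure.
Proof.
split=> [x [Sx _]||a x y [Sx hx] [Sy hy]|x y [Sx hx] [Sy hy]|x [Sx hx]|x h].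
- exact: bS.
- exact: QN_norm_closure (QN_id TS).
- split=> [|e e0]; first exact: (cs_lin cS).
  have p : 0 < complex.Re `|a| + 1 by rewrite ltr_wpDl.
  have [q Qq xq] := hx _ (divr_gt0 (divr_gt0 e0 (ltr0Sn _ 1)) p).
  have [r Qr yr] := hy _ (divr_gt0 e0 (ltr0Sn _ 1)).
  exists (a *: q + r); first exact: (QN_lin TS).
  move=> v; have -> : (a *: x + y - (a *: q + r)) v = a *: ((x - q) v) + (y - r) v.
    by rewrite -[LHS]/(a *: x v + y v - (a *: q v + r v)) -[(x - q) v]/(x v - q v) -[(y - r) v]/(y v - r v); cvec.
  apply: le_trans (hnD _ _) _; rewrite hnZ; have h1 := xq v; have h2 := yr v.
  have h3 : (complex.Re `|a|) * hn ((x - q) v) <= e / 2 * hn v.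
    apply: le_trans (_ : (complex.Re `|a| + 1) * hn ((x - q) v) <= _); first by rewrite ler_wpM2r // lerDl.
    by apply: le_trans (ler_wpM2l (ltW p) h1) _; rewrite mulrA [_ * (_ / _)]mulrC divfK // gt_eqF.
  lra.
- split=> [|e e0]; first exact: (cs_comp cS).
  have [cx cx0 xc] := bop_onb (bS Sx); have px : 0 < cx + 1 by rewrite ltr_wpDl.
  have [q Qq yq] := hy _ (divr_gt0 (divr_gt0 e0 (ltr0Sn _ 1)) px).
  have [cq cq0 qc] := bop_onb (bS (QS Qq)); have pq : 0 < cq + 1 by rewrite ltr_wpDl.
  have [p Qp xp] := hx _ (divr_gt0 (divr_gt0 e0 (ltr0Sn _ 1)) pq).
  exists (p \o q); first exact: (QN_comp TS).
  move=> v; have -> : ((x \o y) - (p \o q)) v = x ((y - q) v) + (x - p) (q v).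
    rewrite -[LHS]/(x (y v) - p (q v)) -[(y - q) v]/(y v - q v) -[(x - p) _]/(x (q v) - p (q v)).
    by rewrite (linB (bop_lin (bS Sx))) addrA subrK.
  apply: le_trans (hnD _ _) _; have -> : e * hn v = e / 2 * hn v + e / 2 * hn v by lra.
  apply: lerD.
    apply: le_trans (xc _) _; apply: le_trans (ler_wpM2l cx0 (yq v)) _.
    rewrite mulrA ler_wpM2r // mulrA ler_pdivrMr // mulrC ler_wpM2l ?lerDl //; lra.
  apply: le_trans (xp _) _; apply: le_trans (ler_wpM2l _ (qc v)) _.
    by rewrite !divr_ge0 // ltW.
  rewrite mulrA ler_wpM2r // mulrAC ler_pdivrMr // ler_wpM2l ?lerDl //; lra.
- split=> [|e e0]; first exact: (cs_adj cS).
  have [q Qq xq] := hx _ e0; exists (adj q); first exact: (QN_adj TS).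
  have Sq := QS Qq; rewrite -(adjB (bS Sx) (bS Sq)); apply: adj_onb => //; [|exact: ltW].
  by apply: bS; exact: (csB cS).
have e2 (e : R) : 0 < e -> 0 < e / 2 by move=> ?; rewrite divr_gt0.
split=> [|e e0]; first by apply: (cs_lim cS) => e /h[y [Sy _] xy]; exists y.
have [y [Sy hy] xy] := h _ (e2 _ e0); have [q Qq yq] := hy _ (e2 _ e0).
exists q => // v; have -> : (x - q) v = (x - y) v + (y - q) v.
  by rewrite -[LHS]/(x v - q v) -[(x - y) v]/(x v - y v) -[(y - q) v]/(y v - q v) addrA subrK.
by apply: le_trans (hnD _ _) _; have := xy v; have := yq v; lra.
Qed.

(* The unitaries u of the norm closure of QN act on H by the affine isometries
   eta |-> u eta u^* + c(u) u^*, which permute the bounded set of the c(u) u^*. *)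
Lemma der_inner : property_T_relative T S tau -> exists xi : H, (forall t, T t -> lact t xi = ract t xi) /\
  forall x, Q x -> c x = ract x xi - lact x xi.
Proof.
move=> /der_bounded[C C0 cC]; pose N := norm_closure; have cN : cstar N := norm_closure_cstar.
have NS x : N x -> S x by case.
have c0 : c 0 = 0 := bm0 TS hc.
have [||| U [bU UC UE _]] := @ext_op _ X H (fun z w => exists x, [/\ Q x, z = hat x & w = c x]) C C0.
- by exists 0; split; [exact: QN0 TS|rewrite (hat0 LS)|rewrite c0].
- move=> a _ _ _ _ [x [Qx -> ->]] [y [Qy -> ->]]; exists (a *: x + y).
  by split; [exact: (QN_lin TS)|rewrite (hat_lin LS _ (QS Qx) (QS Qy))|rewrite (bm_lin hc)].
- by move=> _ _ [x [Qx -> ->]]; exact: cC.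
have Uc x : Q x -> U (hat x) = c x by move=> Qx; apply: UE; exists x.
have lU := bop_lin bU.
(* The defect of the Leibniz rule for the extension [U]. It is bounded in the operator norms of both
   variables and vanishes on QN_S(T), hence on the norm closure. *)
pose D x y : H := U (hat (x \o y)) - (lact x (U (hat y)) + ract y (U (hat x))).
have UB x a : S x -> 0 <= a -> onb x a -> hn (U (hat x)) <= C * a.
  by move=> Sx a0 xa; apply: le_trans (UC _) (ler_wpM2l C0 (hat_le LS Sx a0 xa)).
have Db x y a b : S x -> S y -> 0 <= a -> 0 <= b -> onb x a -> onb y b -> hn (D x y) <= 3 * C * a * b.
  move=> Sx Sy a0 b0 xa yb; have [jl _] := bi_lrep bH; have [jr _] := bi_rrep bH.
  have h1 : hn (U (hat (x \o y))) <= C * (a * b).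
    apply: UB; [exact: (cs_comp cS)|exact: mulr_ge0|move=> v /=].
    by apply: le_trans (xa _) _; rewrite -mulrA ler_wpM2l.
  have h2 : hn (@lact _ _ H x (U (hat y))) <= a * (C * b).
    by apply: le_trans (jr_onb cS jl Sx a0 xa _) (ler_wpM2l a0 (UB _ _ Sy b0 yb)).
  have h3 : hn (@ract _ _ H y (U (hat x))) <= b * (C * a).
    by apply: le_trans (jr_onb cS jr Sy b0 yb _) (ler_wpM2l b0 (UB _ _ Sx a0 xa)).
  apply: le_trans (hnB _ _) _; apply: le_trans (lerD (lexx _) (hnD _ _)) _; lra.
have DBl x q y : S x -> S q -> S y -> D x y = D (x - q) y + D q y.
  move=> Sx Sq Sy; have [jl _] := bi_lrep bH; have [Sxy Sqy] := (cs_comp cS Sx Sy, cs_comp cS Sq Sy).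
  rewrite /D (jrB cS jl) // -[(lact x - lact q) _]/(lact x _ - lact q _) (hatB LS Sx Sq).
  rewrite -[(x - q) \o y]/((x \o y) - (q \o y)) (hatB LS Sxy Sqy) !(linB lU).
  by rewrite (linB (bop_lin (bi_rbop bH Sy))); cvec.
have DBr x y q : S x -> S q -> S y -> D x y = D x (y - q) + D x q.
  move=> Sx Sq Sy; have [jr _] := bi_rrep bH; have [Sxy Sxq] := (cs_comp cS Sx Sy, cs_comp cS Sx Sq).
  rewrite /D (jrB cS jr) // -[(ract y - ract q) _]/(ract y _ - ract q _) (hatB LS Sy Sq).
  have -> : x \o (y - q) = (x \o y) - (x \o q).
    by apply/funext => v; rewrite /= -[(y - q) v]/(y v - q v) (linB (bop_lin (bS Sx))).
  rewrite (hatB LS Sxy Sxq) !(linB lU).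
  by rewrite (linB (bop_lin (bi_lbop bH Sx))); cvec.
have DQ x y : Q x -> Q y -> D x y = 0.
  by move=> Qx Qy; rewrite /D !Uc //; [rewrite cd // subrr|exact: (QN_comp TS)].
have D0 x y : N x -> N y -> D x y = 0.
  move=> [Sx hx] [Sy hy]; apply/hn_eq0/le_anti; rewrite hn_ge0 andbT.
  apply/ler_addgt0Pr => e e0; rewrite add0r; have e2 : 0 < e / 2 by rewrite divr_gt0.
  have [cy cy0 yc] := bop_onb (bS Sy); have p1 : 0 < 3 * C * cy + 1.
    by rewrite ltr_wpDl // !mulr_ge0.
  have [q Qq xq] := hx _ (divr_gt0 e2 p1); have Sq := QS Qq.
  have [cq cq0 qc] := bop_onb (bS Sq); have p2 : 0 < 3 * C * cq + 1 by rewrite ltr_wpDl // !mulr_ge0.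
  have [r Qr yr] := hy _ (divr_gt0 e2 p2); have Sr := QS Qr.
  rewrite (DBl _ q) // (DBr q y r) // (DQ q r) // addr0; apply: le_trans (hnD _ _) _.
  have d1 := divr_gt0 e2 p1; have d2 := divr_gt0 e2 p2.
  have h1 := Db _ _ _ _ (csB cS Sx Sq) Sy (ltW d1) cy0 xq yc.
  have h2 := Db _ _ _ _ Sq (csB cS Sy Sr) cq0 (ltW d2) qc yr.
  have f1 : 3 * C * (e / 2 / (3 * C * cy + 1)) * cy <= e / 2.
    by rewrite mulrAC mulrA ler_pdivrMr // mulrC ler_wpM2l ?lerDl //; lra.
  have f2 : 3 * C * cq * (e / 2 / (3 * C * cq + 1)) <= e / 2.
    by rewrite mulrA ler_pdivrMr // mulrC ler_wpM2l ?lerDl //; lra.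
  lra.
have [[[[_ l1] _ _ _] _] [[[_ r1] _ _ _] _] _] := bH.
pose b u : H := ract (adj u) (U (hat u)).
have uS u : unitary N u -> unitary S u by move=> [/NS Su ? ?].
have rK u w : unitary N u -> @ract _ _ H (adj u) (ract u w) = w.
  move=> /uS[Su _ u2]; have Sau := cs_adj cS Su.
  by rewrite -[LHS]/((ract (adj u) \o ract u) w) -(bi_rM bH) // u2 r1.
have rK' u w : unitary N u -> @ract _ _ H u (ract (adj u) w) = w.
  move=> /uS[Su u1 _]; have Sau := cs_adj cS Su.
  by rewrite -[LHS]/((ract u \o ract (adj u)) w) -(bi_rM bH) // u1 r1.
have lK u w : unitary N u -> @lact _ _ H u (lact (adj u) w) = w.
  move=> /uS[Su _ u2]; have Sau := cs_adj cS Su.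
  by rewrite -[LHS]/((lact u \o lact (adj u)) w) -(bi_lM bH) // u2 l1.
have lK' u w : unitary N u -> @lact _ _ H (adj u) (lact u w) = w.
  move=> /uS[Su u1 _]; have Sau := cs_adj cS Su.
  by rewrite -[LHS]/((lact (adj u) \o lact u) w) -(bi_lM bH) // u1 l1.
have hnl u w : unitary N u -> hn (@lact _ _ H u w) = hn w.
  move=> uN; have [Su _ _] := uS _ uN; apply: (hn_eq H) => //.
  by rewrite -!dotxx /dot (bi_ladj bH) // lK'.
have hnr u w : unitary N u -> hn (@ract _ _ H u w) = hn w.
  move=> uN; have [Su _ _] := uS _ uN; apply: (hn_eq H) => //.
  by rewrite -!dotxx /dot (bi_radj bH) // rK.
have uN1 : unitary N idfun by split; [exact: cs_id|rewrite adj_id|rewrite adj_id].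
have [|a [u uN <-]|s [eta [hs uniq]]] := @circumcenter _ H (b @` unitary N) C.
- by exists (b idfun), idfun.
- rewrite hnr; last exact: unitary_adj.
  have [Su _ _] := uS _ uN; have := UB u 1 Su ler01; rewrite mulr1; apply.
  by apply: (unitary_onb cS); exact: uS.
have fixed u : unitary N u -> U (hat u) = ract u eta - lact u eta.
  move=> uN; have auN := unitary_adj cN uN; have [Nu u1 u2] := uN.
  have [Su Sau] := (NS _ Nu, NS _ (cs_adj cN Nu)).
  have : lact u (ract (adj u) eta) + b u = eta.
    apply: uniq => _ [w wN <-]; pose v := adj u \o w.
    have [Nw w1 w2] := wN; have Sw := NS _ Nw; have Nv : N v by apply: (cs_comp cN) => //; exact: (cs_adj cN).
    have Sv := NS _ Nv; have av : adj v = adj w \o u by rewrite /v (adj_comp (bS Sau) (bS Sw)) (adjK (bS Su)).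
    have vN : unitary N v.
      split=> //; rewrite av; first by rewrite -[LHS]/(adj w \o (u \o adj u) \o w) u2.
      by rewrite -[LHS]/(adj u \o (w \o adj w) \o u) w2.
    have wE : w = u \o v by rewrite -[u \o v]/((u \o adj u) \o w) u2.
    (* The cocycle identity [b(u v) = u b(v) u^* + b(u)]. *)
    have bw : b w = lact u (ract (adj u) (b v)) + b u.
      have aw : adj w = adj v \o adj u by rewrite {1}wE (adj_comp (bS Su) (bS Sv)).
      have /eqP := D0 _ _ Nu Nv; rewrite subr_eq0 -wE => /eqP e.
      have Sav := cs_adj cS Sv.
      rewrite /b e aw (bi_rM bH) // /= !(linD (bop_lin (bi_rbop bH Sav))) (linD (bop_lin (bi_rbop bH Sau))).
      by rewrite (rK v) // !(bi_lrC bH).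
    rewrite bw opprD addrACA subrr addr0 -(linB (bop_lin (bi_lbop bH Su))) hnl //.
    by rewrite -(linB (bop_lin (bi_rbop bH Sau))) hnr //; apply: hs; exists v.
  move=> /(congr1 (@ract _ _ H u)); rewrite (linD (bop_lin (bi_rbop bH Su))) /b rK' //.
  by rewrite -(bi_lrC bH) // rK' // addrC => <-; rewrite addrK.
have all x : N x -> U (hat x) = ract x eta - lact x eta.
  have [jl _] := bi_lrep bH; have [jr _] := bi_rrep bH.
  move=> Nx; suff [] : S x /\ U (hat x) = ract x eta - lact x eta by [].
  apply: (@unitary_ind _ _ N (fun x => S x /\ U (hat x) = ract x eta - lact x eta) cN _ _ x Nx); last first.
    by move=> u uN; split; [case: (uS _ uN)|exact: fixed].
  move=> a y z [Sy hy] [Sz hz].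
  split; first exact: (cs_lin cS).
  rewrite (hat_lin LS) // lU hy hz (jr_lin jl) // (jr_lin jr) //.
  rewrite -[(a *: ract y + ract z) eta]/(a *: ract y eta + ract z eta).
  by rewrite -[(a *: lact y + lact z) eta]/(a *: lact y eta + lact z eta); cvec.
exists eta; split=> [t Tt|x Qx]; last by rewrite -Uc // all //; exact: QN_norm_closure.
have Qt := QN_T TS Tt; have := all _ (QN_norm_closure Qt); rewrite Uc //.
(* [c] vanishes on T because it is T-linear and [c(1) = 0]; so the implementing vector is
   T-central. *)
have Q1 := QN_id TS; have -> : c t = 0.
  by rewrite -[t]/(t \o idfun) (bm_l hc) // (der_id TS bH cd) (lin0 (bop_lin (bi_lbop bH (TsS Tt)))).
by move=> /eqP; rewrite eq_sym subr_eq0 => /eqP.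
Qed.

End Inner_derivations.

(** * Vanishing of the first cohomology *)

Lemma subalgebra_trace (R : realType) (K : hilbertType R) (T S : set (K -> K)) (tau : (K -> K) -> R[i]) :
  T `<=` S -> faithful_normal_tracial_state S tau -> faithful_normal_tracial_state T tau.
Proof.
move=> TS [[lin one] pos faith tr norm]; split.
- by split=> // a x y /TS Sx /TS Sy; exact: lin.
- by move=> x /TS; exact: pos.
- by move=> x /TS; exact: faith.
- by move=> x y /TS Sx /TS Sy; exact: tr.
by move=> D x DT /TS Sx; apply: norm => // d /DT/TS.
Qed.

Section Vanishing.
Variables (R : realType) (K : hilbertType R) (T S : set (K -> K)) (tau : (K -> K) -> R[i]).
Variables (XT X : biact K) (oneT : XT) (one : X).
Hypothesis TS : inclusion T S tau oneT one.
Variable H : biact K.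
Hypothesis bH : bimodule S S H.
Implicit Types (c : ('I_1 -> K -> K) -> H).

Lemma upd1 (x : 'I_1 -> K -> K) (i : 'I_1) y : upd x i y = fun _ => y.
Proof. by apply/funext => j; rewrite (ord1 i) (ord1 j) /upd dfwithin. Qed.

Lemma cocycle1_bimod_map c : cocycle T S c -> bimod_map T S (fun x => c (fun _ => x)).
Proof.
move=> [[lin l r _] _]; split=> [a x y Qx Qy|t x Tt Qx|t x Tt Qx].
- by have := lin (fun _ => x) ord0 a x y (fun _ => Qx) Qx Qy; rewrite !upd1.
- by have := l (fun _ => x) t (fun _ => Qx) Tt; rewrite !upd1.
- by have := r (fun _ => x) t (fun _ => Qx) Tt; rewrite !upd1.
Qed.

Lemma cocycle1_leibniz c x y : cocycle T S c -> QN T S x -> QN T S y ->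
  c (fun _ => x \o y) = lact x (c (fun _ => y)) + ract y (c (fun _ => x)).
Proof.
move=> [_ dc] Qx Qy; pose z (i : 'I_2) := if i == ord0 then x else y.
have Qz : tuple_in T S z by move=> i; rewrite /z; case: eqP.
have f0 : face 0 z = fun _ => y by apply/funext => k; rewrite (ord1 k).
have f1 : face 1 z = fun _ => x \o y by apply/funext => k; rewrite (ord1 k).
have f2 : face 2 z = fun _ => x by apply/funext => k; rewrite (ord1 k).
have := dc z Qz; rewrite /delta !big_ord_recl big_ord0 /= f0 f1 f2 => e.
have {e} : lact x (c (fun _ => y)) - c (fun _ => x \o y) + ract y (c (fun _ => x)) = 0.
  rewrite -e (_ : bump 0 0 = 1%N) // (_ : bump 0 1 = 2%N) //.
  by rewrite addr0 expr0 expr1 sqrrN expr1n !scale1r scaleN1r addrA.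
by move=> /eqP; rewrite addrAC subr_eq0 => /eqP.
Qed.

Lemma cocycle1_coboundary c : quasi_regular T S -> property_T_relative T S tau ->
  cocycle T S c -> coboundary T S c.
Proof.
move=> qr pT cc.
have [xi [cen hxi]] := der_inner TS bH qr (cocycle1_bimod_map cc) (fun x y => cocycle1_leibniz cc) pT.
have [lS rS] := (fun x Sx => bop_lin (@bi_lbop _ _ _ _ bH x Sx), fun x Sx => bop_lin (@bi_rbop _ _ _ _ bH x Sx)).
(* The coboundary of a 0-cochain [b] is [x b - b x], opposite to the convention of [der_inner];
   hence the sign. *)
exists (fun _ => - xi) => [x t Tt|x Qx].
  have St := in_sub TS Tt; by rewrite (linN (lS _ St)) (linN (rS _ St)) cen.
have Qx0 := Qx ord0; have Sx0 := QN_S Qx0.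
have xE : x = fun _ => x ord0 by apply/funext => i; rewrite (ord1 i).
rewrite /delta !big_ord_recl big_ord0 /= {1}xE hxi // addr0 expr0 expr1 scale1r scaleN1r.
rewrite (_ : ord_max = ord0); last exact: ord1.
by rewrite (linN (lS _ Sx0)) (linN (rS _ Sx0)) opprK addrC.
Qed.

End Vanishing.

(** The rows of [p] lie in the module [M^n p]; an embedding into a zero quotient kills them, so
    [p = 0]. The value 0 must also be attained, here with [n = 0], since an empty supremum would be
    minus infinity. *)
Lemma Luck_dim0 (R : realType) (H : hilbertType R) (M : set (H -> H)) (mu : (H -> H) -> \bar R)
    (A : zmodType) (act : (H -> H) -> A -> A) (Z B : set A) :
  M 0 -> mu 0 = 0%E -> Z 0 -> B 0 -> (forall a, M a -> act a 0 = 0) -> Z `<=` B ->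
  Luck_dim M mu act Z B = 0%E.
Proof.
move=> M0 mu0 Z0 B0 a0 ZB; rewrite /Luck_dim.
suff -> : [set d | exists n (p : 'I_n -> 'I_n -> H -> H) (f : ('I_n -> H -> H) -> A),
    [/\ matrix_projection M p, (forall v, projective_module M p v -> Z (f v)),
        (forall a v w, M a -> projective_module M p v -> projective_module M p w ->
           B (f (fun i => (a \o v i) + w i) - (act a (f v) + f w))),
        (forall v, projective_module M p v -> B (f v) -> forall i, v i = 0)
      & d = (\sum_i mu (p i i))%E]] = [set 0%E] by rewrite ereal_sup1.
apply/seteqP; split=> [_ [n [p [f [[Mp _ pp] fZ _ inj ->]]]]|_ ->].
  have p0 i j : p i j = 0.
    have pm : projective_module M p (p i) by split=> [k|k]; [exact: Mp|exact: pp].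
    exact: inj pm (ZB _ (fZ _ pm)) j.
  by apply: big1 => i _; rewrite p0.
exists 0%N, (fun _ _ => 0), (fun _ => 0); split=> //.
- by split=> // -[].
- by move=> a v w Ma _ _; rewrite a0 // addr0 subr0.
- by move=> v _ _ [].
by rewrite big_ord0.
Qed.

Theorem corollary9p17 (R : realType) (K : hilbertType R)
    (S T : set (K -> K)) (tau : (K -> K) -> R[i])
    (E : regular_bimodule T S tau)
    (mu : (rb_Hreg E -> rb_Hreg E) -> \bar R) :
  II1_factor S tau ->
  subfactor T S ->
  irreducible_inclusion T S ->
  quasi_regular T S ->
  unimodular E ->
  regular_trace mu ->
  property_T_relative T S tau ->
  L2_betti mu 1 = 0%E.
Proof.
move=> [[vS _] _ fS] [TsS [vT _]] irr qr _ [[_ [muZ _] _ _ _] _] pT.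
have TS : inclusion T S tau (rb_oneT E) (rb_oneS E).
  split=> //; split=> //; [exact: subalgebra_trace fS|exact: rb_L2T|exact: rb_L2S].
have bH : bimodule S S (rb_Hreg E) by case: (rb_HregP E).
have cS := vn_cstar vS.
have M0 : M_reg (E := E) 0.
  split; first exact: bop0.
  split=> x xi Sx; first by rewrite (lin0 (bop_lin (bi_lbop bH Sx))).
  by rewrite (lin0 (bop_lin (bi_rbop bH Sx))).
have mu0 : mu 0 = 0%E.
  have p0 : pos_op (0 : rb_Hreg E -> rb_Hreg E) := psd_pos (psd0 _).
  (* Homogeneity at the scalar 0: [0 * mu 0] is 0 in the extended reals, whatever [mu 0] is. *)
  have := muZ 0 0 (lexx _) (conj M0 p0); rewrite mul0e => <-.
  by rewrite scaler0.
apply: Luck_dim0 => //.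
- split; last first.
    move=> x Qx; rewrite /delta; apply: big1 => i _.
    have Sx j : S (x j) := QN_S (Qx j).
    case: ifP => _; first by rewrite (lin0 (bop_lin (bi_lbop bH (Sx _)))) scaler0.
    by case: ifP => _; rewrite ?(lin0 (bop_lin (bi_rbop bH (Sx _)))) scaler0.
  split=> //= [x i a y z _ _ _|x t _ Tt|x t _ Tt].
  + by rewrite addr0 scaler0.
  + by rewrite (lin0 (bop_lin (bi_lbop bH (TsS _ Tt)))).
  + by rewrite (lin0 (bop_lin (bi_rbop bH (TsS _ Tt)))).
- exists (fun _ => 0) => [x t Tt|x Qx].
    by rewrite (lin0 (bop_lin (bi_lbop bH (TsS _ Tt)))) (lin0 (bop_lin (bi_rbop bH (TsS _ Tt)))).
  rewrite /delta big1 // => i _; have Sx j : S (x j) := QN_S (Qx j).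
  case: ifP => _; first by rewrite (lin0 (bop_lin (bi_lbop bH (Sx _)))) scaler0.
  by case: ifP => _; rewrite ?(lin0 (bop_lin (bi_rbop bH (Sx _)))) scaler0.
- by move=> a [ba _]; apply/funext => x; rewrite /= (lin0 (bop_lin ba)).
by move=> c; exact: (cocycle1_coboundary TS bH qr pT).
Qed.
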